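(* Let $\alpha,\beta\ge0$, $t\ge 0$. With the functions $P^{O}_l(t;\alpha)$, $P^{S}_l(t;\beta)$, $P^{u}_l(t;\alpha,\beta)$, the polynomials $\pi_l(z;t)$, $\pi_l^*(z;t)$ and the determinants $D_l,D_l^{\pm\pm}$ defined in the context, the following hold (the first for all integers $l\ge1$, the others for all integers $l\ge0$): $$P^{O}_{2l}(t;\alpha)=\tfrac12e^{-\alpha t-t^2/2}\Big\{[\pi^*_{2l-1}(-\alpha;t)-\alpha\pi_{2l-1}(-\alpha;t)]D^{--}_l(t)+[\pi^*_{2l-1}(-\alpha;t)+\alpha\pi_{2l-1}(-\alpha;t)]D^{++}_{l-1}(t)\Big\},$$ $$P^{O}_{2l+1}(t;\alpha)=\tfrac12e^{-\alpha t-t^2/2}\Big\{[\pi^*_{2l}(-\alpha;t)+\alpha\pi_{2l}(-\alpha;t)]e^tD^{+-}_l(t)+[\pi^*_{2l}(-\alpha;t)-\alpha\pi_{2l}(-\alpha;t)]e^{-t}D^{-+}_l(t)\Big\},$$ $$P^{O}_{2l}(t;1)=P^{S}_{2l}(t;1)=e^{-t-t^2/2}D^{-+}_l(t),$$ $$P^{O}_{2l+1}(t;1)=P^{S}_{2l+1}(t;1)=e^{-t^2/2}D^{++}_l(t),$$ $$P^{S}_{2l+1}(t;\beta)=e^{-t^2/2}D^{++}_l(t),$$ $$P^{u}_{2l+1}(t;\alpha,\beta)=e^{-\alpha t-t^2}\pi^*_l(-\alpha;t)D_l(t),$$ $$P^{u}_{4l+1}(t;1,\beta)=e^{-t-t^2}D^{++}_l(t)D^{-+}_l(t),$$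 $$P^{u}_{4l+3}(t;1,\beta)=e^{-t-t^2}D^{++}_l(t)D^{-+}_{l+1}(t).$$
   Context: Let $\iota\in S_N$ be $x\mapsto N+1-x$. - $\tilde f^{O}_{nml}$: number of $\pi\in S_n$ with $\pi=\pi^{-1}$, exactly $m$ fixed points, and no increasing subsequence of length $>l$. - $\tilde f^{S}_{nml}$: number of $\pi\in S_n$ with $\pi=\iota\pi^{-1}\iota$, exactly $m$ values $x$ with $\pi(x)=\iota(x)$ (''negated points''), and no increasing subsequence of length $>l$. - $\tilde f^{u}_{nm_+m_-l}$: number of $\pi\in S_{2n}$ with $\pi=\pi^{-1}$ and $\pi=\iota\pi^{-1}\iota$, exactly $2m_+$ points $x$ with $\pi(x)=x$ (i.e. $m_+$ pairs $\{x,\iota(x)\}$), exactly $2m_-$ points with $\pi(x)=\iota(x)$ (i.e. $m_-$ pairs), and no increasing subsequence of length $>l$. Define $$P^{O}_l(t;\alpha)=e^{-\alpha t-t^2/2}\sum_{n\ge0}\frac{t^n}{n!}\sum_{m\ge0}\alpha^m\tilde f^{O}_{nml},\qquad P^{S}_l(t;\beta)=e^{-\beta t-t^2/2}\sum_{n\ge0}\frac{t^n}{n!}\sum_{m\ge0}\beta^m\tilde f^{S}_{nml},$$ $$P^{u}_l(t;\alpha,\beta)=e^{-\alpha t-\beta t-t^2}\sum_{n\ge0}\frac{t^n}{n!}\sum_{m_+,m_-\ge0}\alpha^{m_+}\beta^{m_-}\tilde f^{u}_{nm_+m_-l}.$$ (These are the probabilities, in natural Poisson models, that the longest increasing subsequence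 at time $t$ has length at most $l$.) $\pi_l(z;t)$ are the monic orthogonal polynomials (degree $l$ in $z$) on the unit circle for the inner product $\langle p,q\rangle=\frac1{2\pi}\int_0^{2\pi}p(e^{i\theta})q(e^{-i\theta})e^{2t\cos\theta}d\theta$, and $\pi_l^*(z;t)=z^l\pi_l(1/z;t)$. With $I_j(2t)=\frac1{2\pi}\int_0^{2\pi}e^{2t\cos\theta}e^{ij\theta}d\theta$ (modified Bessel function), $D_l(t)=\det(I_{j-k}(2t))_{0\le j,k<l}$; $D^{--}_0(t)=1$ and $D^{--}_l(t)=\frac12\det(I_{j-k}(2t)+I_{j+k}(2t))_{0\le j,k<l}$ for $l\ge1$; $D^{++}_l(t)=\det(I_{j-k}(2t)-I_{j+k+2}(2t))_{0\le j,k<l}$; $D^{+-}_l(t)=\det(I_{j-k}(2t)-I_{j+k+1}(2t))_{0\le j,k<l}$; $D^{-+}_l(t)=\det(I_{j-k}(2t)+I_{j+k+1}(2t))_{0\le j,k<l}$. Determinants of size $0$ equal $1$. *)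

(* Defs.v *)
From mathcomp Require Import all_boot all_order all_algebra all_fingroup.
From mathcomp Require Import complex.
From mathcomp Require Import all_classical all_reals all_analysis.

Set Implicit Arguments.
Unset Strict Implicit.
Unset Printing Implicit Defensive.

Import Order.TTheory GRing.Theory Num.Theory.
Import numFieldNormedType.Exports.

Local Open Scope ring_scope.
Local Open Scope complex_scope.

(* The symmetric group S_N acts on 'I_N = {0, ..., N-1}; after the shift by one
   the map x |-> N + 1 - x is rev_ord : x |-> N - 1 - x. *)
Definition iota_perm (N : nat) : {perm 'I_N} := perm (@rev_ord_inj N).

Definition fixed_points (N : nat) (s : {perm 'I_N}) : {set 'I_N} :=
  [set x | s x == x].

Definition negated_points (N : nat) (s : {perm 'I_N}) : {set 'I_N} :=
  [set x | s x == iota_perm N x].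

(* A set A of positions is (the index set of) an increasing subsequence of s. *)
Definition increasing_on (N : nat) (s : {perm 'I_N}) (A : {set 'I_N}) : bool :=
  [forall x in A, forall y in A, (x < y)%N ==> (s x < s y)%N].

Definition no_increasing_gt (N : nat) (l : nat) (s : {perm 'I_N}) : bool :=
  ~~ [exists A : {set 'I_N}, increasing_on s A && (l < #|A|)%N].

Definition fO (n m l : nat) : nat :=
  #|[set s : {perm 'I_n} | [&& s == s^-1%g, #|fixed_points s| == m
                             & no_increasing_gt l s]]|.

Definition fS (n m l : nat) : nat :=
  #|[set s : {perm 'I_n} | [&& s == (iota_perm n * s^-1 * iota_perm n)%g,
                               #|negated_points s| == m
                             & no_increasing_gt l s]]|.

Definition fu (n mp mm l : nat) : nat :=
  #|[set s : {perm 'I_(2 * n)} |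
      [&& s == s^-1%g, s == (iota_perm (2 * n) * s^-1 * iota_perm (2 * n))%g,
          #|fixed_points s| == (2 * mp)%N, #|negated_points s| == (2 * mm)%N
        & no_increasing_gt l s]]|.

(* In the three series below the inner sums over m, m_+, m_- >= 0 stop at n:
   a permutation counted by fO n m l or fS n m l has at most n fixed or negated
   points, one counted by fu n mp mm l at most 2n of each, so all further terms
   are zero. *)
Definition PO (R : realType) (l : nat) (t alpha : R) : R :=
  expR (- (alpha * t) - t ^+ 2 / 2) *
  limn (series (fun n : nat => t ^+ n / n`!%:R *
    \sum_(0 <= m < n.+1) alpha ^+ m * (fO n m l)%:R)).

Definition PS (R : realType) (l : nat) (t beta : R) : R :=
  expR (- (beta * t) - t ^+ 2 / 2) *
  limn (series (fun n : nat => t ^+ n / n`!%:R *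
    \sum_(0 <= m < n.+1) beta ^+ m * (fS n m l)%:R)).

Definition Pu (R : realType) (l : nat) (t alpha beta : R) : R :=
  expR (- (alpha * t) - beta * t - t ^+ 2) *
  limn (series (fun n : nat => t ^+ n / n`!%:R *
    \sum_(0 <= mp < n.+1) \sum_(0 <= mm < n.+1)
      alpha ^+ mp * beta ^+ mm * (fu n mp mm l)%:R)).

(* e^{i theta} *)
Definition expi (R : realType) (theta : R) : R[i] := cos theta +i* sin theta.

(* 1/(2 pi) times the integral over [0, 2 pi] of a complex-valued function,
   taken on real and imaginary parts. *)
Definition circle_mean (R : realType) (f : R -> R[i]) : R[i] :=
  let D := `[0, 2 * pi]%classic in
  ((2 * pi)^-1)%:C *
  ((\int[@lebesgue_measure R]_(x in D) complex.Re (f x)) +i*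
   (\int[@lebesgue_measure R]_(x in D) complex.Im (f x))).

(* The modified Bessel function I_j(x), for an integer index j. *)
Definition besselI (R : realType) (j : int) (x : R) : R[i] :=
  circle_mean (fun theta => (expR (x * cos theta))%:C * expi (j%:~R * theta)).

Definition circle_inner (R : realType) (t : R) (p q : {poly R[i]}) : R[i] :=
  circle_mean (fun theta =>
    p.[expi theta] * q.[expi (- theta)] * (expR (2 * t * cos theta))%:C).

Definition monic_orthogonal (R : realType) (t : R) (p : nat -> {poly R[i]}) :=
  (forall l, p l \is monic /\ size (p l) = l.+1) /\
  (forall l m, l <> m -> circle_inner t (p l) (p m) = 0).

(* The weight is positive, so exactly one sequence satisfies monic_orthogonal t;
   the default value of xget plays no role. *)
Definition opuc (R : realType) (l : nat) (t : R) : {poly R[i]} :=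
  xget (fun=> 0) [set p | monic_orthogonal t p]%classic l.

(* The polynomial z^l p(1/z), for p of degree at most l, as a coefficient
   reversal: the pointwise formula would be wrong at z = 0, where 0^-1 = 0. *)
Definition reversed_poly (K : fieldType) (l : nat) (p : {poly K}) : {poly K} :=
  \poly_(i < l.+1) p`_(l - i).

Lemma reversed_polyE (K : fieldType) (l : nat) (p : {poly K}) (z : K) :
  (size p <= l.+1)%N -> z != 0 -> (reversed_poly l p).[z] = z ^+ l * p.[z^-1].
Proof.
move=> sp z0; rewrite horner_poly (horner_coef_wide _ sp) mulr_sumr.
rewrite (reindex_inj rev_ord_inj) /=; apply: eq_bigr => i _.
have il : (i <= l)%N by rewrite -ltnS.
by rewrite subSS subKn // mulrCA exprVn expfB_cond // (negbTE z0).
Qed.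

Definition opuc_star (R : realType) (l : nat) (t : R) : {poly R[i]} :=
  reversed_poly l (opuc l t).

Definition Dl (R : realType) (l : nat) (t : R) : R[i] :=
  \det (\matrix_(j < l, k < l) besselI (j%:Z - k%:Z) (2 * t)).

Definition Dmm (R : realType) (l : nat) (t : R) : R[i] :=
  if l == 0%N then 1 else
  2^-1 * \det (\matrix_(j < l, k < l)
    (besselI (j%:Z - k%:Z) (2 * t) + besselI (j%:Z + k%:Z) (2 * t))).

Definition Dpp (R : realType) (l : nat) (t : R) : R[i] :=
  \det (\matrix_(j < l, k < l)
    (besselI (j%:Z - k%:Z) (2 * t) - besselI (j%:Z + k%:Z + 2) (2 * t))).

Definition Dpm (R : realType) (l : nat) (t : R) : R[i] :=
  \det (\matrix_(j < l, k < l)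
    (besselI (j%:Z - k%:Z) (2 * t) - besselI (j%:Z + k%:Z + 1) (2 * t))).

Definition Dmp (R : realType) (l : nat) (t : R) : R[i] :=
  \det (\matrix_(j < l, k < l)
    (besselI (j%:Z - k%:Z) (2 * t) + besselI (j%:Z + k%:Z + 1) (2 * t))).

(* Main.v *)
(** The letters of a lattice word name the rows to which boxes are added, so a lattice
    word is a growing partition; blanks (the letter 0) mark unpaired points.  Inserting
    a column in the manner of Fomin's growth diagrams, whose local rule is
    [DU - UD = 1], turns each of the three families of involutions into walks on
    partitions with at most [l] columns: additions only for [f^O], additions and
    removals for [f^S] and [f^u].  The weight of the final partition records the fixed
    points, and the first row length records the longest increasing subsequence.  Each
    generating function is therefore [sum t^n/n! (A^n psi)(0)] for a transfer operator
    [A], and it equals [g_t(0)] for any solution of [g_t' = A g_t], [g_0 = psi] with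
    geometrically growing derivatives.  Such solutions are explicit: Pfaffians or
    determinants of Bessel moments, because alternating multilinear functions of the
    column positions annihilate the forbidden steps.

    At the empty partition the Pfaffians evaluate to Hankel determinants for the weight
    pushed forward by [X = z + 1/z] (for [f^O]), or, by Schur's Pfaffian
    and symmetrisation over nodes discretising the moments, to a Toeplitz determinant
    (for [f^u]).  Multiplying the weight by [1 + a^2 + a X] is a Christoffel
    transformation, which Szego's relation between orthogonal polynomials on the circle
    and on the segment expresses through [pi_m] and [pi_m^*] at [-a].  The nonvanishing
    of the Toeplitz determinants comes from the series itself, whose terms are
    nonnegative and whose constant term is 1. *)

Require Import Defs.
From mathcomp Require Import all_boot all_order all_algebra all_fingroup.
From mathcomp Require Import zify ring lra boolp.
Set Implicit Arguments.
Unset Strict Implicit.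
Unset Printing Implicit Defensive.
Import Order.TTheory GRing.Theory Num.Theory.

(** * Lattice words and insertion *)

(** No bijection between permutations and tableaux is built. A growth diagram is stored as the word
    along its boundary, and only summed identities are used: over all words, filling a blank in
    every possible way amounts to choosing a corner of the shape ([SW_ins]). Likewise only the first
    row is compared with increasing subsequences, through a recursion that both satisfy, and the odd
    columns are compared with the fixed points through the parities of the letters. The diagram of
    [fO] is symmetric and ends at a full square. That of [fS] starts with every column blank and
    follows the staircase along the antidiagonal. That of [fu] does one and then the other. The
    analytic obstacle lies in [fu]: its kernel has the denominator [1 - x * y], which is singular on
    the circle. It is replaced by a form on polynomials that is characterised by a displacement
    equation and by antisymmetry; the closed form is then checked on finitely many nodes inside the
    unit interval that share the moments in question. The determinant identities are stated for
    linear functionals on polynomials, so that they hold over the reals and over the complex numbers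
    alike. *)

Definition cnt (r : nat) (w : seq nat) : nat := count_mem r w.
Arguments cnt : simpl never.

Section Words.
Local Open Scope nat_scope.

(* Words are stored with their last letter at the head, and positions are counted from
   the end of the list; [ins j w] fills the blank [j] and returns the row in which the
   bumping stops. *)
Fixpoint ins (j : nat) (w : seq nat) : seq nat * nat :=
  if w is r :: w' then
    if j == size w' then (1 :: w', 1)
    else let vb := ins j w' in
      if r == vb.2 then (vb.2.+1 :: vb.1, vb.2.+1) else (r :: vb.1, vb.2)
  else ([::], 0).

Fixpoint blank (j : nat) (w : seq nat) : bool :=
  if w is r :: w' then if j == size w' then r == 0 else blank j w' else false.

Definition addable (w : seq nat) (r : nat) : bool :=
  (0 < r) && ((r == 1) || (cnt r w < cnt r.-1 w)).

Definition corner (w : seq nat) (b : nat) : bool :=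
  (0 < b) && (cnt b.+1 w < cnt b w).

Fixpoint yam (w : seq nat) : bool :=
  if w is r :: w' then yam w' && ((r == 0) || addable w' r) else true.

Lemma cnt_cons r s w : cnt r (s :: w) = (s == r) + cnt r w.
Proof. by []. Qed.

Lemma yam_cnt w r : yam w -> 0 < r -> cnt r.+1 w <= cnt r w.
Proof.
elim: w => //= s w IH /andP[yw sw] r0; rewrite !cnt_cons; move: (IH yw r0).
move: sw; rewrite /addable; case: (s =P r.+1) => [->|_] /=; last by lia.
by case: (r.+1 =P r) => //=; lia.
Qed.

Lemma yam_cnt_gt w r : yam w -> size w < r -> cnt r w = 0.
Proof.
elim: w r => //= s w IH r /andP[yw sw] sr; rewrite cnt_cons IH ?addn0 //; last by lia.
case: (s =P r) => // e; move: sw; rewrite e /addable => /orP[/eqP|/andP[r0 /orP[/eqP|]]]; [lia|lia|].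
by rewrite (IH r.-1) //; lia.
Qed.

Lemma size_ins j w : size (ins j w).1 = size w.
Proof. by elim: w => //= r w IH; case: ifP => // _; case: ifP => /= _; rewrite IH. Qed.

Lemma blank_ltn j w : blank j w -> j < size w.
Proof. by elim: w => //= r w IH; case: (j =P size w) => [-> //|_ /IH]; lia. Qed.

Lemma ins_row_gt0 j w : blank j w -> 0 < (ins j w).2.
Proof. by elim: w => //= r w IH; case: ifP => // _ /IH; case: ifP. Qed.

Lemma cnt_ins j w r : blank j w -> 0 < r ->
  cnt r (ins j w).1 = cnt r w + (r == (ins j w).2).
Proof.
elim: w => //= s w IH bj r0; move: bj; case: (j =P size w) => [_ /eqP ->|_ bj] /=.
  by rewrite !cnt_cons; lia.
have := IH bj r0; have := ins_row_gt0 bj; case: (s =P (ins j w).2) => [->|_] /=; rewrite !cnt_cons => ? ->; lia.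
Qed.

Lemma yam_ins j w : yam w -> blank j w -> yam (ins j w).1.
Proof.
elim: w => //= s w IH /andP[yw sw]; case: (j =P size w) => [_ _|_ bj] /=; first by rewrite yw.
have c r := @cnt_ins j w r bj; have b0 := ins_row_gt0 bj; have yv := IH yw bj.
case: (s =P (ins j w).2) sw => [->|sb] sw /=; rewrite yv /= /addable /=.
  apply/orP; right; rewrite !c // eqxx; have := yam_cnt yw b0.
  by case: eqP; lia.
by move: sw; rewrite /addable; case: s sb => [|[|s]] sb //=; rewrite !c //=; lia.
Qed.

Lemma blank_ins j w i : blank j w -> blank i (ins j w).1 = blank i w && (i != j).
Proof.
elim: w => //= s w IH; case: (j =P size w) => [-> /eqP ->|jw bj] /=.
  by case: (i =P size w) => [_|_] /=; rewrite ?andbF ?andbT.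
have b0 := ins_row_gt0 bj.
case: (s =P (ins j w).2) => [->|sb] /=; rewrite size_ins; (case: (i =P size w) => [iw|_]; last exact: IH).
  by rewrite iw; case: (_.2) b0 => //.
by case: eqP => //= _; apply/esym/eqP; rewrite iw => e; rewrite e in jw.
Qed.

(** Positions are counted from the end of the list, so the first [k] of them are what [drop]
    leaves. *)
Definition ones (w : seq nat) (k : nat) : nat := cnt 1 (drop (size w - k) w).

Lemma ones_size w : ones w (size w) = cnt 1 w.
Proof. by rewrite /ones subnn drop0. Qed.

Lemma ones_cons r w k : k <= size w -> ones (r :: w) k = ones w k.
Proof. by move=> kw; rewrite /ones /= subSn. Qed.

Lemma ones_mono w k : ones w k <= cnt 1 w.
Proof.
rewrite /ones; elim: w (_ - _) => //= r w IH [|d]; first by rewrite drop0.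
by rewrite /= cnt_cons; apply: leq_trans (IH d) _; rewrite leq_addl.
Qed.

(** Bumping leaves row [1] at the first letter [1] met after position [j], and never returns to
    it. *)
Lemma ones_ins_row j w : blank j w ->
  ((ins j w).2 == 1) = (ones w j == cnt 1 w).
Proof.
elim: w => //= s w IH; case: (j =P size w) => [-> /eqP ->|jw bj] /=.
  by rewrite ones_cons // ones_size cnt_cons !eqxx.
have jw' := blank_ltn bj.
rewrite ones_cons ?cnt_cons; last exact: ltnW.
have b0 := ins_row_gt0 bj; move: (IH bj) => e; have := ones_mono w j.
case: (s =P (ins j w).2) => [->|sb] /=; lia.
Qed.

Lemma ones_ins j w k : blank j w -> k <= size w ->
  ones (ins j w).1 k = if k <= j then ones w k else maxn (ones w k) (ones w j).+1.
Proof.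
elim: w => // s w IH bj; rewrite leq_eqVlt => /orP[/eqP ->|].
  have jw := blank_ltn bj; rewrite leqNgt jw ones_size -(size_ins j (s :: w)) ones_size.
  rewrite cnt_ins // -/(ones _ _) ; have e := ones_ins_row bj; have := ones_mono (s :: w) j.
  by rewrite [1 == _]eq_sym e /=; case: eqP => [->|]; lia.
rewrite ltnS => kw; move: bj => /=.
case: (j =P size w) => [-> /eqP ->|jw bj] /=; first by rewrite !ones_cons // kw.
have jw' := ltnW (blank_ltn bj).
by rewrite [ones (s :: w) k]ones_cons // [ones (s :: w) j]ones_cons // -IH //; case: ifP => _ /=; rewrite ones_cons // size_ins.
Qed.

End Words.

Lemma big_natD1 (K : nmodType) (B : nat) (P : pred nat) (F : nat -> K) j :
  (j < B)%N -> P j ->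
  (\sum_(0 <= i < B | P i) F i = F j + \sum_(0 <= i < B | P i && (i != j)) F i)%R.
Proof.
move=> jB Pj; rewrite big_mkcond (bigD1_seq j) ?mem_index_iota ?iota_uniq //= Pj.
by congr (_ + _)%R; rewrite -big_mkcondr; apply: eq_bigl => i; rewrite andbC.
Qed.

(** * Sums over lattice words *)

Section WordSums.
Variables (K : comNzRingType) (B : nat).
Local Open Scope ring_scope.

(** A letter of a lattice word never exceeds the length of the word, so for [B > m] the bound keeps
    every lattice word of length [m]. *)
Fixpoint SW (m : nat) (F : seq nat -> K) : K :=
  if m is m'.+1 then
    SW m' (fun w => \sum_(0 <= r < B | (r == 0)%N || addable w r) F (r :: w))
  else F [::].

Lemma eq_SW m F G : (forall w, yam w -> size w = m -> F w = G w) -> SW m F = SW m G.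
Proof.
elim: m F G => [|m IH] F G FG /=; first exact: FG.
apply: IH => w yw sw; apply: eq_bigr => r wr; apply: FG => /=; first by rewrite yw.
by rewrite sw.
Qed.

Lemma SWD m F G : SW m (fun w => F w + G w) = SW m F + SW m G.
Proof. by elim: m F G => //= m IH F G; rewrite -IH; apply: eq_SW => w _ _; rewrite big_split. Qed.

(* Rows addable to the shape of [w] with one box removed from row [b]. *)
Definition addable_del (w : seq nat) (b r : nat) : bool :=
  (0 < r)%N && ((r == 1)%N || (cnt r w - (r == b) < cnt r.-1 w - (r.-1 == b))%N).

Lemma addable_ins j w r : blank j w ->
  addable w r = addable_del (ins j w).1 (ins j w).2 r.
Proof.
move=> bj; rewrite /addable /addable_del; case: r => // -[|r] //=.
by rewrite !cnt_ins // !addnK.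
Qed.

(* The commutation relation [DU - UD = 1] of the differential poset of partitions. *)
Lemma up_down (v : seq nat) (f : nat -> nat -> K) : yam v -> ((size v).+1 < B)%N ->
  f 1%N 1%N + \sum_(0 <= b < B | corner v b)
    \sum_(0 <= r < B | (r == 0)%N || addable_del v b r)
      (if (r == b)%N then f b.+1 b.+1 else f r b) =
  \sum_(0 <= r < B | (r == 0)%N || addable v r)
    \sum_(0 <= b < B | corner (r :: v) b) f r b.
Proof.
move=> yv vB.
have B0 : (0 < B)%N by apply: leq_ltn_trans vB.
have cB b : corner v b -> (b.+1 < B)%N.
  move=> /andP[b0 cb]; rewrite ltnNge; apply/negP => Bb.
  by move: cb; rewrite (@yam_cnt_gt v b) //; lia.
have diag b : corner v b -> addable_del v b b.
  move=> /andP[b0 cb]; rewrite /addable_del b0 /= eqxx.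
  by case: b b0 cb => // -[|b] //= _ cb; have := @yam_cnt v b.+1 yv isT; lia.
(* Three groups: a blank [r = 0], the case [r = b] where both labels move to the next row, and
   [r != b]. In the second group, row [1] and the rows just after the corners are exactly the
   addable rows. *)
transitivity (\sum_(0 <= b < B | corner v b) f 0%N b
  + (f 1%N 1%N + \sum_(0 <= b < B | corner v b) f b.+1 b.+1)
  + \sum_(0 <= b < B) \sum_(0 <= r < B | [&& (0 < r)%N, r != b, corner v b & addable_del v b r]) f r b).
  rewrite addrCA addrA -!addrA; congr (_ + _); rewrite !addrA -big_split /=.
  rewrite [X in _ = _ + X](bigID (fun b => corner v b)) /=.
  rewrite [X in _ = _ + (_ + X)]big1 ?addr0 -?big_split /=; last first.
    by move=> b /negbTE nb; apply: big1 => r; rewrite nb !andbF.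
  apply: congr_big_nat => // b /andP[cb /andP[_ bB']].
  rewrite (@big_natD1 _ _ _ _ 0%N) //=.
  have b0 : (0 < b)%N by case/andP: cb.
  rewrite (negbTE (_ : 0%N != b)); last by rewrite neq_ltn b0.
  rewrite (@big_natD1 _ _ _ _ b) ?diag ?orbT //=; last by rewrite -lt0n b0.
  rewrite eqxx addrA; congr (_ + _ + _).
  apply: congr_big_nat => // r; last by case/andP=> /andP[_ /negbTE ->].
  by move=> _; rewrite cb; case: r => //= r; rewrite andbT andbC.
transitivity (\sum_(0 <= b < B | corner v b) f 0%N b
  + \sum_(0 <= r < B | addable v r) f r r
  + \sum_(0 <= r < B) \sum_(0 <= b < B | [&& (0 < r)%N, r != b, corner v b & addable_del v b r]) f r b).
  congr (_ + _ + _); last first.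
    by rewrite (exchange_big_dep predT).
  case: (B) vB cB => // B' vB cB.
  rewrite [in RHS]big_ltn_cond // [addable v 0]/= big_add1 /=.
  rewrite [in RHS]big_ltn_cond; last by lia.
  rewrite [addable v 1]/=; congr (_ + _).
  rewrite big_mkcond big_nat_recr //= [X in _ + X](_ : _ = 0) ?addr0; last first.
    by case: ifP => // /cB; rewrite ltnn.
  rewrite -big_mkcond big_ltn_cond /=; last by lia.
  rewrite [LHS]big_nat_cond [RHS]big_nat_cond.
  by apply: eq_bigl => -[|b] //=; rewrite andbF.
rewrite [in RHS](@big_natD1 _ _ _ _ 0%N) //=.
rewrite -addrA; congr (_ + _); first by apply: eq_bigl => -[].
rewrite [X in _ = X](eq_bigl (fun r => addable v r)); last first.
  by move=> r; case: r => //= r; rewrite andbT.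
rewrite [X in _ + X](bigID (fun r => addable v r)) /=.
rewrite [X in _ + (_ + X)]big1 ?addr0 -?big_split /=; last first.
  move=> r nr; apply: big1 => b /and4P[r0 rb cb]; move: nr cb.
  rewrite /addable /addable_del /corner r0 /=.
  by case: (r == 1%N) => //=; lia.
apply: congr_big_nat => // r /andP[ar /andP[_ rB]].
rewrite [RHS](@big_natD1 _ _ _ _ r) //=; last first.
  case/andP: ar => r0 _; rewrite /corner r0 /= !cnt_cons eqxx.
  by have := yam_cnt yv r0; case: eqP; lia.
congr (_ + _); apply: eq_bigl => b; move: ar.
rewrite /addable /addable_del /corner !cnt_cons => /andP[r0 ar].
rewrite r0 eq_sym /=; case: (b =P r) => //= br; rewrite ?andbF //= andbT.
move: ar; case: (r =P 1%N) => [->|r1] /=.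
  by rewrite ?andbT; case: b br => //= b br; case: eqP => //; lia.
by case: b br => //= b br ar; case: (r =P b.+2) => [->|] /=; rewrite ?eqxx /=; lia.
Qed.

(** Summed form of the bijection between words with a chosen blank and words with a chosen corner.
    By induction on the last letter: if it is the chosen blank it turns into a [1]; otherwise the
    shorter word is filled and the pair of labels goes through the local rule, which is
    [up_down]. *)
Lemma SW_ins m (F : seq nat -> nat -> K) : (m.+1 < B)%N ->
  SW m (fun w => \sum_(0 <= j < m | blank j w) F (ins j w).1 (ins j w).2) =
  SW m (fun w => \sum_(0 <= b < B | corner w b) F w b).
Proof.
elim: m F => [|m IH] F mB.
  rewrite /= big_geq // big1 // => b; rewrite /corner /cnt /=; lia.
have B0 : (0 < B)%N by lia.
transitivity (SW m (fun w => F (1%N :: w) 1%N +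
   \sum_(0 <= j < m | blank j w) \sum_(0 <= r < B | (r == 0)%N || addable_del (ins j w).1 (ins j w).2 r)
     (if r == (ins j w).2 then F ((ins j w).2.+1 :: (ins j w).1) (ins j w).2.+1
      else F (r :: (ins j w).1) (ins j w).2))).
  rewrite /=; apply: eq_SW => w yw sw.
  rewrite (exchange_big_dep_nat (fun j => (j == m) || blank j w)) /=; last first.
    by move=> r j; rewrite sw => _ _ _; case: (j == m).
  rewrite big_mkcond big_nat_recr //= eqxx /= -big_mkcond addrC; congr (_ + _).
    rewrite sw eqxx (eq_bigl (fun r => r == 0%N)); last by move=> r; case: (r =P 0%N); rewrite ?andbT ?andbF.
    rewrite (@big_natD1 _ _ _ _ 0%N) //= big1 ?addr0 // => r; by case: eqP.
  apply: congr_big_nat => // j jm.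
    by rewrite (_ : j == m = false) //; apply/negbTE; lia.
  have nj : j == m = false by apply/negbTE; lia.
  have bj : blank j w by move: jm; rewrite nj => /andP[].
  rewrite sw nj bj; apply: eq_big => r; last by case: ifP.
  by rewrite andbT -addable_ins.
rewrite SWD (IH (fun v b => \sum_(0 <= r < B | (r == 0)%N || addable_del v b r)
     (if r == b then F (b.+1 :: v) b.+1 else F (r :: v) b))) ?(ltnW mB) // -SWD /=.
apply: eq_SW => v yv sv.
by rewrite (@up_down v (fun r b => F (r :: v) b)) // sv; lia.
Qed.

End WordSums.

(** * Column lengths and walks on partitions *)

Section Columns.
Local Open Scope nat_scope.

(* The length of column [c] of the shape of [w]. *)
Definition columns (w : seq nat) (c : nat) : nat :=
  \sum_(1 <= r < (size w).+1) (c < cnt r w).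

Lemma muE w c : yam w -> forall r, 0 < r -> (c < cnt r w) = (r <= columns w c).
Proof.
move=> yw.
have mon r s : 0 < r -> r <= s -> cnt s w <= cnt r w.
  move=> r0 /subnKC <-; elim: (s - r) => [|d IH]; first by rewrite addn0.
  by rewrite addnS; apply: leq_trans IH; apply: yam_cnt => //; lia.
(* The rows longer than [c] form an initial segment, so their number is also the last of them. *)
have part m : (forall r, 0 < r <= m -> (c < cnt r w) = (r <= \sum_(1 <= i < m.+1) (c < cnt i w)))
   /\ \sum_(1 <= i < m.+1) (c < cnt i w) <= m.
  elim: m => [|m [IH1 IH2]]; first by rewrite big_geq //; split=> // r; lia.
  rewrite big_nat_recr //=; split; last by case: (c < _); lia.
  move=> r /andP[r0]; rewrite leq_eqVlt => /orP[/eqP ->|rm].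
    case: (ltnP c (cnt m.+1 w)) => [cm|_]; last by rewrite addn0 ltnNge IH2.
    rewrite addn1 ltnS; apply/esym.
    case: m IH1 IH2 cm => // m IH1 IH2 cm; rewrite -IH1 ?leqnn //.
    exact: leq_trans cm (mon _ _ _ _).
  rewrite IH1; last by lia.
  case: (ltnP c (cnt m.+1 w)) => cm; last by rewrite addn0.
  have : r <= \sum_(1 <= i < m.+1) (c < cnt i w).
    by rewrite -IH1; [apply: leq_trans cm (mon _ _ _ _); lia|lia].
  by move=> h; rewrite h; lia.
move=> r r0; have [h1 h2] := part (size w).
have [rs|rs] := leqP r (size w); first by apply: h1; rewrite r0.
by rewrite yam_cnt_gt // ltn0; apply/esym/negbTE; rewrite -ltnNge; apply: leq_ltn_trans rs.
Qed.

Lemma mu_leq w c : yam w -> columns w c <= size w.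
Proof.
move=> yw; case e : (columns w c) => [|m] //; have := @muE w c yw m.+1 isT; rewrite e leqnn => h.
by rewrite leqNgt; apply/negP => ?; move: h; rewrite yam_cnt_gt.
Qed.

Lemma mu_eq w c m : yam w -> (forall r, 0 < r -> (c < cnt r w) = (r <= m)) -> columns w c = m.
Proof.
move=> yw h; apply/eqP; rewrite eqn_leq; apply/andP; split.
  by case e: (columns w c) => [|k] //; rewrite -h // muE // e.
by case: m h => // m h; rewrite -muE // h.
Qed.

Lemma mu_eq0 w c : yam w -> cnt 1 w <= c -> columns w c = 0.
Proof.
move=> yw cw; apply/eqP; rewrite -leqn0 leqNgt; apply/negP.
by rewrite -muE // ltnNge cw.
Qed.

Lemma addable_mu w r : yam w -> addable w r ->
  r = (columns w (cnt r w)).+1 /\ ((cnt r w == 0) || (columns w (cnt r w) < columns w (cnt r w).-1)).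
Proof.
move=> yw /andP[r0 ar]; set c := cnt r w.
have h s := @muE w c yw s.
have e : r = (columns w c).+1.
  have := h r r0; rewrite ltnn => /esym/negbT; rewrite -ltnNge => h1.
  have [r1|r1] := eqVneq r 1; first by rewrite r1 in h1 *; move: h1; lia.
  have lt : cnt r w < cnt r.-1 w by move: ar; rewrite (negbTE r1).
  have {}r1 : 0 < r.-1 by lia.
  by have := h r.-1 r1; rewrite lt => /esym; lia.
split=> //; case: (posnP c) => // c0; have := @muE w c.-1 yw r r0; rewrite -/c prednK // leqnn => /esym.
by rewrite e.
Qed.

Lemma mu_addable w c : yam w -> (c == 0) || (columns w c < columns w c.-1) ->
  addable w (columns w c).+1 /\ cnt (columns w c).+1 w = c.
Proof.
move=> yw hc.
have e : cnt (columns w c).+1 w = c.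
  have := @muE w c yw (columns w c).+1 isT; rewrite ltnn => /negbT; rewrite -leqNgt => h.
  apply/eqP; rewrite eqn_leq h /=; case: c hc {h} => //= c; rewrite -muE //.
split=> //; rewrite /addable e /=; case m: (columns w c) => [|m'] //=.
by rewrite muE // m.
Qed.

Lemma mu_cons0 w c : yam w -> columns (0 :: w) c = columns w c.
Proof.
by move=> yw; apply: mu_eq => [|r r0]; rewrite /= ?yw // cnt_cons -muE //; case: r r0.
Qed.

Lemma mu_cons w r c : yam w -> addable w r ->
  columns (r :: w) c = columns w c + (c == cnt r w).
Proof.
move=> yw ar; have [e _] := addable_mu yw ar.
apply: mu_eq => [|s s0]; first by rewrite /= yw ar orbT.
rewrite cnt_cons; case: (r =P s) => [<-|rs].
  case: (c =P cnt r w) => [->|cr].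
    by rewrite add1n ltnSn addn1 -e leqnn.
  by rewrite addn0 -muE; [lia|lia|rewrite e].
rewrite add0n; case: (c =P cnt r w) => [->|cr]; last by rewrite addn0 muE.
by rewrite muE //; move: rs; rewrite {1}e; lia.
Qed.

Lemma corner_mu w b : yam w -> corner w b ->
  columns w (cnt b w).-1 = b /\ columns w (cnt b w) < b.
Proof.
move=> yw /andP[b0 cb]; split.
  have := @muE w (cnt b w).-1 yw b b0; have := @muE w (cnt b w).-1 yw b.+1 isT.
  by case: (cnt b w) cb => // c; rewrite /= ltnSn => h; lia.
by have := @muE w (cnt b w) yw b b0; rewrite ltnn; lia.
Qed.

Lemma mu_corner w c : yam w -> columns w c.+1 < columns w c ->
  corner w (columns w c) /\ cnt (columns w c) w = c.+1.
Proof.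
move=> yw h; have m0 : 0 < columns w c by apply: leq_ltn_trans h.
have h1 := @muE w c yw _ m0; have h2 := @muE w c.+1 yw _ m0.
have h3 := @muE w c yw (columns w c).+1 isT.
by rewrite /corner m0; lia.
Qed.

Definition letters (b : bool) (w : seq nat) := count (fun r => (0 < r) && (odd r == b)) w.

(* Row [r] adds a box in parity class [r]; this is the alternating sum of the row lengths. *)
Lemma letters_mu w l : yam w -> cnt 1 w <= l ->
  letters true w = letters false w + \sum_(0 <= c < l) odd (columns w c).
Proof.
elim: w => [_ _|r w IH yrw].
  by rewrite /letters /= big1 // => c _; rewrite /columns /= big_geq.
rewrite cnt_cons => wl; have /andP[yw] : yam w && ((r == 0) || addable w r) := yrw.
case: (r =P 0) => [->|r0] /= aw.
  rewrite /letters /= -!/(letters _ _) (IH yw); last by lia.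
  by rewrite !add0n; congr (_ + _); apply: eq_bigr => c _; rewrite mu_cons0.
have cl : cnt r w < l.
  have [e|r1] := eqVneq r 1; first by move: wl; rewrite e; lia.
  have lt : cnt r w < cnt r.-1 w by move: aw; rewrite /addable (negbTE r1); lia.
  have {}r1 : 0 < r.-1 by lia.
  apply: leq_trans lt _; apply: leq_trans (leq_trans (leq_addl _ _) wl).
  have := @muE w (cnt 1 w) yw r.-1 r1; have := @muE w (cnt 1 w) yw 1 isT; lia.
have [e _] := addable_mu yw aw.
rewrite /letters /= -!/(letters _ _) (IH yw); last by lia.
(* Only the column that receives the box changes, and its new length is [r]. *)
have E : \sum_(0 <= c < l) odd (columns (r :: w) c) + odd (columns w (cnt r w)) =
    \sum_(0 <= c < l) odd (columns w c) + odd r.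
  rewrite ![\sum_(0 <= c < l) _](bigD1_seq (cnt r w)) ?mem_index_iota ?iota_uniq //=.
  rewrite mu_cons // eqxx addn1 -e addnC [in RHS]addnC addnCA; congr (_ + (_ + _)).
  by apply: eq_bigr => c /negbTE cr; rewrite mu_cons // cr addn0.
have o : odd (columns w (cnt r w)) = ~~ odd r by rewrite [in RHS]e /= negbK.
by move: E; rewrite o; case: (odd r) => /=; case: r r0 {yrw wl aw cl e o} => // r _ /=; lia.
Qed.

End Columns.
Arguments letters : simpl never.

Section ColumnSums.
Variables (K : comNzRingType).
Local Open Scope ring_scope.

Lemma sum_nat_fiber (B l : nat) (P Q : pred nat) (g h : nat -> nat) (f : nat -> K) :
  (forall r, P r -> (g r < l)%N /\ Q (g r) /\ h (g r) = r) ->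
  (forall c, (c < l)%N -> Q c -> [/\ (h c < B)%N, P (h c) & g (h c) = c]) ->
  \sum_(0 <= r < B | P r) f (g r) = \sum_(0 <= c < l | Q c) f c.
Proof.
move=> gP hQ.
rewrite (eq_bigr (fun r => \sum_(0 <= c < l | c == g r) f c)); last first.
  move=> r /gP[gl _]; rewrite (@big_natD1 _ _ _ _ (g r)) // big1 ?addr0 // => c /andP[/eqP ->].
  by rewrite eqxx.
rewrite (exchange_big_dep_nat predT) //= [RHS]big_mkcond; apply: eq_big_nat => c /andP[_ cl].
case: ifP => Qc.
  have [hB Ph gh] := hQ c cl Qc.
  rewrite (@big_natD1 _ _ _ _ (h c)) ?Ph ?gh ?eqxx // big1 ?addr0 // => r /andP[/andP[Pr /eqP e]].
  by have [_ [_]] := gP r Pr; rewrite -e => ->; rewrite eqxx.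
by apply: big1 => r /andP[Pr /eqP e]; have [_ [Qg _]] := gP r Pr; rewrite -e Qc in Qg.
Qed.

Lemma cnt_lt_width w r l : yam w -> addable w r -> (cnt 1 w <= l)%N ->
  (cnt 1 w < l)%N || (r != 1%N) -> (cnt r w < l)%N.
Proof.
move=> yw /andP[r0]; have [->|r1] := eqVneq r 1%N => /= lt wl; first by rewrite orbF.
move=> _; apply: leq_trans lt _; apply: leq_trans wl.
have {}r1 : (0 < r.-1)%N by lia.
have := @muE w (cnt 1 w) yw r.-1 r1; have := @muE w (cnt 1 w) yw 1 isT; lia.
Qed.

Lemma sum_addable B l w (f : nat -> K) : yam w -> ((size w).+1 < B)%N ->
  \sum_(0 <= r < B | addable w r && (cnt r w < l)%N) f (cnt r w) =
  \sum_(0 <= c < l | (c == 0)%N || (columns w c < columns w c.-1)%N) f c.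
Proof.
move=> yw wB; apply: (@sum_nat_fiber _ _ _ _ _ (fun c => (columns w c).+1)).
  by move=> r /andP[ar rl]; have [e h] := addable_mu yw ar; split=> //; split.
move=> c cl hc; have [a e] := mu_addable yw hc; rewrite a e cl; split=> //.
by apply: leq_ltn_trans wB; rewrite ltnS mu_leq.
Qed.

Lemma sum_corner B l w (f : nat -> K) : yam w -> (size w < B)%N -> (cnt 1 w <= l)%N ->
  \sum_(0 <= b < B | corner w b) f (cnt b w).-1 =
  \sum_(0 <= c < l | (columns w c.+1 < columns w c)%N) f c.
Proof.
move=> yw wB wl; apply: (@sum_nat_fiber _ _ _ _ _ (columns w)).
  move=> b cb; have [e h] := corner_mu yw cb.
  have c0 : (0 < cnt b w)%N by case/andP: cb => _; apply: leq_ltn_trans.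
  rewrite e prednK //; split=> //; apply: leq_trans wl.
  case/andP: cb => b0 _.
  have := @muE w (cnt 1 w) yw b b0; have := @muE w (cnt 1 w) yw 1 isT; lia.
move=> c cl hc; have [a e] := mu_corner yw hc; rewrite a e; split=> //.
by apply: leq_ltn_trans wB; rewrite mu_leq.
Qed.

End ColumnSums.

Section Walks.
Variables (K : comNzRingType) (l : nat).
Local Open Scope ring_scope.
Implicit Types (m : nat -> nat) (psi kappa : (nat -> nat) -> K).

Definition inc (c : nat) m : nat -> nat := fun i => (m i + (i == c))%N.
Definition dec (c : nat) m : nat -> nat := fun i => (m i - (i == c))%N.

(* Steps of a walk on the partitions with [l] columns, given by their column lengths. *)
Definition step_up psi m : K :=
  \sum_(0 <= c < l | (c == 0)%N || (m c < m c.-1)%N) psi (inc c m).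
Definition step_down psi m : K := \sum_(0 <= c < l | (m c.+1 < m c)%N) psi (dec c m).
Definition updown kappa psi m : K := step_up psi m + step_down psi m + kappa m * psi m.

Lemma mu_nil : columns [::] = fun=> 0%N.
Proof. by apply/funext => c; rewrite /columns /= big_geq. Qed.

Lemma mu_cons0_fun w : yam w -> columns (0%N :: w) = columns w.
Proof. by move=> yw; apply/funext => c; rewrite mu_cons0. Qed.

Lemma mu_cons_fun w r : yam w -> addable w r -> columns (r :: w) = inc (cnt r w) (columns w).
Proof. by move=> yw ar; apply/funext => c; rewrite mu_cons. Qed.

(** Insertion changes the shape as if the letter [(ins j w).2] were appended to [w]; removing that
    box gives the old shape back. *)
Lemma mu_ins_fun w j : yam w -> blank j w ->
  columns w = dec (cnt (ins j w).2 (ins j w).1).-1 (columns (ins j w).1).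
Proof.
move=> yw bj; have b0 := ins_row_gt0 bj; have c r := @cnt_ins j w r bj.
have yv := yam_ins yw bj.
have ab : addable w (ins j w).2.
  rewrite /addable b0 /=; case: eqP => //= b1.
  have b2 : (0 < (ins j w).2.-1)%N by lia.
  by have := yam_cnt yv b2; rewrite prednK // !c // eqxx; case: eqP; lia.
have yb : yam ((ins j w).2 :: w) by rewrite /= yw ab orbT.
have -> : columns (ins j w).1 = columns ((ins j w).2 :: w).
  apply/funext => i; apply: mu_eq => // r r0.
  by rewrite -(muE _ yb) // c // cnt_cons eq_sym addnC.
by rewrite mu_cons_fun // c // eqxx addn1 /=; apply/funext => i; rewrite /dec /inc addnK.
Qed.

Lemma cnt1_cons w r : yam w -> addable w r -> (cnt 1 w <= l)%N ->
  (cnt 1 (r :: w) <= l)%N = (cnt r w < l)%N.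
Proof.
move=> yw ar wl; rewrite cnt_cons; have [->|r1] := eqVneq r 1%N; first by [].
by rewrite add0n wl (@cnt_lt_width w r l) // r1 orbT.
Qed.

Lemma up_cons B w psi : yam w -> ((size w).+1 < B)%N -> (cnt 1 w <= l)%N ->
  \sum_(0 <= r < B | addable w r) (cnt 1 (r :: w) <= l)%N%:R * psi (columns (r :: w)) =
  step_up psi (columns w).
Proof.
move=> yw wB wl; rewrite /step_up -(@sum_addable _ B) // [RHS]big_mkcondr /=.
apply: eq_bigr => r ar; rewrite cnt1_cons // mu_cons_fun //.
by case: ifP; rewrite ?mul1r ?mul0r.
Qed.

(** Words without blanks are standard tableaux, that is walks of additions. Testing the first row at
    the end is enough, because it only grows. *)
Lemma SW_full B n psi : (n < B)%N ->
  SW B n (fun w => (0%N \notin w)%:R * ((cnt 1 w <= l)%N%:R * psi (columns w))) =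
  iter n step_up psi (fun=> 0%N).
Proof.
elim: n psi => [|n IH] psi nB; first by rewrite /= mu_nil !mul1r.
rewrite iterSr -IH ?(ltnW nB) //=; apply: eq_SW => w yw sw.
rewrite (@big_natD1 _ B _ _ 0%N) //=; last by lia.
rewrite mul0r add0r.
rewrite (eq_bigl (addable w)); last by case=> // r /=; rewrite andbT.
case: (leqP (cnt 1 w) l) => wl; last first.
  rewrite mul0r mulr0 big1 // => r ar.
  by rewrite (_ : (cnt 1 (r :: w) <= l)%N = false) ?mul0r ?mulr0 // cnt_cons; apply/negbTE; lia.
rewrite mul1r -(@up_cons B) // ?sw // mulr_sumr; apply: eq_bigr => r ar.
by rewrite inE; case: r ar.
Qed.

(** The recursion of [KS] removes the last letter: a row label is dropped, a blank either stays
    single with weight [kappa] or fills an earlier blank [j]. Summed over words these become an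
    addition, a pause and, by [SW_ins], a removal. *)
Lemma SW_updown B (n : nat) KS kappa psi : (n.+1 < B)%N -> KS [::] = 1 ->
  (forall r w, (size w < n)%N -> yam (r :: w) -> KS (r :: w) = (cnt 1 (r :: w) <= l)%N%:R *
     (if r == 0%N then kappa (columns w) * KS w
        + \sum_(0 <= j < size w | blank j w) KS (ins j w).1 else KS w)) ->
  SW B n (fun w => KS w * psi (columns w)) = iter n (updown kappa) psi (fun=> 0%N).
Proof.
move=> mB KS0 KSE.
have KSz w : (size w <= n)%N -> yam w -> (l < cnt 1 w)%N -> KS w = 0.
  by case: w => // r w wn yw wl; rewrite KSE // leqNgt wl mul0r.
elim: n psi mB KSE KSz => [|n IH] psi mB KSE KSz; first by rewrite /= mu_nil KS0 mul1r.
have KSE' r w : (size w < n)%N -> yam (r :: w) -> KS (r :: w) = (cnt 1 (r :: w) <= l)%N%:R *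
     (if r == 0%N then kappa (columns w) * KS w
        + \sum_(0 <= j < size w | blank j w) KS (ins j w).1 else KS w).
  by move=> wn; apply: KSE; apply: ltnW.
have KSz' w : (size w <= n)%N -> yam w -> (l < cnt 1 w)%N -> KS w = 0.
  by move=> wn; apply: KSz; apply: ltnW.
rewrite iterSr -IH ?(ltnW mB) //=.
(* In the third sum [psi] is expressed through the filled word and its corner, the form to which
   [SW_ins] applies. *)
transitivity (SW B n (fun w => KS w * step_up psi (columns w) + KS w * (kappa (columns w) * psi (columns w))
   + \sum_(0 <= j < n | blank j w) KS (ins j w).1 *
       psi (dec (cnt (ins j w).2 (ins j w).1).-1 (columns (ins j w).1)))).
  apply: eq_SW => w yw sw; rewrite (@big_natD1 _ B _ _ 0%N) //=; last by lia.
  rewrite (eq_bigl (addable w)); last by case=> // r /=; rewrite andbT.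
  rewrite mu_cons0_fun // KSE ?sw //=; last by rewrite yw.
  rewrite cnt_cons add0n /=.
  rewrite [X in _ = _ + X](eq_bigr (fun j => KS (ins j w).1 * psi (columns w))); last first.
    by move=> j bj; rewrite -mu_ins_fun.
  rewrite -mulr_suml; case: (leqP (cnt 1 w) l) => wl; last first.
    rewrite KSz' ?sw // !mul0r !add0r big1 ?big1 ?mul0r // => [j bj|r ar].
      by rewrite KSz' ?size_ins ?sw ?yam_ins // cnt_ins //; lia.
    by rewrite KSE ?sw /= ?yw ?ar ?orbT // KSz' ?sw // (negbTE (lt0n_neq0 _)) ?mulr0 ?mul0r //; case/andP: ar.
  rewrite -(@up_cons B) // ?sw ?(ltnW mB) // mul1r mulr_sumr addrC mulrDl -!addrA; congr (_ + _); last first.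
    by rewrite mulrCA mulrA.
  apply: eq_bigr => r ar; rewrite KSE ?sw /= ?yw ?ar ?orbT // (negbTE (lt0n_neq0 _)); last by case/andP: ar.
  by rewrite mulrCA mulrA.
rewrite SWD (@SW_ins _ B n (fun v b => KS v * psi (dec (cnt b v).-1 (columns v)))) ?(ltnW mB) // -SWD.
apply: eq_SW => w yw sw.
case: (leqP (cnt 1 w) l) => wl; last first.
  by rewrite KSz' ?sw // !mul0r !add0r big1 // => b _; rewrite mul0r.
rewrite /updown !mulrDr -mulr_sumr (@sum_corner _ B l w (fun c => psi (dec c (columns w)))) ?sw ?(ltnW (ltnW mB)) //.
by rewrite addrAC.
Qed.

End Walks.

(** * Increasing chains and growth diagrams *)

Section Chains.
Variable N : nat.
Implicit Types (s : {perm 'I_N}) (A : {set 'I_N}).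
Local Open Scope nat_scope.

(** Rows are arguments and columns are values of [s]: the chain lies in the rectangle of the first
    [i] rows and [k] columns. *)
Definition chainb s (i k q : nat) : bool :=
  [exists A : {set 'I_N}, [&& increasing_on s A,
     [forall x in A, (x < i) && (s x < k)] & q <= #|A|]].

Lemma increasing_onP s A :
  reflect {in A &, forall x y : 'I_N, x < y -> s x < s y} (increasing_on s A).
Proof.
apply: (iffP forall_inP) => [h x y xA yA xy|h x xA].
  by have /forall_inP/(_ y yA)/implyP := h x xA; apply.
by apply/forall_inP => y yA; apply/implyP; apply: h.
Qed.

Lemma chainP s i k q : reflect (exists A, [/\ {in A &, forall x y : 'I_N, x < y -> s x < s y},
    {in A, forall x : 'I_N, x < i /\ s x < k} & q <= #|A|]) (chainb s i k q).
Proof.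
apply: (iffP existsP) => -[A].
  case/and3P => /increasing_onP h1 /forall_inP h2 h3; exists A; split=> // x xA.
  by have /andP := h2 x xA.
case=> /increasing_onP h1 h2 h3; exists A; rewrite h1 h3 andbT /=.
by apply/forall_inP => x xA; apply/andP; apply: h2.
Qed.

Lemma sub_increasing s A A' : A' \subset A ->
  {in A &, forall x y : 'I_N, x < y -> s x < s y} ->
  {in A' &, forall x y : 'I_N, x < y -> s x < s y}.
Proof. by move=> /subsetP sA h x y xA yA; apply: h; apply: sA. Qed.

Lemma chain_mono s i k q i' k' q' : i <= i' -> k <= k' -> q' <= q ->
  chainb s i k q -> chainb s i' k' q'.
Proof.
move=> ii kk qq /chainP[A [h1 h2 h3]]; apply/chainP; exists A; split=> //; last exact: leq_trans h3.
by move=> x /h2 [xi sx]; split; [apply: leq_trans ii | apply: leq_trans kk].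
Qed.

Lemma chain0 s i k : chainb s i k 0.
Proof. by apply/chainP; exists set0; split=> // x; rewrite inE. Qed.

Lemma chain_empty s k q : chainb s 0 k q = (q == 0).
Proof.
case: q => [|q]; first by rewrite chain0.
apply/chainP => -[A [_ h2 h3]]; have /set0Pn[x xA] : A != set0 by rewrite -card_gt0; lia.
by have [] := h2 x xA.
Qed.

(** A chain that uses the last row ends there, and the rest of it precedes that point in both
    coordinates; any other chain lies in the earlier rows. *)
Lemma chain_row s (i : 'I_N) k q :
  chainb s i.+1 k q.+1 = chainb s i k q.+1 || (s i < k) && chainb s i (s i) q.
Proof.
apply/idP/orP => [/chainP[A [h1 h2 h3]]|[|/andP[ik /chainP[A [h1 h2 h3]]]]].
- have [iA|iA] := boolP (i \in A); last first.
    left; apply/chainP; exists A; split=> // x xA; have [xi sx] := h2 x xA; split=> //.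
    by rewrite ltn_neqAle -ltnS xi andbT; apply: contraNneq iA => /val_inj <-.
  right; have [_ ->] := h2 i iA; apply/chainP; exists (A :\ i); split.
  + exact: sub_increasing (subsetDl _ _) h1.
  + move=> x /setD1P[xi xA]; have [x1 x2] := h2 x xA.
    have xi' : x < i by rewrite ltn_neqAle -ltnS x1 andbT (inj_eq val_inj).
    by split=> //; apply: h1.
  + by move: h3; rewrite (cardsD1 i) iA.
- exact: chain_mono.
- have iA : i \notin A by apply/negP => /h2[]; rewrite ltnn.
  apply/chainP; exists (i |: A); split; last by rewrite cardsU1 iA.
  + move=> x y /setU1P[->|xA] /setU1P[->|yA]; rewrite ?ltnn //; last exact: h1.
      by have [yi _] := h2 y yA; move=> iy; lia.
    by have [_ sx] := h2 x xA.
  + move=> x /setU1P[->|xA]; first by [].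
    by have [xi sx] := h2 x xA; split; [exact: ltnW|exact: ltn_trans ik].
Qed.

Lemma chain_row_ge s (i : 'I_N) k q : k <= s i -> chainb s i.+1 k q = chainb s i k q.
Proof. by case: q => [|q] ki; rewrite ?chain0 // chain_row ltnNge ki /= orbF. Qed.

Lemma chain_tr s i k q : chainb s i k q -> chainb s^-1 k i q.
Proof.
case/chainP => A [h1 h2 h3]; apply/chainP; exists [set s x | x in A]; split.
- move=> _ _ /imsetP[x xA ->] /imsetP[y yA ->]; rewrite !permK => h.
  rewrite ltnNge leq_eqVlt; apply/negP => /orP[/eqP/val_inj e|/(h1 _ _ yA xA)]; last by lia.
  by move: h; rewrite e ltnn.
- by move=> _ /imsetP[x xA ->]; rewrite permK; have [] := h2 x xA.
- by rewrite card_imset //; apply: perm_inj.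
Qed.

Lemma chain_sym s i k q : s = s^-1%g -> chainb s i k q = chainb s k i q.
Proof. by move=> e; apply/idP/idP => /chain_tr; rewrite -e. Qed.

Lemma chain_col s (k : 'I_N) i q : s = s^-1%g ->
  chainb s i k.+1 q.+1 = chainb s i k q.+1 || (s k < i) && chainb s (s k) k q.
Proof.
by move=> e; rewrite chain_sym // chain_row [chainb s k i _]chain_sym // [chainb s k _ _]chain_sym.
Qed.

Lemma no_increasing_chain s l : no_increasing_gt l s = ~~ chainb s N N l.+1.
Proof.
congr (~~ _); apply/existsP/chainP => -[A].
  case/andP => /increasing_onP h1 h2; exists A; split; [exact: h1| |exact: h2].
  by move=> x _; split; apply: ltn_ord.
by move=> [h1 h2 h3]; exists A; rewrite h3 andbT; apply/increasing_onP.
Qed.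

(* The number of letters [1] in the first [k] columns is the maximal size of a chain
   in the first [i] rows and [k] columns. *)
Definition ones_chain s (w : seq nat) (i : nat) : Prop :=
  forall k q, k <= size w -> chainb s i k q = (q <= ones w k).

Lemma ones_chain_behead s r w i : ones_chain s (r :: w) i -> ones_chain s w i.
Proof. by move=> h k q kw; rewrite -(ones_cons r) // h //; apply: ltnW. Qed.

Lemma ones_chain_cnt s w i q : ones_chain s w i -> chainb s i (size w) q = (q <= cnt 1 w).
Proof. by move=> h; rewrite h // ones_size. Qed.

Lemma ones_chain_row_ge s w (i : 'I_N) : size w <= s i -> ones_chain s w i -> ones_chain s w i.+1.
Proof. by move=> ws h k q kw; rewrite chain_row_ge ?h //; apply: leq_trans ws. Qed.

(** [chain_row] and [ones_ins] are the same recursion, for chains and for letters. *)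
Lemma ones_chain_ins s w (i : 'I_N) : blank (s i) w -> ones_chain s w i ->
  ones_chain s (ins (s i) w).1 i.+1.
Proof.
move=> bs h k q; rewrite size_ins => kw; rewrite ones_ins //.
case: q => [|q]; first by rewrite chain0 leq0n.
have sw := ltnW (blank_ltn bs).
rewrite chain_row !h //; case: (leqP k (s i)) => [ks|ks] /=; rewrite ?orbF //.
by rewrite leq_max ltnS.
Qed.

(** The diagonal point exceeds all earlier rows and columns, so it prolongs every chain of the
    square: the new column gets the letter [1]. *)
Lemma ones_chain_fixed s w (i : 'I_N) : s = s^-1%g -> size w = i -> s i = i ->
  ones_chain s w i -> ones_chain s (1 :: w) i.+1.
Proof.
move=> es sw si h k q; rewrite leq_eqVlt => /orP[/eqP ->|]; last first.
  by rewrite [size _]/= ltnS => kw; rewrite ones_cons // chain_row_ge; [exact: h | by rewrite si -sw].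
rewrite [size _]/= -[(size w).+1]/(size (1 :: w)) ones_size cnt_cons eqxx.
case: q => [|q]; first by rewrite chain0.
rewrite /= sw chain_col // si ltnSn /= chain_row_ge ?si //.
have e r : chainb s i i r = (r <= cnt 1 w) by rewrite -{2}sw ones_chain_cnt.
by rewrite !e; lia.
Qed.

Lemma ones_chain_skip s w (i : 'I_N) : s = s^-1%g -> size w = i -> i < s i ->
  ones_chain s w i -> ones_chain s (0 :: w) i.+1.
Proof.
move=> es sw si h k q; rewrite leq_eqVlt => /orP[/eqP ->|]; last first.
  by rewrite [size _]/= ltnS => kw; rewrite ones_cons // chain_row_ge; [exact: h | apply: leq_trans kw _; rewrite sw ltnW].
rewrite [size _]/= -[(size w).+1]/(size (0 :: w)) ones_size cnt_cons add0n /= sw.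
case: q => [|q]; first by rewrite chain0.
rewrite chain_col // ltnS leqNgt si /= orbF chain_row_ge; last exact: ltnW.
by rewrite -{2}sw ones_chain_cnt.
Qed.

(** By symmetry the new row and the new column reach the diagonal cell with the same label [b], and
    the local rule turns two equal labels into [b.+1]. As [b] is positive, the new letter is not a
    [1]. *)
Lemma ones_chain_pair s w (i : 'I_N) : s = s^-1%g -> size w = i -> blank (s i) w ->
  ones_chain s w i ->
  ones_chain s ((ins (s i) w).2.+1 :: (ins (s i) w).1) i.+1.
Proof.
move=> es sw bs h; have h' := ones_chain_ins bs h.
have sv := size_ins (s i) w; have b0 := ins_row_gt0 bs.
move: (ins (s i) w) h' sv b0 => [v b] /= h' sv b0.
move=> k q; rewrite leq_eqVlt => /orP[/eqP ->|]; last first.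
  by rewrite [size _]/= ltnS => kw; rewrite ones_cons // h'.
rewrite [size _]/= -[(size v).+1]/(size (b.+1 :: v)) ones_size cnt_cons /= sv sw.
case: q => [|q]; first by rewrite chain0.
have := blank_ltn bs; rewrite sw => si.
have vi : size v = i by rewrite sv.
rewrite chain_col // ltnS (ltnW si) /= -[X in chainb s _ X q.+1]vi ones_chain_cnt //.
rewrite [chainb s (s i) i q]chain_sym // eqSS (_ : (b == 0) = false) ?add0n; last by case: (b) b0.
apply/orb_idr => hc; rewrite -(ones_chain_cnt q.+1 h') vi chain_row si hc orbT.
by [].
Qed.

End Chains.

(** * Chains and reflection in the antidiagonal *)

Section AntiDiagonal.
Variables (N : nat) (s : {perm 'I_N}).
Hypothesis es : s = (iota_perm N * s^-1 * iota_perm N)%g.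
Local Open Scope nat_scope.
Local Notation iota := (iota_perm N).

Lemma iota_val (x : 'I_N) : iota x = N - x.+1 :> nat.
Proof. by rewrite permE. Qed.

Lemma iotaK : involutive iota.
Proof. by move=> x; apply: val_inj; rewrite /= !iota_val; have := ltn_ord x; lia. Qed.

Lemma anti_sym x : s (iota (s x)) = iota x.
Proof. by rewrite {2}es !permM iotaK permKV. Qed.

Let chain_on (A : {set 'I_N}) := {in A &, forall x y : 'I_N, x < y -> s x < s y}.

(** The reflection sends the point [(x, s x)] of the graph to [(iota (s x), iota x)], again on the
    graph by [anti_sym]; a set of points is given by its rows. *)
Let reflect_set (A : {set 'I_N}) := [set iota (s x) | x in A].

Lemma card_reflect (A : {set 'I_N}) : #|reflect_set A| = #|A|.
Proof. by rewrite card_imset // => x y /perm_inj/perm_inj. Qed.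

Lemma chain_lt A (x y : 'I_N) : chain_on A -> x \in A -> y \in A -> s x < s y -> x < y.
Proof.
move=> h xA yA sxy; rewrite ltnNge leq_eqVlt; apply/negP => /orP[/eqP/val_inj e|/(h _ _ yA xA)]; last by lia.
by move: sxy; rewrite e ltnn.
Qed.

Lemma chain_reflect A : chain_on A -> chain_on (reflect_set A).
Proof.
move=> h _ _ /imsetP[x xA ->] /imsetP[y yA ->]; rewrite !anti_sym !iota_val.
have := ltn_ord (s x); have := ltn_ord (s y); have := ltn_ord x; have := ltn_ord y.
move=> h1 h2 h3 h4 h5; have /(chain_lt h yA xA) : s y < s x by lia.
by lia.
Qed.

(** Such a chain fits in the rectangle cornered at its last point, which can be widened until its
    corner reaches the antidiagonal. *)
Lemma chain_below A q : chain_on A -> {in A, forall x : 'I_N, x + s x + 2 <= N} ->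
  0 < q <= #|A| -> exists2 k, k <= N & chainb s k (N - k) q.
Proof.
move=> h hb /andP[q0 qA].
have /set0Pn[x0 x0A] : A != set0 by rewrite -card_gt0; apply: leq_trans qA.
pose x := [arg max_(x > x0 in A) val x]; have [xA xm] : x \in A /\ forall y, y \in A -> y <= x.
  by rewrite /x; case: arg_maxnP.
exists x.+1; first exact: ltn_ord.
apply/chainP; exists A; split=> // y yA; have yx := xm y yA; split; first by rewrite ltnS.
apply: (@leq_ltn_trans (s x)); last by have := hb x xA; lia.
move: yx; rewrite leq_eqVlt => /orP[/eqP/val_inj ->|/(h _ _ yA xA)] //.
exact: ltnW.
Qed.

(** Every point of the mirror image of the rectangle exceeds every point of the rectangle in both
    coordinates. *)
Lemma chain_double A k k' : chain_on A -> {in A, forall x : 'I_N, x < k /\ s x < k'} -> k + k' <= N ->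
  chain_on (A :|: reflect_set A) /\ #|A :|: reflect_set A| = 2 * #|A|.
Proof.
move=> h hk kk.
have hr : {in reflect_set A, forall x : 'I_N, N - k' <= x /\ N - k <= s x}.
  move=> _ /imsetP[x xA ->]; rewrite anti_sym !iota_val; have [] := hk x xA.
  have := ltn_ord x; have := ltn_ord (s x); lia.
split.
  move=> x y /setUP[xA|xR] /setUP[yA|yR]; first exact: h.
  - by move=> _; have [] := hk x xA; have [] := hr y yR; lia.
  - by have [] := hk y yA; have [] := hr x xR; lia.
  - exact: (chain_reflect h).
rewrite cardsU card_reflect (_ : A :&: _ = set0) ?cards0 ?subn0 ?mul2n ?addnn //.
apply/setP => x; rewrite !inE; apply/negP => /andP[/hk[h1 h2] /hr[h3 h4]]; lia.
Qed.

(** An increasing chain meets the antidiagonal at most once. Either one of its two sides has more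
    than [q] points (the far side is reflected first), or both have exactly [q] and one point lies
    on the antidiagonal. *)
Lemma chain_split A q : chain_on A -> 2 * q < #|A| ->
  (exists k : 'I_N.+1, chainb s k (N - k) q.+1) \/
  (#|A| = 2 * q + 1 /\ exists z : 'I_N, (s (iota z) == z) && chainb s (iota z) z q).
Proof.
move=> h hA.
pose Ab := [set x in A | x + s x + 2 <= N]; pose Aa := [set x in A | N <= x + s x].
pose Ao := [set x in A | x + s x + 1 == N].
have hab : chain_on Ab by apply: sub_increasing h; apply/subsetP => x; rewrite inE => /andP[].
have haa : chain_on Aa by apply: sub_increasing h; apply/subsetP => x; rewrite inE => /andP[].
have ex (B : {set 'I_N}) : chain_on B -> {in B, forall x : 'I_N, x + s x + 2 <= N} -> q.+1 <= #|B| ->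
    exists k : 'I_N.+1, chainb s k (N - k) q.+1.
  move=> hB hb qB; have [k kN hc] := @chain_below B q.+1 hB hb qB.
  by exists (Ordinal (kN : k < N.+1)).
have [ab|ab] := ltnP q #|Ab|.
  by left; apply: (ex Ab) => // x; rewrite inE => /andP[].
have [aa|aa] := ltnP q #|Aa|.
  left; apply: (ex (reflect_set Aa)); rewrite ?card_reflect //; first exact: chain_reflect.
  move=> _ /imsetP[x xA ->]; move: xA; rewrite inE anti_sym !iota_val => /andP[_].
  by have := ltn_ord x; have := ltn_ord (s x); lia.
right.
have ao : #|Ao| <= 1.
  apply/card_le1_eqP => x y; rewrite !inE => /andP[xA /eqP xo] /andP[yA /eqP yo].
  apply: val_inj => /=; have := h x y xA yA; have := h y x yA xA; lia.
have cA : #|A| <= #|Ab| + #|Aa| + #|Ao|.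
  rewrite -(cardsID [set x : 'I_N | x + s x + 2 <= N] A).
  rewrite -(cardsID [set x : 'I_N | N <= x + s x] (A :\: _)) addnA.
  by apply: leq_add; [apply: leq_add|]; apply: subset_leq_card; apply/subsetP => x; rewrite !inE;
     case: (x \in A) => //=; lia.
split; first by lia.
have /set0Pn[x] : Ao != set0 by rewrite -card_gt0; lia.
rewrite inE => /andP[xA /eqP xo]; exists (s x).
have ix : iota (s x) = x by apply: val_inj; rewrite /= iota_val; lia.
rewrite ix eqxx /=; apply/chainP; exists Ab; split=> //; last by lia.
move=> y; rewrite inE => /andP[yA yb].
have yx : y < x.
  rewrite ltnNge leq_eqVlt; apply/negP => /orP[/eqP/val_inj e|xy]; last by have := h _ _ xA yA xy; lia.
  by move: yb; rewrite -e; lia.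
by split=> //; apply: h.
Qed.

(** A long chain can be exchanged for a symmetric one, half of which lies in a rectangle whose
    corner is on the antidiagonal. *)
Lemma no_increasing_odd l :
  no_increasing_gt (2 * l + 1) s = ~~ [exists k : 'I_N.+1, chainb s k (N - k) l.+1].
Proof.
rewrite no_increasing_chain; congr (~~ _); apply/idP/existsP => [/chainP[A [h _ hA]]|[k /chainP[A [h hk hA]]]].
  by have [|//|[e _]] := @chain_split A l h; lia.
have kN := ltn_ord k; have kk : k + (N - k) <= N by lia.
have [h1 h2] := chain_double h hk kk.
apply/chainP; exists (A :|: reflect_set A); by split; rewrite ?h2 //; lia.
Qed.

(** A symmetric chain of [2 * l + 1] points has its middle point on the antidiagonal, at a negated
    point preceded by [l] others; this is the second test. *)
Lemma no_increasing_even l :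
  no_increasing_gt (2 * l) s = ~~ [exists k : 'I_N.+1, chainb s k (N - k) l.+1] &&
    [forall z : 'I_N, (s (iota z) == z) ==> ~~ chainb s (iota z) z l].
Proof.
have -> : [forall z : 'I_N, (s (iota z) == z) ==> ~~ chainb s (iota z) z l] =
   ~~ [exists z : 'I_N, (s (iota z) == z) && chainb s (iota z) z l].
  by rewrite negb_exists; apply: eq_forallb => z; case: (_ == _).
rewrite -negb_or no_increasing_chain; congr (~~ _); apply/idP/orP.
  move=> /chainP[A [h _ hA]].
  by have [|hk|[_ hz]] := @chain_split A l h; [lia|left|right]; apply/existsP.
case=> [hk|/existsP[z /andP[/eqP sz /chainP[A [h hk hA]]]]].
  have := no_increasing_odd l; rewrite hk no_increasing_chain => /negbT; rewrite negbK.
  by apply: chain_mono; lia.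
have kk : iota z + z <= N by rewrite iota_val; have := ltn_ord z; lia.
have [h1 h2] := chain_double h hk kk.
pose A' := A :|: reflect_set A.
have hz : {in A', forall x : 'I_N, (x < iota z /\ s x < z) \/ (iota z < x /\ z < s x)}.
  move=> x /setUP[xA|/imsetP[y yA ->]]; first by left; apply: hk.
  right; rewrite anti_sym; move: (hk y yA); rewrite !iota_val.
  by have := ltn_ord y; have := ltn_ord (s y); have := ltn_ord z; lia.
have zA : iota z \notin A' by apply/negP => /hz; rewrite !ltnn; lia.
apply/chainP; exists (iota z |: A'); split.
- move=> x y /setU1P[->|xA] /setU1P[->|yA]; rewrite ?ltnn ?sz //; last exact: h1.
    by have := hz y yA; lia.
  by have := hz x xA; lia.
- by move=> x _; split; apply: ltn_ord.
- by rewrite cardsU1 zA /A' h2; lia.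
Qed.

End AntiDiagonal.

(** * Words read along growth diagrams *)

Section Process.
Local Open Scope nat_scope.
Implicit Types (f : nat -> nat) (b : nat -> bool).

(* The columns [x < i] of the symmetric growth diagram of the involution [f];
   [b x] says that the fixed point [x] carries no mark. *)
Fixpoint wd f b (i : nat) : seq nat :=
  if i is i'.+1 then
    let w := wd f b i' in
    if f i' < i' then (ins (f i') w).2.+1 :: (ins (f i') w).1
    else if (f i' == i') && ~~ b i' then 1 :: w else 0 :: w
  else [::].

Lemma size_wd f b i : size (wd f b i) = i.
Proof. by elim: i => //= i IH; do 2?case: ifP => _ /=; rewrite ?size_ins IH. Qed.

Lemma eq_wd f g b c i : (forall x, x < i -> (f x < x) = (g x < x) /\ (f x < x -> f x = g x)) ->
  (forall x, x < i -> ((f x == x) && ~~ b x) = ((g x == x) && ~~ c x)) ->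
  wd f b i = wd g c i.
Proof.
elim: i => //= i IH h1 h2; have [e1 e2] := h1 i (ltnSn i).
rewrite IH => [|x xi|x xi]; [|apply: h1; lia|apply: h2; lia].
by rewrite h2 // -e1; case: ifP => // /e2 ->.
Qed.

Section Involution.
Variables (f : nat -> nat) (b : nat -> bool).
Hypothesis fK : involutive f.

(** A column is blank as long as its point has not been met: a marked fixed point is never met, a
    paired one is met at its partner. *)
Lemma blank_wd i j : blank j (wd f b i) = (j < i) && (if f j == j then b j else i <= f j).
Proof.
elim: i j => //= i IH j.
have key : (j == f i) = (f j == i) by apply/eqP/eqP => [->|<-]; rewrite fK.
case: (ltngtP (f i) i) => fi.
- have bi : blank (f i) (wd f b i) by rewrite IH fi fK eq_sym (ltn_eqF fi) leqnn.
  rewrite /= size_ins size_wd blank_ins // IH key.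
  have [->|ji] := eqVneq j i; first by rewrite ltnSn (ltn_eqF fi) ltnNge (ltnW fi).
  by case: (f j =P j) => fj; lia.
- rewrite /= size_wd IH.
  have [->|ji] := eqVneq j i; first by rewrite ltnSn (gtn_eqF fi) fi.
  by case: (f j =P j) => fj; lia.
- have [ji|ji] := eqVneq j i.
    by rewrite ji fi eqxx ltnSn /=; case: (b i) => /=; rewrite size_wd eqxx.
  by case: (b i) => /=; rewrite size_wd IH (negbTE ji); case: (f j =P j) => fj; lia.
Qed.

Lemma blank_wd_partner i : f i < i -> blank (f i) (wd f b i).
Proof. by move=> fi; rewrite blank_wd fi fK eq_sym (ltn_eqF fi) leqnn. Qed.

Lemma addable_ins_next w j : yam w -> blank j w -> addable (ins j w).1 (ins j w).2.+1.
Proof.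
move=> yw bj; have b0 := ins_row_gt0 bj; rewrite /addable /= !cnt_ins // eqxx.
by have := yam_cnt yw b0; case: eqP; lia.
Qed.

Lemma yam_wd i : yam (wd f b i).
Proof.
elim: i => //= i IH; case: ifP => [fi|_]; last by case: ifP => _ /=; rewrite IH.
by rewrite /= yam_ins ?addable_ins_next ?orbT ?blank_wd_partner.
Qed.

Lemma letters_cons c r w : letters c (r :: w) = ((0 < r) && (odd r == c)) + letters c w.
Proof. by []. Qed.

Lemma letters_ins c w j : blank j w -> letters c (ins j w).1 = letters c w + (odd (ins j w).2 == c).
Proof.
elim: w => //= r w IH; case: (j =P size w) => [_ /eqP ->|_ bj] /=.
  by rewrite !letters_cons /= addnC.
have b0 := ins_row_gt0 bj; have e := IH bj.
case: (r =P _) => [->|_] /=; rewrite !letters_cons e /=; last by rewrite addnA.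
by rewrite b0 /= addnC; case: (odd _); case: c {e IH}; rewrite /= ?addn0 ?add0n ?addn1 ?add1n.
Qed.

(** A pair adds, on balance, one letter [b] for the row where bumping stops and the letter [b.+1],
    of opposite parities; an unmarked fixed point adds a single [1]. With [letters_mu], the odd
    columns are as many as the unmarked fixed points. *)
Lemma letters_wd i :
  letters true (wd f b i) = letters false (wd f b i) + \sum_(0 <= x < i) ((f x == x) && ~~ b x).
Proof.
elim: i => [|i IH]; first by rewrite big_geq.
rewrite big_nat_recr //= ; case: (ltngtP (f i) i) => fi /=.
- by rewrite !letters_cons !letters_ins ?blank_wd_partner // IH /=; case: (odd _) => /=; lia.
- by rewrite !letters_cons /= IH; lia.
- by rewrite fun_if [in RHS]fun_if !letters_cons /= IH; case: (b i) => /=; lia.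
Qed.

Variables (N n : nat) (s : {perm 'I_N}).
Hypotheses (es : s = s^-1%g) (nN : n <= N).
Hypothesis sf : forall x : 'I_N, x < n ->
  if b x then n <= s x /\ f x = x else s x = f x :> nat.

(** A mark of [f] stands for a point of [s] beyond the square, so its row and its column are empty
    inside the square. *)
Lemma ones_chain_wd i : i <= n -> ones_chain s (wd f b i) i.
Proof.
elim: i => [_ k q|i IH iN] /=.
  by rewrite leqn0 => /eqP ->; rewrite chain_empty leqn0.
have iN' : i < N by apply: leq_trans nN.
pose x := Ordinal iN'; have := sf (x := x) iN.
have {}IH := IH (ltnW iN); have sw := size_wd f b i.
have -> : i.+1 = x.+1 by []. rewrite -{1}[i]/(val x) in IH.
case bx : (b x) => [] /=; [case=> sx fx|move=> sx].
  rewrite fx ltnn eqxx /=; apply: (@ones_chain_skip _ _ _ x) => //.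
  exact: leq_trans sx.
rewrite andbT; case: (ltngtP (f i) i) => fi.
- rewrite -sx in fi *; apply: (@ones_chain_pair _ _ _ x) => //.
  by rewrite sx; apply: blank_wd_partner; rewrite -sx.
- by apply: (@ones_chain_skip _ _ _ x) => //; rewrite sx.
- by apply: (@ones_chain_fixed _ _ _ x) => //; apply: val_inj; rewrite /= sx.
Qed.

End Involution.

(* Columns are removed from the right; the column [m'] either carries a mark already,
   or is matched by [f] with a column to its left, or is fixed by [f]. *)
Fixpoint okn (f : nat -> nat) (e : bool) (l m : nat) (w : seq nat) : bool :=
  if m is m'.+1 then
    (cnt 1 w <= l) && (let w' := behead w in
      if head 1 w == 0 then
        if f m' == m' then (~~ e || (cnt 1 w' < l)) && okn f e l m' w'
        else okn f e l m' (ins (f m') w').1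
      else okn f e l m' w')
  else true.

Lemma blank_ins_sub j w x : blank x (ins j w).1 -> blank x w.
Proof.
elim: w => //= r w IH; case: (j =P size w) => _ /=; first by case: (x == _).
by case: ifP => _ /=; rewrite size_ins; case: (x == _).
Qed.

Lemma eq_okn f g e l m w : size w = m -> (forall x, blank x w -> f x = g x) ->
  okn f e l m w = okn g e l m w.
Proof.
elim: m w => // m IH [|r w] //= [sw] fg; congr (_ && _).
have fgw x : blank x w -> f x = g x.
  by move=> bx; apply: fg; have := blank_ltn bx; case: eqP => // ->; rewrite ltnn.
case: ifP => [r0|_]; last exact: IH.
have -> : f m = g m by apply: fg; rewrite sw eqxx.
case: ifP => _; first by rewrite IH.
by apply: IH => [|x bx]; [rewrite size_ins | apply/fgw/blank_ins_sub/bx].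
Qed.

(** A descent of the staircase: going from [m.+1] to [m] columns drops column [m] and adds the row
    [iota m]. The point of that row is in column [f m] if column [m] is blank, and beyond the
    remaining columns otherwise. The bound on [cnt 1] tests the rectangle just reached, and a blank
    with [f m = m] is a negated point. *)
Lemma oknP (N : nat) (s : {perm 'I_N}) f e l m w :
  s = (iota_perm N * s^-1 * iota_perm N)%g -> size w = m -> m <= N ->
  ones_chain s w (N - m) ->
  (forall x : 'I_N, blank x w -> [/\ blank (f x) w, f (f x) = x & s (iota_perm N x) = f x :> nat]) ->
  (forall x : 'I_N, x < m -> ~~ blank x w -> x <= s (iota_perm N x)) ->
  okn f e l m w <->
  (forall k, N - m <= k <= N -> ~~ chainb s k (N - k) l.+1) /\
  (e -> forall z : 'I_N, blank z w -> f z = z -> ~~ chainb s (iota_perm N z) z l).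
Proof.
move=> es; elim: m w => [|m IH] [|r w] // sw mN oc H1 H2.
  split=> // _; split=> // k /andP[]; rewrite subn0 => h1 h2.
  have -> : k = N by lia.
  by rewrite subnn; apply/negP => /chain_tr; rewrite chain_empty.
have {}sw : size w = m by case: sw.
pose z := Ordinal (mN : m < N); pose i := iota_perm N z.
have iE : i = N - m.+1 :> nat by rewrite /i iota_val.
have iS : N - m = i.+1 by rewrite iE; lia.
have cE : chainb s (N - m.+1) (N - (N - m.+1)) l.+1 = ~~ (cnt 1 (r :: w) <= l).
  have -> : N - (N - m.+1) = size (r :: w) by rewrite /= sw; lia.
  by rewrite ones_chain_cnt // ltnNge.
have split_k : (forall k, N - m.+1 <= k <= N -> ~~ chainb s k (N - k) l.+1) <->
    cnt 1 (r :: w) <= l /\ (forall k, N - m <= k <= N -> ~~ chainb s k (N - k) l.+1).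
  split=> [h|[h1 h2] k hk].
    split=> [|k hk]; last by apply: h; lia.
    by rewrite -[_ <= _]negbK -cE; apply: h; lia.
  by have [->|ki] := eqVneq k (N - m.+1); [rewrite cE h1|apply: h2; lia].
rewrite split_k and_assoc [okn _ _ _ _ _]/=.
have oc' := ones_chain_behead oc; rewrite -iE in oc'.
have bw x : blank x w -> (x == size w) = false by move=> /blank_ltn; case: eqP => // ->; rewrite ltnn.
have bm : blank m (r :: w) = (r == 0) by rewrite /= sw eqxx.
have bcons x : blank x w -> blank x (r :: w) by move=> h; rewrite /= bw.
have bcons' x : x != m -> blank x (r :: w) -> blank x w by rewrite /= sw => /negbTE ->.
have mN1 : m <= N by apply: ltnW.
(* A row whose point is not among the first [m] columns leaves their word unchanged. *)
have same : (m <= s i) -> (r == 0 -> f m = m) ->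
    okn f e l m w <-> (forall k, N - m <= k <= N -> ~~ chainb s k (N - k) l.+1) /\
      (e -> forall z : 'I_N, blank z w -> f z = z -> ~~ chainb s (iota_perm N z) z l).
  move=> si fz; apply: IH => //.
  - by rewrite iS; apply: ones_chain_row_ge; rewrite ?sw.
  - move=> x bx; have [h1 h2 h3] := H1 x (bcons _ bx); split=> //.
    apply: bcons' h1; apply/eqP => e1; have := H1 x (bcons _ bx).
    rewrite e1 bm => -[/fz fm]; rewrite fm => e2 _.
    by have := blank_ltn bx; rewrite -e2 sw ltnn.
  - move=> x xm bx; apply: H2; first exact: ltnW.
    by apply: contra bx; apply: bcons'; rewrite neq_ltn xm.
have iotam (x : 'I_N) : x = m :> nat -> x = z by move=> e1; apply: val_inj.
have [r0|r0] := eqVneq r 0; last first.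
  rewrite (negbTE r0) in bm same *; rewrite -(rwP andP) same //; last first.
    by apply: (H2 z) => //; rewrite bm.
  split=> -[h1 [h2 h3]]; split=> //; split=> // he x bx fx; apply: (h3 he) => //; last exact: bcons.
  by apply: (bcons' _ _ bx); apply/eqP => e1; move: bx; rewrite e1 bm.
have bz : blank z (r :: w) by rewrite bm r0.
have [bfz ffz siz] := H1 z bz.
case: (eqVneq (f m) m) => fm.
  rewrite -(rwP andP) -(rwP andP) same //; last by rewrite siz fm.
  have cz : chainb s i z l = (l <= cnt 1 w) by rewrite -(ones_chain_cnt l oc') sw.
  split=> [[h1 [h2 [h3 h4]]]|[h1 [h2 h3]]].
    split=> //; split=> // he x bx fx.
    have [e1|xm] := eqVneq (x : nat) m; last by apply: (h4 he) => //; exact: bcons'.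
    by rewrite (iotam _ e1) -/i cz -ltnNge; move: h2; rewrite he.
  split=> //; split.
    by case: (boolP e) => //= he; have := h3 he z bz fm; rewrite -/i cz -ltnNge.
  by split=> // he x bx fx; apply: (h3 he) => //; exact: bcons.
rewrite -(rwP andP).
have bj : blank (f m) w by apply: bcons' bfz.
rewrite IH ?size_ins //.
- split=> -[h1 [h2 h3]]; split=> //; split=> // he x bx fx; apply: (h3 he) => //.
    rewrite blank_ins // bcons' //=; last by apply: contraNneq fm => e1; rewrite -e1 fx.
    by apply: contraNneq fm => e1; rewrite -[X in X == _]e1 -fx e1 ffz.
  by move: bx; rewrite blank_ins // => /andP[/bcons].
- by rewrite iS -siz; apply: ones_chain_ins => //; rewrite siz.
- move=> x; rewrite blank_ins // => /andP[bx xj].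
  have [h1 h2 h3] := H1 x (bcons _ bx); split=> //; rewrite blank_ins //.
  have fxm : f x != m by apply: contraNneq xj => e1; rewrite -h2 e1.
  rewrite bcons' //=; apply/eqP => e1; have := blank_ltn bx.
  by rewrite -h2 e1 ffz sw ltnn.
- move=> x xm; rewrite blank_ins // negb_and negbK => /orP[bx|/eqP xj].
    apply: H2; first exact: ltnW.
    by apply: contra bx; apply: bcons'; rewrite neq_ltn xm.
  have bx : blank x (r :: w) by apply: bcons; rewrite xj.
  have [_ _ ->] := H1 x bx.
  by rewrite xj ffz -xj ltnW.
Qed.

End Process.

(** * Sums over involutions as sums over words *)

Section InvolutionSums.
Variables (K : comNzRingType) (N : nat).
Implicit Types (f : {perm 'I_N}) (S : {set 'I_N}).
Local Open Scope ring_scope.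

Definition invol_on S f := (f == f^-1)%g && [forall x, (x \notin S) ==> (f x == x)].

Lemma invol_onP S f :
  reflect ((forall x, f (f x) = x) /\ (forall x, x \notin S -> f x = x)) (invol_on S f).
Proof.
apply: (iffP andP) => [[/eqP e /forall_inP h]|[h1 h2]]; split.
- by move=> x; rewrite {1}e permK.
- by move=> x /h/eqP.
- by apply/eqP/permP => x; apply: (@perm_inj _ f); rewrite h1 permKV.
- by apply/forall_inP => x /h2/eqP.
Qed.

Lemma perm_fix_eq f (j x : 'I_N) : f j = j -> (f x == j) = (x == j).
Proof. by move=> fj; apply/eqP/eqP => [e|->//]; apply: (@perm_inj _ f); rewrite e fj. Qed.

Lemma invol_on_tperm S f (j m : 'I_N) : m \notin S -> j \in S ->
  invol_on (m |: S) (f * tperm j m)%g && ((f * tperm j m)%g m == j) = invol_on (S :\ j) f.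
Proof.
move=> mS jS; have jm : j != m by apply: contraNneq mS => <-.
apply/andP/invol_onP => [[/invol_onP[h1 h2] /eqP gm]|[h1 h2]].
  have tE x : f x = tperm j m ((f * tperm j m)%g x) by rewrite permM tpermK.
  have gj : (f * tperm j m)%g j = m by rewrite -{2}[m]h1 gm.
  have fj : f j = j by rewrite tE gj tpermR.
  have fm : f m = m by rewrite tE gm tpermL.
  have fx x : x != j -> x != m -> f x = (f * tperm j m)%g x.
    move=> xj xm; rewrite tE tpermD // eq_sym; apply/eqP => e.
      by move: xm; rewrite -[x]h1 e gj eqxx.
    by move: xj; rewrite -[x]h1 e gm eqxx.
  split=> x.
    have [->|xj] := eqVneq x j; first by rewrite !fj.
    have [->|xm] := eqVneq x m; first by rewrite !fm.
    have fxj : f x != j by rewrite perm_fix_eq.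
    have fxm : f x != m by rewrite perm_fix_eq.
    by rewrite (fx (f x)) // fx // h1.
  have [->|xj] := eqVneq x j; first by rewrite fj.
  have [->|xm] := eqVneq x m; first by rewrite fm.
  by rewrite !inE xj /= => xS; rewrite fx // h2 // !inE negb_or xm.
have fj : f j = j by rewrite h2 // !inE eqxx.
have fm : f m = m by rewrite h2 // !inE negb_and mS orbT.
split; last by rewrite permM fm tpermR.
apply/invol_onP; split=> x; rewrite !permM.
  have [->|xj] := eqVneq x j; first by rewrite fj tpermL fm tpermR.
  have [->|xm] := eqVneq x m; first by rewrite fm tpermR fj tpermL.
  have fxj : j != f x by rewrite eq_sym perm_fix_eq.
  have fxm : m != f x by rewrite eq_sym perm_fix_eq.
  by rewrite [tperm j m (f x)]tpermD // h1 tpermD // eq_sym.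
rewrite !inE negb_or => /andP[xm xS]; rewrite h2 ?inE ?negb_and ?xS ?orbT //.
by rewrite tpermD // eq_sym //; apply: contraNneq xS => ->.
Qed.

(** Sorted by the image of [m]: if it is some [j] other than [m], composing with [tperm j m] frees
    both points. *)
Lemma sum_invol_on S (m : 'I_N) (g : {perm 'I_N} -> K) : m \notin S ->
  \sum_(f | invol_on (m |: S) f) g f = \sum_(f | invol_on S f) g f
    + \sum_(j in S) \sum_(f | invol_on (S :\ j) f) g (f * tperm j m)%g.
Proof.
move=> mS; rewrite (bigID (fun f => f m == m)) /=; congr (_ + _).
  apply: eq_bigl => f; apply/andP/invol_onP => [[/invol_onP[h1 h2] /eqP fm]|[h1 h2]].
    by split=> // x xS; have [->|xm] := eqVneq x m; [|apply: h2; rewrite !inE negb_or xm].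
  rewrite h2 // eqxx; split=> //; apply/invol_onP; split=> // x.
  by rewrite !inE negb_or => /andP[_ /h2].
rewrite (partition_big (fun f => f m) (mem S)) /=; last first.
  move=> f /andP[/invol_onP[h1 h2] fm]; apply/negPn/negP => fS.
  have := h2 (f m); rewrite !inE negb_or fm fS h1 => /(_ isT) e.
  by rewrite -e eqxx in fm.
apply: eq_bigr => j jS; rewrite (reindex_inj (mulIg (tperm j m))) /=.
apply: eq_bigl => f; rewrite -(@invol_on_tperm S f j m) // -andbA; congr (_ && _).
by apply: andb_idl => /eqP ->; apply: contraNneq mS => <-.
Qed.

End InvolutionSums.

Section WordsOfInvolutions.
Variables (K : comNzRingType) (N : nat).
Implicit Types (f : {perm 'I_N}) (B S : {set 'I_N}).
Local Open Scope ring_scope.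

(** Extended by the identity to all numbers, so that words can be built by recursion on [nat]. *)
Definition pn f (x : nat) : nat := if insub x is Some i then val (f i) else x.

Lemma pnE f (x : 'I_N) : pn f x = f x.
Proof. by rewrite /pn valK. Qed.

Lemma pn_involutive S f : invol_on S f -> involutive (pn f).
Proof.
move=> /invol_onP[h _] x; have [xN|xN] := ltnP x N.
  by rewrite -[x]/(val (Ordinal xN)) !pnE h.
by rewrite /pn insubN -?leqNgt // insubN -?leqNgt.
Qed.

Definition bn B (x : nat) : bool := [exists y in B, val y == x].

Lemma bnE B (x : 'I_N) : bn B x = (x \in B).
Proof.
apply/exists_inP/idP => [[y yB /eqP/val_inj <-] //|xB].
by exists x.
Qed.

Definition ltset (m : nat) : {set 'I_N} := [set x : 'I_N | (x < m)%N].
Definition fixlt f (m : nat) : {set 'I_N} := [set x : 'I_N | (x < m)%N && (f x == x)].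

Lemma ltset_recr (m : 'I_N) : ltset m.+1 = m |: ltset m.
Proof. by apply/setP => x; rewrite !inE ltnS leq_eqVlt. Qed.

Lemma ltset_notin (m : 'I_N) : m \notin ltset m.
Proof. by rewrite inE ltnn. Qed.

Lemma invol_on0 f : invol_on set0 f = (f == 1%g).
Proof.
apply/invol_onP/eqP => [[_ h]|->]; last by split=> x; rewrite !perm1.
by apply/permP => x; rewrite perm1 h // inE.
Qed.

Lemma sum_subset_in (A : {set 'I_N}) (j : 'I_N) (H : {set 'I_N} -> K) : j \in A ->
  \sum_(B : {set 'I_N} | B \subset A :\ j) H (j |: B) = \sum_(B : {set 'I_N} | (B \subset A) && (j \in B)) H B.
Proof.
move=> jA; rewrite [RHS](reindex_onto (fun B : {set 'I_N} => j |: B) (fun B : {set 'I_N} => B :\ j)) /=; last first.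
  by move=> B /andP[_ jB]; rewrite setD1K.
apply: eq_bigl => B; rewrite subUset sub1set jA setU11 andbT /= subsetD1.
apply: andb_id2l => BA; apply/idP/eqP => [jB|<-]; last by rewrite !inE eqxx.
by apply/setP => x; rewrite !inE; case: eqP => // ->; rewrite (negbTE jB).
Qed.

Lemma sum_subset_U1 (A : {set 'I_N}) (j : 'I_N) (H : {set 'I_N} -> K) : j \notin A ->
  \sum_(B : {set 'I_N} | B \subset j |: A) H B = \sum_(B : {set 'I_N} | B \subset A) (H B + H (j |: B)).
Proof.
move=> jA; rewrite (bigID (fun B : {set 'I_N} => j \in B)) /= -sum_subset_in ?setU11 //.
rewrite big_split /= addrC; congr (_ + _); apply: eq_bigl => B.
  by rewrite -subsetD1 setU1K.
by rewrite setU1K.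
Qed.

(** Up to column [m], a point whose partner is [m] looks like a marked fixed point. *)
Lemma wd_tperm f B (j m : 'I_N) : (j < m)%N -> invol_on (ltset m :\ j) f ->
  j \notin B -> wd (pn (f * tperm j m)%g) (bn B) m = wd (pn f) (bn (j |: B)) m.
Proof.
move=> jm /invol_onP[_ h2] jB.
have fj : f j = j by rewrite h2 // !inE eqxx.
have fm : f m = m by rewrite h2 // !inE ltnn andbF.
have mj : m == j = false by apply/negbTE; rewrite neq_ltn jm orbT.
have fx (x : 'I_N) : (x < m)%N -> x != j -> (f * tperm j m)%g x = f x.
  move=> xm xj; rewrite permM tpermD // eq_sym perm_fix_eq //.
  by rewrite neq_ltn xm.
apply: eq_wd => x xm; have xN : (x < N)%N by apply: ltn_trans (ltn_ord m).
  rewrite -[x]/(val (Ordinal xN)) !pnE; set y := Ordinal xN.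
  have [->|yj] := eqVneq y j; last by rewrite fx.
  by rewrite permM fj tpermL ltnn ltnNge (ltnW jm).
rewrite -[x]/(val (Ordinal xN)) !pnE !bnE; set y := Ordinal xN.
have [->|yj] := eqVneq y j; last by rewrite fx // !inE (negbTE yj).
by rewrite permM fj tpermL setU11 eqxx andbF (inj_eq val_inj) mj.
Qed.

Lemma fixlt_tperm f (j m : 'I_N) : (j < m)%N -> invol_on (ltset m :\ j) f ->
  fixlt (f * tperm j m)%g m.+1 = fixlt f m :\ j.
Proof.
move=> jm /invol_onP[_ h2].
have fj : f j = j by rewrite h2 // !inE eqxx.
have fm : f m = m by rewrite h2 // !inE ltnn andbF.
have mj : m == j = false by apply/negbTE; rewrite neq_ltn jm orbT.
apply/setP => x; rewrite !inE permM; have [->|xj] := eqVneq x j.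
  by rewrite fj tpermL mj andbF.
have [->|xm] := eqVneq x m; first by rewrite fm tpermR ltnn eq_sym mj andbF.
by rewrite tpermD 1?eq_sym ?perm_fix_eq // ltnS leq_eqVlt (inj_eq val_inj) (negbTE xm).
Qed.

Lemma big_ord_lt (m : nat) (P : pred nat) (F : nat -> K) : (m <= N)%N ->
  \sum_(0 <= j < m | P j) F j = \sum_(j < N | (j < m)%N && P j) F j.
Proof.
move=> mN; rewrite (big_nat_widen _ _ _ _ _ mN) big_mkord.
by apply: eq_bigl => j; rewrite andbC.
Qed.

(** Induction on the last point. Unmarked and fixed, it appends a [1]; marked, a blank; paired with
    [j], it fills a blank of the shorter word. [SW_ins] trades the filled blanks for corners [b]
    with new letter [b.+1], and [1] together with these [b.+1] are the addable rows. *)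
Lemma sum_wd C (m : nat) (F : seq nat -> K) : (m <= N)%N -> (m.+1 < C)%N ->
  \sum_(f | invol_on (ltset m) f) \sum_(B : {set 'I_N} | B \subset fixlt f m)
    F (wd (pn f) (bn B) m) = SW C m F.
Proof.
elim: m F => [|m IH] F mN mC.
  have -> : ltset 0 = set0 by apply/setP => x; rewrite !inE.
  rewrite (eq_bigl (pred1 1%g)) => [|f]; last exact: invol_on0.
  rewrite big_pred1_eq (eq_bigl (pred1 set0)) => [|B]; last first.
    have -> : fixlt 1%g 0 = set0 by apply/setP => x; rewrite !inE.
    exact: subset0.
  by rewrite big_pred1_eq.
pose mo := Ordinal mN; rewrite -[m.+1]/(mo.+1) ltset_recr sum_invol_on ?ltset_notin //.
rewrite [X in X + _](eq_bigr (fun f => \sum_(B : {set 'I_N} | B \subset fixlt f m)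
    (F (1%N :: wd (pn f) (bn B) m) + F (0%N :: wd (pn f) (bn B) m)))); last first.
  move=> f /invol_onP[_ h2]; have fm : f mo = mo by rewrite h2 // inE ltnn.
  have -> : fixlt f mo.+1 = mo |: fixlt f m.
    apply/setP => x; rewrite !inE ltnS leq_eqVlt (inj_eq val_inj).
    by have [->|_] := eqVneq x mo; rewrite ?fm ?eqxx.
  have mA : mo \notin fixlt f m by rewrite inE ltnn.
  rewrite sum_subset_U1 //; apply: eq_bigr => B BA.
  have mB : mo \notin B by apply: contra mA; apply: (subsetP BA).
  rewrite /= -[m]/(val mo) !pnE fm ltnn eqxx !bnE (negbTE mB) setU11 /=.
  congr (_ + F (0%N :: _)); apply: eq_wd => // x xm.
  have xN : (x < N)%N by apply: ltn_trans (ltn_ord mo).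
  rewrite -[x]/(val (Ordinal xN)) !bnE !inE (_ : _ == mo = false) //.
  by apply/negbTE; rewrite neq_ltn /= xm.
rewrite [X in _ + X](eq_bigr (fun j : 'I_N => \sum_(f | invol_on (ltset m) f)
   \sum_(B : {set 'I_N} | (B \subset fixlt f m) && (j \in B))
     F ((ins j (wd (pn f) (bn B) m)).2.+1 :: (ins j (wd (pn f) (bn B) m)).1))); last first.
  move=> j; rewrite inE => jm.
  rewrite [RHS](bigID (fun f => f j == j)) /= [X in _ = _ + X]big1 ?addr0; last first.
    move=> f /andP[_ fj]; apply: big1 => B /andP[/subsetP BA /BA].
    by rewrite inE (negbTE fj) andbF.
  apply: eq_big => [f|f hf].
    apply/invol_onP/andP => [[h1 h2]|[/invol_onP[h1 h2] /eqP fj]].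
      split; last by rewrite h2 // !inE eqxx.
      apply/invol_onP; split=> // x xm; apply: h2.
      by rewrite !inE in xm *; rewrite negb_and xm orbT.
    split=> // x; rewrite !inE negb_and negbK => /orP[/eqP -> //|xm].
    by apply: h2; rewrite inE.
  have fj : f j = j by case/invol_onP: hf => _ ->; rewrite // !inE eqxx.
  rewrite fixlt_tperm // -sum_subset_in; last by rewrite inE jm fj eqxx.
  apply: eq_bigr => B; rewrite subsetD1 => /andP[BA jB].
  have fm : f mo = mo by case/invol_onP: hf => _ ->; rewrite // !inE ltnn andbF.
  rewrite [wd _ _ _]/= -[m]/(val mo) !pnE permM fm tpermR jm.
  by rewrite -[val mo]/m -(@wd_tperm f B j mo).
rewrite (exchange_big_dep (fun f => invol_on (ltset m) f)) //= -big_split /=.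
pose F' (w : seq nat) := F (1%N :: w) + F (0%N :: w) +
  \sum_(0 <= j < m | blank j w) F ((ins j w).2.+1 :: (ins j w).1).
transitivity (\sum_(f | invol_on (ltset m) f) \sum_(B : {set 'I_N} | B \subset fixlt f m)
    F' (wd (pn f) (bn B) m)).
  apply: eq_bigr => f hf.
  rewrite (exchange_big_dep (fun B : {set 'I_N} => B \subset fixlt f m)) /=; last by move=> j B _ /andP[].
  rewrite -big_split /=; apply: eq_bigr => B BA; rewrite /F' big_ord_lt ?(ltnW mN) //.
  congr (_ + _); apply: eq_bigl => j; rewrite !inE BA /= blank_wd; last exact: pn_involutive hf.
  rewrite hf andbT; apply: andb_id2l => jm; rewrite jm /= pnE bnE (inj_eq val_inj).
  case: eqP => // fj; apply/idP/idP => [jB|].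
    by move: (subsetP BA _ jB); rewrite inE => /andP[_ /eqP].
  rewrite leqNgt => /negP[].
  case/invol_onP: hf => h1 h2; rewrite ltnNge; apply/negP => mf.
  by apply: fj; have := h2 (f j); rewrite h1 inE -leqNgt mf => /(_ isT).
rewrite IH ?(ltnW mN) ?(ltnW mC) // /F' SWD (@SW_ins K C m (fun v b => F (b.+1 :: v))) ?(ltnW mC) //.
rewrite -SWD; apply: eq_SW => w yw sw.
rewrite [RHS](@big_natD1 _ C _ _ 0%N) //=; last by lia.
rewrite [X in _ = _ + X](@big_natD1 _ C _ _ 1%N) //=; last by lia.
rewrite addrA [F (1%N :: w) + _]addrC; congr (_ + _).
apply: (@sum_nat_fiber K C C _ _ succn predn (fun r => F (r :: w))) => [b cb|c cC].
  have [b0 cb'] := andP cb; have bC : (b <= m)%N.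
    rewrite leqNgt; apply/negP => bm; move: cb'.
    by rewrite (@yam_cnt_gt w b) // sw.
  by rewrite /addable /=; move: cb'; lia.
rewrite /addable /corner; case: c cC => [|[|c]] //= cC; rewrite ?andbF //.
by move=> /andP[/andP[h _] _]; split; lia.
Qed.

End WordsOfInvolutions.

Section Completions.
Variables (K : comNzRingType) (N : nat) (beta : K) (e : bool) (l : nat).
Implicit Types (f : {perm 'I_N}) (w : seq nat).
Local Open Scope ring_scope.

Definition bset w : {set 'I_N} := [set x : 'I_N | blank x w].
Definition fixin (S : {set 'I_N}) f := #|[set x in S | f x == x]|.

(** Total weight of the ways to match the blanks of [w] among themselves so that the rest of the
    staircase passes its tests; a blank matched with itself weighs [beta]. *)
Definition KS w : K := \sum_(f | invol_on (bset w) f)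
  beta ^+ fixin (bset w) f * (okn (pn f) e l (size w) w)%:R.

(** When [e] holds, a negated point asks for a first row shorter than [l], that is for an empty last
    column. *)
Definition stay (m : nat -> nat) : K := beta * (~~ e || ((0 < l)%N && (m l.-1 == 0%N)))%:R.

Lemma stayE w : yam w -> stay (columns w) = beta * (~~ e || (cnt 1 w < l)%N)%:R.
Proof.
move=> yw; congr (_ * (~~ e || _)%:R); case: (l) => [|k] //=.
by have := @muE w k yw 1 isT; case: (columns w k); lia.
Qed.

Lemma KS_nil : KS [::] = 1.
Proof.
rewrite /KS /=; have -> : bset [::] = set0 by apply/setP => x; rewrite !inE.
rewrite (eq_bigl (pred1 1%g)) => [|f]; last exact: invol_on0.
rewrite big_pred1_eq mulr1 /fixin (_ : [set x in set0 | _] = set0) ?cards0 //.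
by apply/setP => x; rewrite !inE.
Qed.

Lemma bset_cons r w (m : 'I_N) : size w = m ->
  bset (r :: w) = if r == 0%N then m |: bset w else bset w.
Proof.
move=> sw; apply/setP => x; rewrite fun_if !inE /= sw (inj_eq val_inj).
have [->|xm] := eqVneq x m; last by case: ifP => _; rewrite !inE ?(negbTE xm).
have mb : (m \in bset w) = false by rewrite inE; apply/negP => /blank_ltn; rewrite sw ltnn.
by case: eqP; rewrite ?setU11 ?mb.
Qed.

(** The matchings are sorted by the image of the last blank: itself, which gives [stay], or an
    earlier blank [j], which the next row fills. *)
Lemma KS_cons r w : (size w < N)%N -> yam (r :: w) ->
  KS (r :: w) = (cnt 1 (r :: w) <= l)%N%:R *
     (if r == 0%N then stay (columns w) * KS w
        + \sum_(0 <= j < size w | blank j w) KS (ins j w).1 else KS w).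
Proof.
move=> wN yrw; have /andP[yw _] : yam w && ((r == 0%N) || addable w r) := yrw; pose m := Ordinal wN.
have sw : size w = m by [].
have mS : m \notin bset w.
  by rewrite inE; apply/negP => /blank_ltn; rewrite sw ltnn.
rewrite {1}/KS (bset_cons r sw) [size _]/=; case: eqVneq => [->|r0]; last first.
  rewrite /KS mulr_sumr; apply: eq_bigr => f hf.
  by rewrite /= (negbTE r0) -mulnb natrM mulrCA.
rewrite sum_invol_on // mulrDr; congr (_ + _).
  rewrite stayE // /KS !mulr_sumr; apply: eq_bigr => f /invol_onP[h1 h2].
  have fm : f m = m by apply: h2.
  have -> : fixin (m |: bset w) f = (fixin (bset w) f).+1.
    have mA : m \notin [set x in bset w | f x == x] by rewrite inE (negbTE mS).
    rewrite /fixin (_ : [set x in m |: bset w | f x == x] = m |: [set x in bset w | f x == x]).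
      by rewrite cardsU1 mA.
    by apply/setP => x; rewrite !inE; have [->|_] := eqVneq x m; rewrite ?fm ?eqxx.
  rewrite /= -[size w]/(val m) pnE fm eqxx -!mulnb !natrM exprS.
  by ring.
rewrite (@big_ord_lt K N) ?(ltnW wN) // mulr_sumr.
apply: eq_big => [j|j jS].
  by rewrite inE andb_idl // => /blank_ltn.
have bj : blank j w by rewrite inE in jS.
have jm : (j < m)%N by rewrite -sw blank_ltn.
have eS : bset (ins j w).1 = bset w :\ j.
  by apply/setP => x; rewrite !inE blank_ins // andbC (inj_eq val_inj).
rewrite /KS eS mulr_sumr size_ins; apply: eq_bigr => f /invol_onP[h1 h2].
have fj : f j = j by rewrite h2 // !inE eqxx.
have fm : f m = m by rewrite h2 // in_setD1 negb_and mS orbT.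
have mj : m == j = false by apply/negbTE; rewrite neq_ltn jm orbT.
have fx (x : 'I_N) : x != j -> x != m -> (f * tperm j m)%g x = f x.
  by move=> xj xm; rewrite permM tpermD // eq_sym perm_fix_eq.
have -> : fixin (m |: bset w) (f * tperm j m)%g = fixin (bset w :\ j) f.
  congr #|pred_of_set _|; apply/setP => x; rewrite !inE.
  have [->|xj] := eqVneq x j; first by rewrite permM fj tpermL mj andbF.
  have [->|xm] := eqVneq x m; last by rewrite fx.
  by rewrite permM fm tpermR eq_sym mj /=; move: mS; rewrite inE => /negbTE ->.
rewrite /= -[size w]/(val m) pnE permM fm tpermR [_ == _ :> nat]eq_sym (inj_eq val_inj) mj.
rewrite -mulnb natrM mulrCA; congr (_ * (_ * (_ : bool)%:R)).
apply: eq_okn; first by rewrite size_ins.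
move=> x; rewrite blank_ins // => /andP[bx xj].
have xm : (x < m)%N by rewrite -sw blank_ltn.
rewrite -[x]/(val (Ordinal (ltn_trans xm wN))) !pnE fx //.
by rewrite neq_ltn /= xm.
Qed.

Lemma SW_completions C n psi : (n <= N)%N -> (n.+1 < C)%N ->
  SW C n (fun w => KS w * psi (columns w)) = iter n (updown l stay) psi (fun=> 0%N).
Proof.
move=> nN nC; apply: SW_updown => //; first exact: KS_nil.
by move=> r w wn; apply: KS_cons; apply: leq_trans nN.
Qed.

End Completions.

Section InvolutionCounts.
Variable K : comNzRingType.
Local Open Scope ring_scope.

Definition odd_weight (a : K) (l : nat) (m : nat -> nat) : K :=
  a ^+ (\sum_(0 <= c < l) odd (m c)).

Definition at_origin (l : nat) (m : nat -> nat) : K := [forall c : 'I_l, m c == 0%N]%:R.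

Lemma mem0_blank w : (0%N \in w) = [exists j : 'I_(size w), blank j w].
Proof.
elim: w => [|r w IH]; first by apply/esym/existsP => -[[]].
rewrite inE IH; apply/orP/existsP => [[/eqP r0|/existsP[j bj]]|[j]].
- by exists ord_max; rewrite /= eqxx -r0.
- by exists (lift ord_max j); rewrite lift_max /= (ltn_eqF (ltn_ord j)).
- rewrite /=; case: eqP => [_ /eqP ->|jw bj]; first by left.
  by right; apply/existsP; exists (Ordinal (blank_ltn bj)).
Qed.

Lemma invol_on_ltset n (f : {perm 'I_n}) : invol_on (ltset n n) f = (f == f^-1)%g.
Proof.
by apply: andb_idr => _; apply/forall_inP => x; rewrite inE ltn_ord.
Qed.

Lemma sum_involutions n l (a : K) :
  \sum_(s : {perm 'I_n} | (s == s^-1)%g && no_increasing_gt l s) a ^+ #|fixed_points s| =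
  iter n (step_up l) (odd_weight a l) (fun=> 0%N).
Proof.
rewrite -(@SW_full K l n.+2 n) // -(@sum_wd K n) // big_mkcondr /=.
apply: eq_big => [s|s hs]; first by rewrite invol_on_ltset.
have hs' : invol_on (ltset n n) s by rewrite invol_on_ltset.
have sK := pn_involutive hs'.
(* A mark leaves a blank in the word, so the factor [0 \notin w] keeps only the unmarked terms. *)
rewrite (bigD1 set0) ?sub0set //= big1 ?addr0; last first.
  move=> B /andP[/subsetP BA /set0Pn[x xB]]; rewrite mem0_blank.
  have -> : [exists j : 'I_(size (wd (pn s) (bn B) n)), blank j (wd (pn s) (bn B) n)].
    apply/existsP; have bx : blank x (wd (pn s) (bn B) n).
      have := BA _ xB; rewrite inE => /andP[xn /eqP sx].
      by rewrite blank_wd // xn pnE sx eqxx bnE.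
    by exists (Ordinal (blank_ltn bx)).
  by rewrite mul0r.
have b0 x : bn (set0 : {set 'I_n}) x = false.
  by apply/negbTE/exists_inPn => y; rewrite inE.
have oc : ones_chain s (wd (pn s) (bn (set0 : {set 'I_n})) n) n.
  apply: (@ones_chain_wd _ _ sK n n s) => //; first exact/eqP.
  by move=> x _; rewrite b0 pnE.
have sw := size_wd (pn s) (bn (set0 : {set 'I_n})) n.
have -> : 0%N \notin wd (pn s) (bn (set0 : {set 'I_n})) n.
  rewrite mem0_blank; apply/existsPn => j; rewrite blank_wd //.
  have jn : (j < n)%N by rewrite -[X in (_ < X)%N]sw.
  rewrite jn -[nat_of_ord j]/(val (Ordinal jn)) pnE b0; case: eqP => //= _.
  by rewrite -ltnNge.
rewrite mul1r no_increasing_chain -[X in chainb s _ X _]sw ones_chain_cnt // -ltnNge ltnS.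
case: (leqP (cnt 1 _) l) => wl; rewrite ?mul0r // mul1r /odd_weight; congr (_ ^+ _).
(* The even letters cancel, leaving the odd columns on one side and the fixed points on the
   other. *)
have := letters_mu (yam_wd _ sK n) wl; rewrite letters_wd // => /addnI <-.
rewrite big_mkord -sum1_card [LHS]big_mkcond /=; apply: eq_bigr => x _.
by rewrite b0 andbT inE pnE (inj_eq val_inj); case: eqP.
Qed.

Lemma SW_pick B n (F : seq nat -> K) : (0 < B)%N ->
  (forall w, yam w -> size w = n -> w != nseq n 0%N -> F w = 0) ->
  SW B n F = F (nseq n 0%N).
Proof.
move=> B0; elim: n F => //= n IH F hF; rewrite IH.
  rewrite (@big_natD1 _ B _ _ 0%N) //= big1 ?addr0 // => r /andP[ar r0].
  have yn : yam (nseq n 0%N) by elim: (n) => //= k ->.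
  apply: hF => /=; rewrite ?yn ?size_nseq //.
  by rewrite eqseq_cons negb_and r0.
move=> w yw sw wn; apply: big1 => r ar; apply: hF; rewrite /= ?yw ?sw //.
by rewrite eqseq_cons negb_and wn orbT.
Qed.

Lemma cnt_nseq0 r n : cnt r.+1 (nseq n 0%N) = 0%N.
Proof. by elim: n => //= n IH; rewrite cnt_cons IH. Qed.

Lemma mu_eq0_nseq w : yam w -> (forall c, columns w c = 0%N) -> w = nseq (size w) 0%N.
Proof.
move=> yw m0; apply/all_pred1P/allP => r rw /=; apply/negPn/negP => r0.
have : (0 < cnt r w)%N by rewrite /cnt -has_count; apply/hasP; exists r => //=.
by rewrite muE ?m0 // ?lt0n // leqn0 (negbTE r0).
Qed.

(** The staircase starts with no rows, where every column is blank. [at_origin] singles out this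
    word in the sum, as the only lattice word of empty shape. *)
Lemma KS_nseq_even n (beta : K) e l :
  KS n beta e l (nseq n 0%N) = iter n (updown l (stay beta e l)) (at_origin l) (fun=> 0%N).
Proof.
rewrite -(@SW_completions K n _ _ _ n.+2) // SW_pick //.
  rewrite /at_origin (_ : [forall c : 'I_l, _]) ?mulr1 //.
  apply/forallP => c; apply/eqP/mu_eq0; last by rewrite cnt_nseq0.
  by elim: (n) => //= k ->.
move=> w yw sw wn; case: n sw wn => [|n] sw wn; first by case: w sw wn {yw}.
case: (leqP (cnt 1 w) l) => wl; last first.
  case: w yw sw wl {wn} => // r w yw [sw] wl.
  by rewrite KS_cons ?sw // leqNgt wl !mul0r.
rewrite /at_origin (_ : [forall c : 'I_l, _] = false) ?mulr0 //.
apply: contraNF wn => /forallP h; rewrite (mu_eq0_nseq yw) ?size_nseq ?sw // => c.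
have [cl|lc] := ltnP c l; first exact: (eqP (h (Ordinal cl))).
by apply: mu_eq0 => //; apply: leq_trans lc.
Qed.

Lemma sum_skew_involutions n (beta : K) e l :
  \sum_(s : {perm 'I_n} | (s == iota_perm n * s^-1 * iota_perm n)%g
        && no_increasing_gt (2 * l + ~~ e) s) beta ^+ #|negated_points s| =
  iter n (updown l (stay beta e l)) (at_origin l) (fun=> 0%N).
Proof.
rewrite -KS_nseq_even /KS.
have bT : bset n (nseq n 0%N) = setT.
  apply/setP => x; rewrite !inE; move: (val x) (ltn_ord x); elim: (n) => //= k IH y.
  by rewrite ltnS leq_eqVlt size_nseq; case: eqP => //= _; apply: IH.
have iK : (iota_perm n * iota_perm n = 1)%g by apply/permP => x; rewrite permM perm1 iotaK.
rewrite bT [RHS](reindex_inj (mulgI (iota_perm n))) /= big_mkcondr /=.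
(* Multiplication by [iota] turns the skew symmetry into being an involution, and negated points
   into fixed points. *)
have E s : invol_on setT (iota_perm n * s)%g = (s == iota_perm n * s^-1 * iota_perm n)%g.
  have iV : ((iota_perm n)^-1 = iota_perm n)%g by apply/eqP; rewrite eq_invg_mul iK.
  rewrite /invol_on [X in _ && X](_ : _ = true) ?andbT; last by apply/forall_inP => x; rewrite inE.
  rewrite invMg iV; apply/eqP/eqP => [e1|{1}->]; last by rewrite !mulgA iK mul1g.
  by rewrite -mulgA -e1 mulgA iK mul1g.
apply: eq_big => [s|s /eqP es]; first by rewrite E.
have := E s; rewrite -{1}es eqxx => /invol_onP[h1 _].
have fK x : s (iota_perm n (s (iota_perm n x))) = x by have := h1 x; rewrite !permM.
have -> : fixin setT (iota_perm n * s)%g = #|negated_points s|.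
  rewrite /fixin -(card_imset _ (@perm_inj _ (iota_perm n))).
  congr #|pred_of_set _|; apply/setP => x; rewrite !inE.
  apply/imsetP/eqP => [[y]|e1].
    by rewrite !inE permM => /eqP e1 ->; rewrite iotaK e1.
  by exists (iota_perm n x); rewrite ?inE /= ?permM ?iotaK ?e1.
rewrite size_nseq [X in _ = _ * (nat_of_bool X)%:R](_ : _ = no_increasing_gt (2 * l + ~~ e) s).
  by case: ifP; rewrite ?mulr1 ?mulr0.
have bl (x : 'I_n) : blank x (nseq n 0%N) by have := in_setT x; rewrite -bT inE.
have H := @oknP n s (pn (iota_perm n * s)%g) e l n (nseq n 0%N).
apply/idP/idP => [/H|hn].
  case=> //; rewrite ?size_nseq ?subnn //.
  - move=> k q _; rewrite chain_empty; case: q => // q.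
    by apply/esym/negbTE; rewrite -ltnNge ltnS (leq_trans (ones_mono _ _)) // cnt_nseq0.
  - by move=> x _; rewrite pnE permM pnE permM fK bl.
  - by move=> x _; rewrite bl.
  move=> c1 c2; have c1' : ~~ [exists k : 'I_n.+1, chainb s k (n - k) l.+1].
    by apply/existsPn => k; apply: c1; rewrite leq0n -ltnS ltn_ord.
  case: e c2 {H} => c2; last by rewrite addn1 -addn1 no_increasing_odd.
  rewrite addn0 no_increasing_even // c1' /=; apply/forallP => z; apply/implyP => /eqP sz.
  by apply: c2 => //; rewrite pnE permM sz.
apply/H; rewrite ?size_nseq ?subnn //.
- move=> k q _; rewrite chain_empty; case: q => // q.
  by apply/esym/negbTE; rewrite -ltnNge ltnS (leq_trans (ones_mono _ _)) // cnt_nseq0.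
- by move=> x _; rewrite pnE permM pnE permM fK bl.
- by move=> x _; rewrite bl.
have [c1 c2] : ~~ [exists k : 'I_n.+1, chainb s k (n - k) l.+1] /\
   (e -> [forall z : 'I_n, (s (iota_perm n z) == z) ==> ~~ chainb s (iota_perm n z) z l]).
  by move: hn; case: (e) => /=; rewrite ?addn0 ?no_increasing_even ?no_increasing_odd // => /andP[].
split=> [k /andP[_ kn]|he z _ fz].
  by have /existsPn/(_ (Ordinal (kn : (k < n.+1)%N))) := c1.
have /forallP/(_ z)/implyP := c2 he; apply; apply/eqP/val_inj => /=.
by move: fz; rewrite pnE permM.
Qed.

End InvolutionCounts.

(** The value is the identity when [phi] is not injective, which keeps [of_triple] and [to_triple]
    total. *)
Definition mkperm (T : finType) (phi : T -> T) : {perm T} :=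
  insubd (1%g : {perm T}) [ffun x => phi x].

Lemma mkpermE (T : finType) (phi : T -> T) : injective phi -> mkperm phi =1 phi.
Proof.
move=> inj x; have h : injectiveb [ffun x => phi x].
  by apply/injectiveP => y z; rewrite !ffunE; apply: inj.
by rewrite /mkperm -pvalE -[pval _]/(val _) val_insubd h ffunE.
Qed.

(** * Signed involutions *)

Section SignedInvolutions.
Variable n : nat.
Local Open Scope nat_scope.
Local Notation iota := (iota_perm (2 * n)).
Implicit Types (s : {perm 'I_(2 * n)}) (y z : 'I_n).

Lemma leq_n2n : n <= 2 * n. Proof. by rewrite mul2n -addnn leq_addr. Qed.

Definition emb y : 'I_(2 * n) := widen_ord leq_n2n y.

Lemma iota_emb y : iota (emb y) = 2 * n - y.+1 :> nat.
Proof. by rewrite iota_val. Qed.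

Lemma iota_emb_ge y : n <= iota (emb y).
Proof. by rewrite iota_emb; have := ltn_ord y; lia. Qed.

Lemma emb_inj : injective emb.
Proof. by move=> y z /(congr1 val) /= e; apply: val_inj. Qed.

Lemma emb_neq_iota y z : emb y != iota (emb z).
Proof.
apply/eqP => /(congr1 val) /= e; have := ltn_ord y; have := iota_emb_ge z.
by rewrite -e leqNgt => /negP.
Qed.

Variant emb_spec (x : 'I_(2 * n)) : option 'I_n -> option 'I_n -> Prop :=
| EmbLow y of x = emb y : emb_spec x (Some y) None
| EmbHigh y of x = iota (emb y) : emb_spec x None (Some y).

Lemma embP x : emb_spec x (insub (val x)) (insub (val (iota x))).
Proof.
case: insubP => [y yn e|]; last first.
  rewrite -leqNgt -[val x]/(nat_of_ord x) => nx; have ix : iota x < n by rewrite iota_val; have := ltn_ord x; lia.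
  rewrite insubT; constructor.
  by rewrite -[LHS](@iotaK (2 * n)); congr (iota _); apply: val_inj.
have -> : x = emb y by apply: val_inj.
by rewrite insubN; [constructor | rewrite -leqNgt; apply: iota_emb_ge].
Qed.

(** A signed involution is coded by its lower half: [t.1] moves the points that stay there, [t.2.1]
    collects those sent to the upper half, and [t.2.2] tells to which mirror image. In a
    [signed_triple] the latter are fixed by [t.1], and they are the marks given to [wd]. *)
Definition signed_val (t : {perm 'I_n} * ({set 'I_n} * {perm 'I_n})) y : 'I_(2 * n) :=
  if y \in t.2.1 then iota (emb (t.2.2 y)) else emb (t.1 y).

Definition signed_fun t (x : 'I_(2 * n)) : 'I_(2 * n) :=
  if insub (val x) is Some y then signed_val t y
  else if insub (val (iota x)) is Some y then iota (signed_val t y) else x.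

Lemma signed_fun_emb t y : signed_fun t (emb y) = signed_val t y.
Proof.
rewrite /signed_fun; case: embP => [z /emb_inj -> //|z e].
by have := emb_neq_iota y z; rewrite e eqxx.
Qed.

Lemma signed_fun_iota t x : signed_fun t (iota x) = iota (signed_fun t x).
Proof.
by rewrite /signed_fun iotaK; case: (embP x) => y _ //; rewrite iotaK.
Qed.

Definition signed_triple (t : {perm 'I_n} * ({set 'I_n} * {perm 'I_n})) : bool :=
  [&& (t.1 == t.1^-1)%g, t.2.1 \subset fixlt t.1 n & invol_on t.2.1 t.2.2].

Lemma signed_tripleP t : signed_triple t ->
  [/\ forall y, t.1 (t.1 y) = y, forall y, y \in t.2.1 -> t.1 y = y,
      forall y, t.2.2 (t.2.2 y) = y & forall y, y \notin t.2.1 -> t.2.2 y = y].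
Proof.
case/and3P => /eqP e1 /subsetP e2 /invol_onP[h1 h2]; split=> // y.
  by rewrite {1}e1 permK.
by move=> /e2; rewrite inE => /andP[_ /eqP].
Qed.

Lemma signed_stable t y : signed_triple t ->
  ((t.2.2 y \in t.2.1) = (y \in t.2.1)) /\ ((t.1 y \in t.2.1) = (y \in t.2.1)).
Proof.
case/signed_tripleP => h1 h2 h3 h4; split; apply/idP/idP => hy.
- by apply: contraLR hy => hy; rewrite h4.
- by apply: contraLR hy => hy; have := h4 _ hy; rewrite h3 => ->.
- by rewrite -[y]h1 (h2 _ hy).
- by rewrite h2.
Qed.

Lemma signed_funK t : signed_triple t -> involutive (signed_fun t).
Proof.
move=> ht; have [h1 h2 h3 h4] := signed_tripleP ht.
have low y : signed_fun t (signed_val t y) = emb y.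
  rewrite {1}/signed_val; have [s1 s2] := signed_stable y ht; case: ifP => hy.
    by rewrite signed_fun_iota signed_fun_emb /signed_val s1 hy iotaK h3.
  by rewrite signed_fun_emb /signed_val s2 hy h1.
move=> x; rewrite {2}/signed_fun; case: (embP x) => y ->; first exact: low.
by rewrite signed_fun_iota low.
Qed.

Definition of_triple t : {perm 'I_(2 * n)} := mkperm (signed_fun t).

Lemma of_tripleE t : signed_triple t -> of_triple t =1 signed_fun t.
Proof. by move=> ht; apply: mkpermE; apply: (can_inj (signed_funK ht)). Qed.

Definition to_triple s : {perm 'I_n} * ({set 'I_n} * {perm 'I_n}) :=
  (mkperm (fun y => if (insub (val (s (emb y))) : option 'I_n) is Some z then z else y),
   ([set y | n <= s (emb y)],
    mkperm (fun y => if (insub (val (s (emb y))) : option 'I_n) is Some z then y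
                     else if (insub (val (iota (s (emb y)))) : option 'I_n) is Some z then z else y))).

Definition signed_perm s := (s == s^-1)%g && (s == iota * s^-1 * iota)%g.

Lemma signed_permP s : reflect ((forall x, s (s x) = x) /\ (forall x, s (iota x) = iota (s x)))
  (signed_perm s).
Proof.
apply: (iffP andP) => [[/eqP e1 /eqP e2]|[h1 h2]]; split.
- by move=> x; rewrite {1}e1 permK.
- by move=> x; rewrite {1}e2 -e1 !permM iotaK.
- by apply/eqP/permP => x; apply: (@perm_inj _ s); rewrite h1 permKV.
- apply/eqP/permP => x; rewrite !permM; apply: (canRL (@iotaK (2 * n))).
  by rewrite -h2; apply: (@perm_inj _ s); rewrite h1 permKV.
Qed.

Lemma to_tripleP s : signed_perm s -> signed_triple (to_triple s) /\
  (forall y, s (emb y) = signed_val (to_triple s) y).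
Proof.
case/signed_permP => h1 h2.
pose phi y := if (insub (val (s (emb y))) : option 'I_n) is Some z then z else y.
pose psi y := if (insub (val (s (emb y))) : option 'I_n) is Some z then y
              else if (insub (val (iota (s (emb y)))) : option 'I_n) is Some z then z else y.
have phiK : involutive phi.
  move=> y; rewrite {2}/phi; case: embP => z e; last by rewrite /phi e insubN // -leqNgt iota_emb_ge.
  by rewrite /phi -e h1 valK.
have psiK : involutive psi.
  move=> y; rewrite {2}/psi; case: embP => z e; first by rewrite /psi e valK.
  have e' : s (emb z) = iota (emb y) by rewrite -[emb z](@iotaK (2 * n)) -e h2 h1.
  by rewrite /psi e' insubN -?leqNgt ?iota_emb_ge // iotaK valK.
have E1 y : (to_triple s).1 y = phi y by rewrite /= mkpermE //; apply: can_inj phiK.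
have E2 y : (to_triple s).2.2 y = psi y by rewrite /= mkpermE //; apply: can_inj psiK.
have E3 y : (y \in (to_triple s).2.1) = (n <= s (emb y)) by rewrite inE.
split; last first.
  move=> y; rewrite /signed_val E1 E2 E3 /phi /psi; case: embP => z ->; last by rewrite iota_emb_ge.
  by rewrite leqNgt [emb z < n](ltn_ord z).
apply/and3P; split.
- by apply/eqP/permP => y; apply: (@perm_inj _ (to_triple s).1); rewrite permKV !E1 phiK.
- apply/subsetP => y; rewrite E3 inE ltn_ord E1 /phi => hy.
  by rewrite insubN ?eqxx // -leqNgt.
- apply/invol_onP; split=> y; first by rewrite !E2 psiK.
  by rewrite E3 -ltnNge E2 /psi => hy; rewrite insubT.
Qed.

Lemma of_triple_signed t : signed_triple t -> signed_perm (of_triple t).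
Proof.
move=> ht; apply/signed_permP; split=> x; rewrite !of_tripleE ?signed_funK //.
exact: signed_fun_iota.
Qed.

Lemma to_tripleK s : signed_perm s -> of_triple (to_triple s) = s.
Proof.
move=> hs; have [ht e] := to_tripleP hs; have [h1 h2] := signed_permP _ hs.
apply/permP => x; rewrite of_tripleE // /signed_fun.
by case: (embP x) => y ->; rewrite -e // h2.
Qed.

Lemma of_tripleK t : signed_triple t -> to_triple (of_triple t) = t.
Proof.
move=> ht; have hs := of_triple_signed ht; have [ht' e] := to_tripleP hs.
have E y : signed_val (to_triple (of_triple t)) y = signed_val t y.
  by rewrite -e of_tripleE // signed_fun_emb.
have [_ h2 _ h4] := signed_tripleP ht; have [_ h2' _ h4'] := signed_tripleP ht'.
have EB y : (y \in (to_triple (of_triple t)).2.1) = (y \in t.2.1).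
  have := E y; rewrite /signed_val; case: ifP => _; case: ifP => // _ /eqP.
    by rewrite eq_sym (negbTE (emb_neq_iota _ _)).
  by rewrite (negbTE (emb_neq_iota _ _)).
move: (to_triple _) E EB h2' h4' => [f' [B' g']] /= E EB h2' h4'.
case: t {ht hs ht' e} E EB h2 h4 => f [B g] /= E EB h2 h4.
congr (_, (_, _)); last 1 first.
- apply/permP => y; have := E y; rewrite /signed_val /= EB; case: ifP => yB.
    by move=> /perm_inj/emb_inj.
  by rewrite h4' ?EB ?yB // h4 ?yB.
- apply/permP => y; have := E y; rewrite /signed_val /= EB; case: ifP => yB.
    by rewrite h2' ?EB // h2.
  by move=> /emb_inj.
- by apply/setP => y.
Qed.

(** The first [n] rows and columns form a symmetric diagram, read by [wd]; from that corner of the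
    staircase on, [okn] adds the rows of the upper half. The other half of the staircase is the
    mirror image in the main diagonal. *)
Lemma signed_no_increasing s l : signed_perm s ->
  no_increasing_gt (2 * l + 1) s =
  okn (pn (to_triple s).2.2) false l n (wd (pn (to_triple s).1) (bn (to_triple s).2.1) n).
Proof.
move=> hs; have [ht e] := to_tripleP hs; have [h1 h2] := signed_permP _ hs.
have [/eqP es /eqP es'] := andP hs.
move: (to_triple s) ht e => t ht e; have [t1 t2 t3 t4] := signed_tripleP ht.
have hf : invol_on (ltset n n) t.1 by rewrite invol_on_ltset; case/and3P: ht.
have fK := pn_involutive hf.
set w := wd _ _ _; have sw : size w = n by apply: size_wd.
have xE (x : 'I_(2 * n)) (xn : x < n) : x = emb (Ordinal xn) by apply: val_inj.
have oc : ones_chain s w (2 * n - n).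
  have -> : 2 * n - n = n by lia.
  apply: (@ones_chain_wd _ _ fK (2 * n) n s) => //; first exact: leq_n2n.
  move=> x xn; rewrite (xE x xn); set y := Ordinal xn.
  have -> : bn t.2.1 (emb y) = (y \in t.2.1) by exact: bnE.
  have -> : pn t.1 (emb y) = t.1 y by exact: pnE.
  rewrite e /signed_val; case: (boolP (y \in t.2.1)) => [yB|//].
  by split; [apply: iota_emb_ge | rewrite t2].
have bw (y : 'I_n) : blank y w = (y \in t.2.1).
  rewrite blank_wd // ltn_ord /= pnE bnE (inj_eq val_inj); case: eqP => // fy.
  rewrite leqNgt ltn_ord /=; apply/esym/negP => yB; apply: fy; exact: t2.
have bwe (y : 'I_n) : blank (emb y) w = (y \in t.2.1) by exact: bw.
have H : okn (pn t.2.2) false l n w <->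
    (forall k, 2 * n - n <= k <= 2 * n -> ~~ chainb s k (2 * n - k) l.+1) /\
    (false -> forall z : 'I_(2 * n), blank z w -> pn t.2.2 z = z -> ~~ chainb s (iota z) z l).
  apply: oknP => // [|x bx|x xn]; first exact: leq_n2n.
    have xn : x < n by move: (blank_ltn bx); rewrite sw.
    rewrite (xE x xn) in bx *; move: (Ordinal xn) bx => y; rewrite bwe => yB.
    have -> : pn t.2.2 (emb y) = t.2.2 y by exact: pnE.
    rewrite bw (signed_stable y ht).1 pnE t3; split=> //.
    by rewrite h2 e /signed_val yB iotaK.
  rewrite (xE x xn) h2 e; move: (Ordinal xn) => y; rewrite bwe /signed_val => /negbTE ->.
  by apply: leq_trans (iota_emb_ge _); apply: ltnW; apply: (ltn_ord y).
rewrite no_increasing_odd //; apply/idP/idP => [/existsPn h|/H[h _]].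
  apply/H; split=> // k /andP[_ kn].
  exact: (h (Ordinal (kn : k < (2 * n).+1))).
apply/existsPn => k; have kn := ltn_ord k; have [nk|kn'] := leqP n k; first by apply: h; lia.
rewrite chain_sym //; have -> : val k = 2 * n - (2 * n - k) by rewrite /=; lia.
by rewrite [X in chainb s (_ - X)](_ : _ = val k) /=; [apply: h|]; lia.
Qed.

End SignedInvolutions.

Lemma okn_cnt f e l w : okn f e l (size w) w -> (cnt 1 w <= l)%N.
Proof. by case: w => //= r w /andP[]. Qed.

Section SignedCounts.
Variables (K : comNzRingType) (n : nat).
Local Open Scope ring_scope.
Local Notation iota := (iota_perm (2 * n)).

Lemma card_iota_stable (A : {set 'I_(2 * n)}) : (forall x, (iota x \in A) = (x \in A)) ->
  #|A| = (2 * #|[set y : 'I_n | emb y \in A]|)%N.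
Proof.
move=> hA; pose L := [set emb y | y in [set y : 'I_n | emb y \in A]].
have cL : #|L| = #|[set y : 'I_n | emb y \in A]| by rewrite card_imset //; apply: emb_inj.
have E : A = L :|: [set iota x | x in L].
  apply/setP => x; rewrite inE; apply/idP/orP => [xA|[/imsetP[y]|/imsetP[z /imsetP[y]]]].
  - case: (embP x) => y e; [left|right].
      by rewrite e imset_f // inE -e.
    by rewrite e; do 2!apply: imset_f; rewrite inE -hA -e.
  - by rewrite inE => yA ->.
  - by rewrite inE => yA -> ->; rewrite hA.
rewrite {1}E cardsU [#|[set iota x | x in L]|]card_imset; last exact: perm_inj.
rewrite (_ : L :&: _ = set0) ?cards0 ?subn0 ?cL; first by lia.
apply/setP => x; rewrite !inE; apply/negP => /andP[/imsetP[y _ ->] /imsetP[_ /imsetP[z _ ->]]].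
by move/eqP; rewrite (negbTE (emb_neq_iota _ _)).
Qed.

Lemma signed_fixed (s : {perm 'I_(2 * n)}) : signed_perm s ->
  #|fixed_points s| = (2 * #|fixlt (to_triple s).1 n :\: (to_triple s).2.1|)%N.
Proof.
move=> hs; have [ht e] := to_tripleP hs; have [h1 h2] := signed_permP _ hs.
rewrite card_iota_stable; last first.
  by move=> x; rewrite !inE h2 (inj_eq (@perm_inj _ iota)).
congr (2 * #|pred_of_set _|)%N; apply/setP => y.
move: (to_triple s) ht e => t ht e; rewrite !inE e /signed_val ltn_ord /=.
case: (y \in _); last by rewrite (inj_eq (@emb_inj n)).
by rewrite eq_sym (negbTE (emb_neq_iota _ _)).
Qed.

Lemma signed_negated (s : {perm 'I_(2 * n)}) : signed_perm s ->
  #|negated_points s| = (2 * fixin (to_triple s).2.1 (to_triple s).2.2)%N.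
Proof.
move=> hs; have [ht e] := to_tripleP hs; have [h1 h2] := signed_permP _ hs.
rewrite card_iota_stable; last first.
  by move=> x; rewrite !inE h2 (inj_eq (@perm_inj _ iota)).
congr (2 * #|pred_of_set _|)%N; apply/setP => y.
move: (to_triple s) ht e => t ht e; rewrite !inE e /signed_val.
case: (y \in _); last by rewrite (negbTE (emb_neq_iota _ _)).
by rewrite (inj_eq (@perm_inj _ iota)) (inj_eq (@emb_inj n)).
Qed.

(** A signed involution is a marked involution of the lower half followed by an involution of its
    marks: the former are summed by [sum_wd], the latter make up [KS]. *)
Lemma sum_signed_involutions l (a b : K) :
  \sum_(s : {perm 'I_(2 * n)} | signed_perm s && no_increasing_gt (2 * l + 1) s)
    a ^+ (#|fixed_points s| %/ 2) * b ^+ (#|negated_points s| %/ 2) =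
  iter n (updown l (stay b false l)) (odd_weight a l) (fun=> 0%N).
Proof.
rewrite -(@SW_completions K n b false l n.+2 n) // -(@sum_wd K n) //.
rewrite big_mkcondr /=.
rewrite (partition_big (@to_triple n) (@signed_triple n)) /=; last by move=> s /to_tripleP[].
transitivity (\sum_(t | @signed_triple n t) a ^+ #|fixlt t.1 n :\: t.2.1| *
   (b ^+ fixin t.2.1 t.2.2 * (okn (pn t.2.2) false l n (wd (pn t.1) (bn t.2.1) n))%:R)).
  apply: eq_bigr => t ht; rewrite (big_pred1 (of_triple t)).
    have hs := of_triple_signed ht.
    rewrite signed_no_increasing // signed_fixed // signed_negated // of_tripleK //.
    by rewrite !mulKn //; case: ifP; rewrite ?mulr1 ?mulr0.
  move=> s; apply/andP/eqP => [[hs /eqP <-]|->]; first by rewrite to_tripleK.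
  by rewrite of_triple_signed // of_tripleK.
rewrite (eq_bigl (fun t : {perm 'I_n} * ({set 'I_n} * {perm 'I_n}) =>
   (invol_on (ltset n n) t.1) && ((t.2.1 \subset fixlt t.1 n) && invol_on t.2.1 t.2.2))); last first.
  by move=> t; rewrite /signed_triple invol_on_ltset.
rewrite -(pair_big_dep (fun f => invol_on (ltset n n) f)
   (fun f (u : {set 'I_n} * {perm 'I_n}) => (u.1 \subset fixlt f n) && invol_on u.1 u.2)
   (fun f u => a ^+ #|fixlt f n :\: u.1| *
   (b ^+ fixin u.1 u.2 * (okn (pn u.2) false l n (wd (pn f) (bn u.1) n))%:R))) /=.
apply: eq_bigr => f hf.
rewrite -(pair_big_dep (fun B : {set 'I_n} => B \subset fixlt f n) (fun B g => invol_on B g)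
   (fun B g => a ^+ #|fixlt f n :\: B| *
   (b ^+ fixin B g * (okn (pn g) false l n (wd (pn f) (bn B) n))%:R))) /=.
apply: eq_bigr => B BA.
have fK := pn_involutive hf; set w := wd _ _ _.
have sw : size w = n by apply: size_wd.
have bB : bset n w = B.
  apply/setP => y; rewrite inE blank_wd // ltn_ord /= pnE bnE (inj_eq val_inj); case: eqP => // fy.
  rewrite leqNgt ltn_ord /=; apply/esym/negP => /(subsetP BA); rewrite inE => /andP[_ /eqP]; exact: fy.
rewrite /KS bB sw mulr_suml; apply: eq_bigr => g _; rewrite mulrC.
case ok : (okn _ _ _ _ _); rewrite ?mulr0 ?mul0r // !mulr1; congr (_ * _ ^+ _).
have wl : (cnt 1 w <= l)%N.
  by apply: (@okn_cnt (pn g) false); rewrite sw.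
have := letters_mu (yam_wd _ fK n) wl; rewrite letters_wd // => /addnI <-.
rewrite big_mkord -sum1_card [LHS]big_mkcond /=; apply: eq_bigr => x _.
by rewrite !inE ltn_ord /= pnE (inj_eq val_inj) bnE andbC; case: (_ && _).
Qed.

End SignedCounts.

(** * Pfaffians and alternating functions *)

Lemma mem_mkseqP (T : eqType) (f : nat -> T) n y :
  y \in mkseq f n -> exists2 i, i < n & y = f i.
Proof. by move=> /mapP[i]; rewrite mem_iota; exists i. Qed.

Local Open Scope ring_scope.

Section SignedDeletion.
Variables (K : comNzRingType) (T1 T2 : Type) (W : T1 -> T2 -> K).
Implicit Types (F G : seq T2 -> K) (s u : seq T2).

(* The sum over i of (-1)^i W(x, s_i) F(s without s_i). *)
Fixpoint dsum (x : T1) F s : K :=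
  if s is y :: s' then W x y * F s' - dsum x (fun u => F (y :: u)) s' else 0.

Lemma dsum_lin x c F G s : dsum x (fun u => c * F u + G u) s = c * dsum x F s + dsum x G s.
Proof. by elim: s F G => [|y s IH] F G /=; rewrite ?IH; ring. Qed.

Lemma dsum_ext x F G s : F =1 G -> dsum x F s = dsum x G s.
Proof. by elim: s F G => [//|y s IH] F G e /=; rewrite e (IH _ (fun u => G (y :: u))) // => u; rewrite e. Qed.

Lemma dsum0 x s : dsum x (fun=> 0) s = 0.
Proof. by have := dsum_lin x (-1) (fun=> 0) (fun=> 0) s; rewrite (@dsum_ext _ _ (fun=> 0)) => [->|u]; ring. Qed.

Lemma dsumZ x c F s : dsum x (fun u => c * F u) s = c * dsum x F s.
Proof. by have := dsum_lin x c F (fun=> 0) s; rewrite dsum0 addr0 => <-; apply: dsum_ext => u; rewrite addr0. Qed.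

Lemma dsumN x F s : dsum x (fun u => - F u) s = - dsum x F s.
Proof. by rewrite -mulN1r -dsumZ; apply: dsum_ext => u; rewrite mulN1r. Qed.

Lemma dsumD x F G s : dsum x (fun u => F u + G u) s = dsum x F s + dsum x G s.
Proof. by rewrite -[dsum x F s]mul1r -dsum_lin; apply: dsum_ext => u; rewrite mul1r. Qed.

Lemma dsum_bigsum x (I : Type) (r : seq I) (F : I -> seq T2 -> K) s :
  dsum x (fun u => \sum_(i <- r) F i u) s = \sum_(i <- r) dsum x (F i) s.
Proof.
elim: r => [|i r IH].
  by rewrite big_nil -[RHS](dsum0 x s); apply: dsum_ext => u; rewrite big_nil.
rewrite big_cons -IH -dsumD; apply: dsum_ext => u; exact: big_cons.
Qed.

(** Two entries deleted in the two possible orders get opposite signs; this is why determinants and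
    Pfaffians alternate. *)
Lemma dsum_anti x y F s : dsum x (dsum y F) s = - dsum y (dsum x F) s.
Proof.
elim: s F => [|z s IH] F /=; first by rewrite oppr0.
have e a b : dsum a (fun u => W b z * F u - dsum b (fun v => F (z :: v)) u) s =
    W b z * dsum a F s - dsum a (dsum b (fun v => F (z :: v))) s.
  by rewrite dsum_lin dsumN.
by rewrite !e IH; ring.
Qed.

Lemma dsum_cat_iso x F s1 s2 : (forall i, (i < size s1)%N -> forall y0, W x (nth y0 s1 i) = 0) ->
  dsum x F (s1 ++ s2) = (-1) ^+ size s1 * dsum x (fun u => F (s1 ++ u)) s2.
Proof.
elim: s1 F => [|y s1 IH] F h /=; first by rewrite expr0 mul1r.
by rewrite (h 0%N isT y) /= mul0r sub0r IH ?exprS ?mulN1r ?mulNr // => i hi; apply: (h i.+1).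
Qed.

Lemma dsum_rcons x F s y : dsum x F (rcons s y) =
  dsum x (fun u => F (rcons u y)) s + (-1) ^+ size s * (W x y * F s).
Proof.
elim: s F => [|z s IH] F /=; first by rewrite expr0; ring.
by rewrite IH exprS; ring.
Qed.

Lemma dsum_rev x F s : dsum x F (rev s) = (-1) ^+ (size s).-1 * dsum x (fun u => F (rev u)) s.
Proof.
elim: s F => [|y s IH] F; first by rewrite /= mulr0.
rewrite rev_cons dsum_rcons IH /= size_rev mulrDr addrC; congr (_ + _).
case: s {IH} => [|z s]; first by rewrite /= oppr0 !mulr0.
rewrite [size _]/= exprS mulN1r mulrNN; congr (_ * _); apply: dsum_ext => u.
by rewrite rev_cons.
Qed.

Lemma dsum_sum x F s y0 : dsum x F s =
  \sum_(j < size s) (-1) ^+ j * (W x (nth y0 s j) * F (take j s ++ drop j.+1 s)).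
Proof.
elim: s F => [|y s IH] F /=; first by rewrite big_ord0.
rewrite big_ord_recl expr0 mul1r [in RHS]/= drop0 IH; congr (_ + _).
by rewrite -sumrN; apply: eq_bigr => j _; rewrite /bump add1n /= exprS mulN1r mulNr.
Qed.

Definition is_alternating F := forall s1 x y s2, F (s1 ++ x :: y :: s2) = - F (s1 ++ y :: x :: s2).

Lemma alternating_cons F y : is_alternating F -> is_alternating (fun u => F (y :: u)).
Proof. by move=> aF s1 a b s2; rewrite -!cat_cons aF. Qed.

Lemma alternating_dsum x F : is_alternating F -> is_alternating (dsum x F).
Proof.
move=> aF s1; elim: s1 F aF => [|z s1 IH] F aF a b s2 /=.
  rewrite (@dsum_ext x (fun u => F (b :: a :: u)) (fun u => - F (a :: b :: u))) => [|u].
    by rewrite dsumN; ring.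
  exact: (aF [::]).
by rewrite aF IH; [ring|exact: alternating_cons].
Qed.

End SignedDeletion.

Lemma dsum_eq (K : comNzRingType) (T1 : Type) (T2 : eqType) (W W' : T1 -> T2 -> K) x
    (F G : seq T2 -> K) s : (forall y, y \in s -> W x y = W' x y) ->
  (forall u, subseq u s -> (size u).+1 = size s -> F u = G u) -> dsum W x F s = dsum W' x G s.
Proof.
elim: s F G => [//|y s IH] F G hW h /=; congr (_ * _ - _).
- by rewrite hW ?mem_head.
- by apply: h; rewrite ?subseq_cons.
apply: IH => [z zs|u us su]; first by rewrite hW // inE zs orbT.
by apply: h; rewrite /= ?eqxx // su.
Qed.

Section Alternating.
Variables (K : realFieldType) (T : Type) (f : seq T -> K).
Hypothesis af : is_alternating f.

Lemma alternating_dup s1 x s2 : f (s1 ++ x :: x :: s2) = 0.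
Proof. by have := af s1 x x s2; lra. Qed.

Lemma alternating_move s1 x s2 s3 : f (s1 ++ x :: s2 ++ s3) = (-1) ^+ size s2 * f (s1 ++ s2 ++ x :: s3).
Proof.
elim: s2 s1 => [|y s2 IH] s1; first by rewrite mul1r.
by rewrite !cat_cons af -cat_rcons IH cat_rcons /= exprS mulN1r mulNr.
Qed.

Lemma alternating_dup2 s1 x s2 s3 : f (s1 ++ x :: s2 ++ x :: s3) = 0.
Proof. by rewrite alternating_move catA alternating_dup mulr0. Qed.

Lemma alternating_swap s1 x s2 y s3 : f (s1 ++ x :: s2 ++ y :: s3) = - f (s1 ++ y :: s2 ++ x :: s3).
Proof.
rewrite alternating_move [in RHS]alternating_move -mulrN; congr (_ * _).
by rewrite !catA af.
Qed.

End Alternating.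

Section Pfaffian.
Variables (K : comNzRingType).

(** Expansion along the first entry. [n] counts the pairs, and the value is [0] unless the list has
    [2 * n] entries. *)
Fixpoint pfn (T : Type) (W : T -> T -> K) n s : K :=
  if n is n'.+1 then (if s is x :: s' then dsum W x (pfn W n') s' else 0)
  else if s is [::] then 1 else 0.

Fixpoint detl (T1 T2 : Type) (W : T1 -> T2 -> K) ps qs : K :=
  if ps is p :: ps' then dsum W p (detl W ps') qs else if qs is [::] then 1 else 0.

Lemma alternating_pfn (T : Type) (W : T -> T -> K) n :
  (forall x y, W x y = - W y x) -> is_alternating (pfn W n).
Proof.
move=> aW; elim: n => [|n IH] [|z s1] a b s2 //=; rewrite ?oppr0 //.
  have e c d : dsum W c (pfn W n) (d :: s2) = W c d * pfn W n s2 -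
      (if n is n'.+1 then dsum W c (dsum W d (pfn W n')) s2 else 0).
    by case: n IH => [|n] IH //=; rewrite dsum0.
  rewrite -![_ - _]/(dsum W _ (pfn W n) (_ :: s2)) !e aW.
  case: n {IH e} => [|n]; first by ring.
  by rewrite [dsum W b _ _]dsum_anti; ring.
exact: alternating_dsum.
Qed.

Lemma alternating_detl_rows (T1 T2 : Type) (W : T1 -> T2 -> K) qs :
  is_alternating (fun ps => detl W ps qs).
Proof.
move=> s1; elim: s1 qs => [|z s1 IH] qs a b s2 /=; first exact: dsum_anti.
by rewrite -dsumN; apply: dsum_ext => u; exact: IH.
Qed.

Lemma detl_det (T1 T2 : Type) (W : T1 -> T2 -> K) x0 y0 n ps qs : size ps = n -> size qs = n ->
  detl W ps qs = \det (\matrix_(i < n, j < n) W (nth x0 ps i) (nth y0 qs j)).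
Proof.
elim: n ps qs => [|n IH] [|p ps] [|q qs] //= sp sq; first by rewrite det_mx00.
rewrite -/(dsum W p (detl W ps) (q :: qs)) (dsum_sum _ _ _ _ y0).
rewrite (expand_det_row _ ord0) -(big_mkord xpredT (fun j => (-1) ^+ j * (W p (nth y0 (q :: qs) j) *
  detl W ps (take j (q :: qs) ++ drop j.+1 (q :: qs))))) [size (q :: qs)]/= sq big_mkord.
case: sq => sq; apply: eq_bigr => j _.
rewrite mxE /= /cofactor add0n mulrCA; congr (_ * (_ * _)).
rewrite (IH ps); last 2 first.
- by case: sp.
- rewrite size_cat size_takel /= ?size_drop ?sq; have := ltn_ord j; lia.
congr (\det _); apply/matrixP => i k; rewrite !mxE /=; congr (W _ _).
have -> : nth y0 (q :: qs) (bump j k) = nth y0 (take j (q :: qs) ++ drop j.+1 (q :: qs)) k => [|//].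
rewrite nth_cat size_takel /=; last by rewrite sq; have := ltn_ord j; lia.
rewrite /bump; case: (ltnP k j) => kj; first by rewrite nth_take // leqNgt kj.
by rewrite add1n /= nth_drop subnKC.
Qed.

(** No pair inside [ps] contributes, so each entry of [ps] is matched with one of [qs]. Listing [qs]
    backwards absorbs the sign. *)
Lemma pfn_iso (T : eqType) (W : T -> T -> K) ps qs : size ps = size qs ->
  {in ps &, forall x y, W x y = 0} -> pfn W (size ps) (ps ++ rev qs) = detl W ps qs.
Proof.
elim: ps qs => [|p ps IH] qs; first by case: qs.
move=> sz iso; rewrite [LHS]/= dsum_cat_iso => [|i hi y0]; last first.
  by apply: iso; rewrite inE ?eqxx // mem_nth ?orbT.
rewrite dsum_rev mulrA -exprD /= -sz /= addnn -mul2n exprM sqrrN !expr1n mul1r.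
apply: dsum_eq => // u _ su; apply: IH; first by case: su; rewrite -sz => -[].
by move=> x y xp yp; apply: iso; rewrite inE ?xp ?yp orbT.
Qed.

Fixpoint zigzag (T : Type) (p q : T -> K) s : K :=
  if s is x :: s' then p x * zigzag q p s' else 1.

(** Deleting one or the other entry of a consecutive pair gives the same product, with opposite
    signs. *)
Lemma dsum_zigzag (T : eqType) (W : T -> T -> K) x c (p q : T -> K) n s : size s = n.*2 ->
  (forall y, y \in s -> W x y = c * q y) -> dsum W x (zigzag q p) s = 0.
Proof.
elim: n s => [|n IH] [|a [|b s]] //= [sz] h.
rewrite -/(zigzag p q s) !h ?inE ?eqxx ?orbT //.
rewrite (_ : dsum _ _ _ s = q a * p b * dsum W x (zigzag q p) s); last first.
  by rewrite -dsumZ; apply: dsum_ext => u; rewrite mulrA.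
rewrite IH //; last by move=> y ys; rewrite h // !inE ys !orbT.
ring.
Qed.

(** When the kernel has rank one above the diagonal, only the matching of neighbours survives; the
    other terms cancel by [dsum_zigzag]. *)
Lemma pfn_zigzag (T : eqType) (W : T -> T -> K) (p q : T -> K) n s : size s = n.*2 ->
  pairwise (fun x y => W x y == p x * q y) s -> pfn W n s = zigzag p q s.
Proof.
elim: n s => [|n IH] [|x [|y s]] //= [sz] /andP[/andP[/eqP xy /allP xs] /andP[ys ss]].
rewrite xy IH // (@dsum_eq _ _ _ W W x _ (fun u => p y * zigzag q p u)) // => [|u us su]; last first.
  case: n IH sz => [|n] IH sz; first by case: s sz us su {xs ys ss} => // _; rewrite subseq0 => /eqP->.
  case: u us su => [|z u] us su; first by move: su; rewrite sz.
  rewrite IH //; last first.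
    rewrite pairwise_cons (subseq_pairwise us ss) andbT; apply/allP => w wu.
    by rewrite (allP ys) // (mem_subseq us).
  by move: su; rewrite sz /= => -[->].
rewrite dsumZ (@dsum_zigzag _ W x (p x) p q n) //; first by ring.
by move=> z /xs /eqP.
Qed.

End Pfaffian.

Section Multilinear.
Variables (K : realFieldType) (V : lmodType K).
Implicit Types (W : V -> V -> K) (f : seq V -> K).

Definition multilinear f := forall s1 a u v s2,
  f (s1 ++ (a *: u + v) :: s2) = a * f (s1 ++ u :: s2) + f (s1 ++ v :: s2).

Definition skew_form W := (forall x y, W x y = - W y x) /\
  (forall a u v w, W (a *: u + v) w = a * W u w + W v w).

Lemma skew_form_linr W w a u v : skew_form W -> W w (a *: u + v) = a * W w u + W w v.
Proof. by move=> [aW lW]; rewrite aW lW (aW u) (aW v); ring. Qed.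

Lemma multilinear_dsum W x f : skew_form W -> multilinear f -> multilinear (dsum W x f).
Proof.
move=> sW mf s1; elim: s1 f mf => [|z s1 IH] f mf a u v s2 /=.
  rewrite skew_form_linr // (@dsum_ext _ _ _ W x (fun s => f ((a *: u + v) :: s))
     (fun s => a * f (u :: s) + f (v :: s))) ?dsum_lin => [|s]; first by ring.
  exact: (mf [::]).
by rewrite mf IH; [ring|move=> s a' u' v' s'; rewrite -!cat_cons mf].
Qed.

Lemma dsum_linl W a u v f s : skew_form W ->
  dsum W (a *: u + v) f s = a * dsum W u f s + dsum W v f s.
Proof. by move=> [aW lW]; elim: s f => [|y s IH] f /=; rewrite ?lW ?IH; ring. Qed.

Lemma multilinear_pfn W n : skew_form W -> multilinear (pfn W n).
Proof.
move=> sW; elim: n => [|n IH] [|z s1] a u v s2 //=; rewrite ?mulr0 ?addr0 //.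
  exact: dsum_linl.
exact: multilinear_dsum.
Qed.

Variable f : seq V -> K.
Hypotheses (af : is_alternating f) (mf : multilinear f).

Lemma multilinear_add s1 u v s2 : f (s1 ++ (u + v) :: s2) = f (s1 ++ u :: s2) + f (s1 ++ v :: s2).
Proof. by rewrite -[u]scale1r mf scale1r mul1r. Qed.

Lemma multilinear_pair s1 u v s2 s3 :
  f (s1 ++ (u + v) :: s2 ++ (u - v) :: s3) = - 2 * f (s1 ++ u :: s2 ++ v :: s3).
Proof.
have h w : f (s1 ++ w :: s2 ++ (u - v) :: s3) =
    - f (s1 ++ w :: s2 ++ v :: s3) + f (s1 ++ w :: s2 ++ u :: s3).
  by rewrite -!cat_cons !catA [u - v]addrC -scaleN1r mf mulN1r.
rewrite multilinear_add !h !(alternating_dup2 af) (alternating_swap af _ v).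
by ring.
Qed.

(** Symmetrisation about a centre. For a kernel that changes sign under the reflection, the sums are
    isotropic, so the Pfaffian becomes a determinant of sums against differences. *)
Lemma multilinear_nested (p q : nat -> V) k s1 s2 s3 :
  f (s1 ++ rev (mkseq (fun i => p i + q i) k) ++ s2 ++ mkseq (fun i => p i - q i) k ++ s3) =
  (- 2) ^+ k * f (s1 ++ rev (mkseq p k) ++ s2 ++ mkseq q k ++ s3).
Proof.
elim: k s1 s3 => [|k IH] s1 s3; first by rewrite expr0 mul1r.
rewrite !mkseqS !rev_rcons !cat_cons !cat_rcons.
rewrite !(catA s2) !(catA (rev _)) multilinear_pair -!catA -cat_rcons IH cat_rcons exprS mulrA.
by [].
Qed.

Lemma multilinear_shear x (I : Type) (h : I -> V) (mu : I -> K) s :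
  f (x :: [seq h i + mu i *: x | i <- s]) = f (x :: [seq h i | i <- s]).
Proof.
suff H s1 : f (x :: s1 ++ [seq h i + mu i *: x | i <- s]) = f (x :: s1 ++ [seq h i | i <- s]).
  exact: (H [::]).
elim: s s1 => [//|i s IH] s1 /=; rewrite -cat_cons addrC mf cat_cons.
by rewrite (alternating_dup2 af [::]) mulr0 add0r -cat_rcons IH cat_rcons.
Qed.

End Multilinear.

(** * Chebyshev polynomials and Hankel determinants *)

Section Chebyshev.
Variables (A : comNzRingType) (X : A).

Fixpoint chebn (a b : A) n : A := if n is n'.+1 then chebn b (X * b - a) n' else a.

Definition cheb (a b : A) (n : int) : A :=
  match n with Posz n => chebn a b n | Negz n => chebn a (X * a - b) n.+1 end.

Definition chebyshev (u : int -> A) := forall n : int, u (n + 1) + u (n - 1) = X * u n.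

Lemma chebnSS a b n : chebn a b n.+2 = X * chebn a b n.+1 - chebn a b n.
Proof. by elim: n a b => [//|n IH] a b; rewrite [LHS]/= -[chebn _ _ _]/(chebn b (X * b - a) n.+2) IH. Qed.

Lemma cheb0 a b : cheb a b 0 = a. Proof. by []. Qed.
Lemma cheb1 a b : cheb a b 1 = b. Proof. by []. Qed.

Lemma chebyshev_cheb a b : chebyshev (cheb a b).
Proof.
have s n : chebn a b n.+2 + chebn a b n = X * chebn a b n.+1 by rewrite chebnSS; ring.
case=> [[|n]|[|n]].
- by rewrite /cheb /=; ring.
- by rewrite (_ : Posz n.+1 + 1 = Posz n.+2) 1?(_ : Posz n.+1 - 1 = Posz n); [exact: s|lia|lia].
- by rewrite /cheb /=; ring.
rewrite (_ : Negz n.+1 + 1 = Negz n) 1?(_ : Negz n.+1 - 1 = Negz n.+2); [|lia|lia].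
by have := chebnSS a (X * a - b) n.+1; rewrite /cheb => ->; ring.
Qed.

Lemma chebyshev_ext u v : chebyshev u -> chebyshev v -> u 0 = v 0 -> u 1 = v 1 -> forall n, u n = v n.
Proof.
move=> hu hv e0 e1.
have P n : u (Posz n) = v (Posz n) /\ u (Posz n + 1) = v (Posz n + 1).
  elim: n => [//|n [h1 h2]]; rewrite (_ : Posz n.+1 = Posz n + 1); last by lia.
  split=> //; have := hu (Posz n + 1); have := hv (Posz n + 1).
  by rewrite !addrK h1 h2 => <- /addIr.
have N n : u (- Posz n) = v (- Posz n) /\ u (- Posz n + 1) = v (- Posz n + 1).
  elim: n => [|n [h1 h2]]; first by rewrite oppr0 add0r.
  rewrite (_ : - Posz n.+1 = - Posz n - 1); last by lia.
  rewrite subrK; split=> //; have := hu (- Posz n); have := hv (- Posz n).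
  by rewrite h1 h2 => <- /addrI.
case=> n; first by case: (P n).
by rewrite NegzE; case: (N n.+1).
Qed.

Lemma chebyshev_comp u (f : int -> int) : chebyshev u ->
  (forall n, f (n + 1) = f n + 1 /\ f (n - 1) = f n - 1) \/
  (forall n, f (n + 1) = f n - 1 /\ f (n - 1) = f n + 1) -> chebyshev (fun n => u (f n)).
Proof.
move=> hu [h|h] n; have [-> ->] := h n; rewrite -?hu //.
by rewrite addrC hu.
Qed.

Lemma chebyshevD u v : chebyshev u -> chebyshev v -> chebyshev (fun n => u n + v n).
Proof. by move=> hu hv n; rewrite mulrDr -hu -hv; ring. Qed.

Lemma chebyshevB u v : chebyshev u -> chebyshev v -> chebyshev (fun n => u n - v n).
Proof. by move=> hu hv n; rewrite mulrBr -hu -hv; ring. Qed.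

Lemma chebyshevMl c u : chebyshev u -> chebyshev (fun n => c * u n).
Proof. by move=> hu n; rewrite mulrCA -hu mulrDr. Qed.

Lemma chebyshevMr c u : chebyshev u -> chebyshev (fun n => u n * c).
Proof. by move=> hu n; rewrite mulrA -hu mulrDl. Qed.

Lemma chebyshevNr u : chebyshev u -> chebyshev (fun n => - u n).
Proof. by move=> hu n; rewrite mulrN -hu; ring. Qed.

(** With [X = z + 1/z], [chebC] is [z^n + z^-n] and [chebU] is [(z^n - z^-n) / (z - z^-1)]. [chebP]
    and [chebM] are the sum and the difference of [z^(n+1/2)] and [z^-(n+1/2)], divided by their
    values at [n = 0]. *)
Definition chebC := cheb 2 X.
Definition chebU := cheb 0 1.
Definition chebP := cheb 1 (X - 1).
Definition chebM := cheb 1 (X + 1).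

Ltac chebsolve := repeat first
  [ exact: chebyshev_cheb | apply: chebyshevB | apply: chebyshevD | apply: chebyshevNr
  | apply: chebyshevMl | apply: chebyshevMr
  | (apply: chebyshev_comp; [|by first [left=> ?; split; lia | right=> ?; split; lia]]) ].
Ltac chebring := rewrite ?/chebC ?/chebU ?/chebP ?/chebM ?/cheb /=; ring.

(* Both sides satisfy the recursion in each index, so four values decide. *)
Lemma chebyshev_ext2 (F G : int -> int -> A) :
  (forall k, chebyshev (F^~ k)) -> (forall j, chebyshev (F j)) ->
  (forall k, chebyshev (G^~ k)) -> (forall j, chebyshev (G j)) ->
  F 0 0 = G 0 0 -> F 0 1 = G 0 1 -> F 1 0 = G 1 0 -> F 1 1 = G 1 1 -> forall j k, F j k = G j k.
Proof.
move=> F1 F2 G1 G2 e00 e01 e10 e11 j k.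
by apply: (chebyshev_ext (F1 k) (G1 k)); exact: chebyshev_ext.
Qed.

Lemma chebCN n : chebC (- n) = chebC n.
Proof. by apply: (@chebyshev_ext (fun n => chebC (- n)) chebC); try chebsolve; chebring. Qed.

Lemma chebUN n : chebU (- n) = - chebU n.
Proof. by apply: (@chebyshev_ext (fun n => chebU (- n)) (fun n => - chebU n)); try chebsolve; chebring. Qed.

Lemma chebU_CE n : chebU (n + 1) - chebU (n - 1) = chebC n.
Proof.
by apply: (@chebyshev_ext (fun n => chebU (n + 1) - chebU (n - 1)) chebC); try chebsolve; chebring.
Qed.

Lemma chebCC j k : chebC j * chebC k = chebC (j + k) + chebC (j - k).
Proof.
by apply: (@chebyshev_ext2 (fun j k => chebC j * chebC k) (fun j k => chebC (j + k) + chebC (j - k)));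
  move=> *; try chebsolve; chebring.
Qed.

Lemma chebCU j k : chebC j * chebU k = chebU (k + j) + chebU (k - j).
Proof.
by apply: (@chebyshev_ext2 (fun j k => chebC j * chebU k) (fun j k => chebU (k + j) + chebU (k - j)));
  move=> *; try chebsolve; chebring.
Qed.

Lemma chebUU j k : (4 - X ^+ 2) * (chebU j * chebU k) = chebC (j - k) - chebC (j + k).
Proof.
by apply: (@chebyshev_ext2 (fun j k => (4 - X ^+ 2) * (chebU j * chebU k))
  (fun j k => chebC (j - k) - chebC (j + k))); move=> *; try chebsolve; chebring.
Qed.

Lemma chebPP j k : (2 + X) * (chebP j * chebP k) = chebC (j - k) + chebC (j + k + 1).
Proof.
by apply: (@chebyshev_ext2 (fun j k => (2 + X) * (chebP j * chebP k))
  (fun j k => chebC (j - k) + chebC (j + k + 1))); move=> *; try chebsolve; chebring.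
Qed.

Lemma chebMM j k : (2 - X) * (chebM j * chebM k) = chebC (j - k) - chebC (j + k + 1).
Proof.
by apply: (@chebyshev_ext2 (fun j k => (2 - X) * (chebM j * chebM k))
  (fun j k => chebC (j - k) - chebC (j + k + 1))); move=> *; try chebsolve; chebring.
Qed.

Lemma chebPM j k : chebP j * chebM k = chebU (j + k + 1) - chebU (j - k).
Proof.
by apply: (@chebyshev_ext2 (fun j k => chebP j * chebM k)
  (fun j k => chebU (j + k + 1) - chebU (j - k))); move=> *; try chebsolve; chebring.
Qed.

End Chebyshev.

Section GramDeterminants.
Variable K : numFieldType.
Implicit Types (P Q : {poly K}).

Definition poly_linear (f : {poly K} -> K) := forall a P Q, f (a *: P + Q) = a * f P + f Q.

Lemma poly_linear_sum f (I : Type) (r : seq I) (S : pred I) (c : I -> K) (F : I -> {poly K}) :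
  poly_linear f -> f (\sum_(i <- r | S i) c i *: F i) = \sum_(i <- r | S i) c i * f (F i).
Proof.
move=> lf; have f0 : f 0 = 0.
  by have := lf (-1) 0 0; rewrite scaler0 addr0 mulN1r addNr.
by elim/big_rec2: _ => [//|i y P _ <-]; rewrite lf.
Qed.

Lemma poly_linear_coef f P n : poly_linear f -> (size P <= n)%N ->
  f P = \sum_(i < n) P`_i * f 'X^i.
Proof.
move=> lf sP; rewrite -(poly_linear_sum _ _ _ _ lf); congr (f _).
rewrite -poly_def; apply/polyP => i; rewrite coef_poly.
by case: ltnP => // ni; rewrite nth_default // (leq_trans sP).
Qed.

Definition monic_basis (p : nat -> {poly K}) := forall n, p n \is monic /\ size (p n) = n.+1.

Lemma monic_basisX : monic_basis (fun n => 'X^n).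
Proof. by move=> n; rewrite monicXn size_polyXn. Qed.

(* The change of basis is unitriangular. *)
Lemma gram_left n (p : nat -> {poly K}) (f : 'I_n -> {poly K} -> K) : monic_basis p ->
  (forall j, poly_linear (f j)) ->
  \det (\matrix_(i < n, j < n) f j (p i)) = \det (\matrix_(i < n, j < n) f j 'X^i).
Proof.
move=> bp lf; pose L := \matrix_(i < n, k < n) (p i)`_k.
have -> : \matrix_(i < n, j < n) f j (p i) = L *m \matrix_(i < n, j < n) f j 'X^i.
  apply/matrixP => i j; rewrite !mxE (@poly_linear_coef _ _ n) //; last first.
    by have [_ ->] := bp i.
  by apply: eq_bigr => k _; rewrite !mxE.
rewrite det_mulmx det_trig; last first.
  apply/is_trig_mxP => i j ij; rewrite mxE nth_default //.
  by have [_ ->] := bp i.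
rewrite big1 ?mul1r // => i _; rewrite mxE.
by have [/eqP] := bp i; rewrite /lead_coef => <- ->.
Qed.

Lemma gram n (p q : nat -> {poly K}) (B : {poly K} -> {poly K} -> K) : monic_basis p -> monic_basis q ->
  (forall Q, poly_linear (B^~ Q)) -> (forall P, poly_linear (B P)) ->
  \det (\matrix_(i < n, j < n) B (p i) (q j)) = \det (\matrix_(i < n, j < n) B 'X^i 'X^j).
Proof.
move=> bp bq l1 l2.
rewrite (@gram_left _ _ (fun j P => B P (q j)) bp) // -det_tr -[RHS]det_tr.
have e (g : nat -> {poly K}) : (\matrix_(i < n, j < n) B 'X^i (g j))^T =
    \matrix_(i < n, j < n) B 'X^j (g i) by apply/matrixP => i j; rewrite !mxE.
rewrite !e; exact: (@gram_left n q (fun j => B 'X^j) bq).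
Qed.

Lemma det_scale n (a b : 'I_n -> K) (M : 'M[K]_n) :
  \det (\matrix_(i, j) (a i * b j * M i j)) = (\prod_i a i) * (\prod_i b i) * \det M.
Proof.
have -> : \matrix_(i, j) (a i * b j * M i j) =
    diag_mx (\row_i a i) *m M *m diag_mx (\row_j b j).
  by apply/matrixP => i j; rewrite mul_mx_diag mul_diag_mx !mxE; ring.
rewrite !det_mulmx !det_diag mulrAC; congr (_ * _ * _); apply: eq_bigr => i _; exact: mxE.
Qed.

Lemma monic_basis_chebn (a b : {poly K}) d : a \is monic -> size a = d.+1 ->
  b \is monic -> size b = d.+2 ->
  forall n, chebn 'X a b n \is monic /\ size (chebn 'X a b n) = (d + n).+1.
Proof.
move=> ma sa mb sb n; elim: n a b d ma sa mb sb => [|n IH] a b d ma sa mb sb /=.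
  by rewrite addn0.
have sXb : size ('X * b) = d.+3 by rewrite mulrC size_mulX ?monic_neq0 // sb.
have lt : (size (- a) < size ('X * b)%R)%N by rewrite size_polyN sa sXb; lia.
rewrite addnS -addSn; apply: IH => //; last by rewrite size_polyDl.
by rewrite monicE lead_coefDl // mulrC lead_coefMX.
Qed.

(** [chebC] is [2] at index [0]; it is halved there to make the family monic. *)
Definition cosines n : {poly K} := if n is n'.+1 then chebC 'X n'.+1 else 1.

Lemma monic_basis_cosines : monic_basis cosines.
Proof.
case=> [|n]; first by rewrite monic1 size_poly1.
have -> : cosines n.+1 = chebn 'X 'X ('X * 'X - 2) n by [].
have s2 : size (- 2 : {poly K}) = 1%N by rewrite size_polyN -[2](rmorph_nat polyC) size_polyC pnatr_eq0.
have sXX : size ('X * 'X : {poly K}) = 3 by rewrite size_mulX ?polyX_eq0 // size_polyX.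
have lt : (size (- 2 : {poly K})%R < size ('X * 'X : {poly K})%R)%N by rewrite s2 sXX.
apply: (@monic_basis_chebn _ _ 1); rewrite ?monicX ?size_polyX ?size_polyDl //.
by rewrite monicE lead_coefDl // lead_coefMX lead_coefX.
Qed.

Lemma monic_basisU : monic_basis (fun n => chebU 'X n.+1).
Proof.
move=> n; have -> : chebU 'X n.+1 = chebn 'X (1 : {poly K}) ('X * 1 - 0) n by [].
by apply: (@monic_basis_chebn _ _ 0); rewrite ?mulr1 ?subr0 ?monic1 ?size_poly1 ?monicX ?size_polyX.
Qed.

Lemma monic_basis_shift (a : K) : forall n, chebn 'X 1 ('X - a%:P) n \is monic /\
  size (chebn 'X 1 ('X - a%:P) n) = n.+1.
Proof.
by apply: (@monic_basis_chebn _ _ 0); rewrite ?monic1 ?size_poly1 ?monicXsubC ?size_XsubC.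
Qed.

Lemma monic_basisP : monic_basis (fun n => chebP 'X n).
Proof. by move=> n; exact: (monic_basis_shift 1). Qed.

Lemma monic_basisM : monic_basis (fun n => chebM 'X n).
Proof.
move=> n; have := monic_basis_shift (-1) n; rewrite polyCN opprK.
by rewrite polyC1.
Qed.

(** In this basis evaluation at [a] is the first coordinate. *)
Definition vanishing (a : K) n : {poly K} := if n is n'.+1 then ('X - a%:P) * 'X^n' else 1.

Lemma monic_basis_vanishing a : monic_basis (vanishing a).
Proof.
case=> [|n]; first by rewrite monic1 size_poly1.
by rewrite /vanishing monicMl ?monicXn ?monicXsubC // size_monicM ?monicXsubC ?monic_neq0 ?monicXn //
   size_XsubC size_polyXn.
Qed.

End GramDeterminants.

Section Hankel.
Variables (K : numFieldType) (E : {poly K} -> K).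
Hypothesis lE : poly_linear E.
Implicit Types (w P Q : {poly K}).

Lemma poly_linear0 : E 0 = 0.
Proof. by have := lE (-1) 0 0; rewrite scaler0 addr0 mulN1r addNr. Qed.

Lemma poly_linearD P Q : E (P + Q) = E P + E Q.
Proof. by rewrite -[P]scale1r lE scale1r mul1r. Qed.

Lemma poly_linearZ a P : E (a *: P) = a * E P.
Proof. by rewrite -[a *: P]addr0 lE poly_linear0 addr0. Qed.

Lemma poly_linearN P : E (- P) = - E P.
Proof. by rewrite -scaleN1r poly_linearZ mulN1r. Qed.

Lemma poly_linearB P Q : E (P - Q) = E P - E Q.
Proof. by rewrite poly_linearD poly_linearN. Qed.

Definition hankel n w : K := \det (\matrix_(i < n, j < n) E (w * 'X^(i + j))).

Lemma hankel_gram n w (p q : nat -> {poly K}) : monic_basis p -> monic_basis q ->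
  \det (\matrix_(i < n, j < n) E (w * (p i * q j))) = hankel n w.
Proof.
move=> bp bq; rewrite (@gram _ n p q (fun P Q => E (w * (P * Q))) bp bq).
- by congr (\det _); apply/matrixP => i j; rewrite !mxE exprD.
- by move=> Q a P P'; rewrite mulrDl mulrDr -scalerAl -scalerAr lE.
by move=> P a Q Q'; rewrite mulrDr mulrDr -!scalerAr lE.
Qed.

Lemma hankelZ n a w : hankel n (a *: w) = a ^+ n * hankel n w.
Proof.
rewrite /hankel -detZ; congr (\det _); apply/matrixP => i j.
by rewrite !mxE -scalerAl poly_linearZ.
Qed.

Lemma hankelN n w : hankel n (- w) = (-1) ^+ n * hankel n w.
Proof. by rewrite -hankelZ scaleN1r. Qed.

Lemma hankel0 w : hankel 0 w = 1. Proof. exact: det_mx00. Qed.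

Variable c : int -> K.
Hypothesis cE : forall j, E (chebC 'X j) = 2 * c j.

Lemma moment_sym j : c (- j) = c j.
Proof. by apply: (@mulfI _ 2); rewrite ?pnatr_eq0 // -!cE chebCN. Qed.

Let half n (M : 'M[K]_n) w (p q : nat -> {poly K}) : monic_basis p -> monic_basis q ->
  (forall i j : 'I_n, E (w * (p i * q j)) = 2 * M i j) -> 2 ^+ n * \det M = hankel n w.
Proof.
move=> bp bq h; rewrite -(hankel_gram n w bp bq).
rewrite -detZ; congr (\det _); apply/matrixP => i j; rewrite !mxE; exact/esym/h.
Qed.

(** A product of sines is a difference of cosines, so the entries are Gram entries of [chebU] for
    the weight [4 - X^2], which is [4 sin^2]. The next identities change only the trigonometric
    family. *)
Lemma hankel_pp n : 2 ^+ n * \det (\matrix_(j < n, k < n) (c (j%:Z - k%:Z) - c (j%:Z + k%:Z + 2))) =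
  hankel n (4 - 'X ^+ 2).
Proof.
apply: half (@monic_basisU _) (@monic_basisU _) _ => i j.
rewrite mxE chebUU poly_linearB !cE mulrBr; congr (_ * c _ - _ * c _); lia.
Qed.

Lemma hankel_pm n : 2 ^+ n * \det (\matrix_(j < n, k < n) (c (j%:Z - k%:Z) - c (j%:Z + k%:Z + 1))) =
  hankel n (2 - 'X).
Proof.
apply: half (@monic_basisM _) (@monic_basisM _) _ => i j.
by rewrite mxE chebMM poly_linearB !cE mulrBr.
Qed.

Lemma hankel_mp n : 2 ^+ n * \det (\matrix_(j < n, k < n) (c (j%:Z - k%:Z) + c (j%:Z + k%:Z + 1))) =
  hankel n (2 + 'X).
Proof.
apply: half (@monic_basisP _) (@monic_basisP _) _ => i j.
by rewrite mxE chebPP poly_linearD !cE mulrDr.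
Qed.

(** The cosine of index [0] is [2] instead of the monic [1]; its row and its column give the factor
    [4]. *)
Lemma hankel_mm n : (0 < n)%N ->
  2 ^+ n * \det (\matrix_(j < n, k < n) (c (j%:Z - k%:Z) + c (j%:Z + k%:Z))) = 4 * hankel n 1.
Proof.
case: n => // n _; rewrite -(hankel_gram n.+1 1 (@monic_basis_cosines _) (@monic_basis_cosines _)).
pose w (i : 'I_n.+1) : K := if i == ord0 then 2 else 1.
have hw (i : 'I_n.+1) : chebC 'X i = w i *: @cosines K i.
  rewrite /w; case: eqP => [->|/eqP]; first by rewrite scaler_nat.
  by case: i => -[|i] // hi _; rewrite scale1r.
have pw : \prod_i w i = 2.
  by rewrite (bigD1 ord0) //= big1 ?mulr1 => [|i /negbTE i0]; rewrite /w ?eqxx ?i0.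
rewrite (_ : 4 = 2 * 2 :> K); last by ring.
rewrite -pw -det_scale -detZ pw; congr (\det _); apply/matrixP => i j; rewrite !mxE mul1r.
transitivity (E (chebC 'X i * chebC 'X j)); first by rewrite chebCC poly_linearD !cE; ring.
by rewrite !hw -scalerAl -scalerAr scalerA poly_linearZ.
Qed.

End Hankel.

Section Evaluation.
Variable K : numFieldType.

Lemma vanishing_horner (a : K) i : (vanishing a i).[a] = (i == 0%N)%:R.
Proof. by case: i => [|i]; rewrite /= !hornerE // subrr mul0r. Qed.

Lemma horner_chebn (a b : {poly K}) (x : K) n : (chebn 'X a b n).[x] = chebn x a.[x] b.[x] n.
Proof. by elim: n a b => [//|n IH] a b /=; rewrite IH !hornerE. Qed.

Lemma horner_cheb (a b : {poly K}) (x : K) n : (cheb 'X a b n).[x] = cheb x a.[x] b.[x] n.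
Proof. by case: n => n; rewrite /cheb horner_chebn ?hornerE. Qed.

Lemma cheb_powers (z a b d al be : K) n : z != 0 -> d * a = al + be -> d * b = al * z + be * z^-1 ->
  d * cheb (z + z^-1) a b n = al * z ^ n + be * z ^ (- n).
Proof.
move=> z0 e0 e1; move: n; apply: (chebyshev_ext (X := z + z^-1)).
- by apply: chebyshevMl; exact: chebyshev_cheb.
- move=> n; rewrite opprD opprB [1 - n]addrC !expfzDr // -!exprN1 /= expr1z.
  by rewrite (_ : z ^ (-1) = z^-1) //; field.
- by rewrite cheb0 oppr0 expr0z !mulr1.
- by rewrite cheb1 expr1z.
Qed.

Lemma horner_chebC (z : K) (n : int) : z != 0 -> (chebC 'X n).[z + z^-1] = z ^ n + z ^ (- n).
Proof.
move=> z0; rewrite /chebC horner_cheb hornerX -[in (2 : {poly K})](rmorph_nat polyC) hornerC -[LHS]mul1r.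
by rewrite (cheb_powers (al := 1) (be := 1)) ?mul1r.
Qed.

End Evaluation.

Arguments cheb : simpl never.

(** * Moment functionals and the evaluation of Pfaffians *)

Section Moments.
Variable K : numFieldType.
Implicit Types (mu : nat -> K) (P Q : {poly K}).

Definition expect mu P : K := \sum_(i < size P) P`_i * mu i.

Lemma expect_wide mu P n : (size P <= n)%N -> expect mu P = \sum_(i < n) P`_i * mu i.
Proof.
move=> sP; rewrite /expect (big_ord_widen n (fun i => P`_i * mu i)) // big_mkcond /=.
by apply: eq_bigr => i _; case: ltnP => // h; rewrite nth_default ?mul0r.
Qed.

Lemma poly_linear_expect mu : poly_linear (expect mu).
Proof.
move=> a P Q; pose n := maxn (size P) (size Q).
rewrite !(@expect_wide mu _ n) ?leq_maxl ?leq_maxr //; last first.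
  by rewrite (leq_trans (size_polyD _ _)) // geq_max leq_maxr (leq_trans (size_scale_leq _ _)) ?leq_maxl.
by rewrite mulr_sumr -big_split /=; apply: eq_bigr => i _; rewrite coefD coefZ; ring.
Qed.

Lemma expectX mu n : expect mu 'X^n = mu n.
Proof.
rewrite /expect size_polyXn big_ord_recr /= coefXn eqxx mul1r big1 ?add0r // => i _.
by rewrite coefXn ltn_eqF ?mul0r.
Qed.

Lemma expect_lin mu nu a P : expect (fun i => a * mu i + nu i) P = a * expect mu P + expect nu P.
Proof. by rewrite /expect mulr_sumr -big_split /=; apply: eq_bigr => i _; ring. Qed.

Definition bil (w : nat -> nat -> K) P Q : K := expect (fun i => expect (w i) Q) P.

Lemma bilXX w i j : bil w 'X^i 'X^j = w i j.
Proof. by rewrite /bil expectX expectX. Qed.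

Lemma bil_linl w Q : poly_linear ((bil w)^~ Q).
Proof. exact: poly_linear_expect. Qed.

Lemma bil_linr w P : poly_linear (bil w P).
Proof.
move=> a Q Q'; rewrite /bil -expect_lin; apply: eq_bigr => i _.
by rewrite poly_linear_expect.
Qed.

Lemma bilDl w P Q S : bil w (P + Q) S = bil w P S + bil w Q S.
Proof. exact: (poly_linearD (bil_linl w S)). Qed.

Lemma bilDr w P Q S : bil w S (P + Q) = bil w S P + bil w S Q.
Proof. exact: (poly_linearD (bil_linr w S)). Qed.

Lemma bilNr w P Q : bil w P (- Q) = - bil w P Q.
Proof. exact: (poly_linearN (bil_linr w P)). Qed.

Lemma bilZl w a P Q : bil w (a *: P) Q = a * bil w P Q.
Proof. exact: (poly_linearZ (bil_linl w Q)). Qed.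

Lemma bilZr w a P Q : bil w P (a *: Q) = a * bil w P Q.
Proof. exact: (poly_linearZ (bil_linr w P)). Qed.

Lemma det_reindex n (s : 'S_n) (M : 'M[K]_n) :
  \det (\matrix_(i, j) M (s i) (s j)) = \det M.
Proof.
have -> : \matrix_(i, j) M (s i) (s j) = row_perm s (col_perm s M).
  by apply/matrixP => i j; rewrite !mxE.
rewrite row_permE col_permE !det_mulmx !det_perm mulrCA mulrA odd_permV.
by rewrite -mulrA -signr_addb addbb mulr1.
Qed.

Lemma det_rev n (A : nat -> nat -> K) :
  \det (\matrix_(i < n, j < n) A (n - i.+1)%N (n - j.+1)%N) = \det (\matrix_(i < n, j < n) A i j).
Proof.
rewrite -[RHS](det_reindex (perm (@rev_ord_inj n))); congr (\det _).
by apply/matrixP => i j; rewrite !mxE !permE.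
Qed.

Lemma det_corner n (A : nat -> nat -> K) c :
  \det (\matrix_(i < n.+1, j < n.+1) (A i j - c *+ ((i == 0%N :> nat) && (j == 0%N :> nat)))) =
  \det (\matrix_(i < n.+1, j < n.+1) A i j) - c * \det (\matrix_(i < n, j < n) A i.+1 j.+1).
Proof.
rewrite !(expand_det_row _ ord0) (bigD1 ord0) //= [in RHS](bigD1 ord0) //=.
have cof j : cofactor (\matrix_(i < n.+1, j < n.+1)
      (A i j - c *+ ((i == 0%N :> nat) && (j == 0%N :> nat)))) ord0 j =
    cofactor (\matrix_(i < n.+1, j < n.+1) A i j) ord0 j.
  congr (_ * \det _); apply/matrixP => i k; rewrite !mxE /=.
  by rewrite subr0.
rewrite cof !mxE /= mulr1n mulrBl -!addrA; congr (_ + _); rewrite addrC; congr (_ + _).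
  by apply: eq_bigr => j j0; rewrite cof !mxE /= -val_eqE /= in j0 *; rewrite (negbTE j0) subr0.
congr (- (_ * _)); rewrite /cofactor addn0 expr0 mul1r; congr (\det _).
by apply/matrixP => i j; rewrite !mxE.
Qed.

End Moments.

Lemma pfn_map (K : comNzRingType) (T T' : Type) (h : T -> T') (W : T' -> T' -> K) n s :
  pfn W n (map h s) = pfn (fun x y => W (h x) (h y)) n s.
Proof.
have dmap x F u : dsum W (h x) F (map h u) = dsum (fun x y => W (h x) (h y)) x (fun v => F (map h v)) u.
  by elim: u F => [//|y u IH] F /=; rewrite IH.
elim: n s => [|n IH] [|x s] //=; rewrite dmap; exact: dsum_ext.
Qed.

Arguments pfn : simpl never.

Section Mkseq.
Variable T : Type.
Implicit Type h : nat -> T.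

Lemma eq_mkseq_in h h' n : (forall i, (i < n)%N -> h i = h' i) -> mkseq h n = mkseq h' n.
Proof. by move=> e; apply/eq_in_map => i; rewrite mem_iota => /andP[_ ?]; apply: e. Qed.

Lemma mkseq_add h m n : mkseq h (m + n) = mkseq h m ++ mkseq (fun i => h (m + i)%N) n.
Proof. by rewrite /mkseq iotaD map_cat add0n -[m in iota m n]addn0 iotaDl -map_comp. Qed.

Lemma mkseq_cons h n : mkseq h n.+1 = h 0%N :: mkseq (fun i => h i.+1) n.
Proof.
by rewrite -[n.+1]add1n mkseq_add /=; congr (_ :: _); apply: eq_mkseq => i; rewrite add1n.
Qed.

Lemma rev_mkseq h n : rev (mkseq h n) = mkseq (fun i => h (n - i.+1)%N) n.
Proof.
elim: n => [//|n IH]; rewrite mkseqS rev_rcons IH -[in RHS]add1n mkseq_add /= subn1.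
by congr (_ :: _); apply: eq_mkseq => i; rewrite subSS.
Qed.

End Mkseq.

Section Evaluation.
Variables (K : realFieldType) (E : {poly K} -> K).
Hypothesis lE : poly_linear E.
Variable al : K.
Local Notation phi := ((1 + al ^+ 2)%:P + al *: 'X).

Lemma skew_bil (w : nat -> nat -> K) : (forall i j, w i j = - w j i) -> skew_form (bil w).
Proof.
move=> aw; split=> [P Q|a u v Q]; last exact: bil_linl.
rewrite /bil /expect; under eq_bigr => i _ do rewrite mulr_sumr.
rewrite exchange_big -sumrN; apply: eq_bigr => j _; rewrite mulr_sumr -sumrN.
by apply: eq_bigr => i _; rewrite aw; ring.
Qed.

Lemma pfn_split (w : nat -> nat -> K) (P Q : nat -> {poly K}) n : 
  (forall i j, (i < n)%N -> (j < n)%N -> bil w (P i) (P j) = 0) ->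
  pfn (bil w) n (rev (mkseq P n) ++ mkseq Q n) = \det (\matrix_(i < n, j < n) bil w (P i) (Q j)).
Proof.
move=> iso; have := @pfn_iso _ _ (bil w) (rev (mkseq P n)) (rev (mkseq Q n)).
rewrite revK !size_rev !size_mkseq => -> //; last first.
  by move=> x y; rewrite !mem_rev => /mapP[i + ->] /mapP[j + ->]; rewrite !mem_iota; exact: iso.
rewrite (detl_det _ 0 0 (n := n)) ?size_rev ?size_mkseq //.
rewrite -[RHS](@det_rev _ n (fun i j => bil w (P i) (Q j))); congr (\det _); apply/matrixP => i j.
by have ii := ltn_ord i; have jj := ltn_ord j; rewrite !mxE !nth_rev ?size_mkseq // !nth_mkseq //; lia.
Qed.

Lemma chebn_two (a : K) n : chebn 2 a a n = a.
Proof. by elim: n => [//|n IH] /=; rewrite (_ : 2 * a - a = a) //; ring. Qed.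

Lemma chebn_mtwo (a : K) n : chebn (-2) a (- a) n = (-1) ^+ n * a.
Proof.
elim: n a => [a|n IH a] /=; first by rewrite mul1r.
by rewrite (_ : -2 * - a - a = - - a) ?IH; [rewrite exprS; ring|ring].
Qed.

Lemma chebM_mtwo n : (chebM 'X (Posz n)).[-2] = (-1) ^+ n :> K.
Proof.
rewrite /chebM /cheb horner_chebn !hornerE (_ : -2 + 1 = - 1 :> K); last by ring.
by rewrite chebn_mtwo mulr1.
Qed.

Lemma chebP_two n : (chebP 'X (Posz n)).[2] = 1 :> K.
Proof.
rewrite /chebP /cheb horner_chebn !hornerE (_ : 2 - 1 = 1 :> K); last by ring.
exact: chebn_two.
Qed.

Lemma pfn_mkseqX (w : nat -> nat -> K) n h m :
  pfn w n (mkseq h m) = pfn (bil w) n (mkseq (fun i => 'X^(h i)) m).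
Proof.
have -> : mkseq (fun i => 'X^(h i)) m = map (fun i => 'X^i : {poly K}) (mkseq h m).
  by rewrite /mkseq -map_comp.
rewrite [RHS]pfn_map; have -> // : (fun i j => bil w 'X^i 'X^j) = w.
by apply/funext => i; apply/funext => j; rewrite bilXX.
Qed.

Let half_cancel (a b : K) k : (- 2) ^+ k * a = (-1) ^+ k * b -> 2 ^+ k * a = b.
Proof.
rewrite -[- 2]mulN1r exprMn -mulrA => /(congr1 (fun x => (-1) ^+ k * x)).
by rewrite !mulrA -exprD addnn -mul2n exprM sqrrN !expr1n !mul1r.
Qed.

Lemma evaluated_linl f kap x y q : poly_linear (fun p => E (f * (p * q)) - kap * (p.[x] * q.[y])).
Proof.
move=> a p p'; rewrite [(_ + p') * _]mulrDl [f * (_ + _)]mulrDr -scalerAl -scalerAr lE hornerD hornerZ.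
ring.
Qed.

Lemma evaluated_linr f kap x y p : poly_linear (fun q => E (f * (p * q)) - kap * (p.[x] * q.[y])).
Proof.
move=> a q q'; rewrite [p * (_ + q')]mulrDr [f * (_ + _)]mulrDr -!scalerAr lE hornerD hornerZ.
ring.
Qed.

(** The kernel changes sign when both positions are reflected in the centre of [0 .. 2k - 1].
    Symmetrising about the centre leaves a [k] by [k] determinant, where
    [chebU (i + j + 1) - chebU (i - j)] is the product [chebP i * chebM j]. *)
Lemma pfn_even (w : nat -> nat -> K) k c : 4 * c = 1 - al ^+ 2 ->
  (forall i j, w i j = - w j i) ->
  (forall i j : nat, w i.+1 j.+1 = 2^-1 * E (phi * chebU 'X (i%:Z - j%:Z)) + c * ((-1) ^+ j - (-1) ^+ i)) ->
  2 ^+ k * pfn w k (mkseq (fun i => (2 * k - i.+1).+1) (2 * k)) =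
  hankel E k phi + (1 - al ^+ 2) * (if k is k'.+1 then hankel E k' (phi * (4 - 'X ^+ 2)) else 0).
Proof.
move=> hc aw hw; have sW := skew_bil aw.
have two : 2 != 0 :> K by rewrite pnatr_eq0.
pose e a : {poly K} := 'X^(a.+1).
have we i j : bil w (e i) (e j) = w i.+1 j.+1 by rewrite /e bilXX.
pose P i := e (k + i)%N + e (k - i.+1)%N; pose Q i := e (k + i)%N - e (k - i.+1)%N.
have Ue (a b : int) : a = - b -> E (phi * chebU 'X a) = - E (phi * chebU 'X b).
  by move=> ->; rewrite chebUN mulrN poly_linearN.
have sg i : (i < k)%N -> (-1) ^+ (k - i.+1) = - (-1) ^+ (k + i) :> K.
  move=> ik; rewrite -signr_odd -[in RHS]signr_odd; have -> : odd (k - i.+1) = ~~ odd (k + i) by lia.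
  by case: (odd _); rewrite ?expr1 ?expr0 ?opprK.
have flip i j : (i < k)%N -> (j < k)%N ->
    w (k - i.+1).+1 (k - j.+1).+1 = - w (k + i).+1 (k + j).+1 /\
    w (k - i.+1).+1 (k + j).+1 = - w (k + i).+1 (k - j.+1).+1.
  move=> ik jk; rewrite !hw !sg //; split.
    by rewrite (Ue _ ((k + i)%:Z - (k + j)%:Z)); [ring|lia].
  by rewrite (Ue _ ((k + i)%:Z - (k - j.+1)%:Z)); [ring|lia].
have [aW _] := sW.
have nested := multilinear_nested (@alternating_pfn _ _ _ k aW) (@multilinear_pfn _ _ _ k sW)
  (fun i => e (k + i)%N) (fun i => e (k - i.+1)%N) k [::] [::] [::].
rewrite !cats0 /= in nested.
rewrite pfn_mkseqX mul2n -addnn mkseq_add.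
have -> : mkseq (fun i => 'X^((k + k - i.+1).+1)) k ++ mkseq (fun i => 'X^((k + k - (k + i).+1).+1)) k =
    rev (mkseq (fun i => e (k + i)%N) k) ++ mkseq (fun i => e (k - i.+1)%N) k.
  by rewrite rev_mkseq; congr (_ ++ _); apply: eq_mkseq_in => i ik; congr 'X^(_.+1); lia.
apply: half_cancel; rewrite -nested pfn_split; last first.
  move=> i j ik jk; rewrite !(bilDl, bilDr) !we; have [-> ->] := flip i j ik jk; ring.
(* [chebP i] is [1] at [2] and [chebM j] is [(-1)^j] at [-2], so the alternating term is a rank one
   form in evaluations and follows changes of basis. *)
pose kap := (1 - al ^+ 2) * (-1) ^+ k.
pose B (p q : {poly K}) := E (phi * (p * q)) - kap * (p.[2] * q.[-2]).
have B1 q : poly_linear (B^~ q).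
  exact: evaluated_linl.
have B2 p : poly_linear (B p).
  exact: evaluated_linr.
have -> : \det (\matrix_(i < k, j < k) bil w (P i) (Q j)) =
    (-1) ^+ k * \det (\matrix_(i < k, j < k) B (chebP 'X i) (chebM 'X j)).
  rewrite -detZ; congr (\det _); apply/matrixP => i j; rewrite !mxE.
  rewrite !(bilDl, bilDr, bilNr) !we; have [-> ->] := flip i j (ltn_ord i) (ltn_ord j).
  rewrite !hw sg // /B chebP_two chebM_mtwo chebPM [phi * (_ - _)]mulrBr (poly_linearB lE).
  rewrite (_ : (k + i)%:Z - (k + j)%:Z = i%:Z - j%:Z); last by lia.
  rewrite (_ : (k + i)%:Z - (k - j.+1)%:Z = i%:Z + j%:Z + 1); last by have := ltn_ord j; lia.
  by rewrite /kap -hc exprD; field.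
congr (_ * _).
rewrite (gram k (@monic_basisP _) (@monic_basisM _) B1 B2).
(* In these bases the rank one form touches only the corner entry, and [(X - 2) * (X + 2)] comes out
   of the complementary minor. *)
rewrite -(gram k (monic_basis_vanishing 2) (monic_basis_vanishing (-2)) B1 B2).
case: k @kap @B B1 B2 {P Q flip nested sg} => [|k] kap B B1 B2.
  by rewrite hankel0 det_mx00 mulr0 addr0.
rewrite (_ : \matrix_(i, j) _ = \matrix_(i < k.+1, j < k.+1)
   (E (phi * (vanishing 2 i * vanishing (-2) j)) - kap *+ ((i == 0%N :> nat) && (j == 0%N :> nat)))).
  rewrite (@det_corner _ k (fun i j => E (phi * (vanishing 2 i * vanishing (-2) j)))).
  rewrite hankel_gram //; try exact: monic_basis_vanishing.
  congr (_ + _); rewrite /kap -mulNr -mulrN -mulrA; congr (_ * _).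
  rewrite (_ : \det _ = hankel E k (- (phi * (4 - 'X ^+ 2)))); last first.
    congr (\det _); apply/matrixP => i j; rewrite !mxE /=.
    by rewrite polyCN opprK !polyC_natr exprD; congr (E _); ring.
  by rewrite (hankelN lE) mulrA exprS mulN1r opprK -exprD addnn -mul2n exprM sqrrN !expr1n mul1r.
apply/matrixP => i j; rewrite !mxE /B !vanishing_horner.
by case: (_ == _); case: (_ == _); rewrite ?mulr0 ?mulr1 ?mulr0n ?mulr1n ?mul0r ?mulr0.
Qed.

Lemma cosines_two n : (cosines K n).[2] = if n == 0%N then 1 else 2.
Proof.
case: n => [|n]; first by rewrite hornerE.
rewrite -[cosines _ _]/(chebn 'X 2 'X n.+1) horner_chebn hornerX -[in (2 : {poly K})](rmorph_nat polyC) hornerC.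
exact: chebn_two.
Qed.

Lemma cosines_mtwo n : (cosines K n).[-2] = (-1) ^+ n * if n == 0%N then 1 else 2.
Proof.
case: n => [|n]; first by rewrite hornerE mulr1.
rewrite -[cosines _ _]/(chebn 'X 2 'X n.+1) horner_chebn hornerX -[in (2 : {poly K})](rmorph_nat polyC) hornerC.
exact: chebn_mtwo.
Qed.

Definition bordered_mx k w (u : {poly K} -> K) :=
  \matrix_(i < k.+1, j < k.+1) (if j == 0%N :> nat then u 'X^i else E (w * ('X^i * chebU 'X (Posz j)))).

(* The determinant of the functionals P |-> u P, P |-> E(w U_1 P), P |-> E(w U_2 P), ... *)
Definition bordered k w u : K := \det (bordered_mx k w u).

Lemma bordered_lin k w a u v : bordered k w (fun P => a * u P + v P) = a * bordered k w u + bordered k w v.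
Proof.
have cof f g i : cofactor (bordered_mx k w f) i ord0 = cofactor (bordered_mx k w g) i ord0.
  by congr (_ * \det _); apply/matrixP => i' j'; rewrite !mxE.
rewrite /bordered !(expand_det_col _ ord0) mulr_sumr -big_split /=.
apply: eq_bigr => i _; rewrite (cof _ u) (cof v u).
by rewrite [X in X * _ = _]mxE [X in _ = _ * (X * _) + _]mxE [X in _ = _ + X * _]mxE /= mulrDl mulrA.
Qed.

(** In the basis vanishing at [a] the border has a single nonzero entry. *)
Lemma bordered_horner k w a : bordered k w (horner^~ a) = hankel E k (w * ('X - a%:P)).
Proof.
rewrite /bordered -(@gram_left _ k.+1 _ (fun j P => if j == 0%N :> nat then P.[a] else
  E (w * (P * chebU 'X (Posz j)))) (monic_basis_vanishing a)); last first.
  move=> j; case: (_ == _) => c P Q; first by rewrite hornerD hornerZ.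
  by rewrite [(_ + Q) * _]mulrDl [w * (_ + _)]mulrDr -scalerAl -scalerAr lE.
rewrite (expand_det_col _ ord0) (bigD1 ord0) //= big1 ?addr0 => [|i]; last first.
  by rewrite -val_eqE /= => i0; rewrite !mxE /= vanishing_horner (negbTE i0) mul0r.
rewrite mxE /= !hornerE /cofactor /= ?addn0 ?expr0 ?mul1r.
rewrite -(hankel_gram lE _ _ (@monic_basisX _) (@monic_basisU _)); congr (\det _).
by apply/matrixP => i j; rewrite !mxE /= !mulrA.
Qed.

(** Multiples of the extra row clear the alternating term of the kernel. The centre position [k]
    then joins the sums, the extra row joins the differences, and its column combines evaluations at
    [2] and at [-2]. *)
Lemma pfn_odd (w : nat -> nat -> K) k A B : 4 * (A * B) = 1 - al ^+ 2 ->
  (forall i j, w i j = - w j i) ->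
  (forall i j : nat, w i.+1 j.+1 = 2^-1 * E (phi * chebU 'X (i%:Z - j%:Z)) + A * B * ((-1) ^+ j - (-1) ^+ i)) ->
  (forall j : nat, w 0%N j.+1 = A + B * (-1) ^+ j) ->
  2 ^+ k * pfn w k.+1 (0%N :: mkseq (fun i => (2 * k + 1 - i.+1).+1) (2 * k + 1)) =
  A * hankel E k (phi * (2 - 'X)) + B * hankel E k (phi * (2 + 'X)).
Proof.
move=> hc aw hw hw0; have sW := skew_bil aw; have [aW _] := sW.
have two : 2 != 0 :> K by rewrite pnatr_eq0.
(* With this [mu], the products with the border cancel [A * B * ((-1)^j - (-1)^i)] in [we]. *)
pose h a : {poly K} := 'X^(a.+1); pose mu a : K := B * (-1) ^+ a.
pose e a : {poly K} := h a + mu a *: 1.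
have w00 : w 0%N 0%N = 0 by have := aw 0%N 0%N; lra.
have b1 i : bil w 1 (e i) = A + B * (-1) ^+ i.
  by rewrite bilDr bilZr -[1]/('X^0) /h !bilXX hw0 w00 mulr0 addr0.
have we i j : bil w (e i) (e j) = 2^-1 * E (phi * chebU 'X (i%:Z - j%:Z)).
  have h1 a : bil w (h a) 1 = - (A + B * (-1) ^+ a) by rewrite -[1]/('X^0) /h bilXX aw hw0.
  by rewrite [e i]/e bilDl bilZl b1 [e j]/e bilDr bilZr h1 /h bilXX hw /mu; ring.
have Ue (a b : int) : a = - b -> E (phi * chebU 'X a) = - E (phi * chebU 'X b).
  by move=> ->; rewrite chebUN mulrN poly_linearN.
have -> : pfn w k.+1 (0%N :: mkseq (fun i => (2 * k + 1 - i.+1).+1) (2 * k + 1)) =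
    pfn (bil w) k.+1 (1 :: rev (mkseq (fun i => e (k + i.+1)%N) k) ++ [:: e k] ++
      mkseq (fun i => e (k - i.+1)%N) k).
  pose s := mkseq (fun i => 2 * k - i)%N (2 * k + 1).
  have es (g : nat -> {poly K}) : map g s = rev (mkseq (fun i => g (k + i.+1)%N) k) ++ [:: g k] ++
      mkseq (fun i => g (k - i.+1)%N) k.
    rewrite /s /mkseq -map_comp -/(mkseq _ _) (_ : 2 * k + 1 = k + (1 + k))%N; last by lia.
    rewrite mkseq_add mkseq_add rev_mkseq.
    congr (_ ++ _); first by apply: eq_mkseq_in => i ik /=; congr g; lia.
    congr (_ ++ _); first by congr [:: g _]; lia.
    by apply: eq_mkseq_in => i ik /=; congr g; lia.
  rewrite -es.
  rewrite (_ : map e s = [seq h i + mu i *: 1 | i <- s]) //.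
  rewrite (multilinear_shear (@alternating_pfn _ _ _ k.+1 aW) (@multilinear_pfn _ _ _ k.+1 sW)).
  have -> : 1 :: map h s = map (fun i => 'X^i) (0%N :: mkseq (fun i => (2 * k + 1 - i.+1).+1) (2 * k + 1)).
    rewrite /s /mkseq /= -!map_comp; congr (_ :: _).
    by apply/eq_map => i /=; rewrite /h; congr 'X^(_.+1); lia.
  rewrite [RHS]pfn_map; have -> // : (fun i j => bil w 'X^i 'X^j) = w.
  by apply/funext => i; apply/funext => j; rewrite bilXX.
clearbody e.
pose P i := if i is i'.+1 then e (k + i'.+1)%N + e (k - i'.+1)%N else e k.
pose Q i := if i is i'.+1 then e (k + i'.+1)%N - e (k - i'.+1)%N else 1.
have nested := multilinear_nested (@alternating_pfn _ _ _ k.+1 aW) (@multilinear_pfn _ _ _ k.+1 sW)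
  (fun i => e (k + i.+1)%N) (fun i => e (k - i.+1)%N) k [:: 1] [:: e k] [::].
rewrite !cats0 in nested; apply: half_cancel; rewrite -nested.
have := alternating_move (@alternating_pfn _ _ _ k.+1 aW) [::] 1
  (rev (mkseq (fun i => P i.+1) k) ++ [:: e k]) (mkseq (fun i => Q i.+1) k).
rewrite [([::] ++ _)%SEQ]/= -!catA /= => ->; rewrite size_cat size_rev size_mkseq addn1.
have -> : rev (mkseq (fun i => P i.+1) k) ++ [:: e k, 1 & mkseq (fun i => Q i.+1) k] =
    rev (mkseq P k.+1) ++ mkseq Q k.+1.
  by rewrite !mkseq_cons rev_cons -cats1 -catA.
rewrite pfn_split; last first.
  case=> [|i] [|j] ik jk; rewrite /P ?(bilDl, bilDr) !we.
  - by rewrite subrr /chebU cheb0 mulr0 poly_linear0 // mulr0.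
  - by rewrite (Ue (k%:Z - (k - j.+1)%:Z) (k%:Z - (k + j.+1)%:Z)); [ring|lia].
  - by rewrite (Ue ((k - i.+1)%:Z - k%:Z) ((k + i.+1)%:Z - k%:Z)); [ring|lia].
  rewrite (Ue ((k - i.+1)%:Z - (k - j.+1)%:Z) ((k + i.+1)%:Z - (k + j.+1)%:Z)); last by lia.
  by rewrite (Ue ((k - i.+1)%:Z - (k + j.+1)%:Z) ((k + i.+1)%:Z - (k - j.+1)%:Z)); [ring|lia].
(* At [2] and [-2] the cosines are [2] and [2 (-1)^n], halved at [n = 0]; these are the entries of
   the border after symmetrisation. *)
pose u p : K := A * p.[2] + B * (-1) ^+ k * p.[-2].
have -> : \det (\matrix_(i < k.+1, j < k.+1) bil w (P i) (Q j)) = (-1) ^+ k.+1 *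
    \det (\matrix_(i < k.+1, j < k.+1) (if j == 0%N :> nat then u (cosines K i) else
       E (phi * (cosines K i * chebU 'X (Posz j))))).
  rewrite -detZ; congr (\det _); apply/matrixP => -[i ik] [[|j] jk]; rewrite !mxE /=.
    rewrite aW /u cosines_two cosines_mtwo; case: i ik => [|i] ik /=; rewrite ?bilDr !b1; first by ring.
    rewrite exprD (_ : (-1) ^+ (k - i.+1) = (-1) ^+ k * (-1) ^+ i.+1); first by ring.
    by rewrite -exprD -signr_odd -[RHS]signr_odd; congr (_ ^+ nat_of_bool _); lia.
  have c0 : cosines K 0 = 1 by [].
  case: i ik => [|i] ik; rewrite /= ?(bilDl, bilDr, bilNr) !we.
    rewrite (Ue (k%:Z - (k + j.+1)%:Z) j.+1) ?mul1r; last by lia.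
    by rewrite (_ : k%:Z - (k - j.+1)%:Z = j.+1); [field|lia].
  rewrite chebCU mulrDr poly_linearD //.
  rewrite (_ : (k + i.+1)%:Z - (k + j.+1)%:Z = i%:Z - j%:Z); last by lia.
  rewrite (_ : (k + i.+1)%:Z - (k - j.+1)%:Z = j.+1 + i.+1 :> int); last by lia.
  rewrite (Ue ((k - i.+1)%:Z - (k + j.+1)%:Z) (j.+1 + i.+1)); last by lia.
  rewrite (Ue ((k - i.+1)%:Z - (k - j.+1)%:Z) (i%:Z - j%:Z)); last by lia.
  rewrite (Ue (Posz j.+1 - Posz i.+1) (i%:Z - j%:Z)); last by lia.
  by field.
rewrite mulrA -exprD addnn -mul2n exprM sqrrN !expr1n mul1r.
rewrite (@gram_left _ k.+1 _ (fun j p => if j == 0%N :> nat then u p else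
    E (phi * (p * chebU 'X (Posz j)))) (@monic_basis_cosines K)); last first.
  move=> j; case: (_ == _) => c p q; first by rewrite /u !hornerD !hornerZ; ring.
  by rewrite [(_ + q) * _]mulrDl [phi * (_ + _)]mulrDr -scalerAl -scalerAr lE.
rewrite -/(bordered_mx k phi u) -/(bordered k phi u) /u bordered_lin.
rewrite -[X in _ + bordered _ _ X](_ : (fun p => B * (-1) ^+ k * p.[-2] + 0 * p.[2]) = _); last first.
  by apply/funext => p; ring.
rewrite bordered_lin bordered_horner.
have -> : bordered k phi (fun p => 0 * p.[2]) = 0.
  have := bordered_lin k phi (-1) (fun p => 0 * p.[2]) (fun p => 0 * p.[2]).
  rewrite (_ : (fun p : {poly K} => _ + _) = (fun p => 0 * p.[2])); last by apply/funext => p; ring.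
  by move=> ->; rewrite mulN1r addNr.
rewrite bordered_horner addr0 polyCN opprK !polyC_natr.
rewrite (_ : phi * ('X - 2) = - (phi * (2 - 'X))) ?(hankelN lE); last by rewrite -mulrN opprB.
by rewrite ['X + _]addrC; ring.
Qed.

End Evaluation.

(** * Schur's Pfaffian and Toeplitz determinants *)

Section SchurPfaffian.
Variable K : realFieldType.

Lemma pfnS (T : Type) (W : T -> T -> K) n x s : pfn W n.+1 (x :: s) = dsum W x (pfn W n) s.
Proof. by []. Qed.

Lemma dsum_first (T1 T2 : Type) (W : T1 -> T2 -> K) x F y s :
  (forall i y0, (i < size s)%N -> W x (nth y0 s i) = 0) -> dsum W x F (y :: s) = W x y * F s.
Proof.
elim: s F y => [|z s IH] F y h; first by rewrite /= subr0.
rewrite [LHS]/= -[_ - dsum _ _ _ s]/(dsum W x (fun u => F (y :: u)) (z :: s)).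
rewrite IH => [|i y0 hi]; first by rewrite (h 0%N z) // mul0r subr0.
exact: (h i.+1).
Qed.

Lemma shear_second (V : lmodType K) (f : seq V -> K) (h : nat -> V) mu x y s :
  is_alternating f -> multilinear f ->
  f (x :: y :: map h s) = f (x :: y :: [seq h i + mu i *: x | i <- s]).
Proof.
move=> af mf; have := multilinear_shear af mf x (fun i => if i is Some j then h j else y)
  (fun i => if i is Some j then mu j else 0) (None :: map Some s).
by rewrite /= scale0r addr0 -!map_comp => <-.
Qed.

(** Pfaffian elimination: combined with [x] and [y], the other entries become orthogonal to both,
    and the kernel becomes its Schur complement. *)
Lemma pfn_schur (T : Type) (W : T -> T -> K) n x y s :
  (forall u v, W u v = - W v u) -> W x y != 0 ->
  pfn W n.+1 (x :: y :: s) =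
  W x y * pfn (fun u v => W u v - (W x u * W y v - W x v * W y u) / W x y) n s.
Proof.
move=> aW xy; pose h := nth x (x :: y :: s); pose w i j := W (h i) (h j).
have aw i j : w i j = - w j i by exact: aW.
have sw := skew_bil aw; have [abw _] := sw.
have af := @alternating_pfn _ _ _ n.+1 abw; have mf := @multilinear_pfn _ _ _ n.+1 sw.
pose X i : {poly K} := 'X^i; pose r := iota 2 (size s).
have e1 : x :: y :: s = map h (0%N :: 1%N :: r) by rewrite -[LHS](mkseq_nth x).
have e2 : s = map h r by case: e1.
have toX u : pfn W n.+1 (map h u) = pfn (bil w) n.+1 (map X u).
  rewrite [in LHS]pfn_map [RHS]pfn_map; congr (pfn _ _ _).
  by apply/funext => i; apply/funext => j; rewrite bilXX.
pose a i := w 1%N i / w 0%N 1%N; pose b i := - w 0%N i / w 0%N 1%N.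
pose e i := X i + a i *: X 0%N + b i *: X 1%N.
have w00 : w 0%N 0%N = 0 by have := aw 0%N 0%N; lra.
have w11 : w 1%N 1%N = 0 by have := aw 1%N 1%N; lra.
have xy' : w 0%N 1%N != 0 by [].
rewrite e1 toX /= (shear_second X a _ _ r af mf) (af [::]) (shear_second _ b _ _ r af mf) (af [::]) /= opprK.
rewrite pfnS dsum_first => [|i y0 hi]; last first.
  rewrite size_map in hi; rewrite (nth_map 0%N) //.
  by rewrite !bilDr !bilZr !bilXX w00 mulr0 addr0 /b -mulrA mulVf // mulr1 subrr.
rewrite bilXX -[w 0%N 1%N]/(W x y) e2 [in LHS]pfn_map [in RHS]pfn_map; congr (_ * pfn _ _ _).
apply/funext => i; apply/funext => j.
rewrite !(bilDl, bilDr, bilZl, bilZr) !bilXX w00 w11 (aw i 0%N) (aw i 1%N) (aw 1%N 0%N).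
rewrite -/(w i j) -[W x (h i)]/(w 0%N i) -[W x (h j)]/(w 0%N j) -[W y (h i)]/(w 1%N i).
by rewrite -[W y (h j)]/(w 1%N j) -[W x y]/(w 0%N 1%N) /a /b; field.
Qed.

Lemma sub_pairwise_in (T : eqType) (r r' : rel T) s :
  {in s &, forall u v, r u v -> r' u v} -> pairwise r s -> pairwise r' s.
Proof.
elim: s => [//|x s IH] h /= /andP[/allP hx hs]; rewrite IH ?andbT // => [|u v us vs].
  by apply/allP => y ys; rewrite h ?hx // inE ?eqxx ?ys ?orbT.
by apply: h; rewrite inE ?us ?vs orbT.
Qed.

Lemma pfn_eq (T : eqType) (W W' : T -> T -> K) n s :
  pairwise (fun u v => W u v == W' u v) s -> pfn W n s = pfn W' n s.
Proof.
elim: n s => [//|n IH] [//|x s] /= /andP[/allP hx hs].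
rewrite !pfnS; apply: dsum_eq => [y /hx /eqP //|u us _].
by apply: IH; exact: subseq_pairwise hs.
Qed.

Lemma pfn_scale (T : Type) (W : T -> T -> K) (g : T -> K) n s :
  pfn (fun u v => g u * g v * W u v) n s = (\prod_(u <- s) g u) * pfn W n s.
Proof.
have ds x c F F' u : (forall v, F' v = c * (\prod_(y <- v) g y) * F v) ->
    dsum (fun u v => g u * g v * W u v) x F' u = g x * c * (\prod_(y <- u) g y) * dsum W x F u.
  elim: u c F F' => [|y u IHu] c F F' h; rewrite /= ?mulr0 //.
  rewrite h (IHu (c * g y) (fun v => F (y :: v))) => [|v]; first by rewrite big_cons; ring.
  by rewrite h big_cons; ring.
elim: n s => [|n IH] [|x s]; rewrite ?big_nil ?mul1r ?mulr0 //.
rewrite !pfnS (ds x 1 (pfn W n)) ?big_cons ?mulr1 // => v.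
by rewrite IH mul1r.
Qed.

Fixpoint prodl (T : Type) (D : T -> T -> K) s : K :=
  if s is x :: s' then (\prod_(y <- s') D x y) * prodl D s' else 1.

Definition schur_kernel (x y : K) : K := (x - y) / (1 - x * y).

Lemma schur_kernelN x y : schur_kernel x y = - schur_kernel y x.
Proof. by rewrite /schur_kernel -opprB mulNr [y * x]mulrC. Qed.

(** For this kernel the Schur complement of [x] and [y] is the kernel itself, scaled by [g u * g v].
    When [x = y] the pivot vanishes, and so do both sides. *)
Lemma schur_pfaffian n s : size s = n.*2 -> pairwise (fun x y => x * y != 1) s ->
  pfn schur_kernel n s = prodl schur_kernel s.
Proof.
elim: n s => [|n IH] [|x [|y s]] //= [sz] /andP[/andP[xy /allP hx] /andP[/allP hy hs]].
rewrite big_cons; have [<-|nxy] := eqVneq x y.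
  rewrite (@alternating_dup _ _ _ (@alternating_pfn _ _ _ n.+1 schur_kernelN) [::] x s).
  by rewrite {1}/schur_kernel subrr !mul0r.
have d (u v : K) : u * v != 1 -> 1 - u * v != 0 by rewrite subr_eq0 eq_sym.
have kxy : schur_kernel x y != 0.
  by rewrite /schur_kernel mulf_neq0 ?invr_eq0 ?d // subr_eq0.
rewrite (pfn_schur _ _ schur_kernelN) //.
pose g u := schur_kernel x u * schur_kernel y u.
rewrite (@pfn_eq _ _ (fun u v => g u * g v * schur_kernel u v)).
  by rewrite pfn_scale IH // big_split /=; ring.
apply: sub_pairwise_in hs => u v us vs uv; apply/eqP; rewrite /g /schur_kernel.
have := d _ _ uv; have := d _ _ (hx u us); have := d _ _ (hx v vs).
have := d _ _ (hy u us); have := d _ _ (hy v vs); have := d _ _ xy.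
move=> d1 d2 d3 d4 d5 d6; have d7 : x - y != 0 by rewrite subr_eq0.
by field; rewrite d1 d2 d3 d4 d5 d6 d7.
Qed.

End SchurPfaffian.

Section NestedSums.
Variables (K : realFieldType) (T : Type) (I : finType) (g : T -> I -> K).
Implicit Types (F G : seq I -> K).

Fixpoint nsum (s : seq T) F : K :=
  if s is P :: s' then \sum_r g P r * nsum s' (fun v => F (r :: v)) else F [::].

Lemma nsum_lin s a F G : nsum s (fun v => a * F v - G v) = a * nsum s F - nsum s G.
Proof.
elim: s F G => [//|P s IH] F G /=; rewrite mulr_sumr -sumrB; apply: eq_bigr => r _.
by rewrite IH; ring.
Qed.

Variable A : I -> I -> K.

Definition mixed P Q : K := \sum_r \sum_q g P r * g Q q * A r q.

Lemma dsum_nsum P G s :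
  dsum mixed P (nsum^~ G) s = \sum_r g P r * nsum s (dsum A r G).
Proof.
elim: s G => [|Q s IH] G /=; first by rewrite big1 // => r _; rewrite mulr0.
rewrite (@dsum_bigsum _ _ _ mixed P _ _ (fun q u => g Q q * nsum u (fun v => G (q :: v)))).
under [X in _ - X]eq_bigr => q _ do rewrite dsumZ IH mulr_sumr.
rewrite [X in _ - X]exchange_big /= /mixed mulr_suml -sumrB; apply: eq_bigr => r _.
rewrite mulr_suml mulr_sumr -sumrB; apply: eq_bigr => q _; rewrite nsum_lin.
by ring.
Qed.

(** Multilinearity: the Pfaffian of an averaged kernel is the average of Pfaffians over independent
    choices of nodes. *)
Lemma pfn_nsum n s : pfn mixed n s = nsum s (pfn A n).
Proof.
elim: n s => [|n IH] [|P s] //.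
  by rewrite /= big1 // => r _; rewrite (_ : nsum s _ = 0) ?mulr0 //; elim: s => //= Q s IH;
    rewrite big1 // => q _; rewrite IH mulr0.
rewrite pfnS (@dsum_ext _ _ _ mixed P (pfn mixed n) (nsum^~ (pfn A n)) s IH) dsum_nsum.
by [].
Qed.

Lemma nsum_ffun l (h : nat -> T) F : nsum (mkseq h l) F =
  \sum_(rho : {ffun 'I_l -> I}) (\prod_(i < l) g (h i) (rho i)) * F [seq rho i | i <- enum 'I_l].
Proof.
elim: l h F => [|l IH] h F.
  rewrite (big_pred1 (ffun0 (card_ord 0))) => [|rho]; last by apply/esym/eqP/ffunP => -[].
  by rewrite big_ord0 mul1r (size0nil (size_enum_ord 0)).
pose glue (p : I * {ffun 'I_l -> I}) : {ffun 'I_l.+1 -> I} :=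
  [ffun i => if unlift ord0 i is Some j then p.2 j else p.1].
have glueb : bijective glue.
  exists (fun rho : {ffun 'I_l.+1 -> I} => (rho ord0, [ffun j => rho (lift ord0 j)])) => [[r rho]|rho].
    rewrite /glue !ffunE unlift_none; congr (_, _); apply/ffunP => j.
    by rewrite !ffunE liftK.
  by apply/ffunP => i; rewrite ffunE; case: unliftP => [j|] -> //=; rewrite ffunE.
rewrite (reindex glue); last exact: onW_bij.
rewrite mkseq_cons -(pair_bigA _ (fun r rho => \prod_(i < l.+1) g (h i) (glue (r, rho) i) *
   F [seq glue (r, rho) i | i <- enum 'I_l.+1])) /=.
apply: eq_bigr => r _; rewrite IH mulr_sumr; apply: eq_bigr => rho _.
rewrite big_ord_recl mulrA enum_ordSl /= -map_comp {1}/glue ffunE unlift_none /=.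
congr (_ * _ * F (_ :: _)).
- by apply: eq_bigr => i _; rewrite ffunE liftK.
by apply: eq_map => i /=; rewrite ffunE liftK.
Qed.

End NestedSums.

Section Andreief.
Variables (K : realFieldType) (I : finType) (l : nat).
Implicit Types (rho : {ffun 'I_l -> I}) (s : 'S_l).

Definition rearrange rho s : {ffun 'I_l -> I} := [ffun i => rho (s i)].

Lemma alternating_perm (f : seq I -> K) rho s : is_alternating f ->
  f [seq rearrange rho s i | i <- enum 'I_l] = (-1) ^+ s * f [seq rho i | i <- enum 'I_l].
Proof.
move=> af.
have split2 (e : seq 'I_l) x y : x != y -> x \in e -> y \in e -> exists e1 e2 e3,
    e = e1 ++ x :: e2 ++ y :: e3 \/ e = e1 ++ y :: e2 ++ x :: e3.
  move=> xy /splitPr[e1 e2]; rewrite mem_cat inE eq_sym (negbTE xy) /= => /orP[]/splitPr[a b].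
    by exists a, b, e2; right; rewrite -catA.
  by exists e1, a, b; left.
have tp1 (r : {ffun 'I_l -> I}) x y e1 e2 e3 : uniq (e1 ++ x :: e2 ++ y :: e3) ->
    f [seq rearrange r (tperm x y) i | i <- e1 ++ x :: e2 ++ y :: e3] =
    - f [seq r i | i <- e1 ++ x :: e2 ++ y :: e3].
  have pe : perm_eq (e1 ++ x :: e2 ++ y :: e3) (x :: y :: e1 ++ e2 ++ e3).
    by apply/seq.permP => p; rewrite !(count_cat, count_cat) /= !count_cat /=; lia.
  rewrite (perm_uniq pe) /= !inE !mem_cat !negb_or.
  case/and3P => /and4P[_ x1 x2 x3] /and3P[y1 y2 y3] _.
  have id_on (e' : seq 'I_l) : x \notin e' -> y \notin e' ->
      [seq rearrange r (tperm x y) i | i <- e'] = [seq r i | i <- e'].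
    move=> nx ny; apply/eq_in_map => i ie; rewrite ffunE tpermD //.
      by apply: contraNneq nx => ->.
    by apply: contraNneq ny => ->.
  have rx : rearrange r (tperm x y) x = r y by rewrite ffunE tpermL.
  have ry : rearrange r (tperm x y) y = r x by rewrite ffunE tpermR.
  rewrite !map_cat /= !map_cat /= rx ry !id_on //.
  exact: alternating_swap.
have tp (r : {ffun 'I_l -> I}) x y : x != y ->
    f [seq rearrange r (tperm x y) i | i <- enum 'I_l] = - f [seq r i | i <- enum 'I_l].
  move=> xy; have := enum_uniq 'I_l.
  have [e1 [e2 [e3 [->|->]]]] := split2 _ _ _ xy (mem_enum 'I_l x) (mem_enum 'I_l y); first exact: tp1.
  by rewrite tpermC; exact: tp1.
have [ts -> dts] := prod_tpermP s; elim: ts rho dts => [|[x y] ts IH] rho /=.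
  move=> _; rewrite big_nil odd_perm1 mul1r; congr f; apply: eq_map => i.
  by rewrite ffunE perm1.
case/andP => xy dts; rewrite big_cons odd_permM odd_tperm xy signr_addb expr1 mulN1r mulNr -IH //.
rewrite -(tp _ x y xy); congr f; apply: eq_map => i.
by rewrite !ffunE permM.
Qed.

(** Summing over the rearrangements of [rho] with their signs turns the product into a
    determinant. *)
Lemma andreief_left (g : 'I_l -> I -> K) (F : {ffun 'I_l -> I} -> K) :
  (forall rho s, F (rearrange rho s) = (-1) ^+ s * F rho) ->
  l`!%:R * (\sum_(rho : {ffun 'I_l -> I}) (\prod_i g i (rho i)) * F rho) =
  \sum_(rho : {ffun 'I_l -> I}) \det (\matrix_(i, j) g i (rho j)) * F rho.
Proof.
move=> aF.
have -> : \sum_(rho : {ffun 'I_l -> I}) \det (\matrix_(i, j) g i (rho j)) * F rho =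
    \sum_(s : 'S_l) \sum_(rho : {ffun 'I_l -> I}) (-1) ^+ s * (\prod_i g i (rho (s i))) * F rho.
  rewrite exchange_big /=; apply: eq_bigr => rho _; rewrite mulr_suml; apply: eq_bigr => s _.
  by congr (_ * _ * _); apply: eq_bigr => i _; rewrite mxE.
rewrite [RHS](eq_bigr (fun=> \sum_(rho : {ffun 'I_l -> I}) (\prod_i g i (rho i)) * F rho)) => [|s _].
  by rewrite sumr_const card_Sn mulr_natl.
rewrite [RHS](reindex (rearrange^~ s)) /=; last first.
  by exists (rearrange^~ (s^-1)%g) => rho _; apply/ffunP => i; rewrite !ffunE ?permKV ?permK.
apply: eq_bigr => rho _; rewrite aF [in RHS](eq_bigr (fun i => g i (rho (s i)))) => [|i _].
  by rewrite [RHS]mulrCA mulrA.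
by rewrite ffunE.
Qed.

Lemma andreief (m : I -> K) (a b : 'I_l -> I -> K) :
  \sum_(rho : {ffun 'I_l -> I}) (\prod_i m (rho i)) *
    (\det (\matrix_(i, j) a i (rho j)) * \det (\matrix_(i, j) b i (rho j))) =
  l`!%:R * \det (\matrix_(i < l, j < l) \sum_r m r * a i r * b j r).
Proof.
pose F (rho : {ffun 'I_l -> I}) := (\prod_i m (rho i)) * \det (\matrix_(i, j) b i (rho j)).
have aF rho s : F (rearrange rho s) = (-1) ^+ s * F rho.
  rewrite /F [X in X * _ = _](_ : _ = \prod_i m (rho i)); last first.
    by rewrite [RHS](reindex_inj (@perm_inj _ s)) /=; apply: eq_bigr => i _; rewrite ffunE.
  rewrite mulrCA; congr (_ * _).
  rewrite (_ : \matrix_(i, j) _ = col_perm s (\matrix_(i, j) b i (rho j))).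
    by rewrite col_permE det_mulmx det_perm odd_permV mulrC.
  by apply/matrixP => i j; rewrite !mxE ffunE.
have := andreief_left a aF; rewrite /F.
under [X in _ = X -> _]eq_bigr => rho _ do rewrite mulrCA.
move=> <-; congr (_ * _).
have -> : \det (\matrix_(i < l, j < l) \sum_r m r * a i r * b j r) =
    \sum_(s : 'S_l) (-1) ^+ s * \sum_(rho : {ffun 'I_l -> I}) \prod_i (m (rho i) * a i (rho i) * b (s i) (rho i)).
  apply: eq_bigr => s _; congr (_ * _).
  transitivity (\prod_i \sum_r (m r * a i r * b (s i) r)).
    by apply: eq_bigr => i _; rewrite mxE.
  exact: bigA_distr_bigA.
under [RHS]eq_bigr => s _ do rewrite mulr_sumr.
rewrite exchange_big /=; apply: eq_bigr => rho _; rewrite -det_tr /determinant !mulr_sumr.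
apply: eq_bigr => s _.
have swap (x y z w : K) : x * (y * (w * z)) = w * (y * x * z) by ring.
have -> : \prod_i (\matrix_(i, j) b i (rho j))^T i (s i) = \prod_i b (s i) (rho i).
  by apply: eq_bigr => i _; rewrite !mxE.
rewrite !big_split /=.
exact: swap.
Qed.

End Andreief.

Section Vandermonde.
Variable K : realFieldType.

Lemma prodl_mkseq (T : Type) (D : T -> T -> K) (y : nat -> T) n :
  prodl D (mkseq y n) = \prod_(i < n) \prod_(j < n | (i < j)%N) D (y i) (y j).
Proof.
transitivity (\prod_(0 <= i < n) \prod_(i.+1 <= j < n) D (y i) (y j)).
  elim: n y => [|n IH] y; first by rewrite big_nil.
  rewrite mkseq_cons [LHS]/= IH big_nat_recl //; congr (_ * _).
    by rewrite big_map big_add1 /= /index_iota subn0.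
  by apply: eq_bigr => i _; rewrite [RHS]big_add1.
by rewrite big_mkord; apply: eq_bigr => i _; rewrite big_geq_mkord.
Qed.

Lemma vandermonde_rev n (y : nat -> K) :
  \det (\matrix_(i < n, j < n) y j ^+ (n - i.+1)) = prodl (fun a b => a - b) (mkseq y n).
Proof.
rewrite prodl_mkseq -[LHS](@det_rev _ n (fun i j => y j ^+ (n - i.+1))).
rewrite (_ : \matrix_(i, j) _ = Vandermonde n (\row_(j < n) y (n - j.+1)%N)); last first.
  apply/matrixP => i j; rewrite !mxE; congr (_ ^+ _); have := ltn_ord i; lia.
rewrite det_Vandermonde (reindex_inj rev_ord_inj) /=.
under eq_bigr => i _ do rewrite (reindex_inj rev_ord_inj) big_mkcond /=.
rewrite exchange_big /=; apply: eq_bigr => i _; rewrite [RHS]big_mkcond /=.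
apply: eq_bigr => j _; have := ltn_ord i; have := ltn_ord j => hj hi.
rewrite (_ : (n - j.+1 < n - i.+1)%N = (i < j)%N); last by lia.
by case: ifP => // _; rewrite !mxE /=; congr (y _ - y _); lia.
Qed.

(* Since K(x,y) (X - Y) = (x - y)(1/x - 1/y) with X = x + 1/x, Y = y + 1/y, the
   product of kernels turns one Vandermonde determinant into two. *)
Lemma schur_to_toeplitz (I : finType) (x m : I -> K) (P : nat -> {poly K}) l (F : seq I -> K) :
  monic_basis P -> is_alternating F ->
  (forall r, x r != 0) -> (forall r q, x r * x q != 1) ->
  (forall v, size v = l -> F v = prodl (@schur_kernel K) (map x v)) ->
  nsum (fun i r => m r * (P (l - i.+1)%N).[x r + (x r)^-1]) (mkseq id l) F =
  \det (\matrix_(i < l, j < l) \sum_r m r * x r ^+ (l - i.+1) * (x r)^-1 ^+ (l - j.+1)).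
Proof.
move=> bP aF x0 x1 hF; rewrite nsum_ffun.
apply: (@mulfI _ l`!%:R); first by rewrite pnatr_eq0 -lt0n fact_gt0.
rewrite -(andreief m (fun i r => x r ^+ (l - i.+1)) (fun j r => (x r)^-1 ^+ (l - j.+1))).
rewrite (andreief_left (fun i r => m r * (P (l - i.+1)%N).[x r + (x r)^-1])
  (F := fun rho => F [seq rho i | i <- enum 'I_l])); last by move=> rho s; exact: alternating_perm.
apply: eq_bigr => rho _; rewrite hF; last by rewrite size_map size_enum_ord.
case: l aF hF rho => [|l] aF hF rho.
  by rewrite !det_mx00 big_ord0 (size0nil (size_enum_ord 0)) !mulr1.
pose X r := x r + (x r)^-1; pose y k := x (rho (inord k)).
have yE (j : 'I_l.+1) : x (rho j) = y j by rewrite /y inord_val.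
have -> : map x [seq rho i | i <- enum 'I_l.+1] = mkseq y l.+1.
  rewrite /mkseq -val_enum_ord -!map_comp; apply: eq_map => j; exact: yE.
have -> : \det (\matrix_(i, j) (m (rho j) * (P (l.+1 - i.+1)%N).[X (rho j)])) =
    (\prod_i m (rho i)) * prodl (fun a b => a - b) (mkseq (fun k => y k + (y k)^-1) l.+1).
  rewrite (_ : \matrix_(i, j) _ = \matrix_(i, j) (1 * m (rho j) *
     (\matrix_(i, j) (P (l.+1 - i.+1)%N).[X (rho j)]) i j)); last first.
    by apply/matrixP => i j; rewrite !mxE mul1r.
  rewrite det_scale big1_eq mul1r -vandermonde_rev; congr (_ * _).
  have flip (Q : nat -> {poly K}) : \det (\matrix_(i < l.+1, j < l.+1) (Q (l.+1 - i.+1)%N).[X (rho j)]) =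
      \det (\matrix_(i < l.+1, j < l.+1) (Q i).[y (l.+1 - j.+1)%N + (y (l.+1 - j.+1)%N)^-1]).
    rewrite -[RHS](@det_rev _ l.+1 (fun i j => (Q i).[y (l.+1 - j.+1)%N + (y (l.+1 - j.+1)%N)^-1])).
    congr (\det _); apply/matrixP => i j; rewrite !mxE /X !yE; congr (_.[y _ + (y _)^-1]); have := ltn_ord j; lia.
  rewrite flip (@gram_left _ l.+1 P (fun j Q => Q.[y (l.+1 - j.+1)%N + (y (l.+1 - j.+1)%N)^-1]) bP); last first.
    by move=> j a Q Q'; rewrite hornerD hornerZ.
  rewrite -(flip (fun i => 'X^i)); congr (\det _); apply/matrixP => i j; rewrite !mxE.
  by rewrite hornerXn /X yE.
have -> : \det (\matrix_(i, j) x (rho j) ^+ (l.+1 - i.+1)) = prodl (fun a b => a - b) (mkseq y l.+1).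
  by rewrite -vandermonde_rev; congr (\det _); apply/matrixP => i j; rewrite !mxE yE.
have -> : \det (\matrix_(i, j) (x (rho j))^-1 ^+ (l.+1 - i.+1)) =
    prodl (fun a b => a - b) (mkseq (fun k => (y k)^-1) l.+1).
  by rewrite -vandermonde_rev; congr (\det _); apply/matrixP => i j; rewrite !mxE yE.
rewrite -mulrA; congr (_ * _); rewrite !prodl_mkseq -!big_split /=; apply: eq_bigr => i _.
rewrite -!big_split /=; apply: eq_bigr => j _; rewrite /schur_kernel.
have hi : y i != 0 by exact: x0.
have hj : y j != 0 by exact: x0.
have hij : 1 - y i * y j != 0 by rewrite subr_eq0 eq_sym; exact: x1.
by field; rewrite hi hj hij.
Qed.

End Vandermonde.

(** * Displacement equation and finite quadrature *)

Section Displacement.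
Variables (K : realFieldType) (theta : nat -> nat -> K).
Hypothesis thetaC : forall i j, theta i j = theta j i.

(* The antisymmetric solution of om(i+1,j) - om(i,j+1) = theta(i,j). *)
Definition antidiagonal i j : K := \sum_(0 <= n < i) theta (i.-1 - n)%N (j + n)%N.
Definition undisplace i j : K := 2^-1 * (antidiagonal i j - antidiagonal j i).

Lemma undisplaceN i j : undisplace i j = - undisplace j i.
Proof. by rewrite /undisplace; ring. Qed.

Lemma antidiagonalE i j : antidiagonal i.+1 j = theta i j + antidiagonal i j.+1.
Proof.
rewrite /antidiagonal big_nat_recl //= subn0 addn0; congr (_ + _); apply: eq_big_nat => n hn.
by congr (theta _ _); lia.
Qed.

Lemma undisplaceE i j : undisplace i.+1 j - undisplace i j.+1 = theta i j.
Proof. by rewrite /undisplace !antidiagonalE (thetaC j); field. Qed.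

Lemma undisplace_uniq (om : nat -> nat -> K) D : (forall i j, om i j = - om j i) ->
  (forall i j, (i + j < D)%N -> om i.+1 j - om i j.+1 = theta i j) ->
  forall i j, (i + j <= D)%N -> om i j = undisplace i j.
Proof.
move=> oN oE i j ij; pose d i j := om i j - undisplace i j.
have dN a b : d a b = - d b a by rewrite /d oN undisplaceN; ring.
have dE a b : (a + b <= D)%N -> d a b = d 0%N (a + b)%N.
  elim: a b => [//|a IH] b ab; rewrite addSnnS -IH; last by lia.
  have h := oE a b; have := undisplaceE a b; rewrite -h ?/d; last by lia.
  by move=> e; lra.
have e1 := dE i j ij; have e2 := dE j i; rewrite [(j + i)%N]addnC in e2.
by have := dN i j; rewrite e1 e2 // => e3; apply/eqP; rewrite -subr_eq0 -/(d i j) e1; apply/eqP; lra.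
Qed.

End Displacement.

Section Discretisation.
Variables (K : realFieldType) (E : {poly K} -> K) (c : int -> K).
Hypothesis lE : poly_linear E.
Hypothesis cE : forall j, E (chebC 'X j) = 2 * c j.

(** A Vandermonde system; the masses may be negative. Nodes inside the unit interval keep
    [1 - x * y] and [1 - x] away from zero. *)
Lemma quadrature M : exists N, exists x m : 'I_N -> K, (forall r, 0 < x r < 1) /\
  forall k : int, `|k| <= M%:Z -> \sum_r m r * x r ^ k = c k.
Proof.
pose N := (2 * M).+1; pose x (r : 'I_N) : K := (r.+2%:R)^-1.
have x0 r : x r != 0 by rewrite invr_eq0 pnatr_eq0.
pose V := Vandermonde N (\row_j x j).
have Vu : V \in unitmx.
  rewrite unitmxE unitfE det_Vandermonde; apply/prodf_neq0 => i _; apply/prodf_neq0 => j ij.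
  rewrite !mxE subr_eq0 /x; apply/eqP => /invr_inj/eqP; rewrite eqr_nat; lia.
pose m' := invmx V *m \col_i c (i%:Z - M%:Z).
(* The factor [x^M] shifts the exponents [-M .. M] to the range [0 .. 2 M] of the system. *)
exists N, x, (fun r => m' r ord0 * x r ^+ M); split=> [r|k kM].
  by rewrite invr_gt0 ltr0n invf_lt1 ?ltr0n ?ltr1n.
pose a := absz (k + M%:Z); have ha : k = a%:Z - M%:Z by rewrite /a; lia.
have aN : (a < N)%N by rewrite /N /a; lia.
have := mulKVmx Vu (\col_i c (i%:Z - M%:Z)) => /matrixP/(_ (Ordinal aN) ord0).
rewrite -/m' !mxE /= => h; rewrite ha -h; apply: eq_bigr => r _.
rewrite !mxE -mulrA mulrC; congr (_ * _).
by rewrite -[x r ^+ M]/(x r ^ M%:Z) -expfzDr // addrCA subrr addr0.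
Qed.

Lemma poly_linear_cosines (f g : {poly K} -> K) d : poly_linear f -> poly_linear g ->
  (forall n, (n <= d)%N -> f (cosines K n) = g (cosines K n)) ->
  forall P : {poly K}, (size P <= d.+1)%N -> f P = g P.
Proof.
move=> lf lg; elim: d => [|d IH] h P sP.
  rewrite (size1_polyC sP) -alg_polyC (poly_linearZ lf) (poly_linearZ lg).
  by rewrite -[1]/(cosines K 0) h.
have [mc sc] := @monic_basis_cosines K d.+1.
pose Q := P - P`_d.+1 *: cosines K d.+1.
have sQ : (size Q <= d.+1)%N.
  apply/leq_sizeP => j dj; rewrite /Q coefB coefZ.
  case: (ltngtP j d.+1) dj => // [hj|->] _.
    have -> : P`_j = 0 by apply: nth_default; exact: leq_trans sP hj.
    have -> : (cosines K d.+1)`_j = 0 by apply: nth_default; rewrite sc.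
    by rewrite mulr0 subr0.
  by move/eqP: mc; rewrite /lead_coef sc => ->; rewrite mulr1 subrr.
have -> : P = P`_d.+1 *: cosines K d.+1 + Q by rewrite /Q addrCA subrr addr0.
by rewrite lf lg h // (IH _ Q sQ) // => n nd; apply: h; exact: leqW.
Qed.

Variables (N : nat) (x m : 'I_N -> K) (M : nat).
Hypothesis x01 : forall r, 0 < x r < 1.
Hypothesis mE : forall k : int, `|k| <= M%:Z -> \sum_r m r * x r ^ k = c k.

Let x0 r : x r != 0. Proof. by have /andP[/lt0r_neq0] := x01 r. Qed.

Let X r := x r + (x r)^-1.

Lemma quadratureE (P : {poly K}) (k : int) d : (size P <= d.+1)%N -> d%:Z + `|k| <= M%:Z ->
  \sum_r m r * P.[X r] * x r ^ k = 2^-1 * E (P * chebC 'X k).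
Proof.
move=> sP dk; have two : 2 != 0 :> K by rewrite pnatr_eq0.
apply: (@poly_linear_cosines (fun P => \sum_r m r * P.[X r] * x r ^ k)
  (fun P => 2^-1 * E (P * chebC 'X k)) d) => //.
- move=> a Q Q'; rewrite mulr_sumr -big_split /=; apply: eq_bigr => r _.
  by rewrite hornerD hornerZ; ring.
- by move=> a Q Q'; rewrite mulrDl -scalerAl lE; ring.
move=> [|n] nd.
  rewrite mul1r cE mulrA mulVf // mul1r -mE; last by lia.
  by apply: eq_bigr => r _; rewrite hornerE mulr1.
rewrite -[cosines K n.+1]/(chebC 'X n.+1) chebCC (poly_linearD lE) !cE.
rewrite -mulrDr mulrA mulVf // mul1r -[c (n.+1%:Z - k)](moment_sym cE) opprB -!mE; try lia.
rewrite -big_split /=; apply: eq_bigr => r _; rewrite horner_chebC // !expfzDr //; ring.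
Qed.

End Discretisation.

Section Pairing.
Variables (K : realFieldType) (E : {poly K} -> K) (al : K).

(** On the nodes of a quadrature this is the sum of [m * (1 + al * x) * P.[X] * x^k]. *)
Definition charge_form (k : int) (P : {poly K}) : K := 2^-1 * E (P * (chebC 'X k + al *: chebC 'X (k + 1))).

(** On nodes, [schur_kernel x y * (X - Y)] is [2 - x / y - y / x]; averaged against monomials it
    gives this expression, in which no denominator [1 - x * y] is left. *)
Definition theta i j : K := 2 * charge_form 0 'X^i * charge_form 0 'X^j -
  charge_form 1 'X^i * charge_form (-1) 'X^j - charge_form (-1) 'X^i * charge_form 1 'X^j.

Lemma thetaC i j : theta i j = theta j i.
Proof. by rewrite /theta; ring. Qed.

(* Index [0] is the extra row of an odd Pfaffian, [a.+1] the position [a]. *)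
Definition weightU (i j : nat) : K :=
  match i, j with
  | 0%N, 0%N => 0
  | 0%N, b.+1 => charge_form 0 (chebU 'X (Posz b))
  | a.+1, 0%N => - charge_form 0 (chebU 'X (Posz a))
  | a.+1, b.+1 => bil (undisplace theta) (chebU 'X (Posz a)) (chebU 'X (Posz b))
  end.

Lemma weightUN i j : weightU i j = - weightU j i.
Proof.
case: i j => [|i] [|j] /=; rewrite ?oppr0 ?opprK //.
by have [h _] := skew_bil (undisplaceN theta); exact: h.
Qed.

Hypothesis lE : poly_linear E.
Variable c : int -> K.
Hypothesis cE : forall j, E (chebC 'X j) = 2 * c j.

Lemma poly_linear_charge k : poly_linear (charge_form k).
Proof. by move=> a P Q; rewrite /charge_form mulrDl -scalerAl lE; ring. Qed.

Lemma size_chebU n : (size (chebU 'X (Posz n) : {poly K}) <= n)%N.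
Proof.
case: n => [|n]; first by rewrite /chebU /cheb size_poly0.
by have [_ ->] := @monic_basisU K n.
Qed.

Lemma nsum_map (T T' : Type) (I : finType) (g : T' -> I -> K) (h : T -> T') s F :
  nsum g (map h s) F = nsum (fun t => g (h t)) s F.
Proof. by elim: s F => [//|t s IH] F /=; apply: eq_bigr => r _; rewrite IH. Qed.

Lemma nsum_some (T : Type) (I : finType) (g : T -> option I -> K) s F : (forall t, g t None = 0) ->
  nsum g s F = nsum (fun t r => g t (Some r)) s (fun v => F (map Some v)).
Proof.
move=> g0; elim: s F => [//|t s IH] F /=.
rewrite (bigD1 None) //= g0 mul0r add0r (reindex_omap Some id) /=; last by case.
by apply: eq_big => [r|r _]; rewrite ?eqxx // IH.
Qed.

(** On nodes with enough exact moments, [weightU] is the average of Schur's kernel against [chebU]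
    ([mixedE]), so the Pfaffian is an average of Schur products, which [schur_to_toeplitz]
    evaluates. *)
Lemma pfn_weightU (e : bool) n l : (e + l)%N = n.*2 ->
  pfn weightU n (nseq e 0%N ++ mkseq (fun i => (l - i.+1).+2) l) =
  \det (\matrix_(i < l, j < l) (c (i%:Z - j%:Z) + al * c (i%:Z - j%:Z + 1))).
Proof.
move=> el; set d := (2 * l)%N; pose M := (2 * l + 2)%N.
have [N [x [m [x01 mE]]]] := @quadrature K c M.
have x0 r : x r != 0 by have /andP[/lt0r_neq0] := x01 r.
pose X r := x r + (x r)^-1; pose mu r := m r * (1 + al * x r).
have chargeE (k : int) (P : {poly K}) : (size P <= d.+1)%N -> -1 <= k <= 1 -> charge_form k P = \sum_r mu r * P.[X r] * x r ^ k.
  move=> sP hk; rewrite /charge_form mulrDr (poly_linearD lE) -scalerAr (poly_linearZ lE) mulrDr mulrCA.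
  rewrite -!(quadratureE lE cE x01 mE (d := d)) //; try lia.
  rewrite mulr_sumr -big_split /=; apply: eq_bigr => r _.
  by rewrite /mu expfzDr // expr1z; ring.
pose kap i j := \sum_r \sum_q mu r * X r ^+ i * (mu q * X q ^+ j) * schur_kernel (x r) (x q).
have x1 r q : x r * x q != 1.
  have /andP[a1 a2] := x01 r; have /andP[b1 b2] := x01 q.
  by rewrite lt_eqF // -[ltRHS](mulr1 1) ltr_pM // ltW.
pose kb (P Q : {poly K}) := \sum_r \sum_q mu r * P.[X r] * (mu q * Q.[X q]) * schur_kernel (x r) (x q).
have kbl Q : poly_linear (kb^~ Q).
  move=> a P P'; rewrite /kb mulr_sumr -big_split; apply: eq_bigr => r _ /=.
  by rewrite mulr_sumr -big_split; apply: eq_bigr => q _ /=; rewrite hornerD hornerZ; ring.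
have kbr P : poly_linear (kb P).
  move=> a Q Q'; rewrite /kb mulr_sumr -big_split; apply: eq_bigr => r _ /=.
  by rewrite mulr_sumr -big_split; apply: eq_bigr => q _ /=; rewrite hornerD hornerZ; ring.
(* The averaged kernel is antisymmetric and solves the displacement equation in the degrees where
   the quadrature is exact. *)
have kapE i j : (i + j <= d)%N -> kap i j = undisplace theta i j.
  apply: undisplace_uniq; first exact: thetaC.
    move=> a b; rewrite /kap exchange_big /= -sumrN; apply: eq_bigr => r _.
    by rewrite -sumrN; apply: eq_bigr => q _; rewrite schur_kernelN; ring.
  move=> a b ab; rewrite /theta !chargeE ?size_polyXn; try lia.
  rewrite -[2 * _ * _]mulrA !mulr_suml mulr_sumr -!sumrB; apply: eq_bigr => r _.
  rewrite !mulr_sumr -!sumrB; apply: eq_bigr => q _.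
  rewrite !hornerXn expr0z !mulr1 !expr1z !exprS /schur_kernel.
  have inv (z : K) : z ^ (-1) = z^-1 by rewrite exprN1.
  rewrite !inv.
  have d1 : 1 - x r * x q != 0 by rewrite subr_eq0 eq_sym.
  by rewrite /X; field; rewrite !x0 d1.
(* The extra row of the odd case is one more node, at [1], where Schur's kernel against every other
   node is [1]. *)
pose y (r : option 'I_N) := if r is Some r' then x r' else 1.
pose g (i : nat) (r : option 'I_N) : K := match i, r with
  | 0%N, None => 1 | 0%N, Some _ => 0 | i'.+1, None => 0
  | i'.+1, Some r' => mu r' * (chebU 'X (Posz i')).[X r'] end.
have sumo (F : option 'I_N -> K) : \sum_r F r = F None + \sum_r F (Some r).
  rewrite (bigD1 None) //=; congr (_ + _); rewrite (reindex_omap Some id) /=; last by case.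
  by apply: eq_bigl => r; rewrite eqxx.
have sk1 (z : K) : z != 1 -> schur_kernel 1 z = 1.
  by move=> z1; rewrite /schur_kernel mul1r divff // subr_eq0 eq_sym.
have xr1 r : x r != 1 by have /andP[_ h] := x01 r; rewrite lt_eqF.
have mixedE i j : (i <= l.+1)%N -> (j <= l.+1)%N ->
    mixed g (fun r q => schur_kernel (y r) (y q)) i j = weightU i j.
  have border b : (b <= l)%N -> \sum_q g b.+1 (Some q) * schur_kernel 1 (x q) = charge_form 0 (chebU 'X (Posz b)).
    move=> bl; rewrite chargeE //; last by rewrite (leq_trans (size_chebU b)) // /d; lia.
    by apply: eq_bigr => q _; rewrite sk1 // expr0z.
  case: i j => [|a] [|b] al' bl'; rewrite /mixed !sumo /=.
  - rewrite {1}/schur_kernel subrr mul0r mulr0 add0r big1 ?add0r => [|r _]; last by rewrite mulr0 mul0r.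
    by rewrite big1 // => r _; rewrite big1 // => q _; rewrite !mul0r.
  - rewrite mulr0 mul0r add0r [X in _ + X]big1 ?addr0 => [|r _]; last by rewrite big1 // => q _; rewrite !mul0r.
    by rewrite -border //; apply: eq_bigr => q _; rewrite mul1r.
  - rewrite !mul0r add0r big1 ?add0r => [|r _]; last by rewrite !mul0r.
    rewrite -border // -sumrN; apply: eq_bigr => r _; rewrite sumo /= big1 ?addr0 => [|q _].
      by rewrite mulr1 schur_kernelN mulrN.
    by rewrite mulr0 mul0r.
  rewrite !mul0r add0r big1 ?add0r => [|q _]; last by rewrite !mul0r.
  have sa := size_chebU a; have sb := size_chebU b.
  transitivity (kb (chebU 'X (Posz a)) (chebU 'X (Posz b))).
    by apply: eq_bigr => r _; rewrite sumo /= mulr0 mul0r add0r.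
  have la : (size (chebU 'X (Posz a) : {poly K}) <= l)%N by exact: leq_trans sa _.
  have lb : (size (chebU 'X (Posz b) : {poly K}) <= l)%N by exact: leq_trans sb _.
  rewrite (poly_linear_coef (kbl _) la) (poly_linear_coef (bil_linl _ _) la).
  apply: eq_bigr => i _; congr (_ * _).
  rewrite (poly_linear_coef (kbr _) lb) (poly_linear_coef (bil_linr _ _) lb).
  apply: eq_bigr => j _; congr (_ * _).
  rewrite bilXX -kapE; last by rewrite /d; have := ltn_ord i; have := ltn_ord j; lia.
  by apply: eq_bigr => r _; apply: eq_bigr => q _; rewrite !hornerXn.
pose W r q := schur_kernel (y r) (y q).
have aW r q : W r q = - W q r by exact: schur_kernelN.
rewrite -(@pfn_eq _ _ (mixed g W)); last first.
  have all_small i : i \in nseq e 0%N ++ mkseq (fun i => (l - i.+1).+2) l -> (i <= l.+1)%N.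
    rewrite mem_cat mem_nseq => /orP[/andP[_ /eqP->]//|/mapP[j]].
    by rewrite mem_iota => hj ->; lia.
  rewrite (introT (pairwiseP 0%N)) // => i j; rewrite !inE => hi hj _.
  by apply/eqP; apply: mixedE; apply: all_small; exact: mem_nth.
rewrite pfn_nsum.
pose F v := pfn W n (nseq e None ++ map Some v).
have -> : nsum g (nseq e 0%N ++ mkseq (fun i => (l - i.+1).+2) l) (pfn W n) =
    nsum (fun i r => mu r * (chebU 'X (Posz (l - i.+1).+1)).[X r]) (mkseq id l) F.
  have -> : mkseq (fun i => (l - i.+1).+2) l = map (fun i => (l - i.+1).+2) (mkseq id l).
    by rewrite /mkseq -map_comp.
  rewrite /F; case: (e); rewrite /= ?sumo /= ?mul1r ?[X in _ + X]big1 ?addr0; try by move=> *; rewrite mul0r.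
    by rewrite nsum_map nsum_some.
  by rewrite nsum_map nsum_some.
rewrite (@schur_to_toeplitz _ _ x mu (fun n => chebU 'X (Posz n.+1)) l F); last first.
- move=> v sv; rewrite /F -(@pfn_map _ _ _ y (@schur_kernel K)) map_cat map_nseq -map_comp /=.
  rewrite schur_pfaffian; last 2 first.
  + by rewrite size_cat size_nseq size_map sv.
  + have pw s : pairwise (fun a b => a * b != 1) (map x s).
      by elim: s => [//|r s IH] /=; rewrite IH andbT all_map; apply/allP => q _ /=.
    case: (e) => //=; rewrite pw andbT all_map; apply/allP => q _ /=; by rewrite mul1r.
  case: (e) => //=; rewrite big1_seq ?mul1r // => z /= /mapP[r _ ->]; exact: sk1.
- exact: x1.
- exact: x0.
- move=> s1 r q s2; rewrite /F !map_cat /= !catA; exact: alternating_pfn.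
- exact: monic_basisU.
rewrite -det_tr; congr (\det _); apply/matrixP => i j; rewrite !mxE.
rewrite -!mE ?mulr_sumr -?big_split /=; try (have := ltn_ord i; have := ltn_ord j; lia).
apply: eq_bigr => r _; rewrite -[x r ^+ _]/(x r ^ (l - j.+1)%N%:Z) exprVn.
rewrite -[(x r ^+ _)^-1]/(x r ^ (- (l - i.+1)%N%:Z)) || rewrite exprnN.
rewrite /mu (expfzDr (i%:Z - j%:Z) 1 (x0 r)) expr1z -mulrA -expfzDr //.
rewrite (_ : (l - j.+1)%N%:Z + - (l - i.+1)%N%:Z = i%:Z - j%:Z); first by ring.
by have := ltn_ord i; have := ltn_ord j; lia.
Qed.

End Pairing.

Section Folding.
Variable V : nmodType.

Lemma fold_even (F : nat -> V) n :
  \sum_(i < (n + n).+2) F i = \sum_(j < n.+1) (F (n.+1 + j)%N + F (n - j)%N).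
Proof.
rewrite -addnS -addSn big_split_ord big_split /= addrC; congr (_ + _).
by rewrite (reindex_inj rev_ord_inj).
Qed.

Lemma fold_odd (F : nat -> V) n :
  \sum_(i < (n + n).+1) F i = F n + \sum_(j < n) (F (n + j).+1 + F (n - j.+1)%N).
Proof.
rewrite -addSn big_split_ord big_ord_recr /= addrAC addrC big_split /=; congr (_ + _).
by rewrite addrC; congr (_ + _); rewrite (reindex_inj rev_ord_inj).
Qed.

End Folding.

(** * Szego's relations *)

Section Christoffel.
Variable K : numFieldType.

(* Both sides are the determinant of the functionals [P |-> P.[a]] and [g j]. *)
Lemma det_root k (g : 'I_k -> {poly K} -> K) (q : {poly K}) a : (forall j, poly_linear (g j)) ->
  q \is monic -> size q = k.+1 -> (forall j, g j q = 0) ->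
  \det (\matrix_(i < k, j < k) g j (('X - a%:P) * 'X^i)) =
  (-1) ^+ k * q.[a] * \det (\matrix_(i < k, j < k) g j 'X^i).
Proof.
move=> lg mq sq oq.
pose f (j : 'I_k.+1) P := if unlift ord0 j is Some j' then g j' P else P.[a].
have f0 P : f ord0 P = P.[a] by rewrite /f unlift_none.
have fl j P : f (lift ord0 j) P = g j P by rewrite /f liftK.
have lf j : poly_linear (f j).
  case: (unliftP ord0 j) => [j' ->|->] c P Q; first by rewrite !fl lg.
  by rewrite !f0 hornerD hornerZ.
pose basis i : {poly K} := if i == k then q else 'X^i.
have bb : monic_basis basis.
  by move=> i; rewrite /basis; case: eqP => [->|_] //; exact: monic_basisX.
have := @gram_left K k.+1 _ f bb lf.
rewrite -(@gram_left K k.+1 _ f (monic_basis_vanishing a) lf) => e.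
transitivity (\det (\matrix_(i < k.+1, j < k.+1) f j (vanishing a i))).
  rewrite (expand_det_col _ ord0) (bigD1 ord0) //= big1 ?addr0 => [|i i0]; last first.
    by rewrite mxE f0 vanishing_horner (_ : _ == _ = false) ?mul0r //; apply/negbTE.
  rewrite mxE f0 vanishing_horner mul1r /cofactor addn0 expr0 mul1r.
  by congr (\det _); apply/matrixP => i j; rewrite !mxE fl.
rewrite -e (expand_det_row _ ord_max) (bigD1 ord0) //= big1 ?addr0 => [|j]; last first.
  case: (unliftP ord0 j) => [j' ->|->]; last by rewrite eqxx.
  by rewrite mxE fl /basis eqxx oq mul0r.
rewrite mxE f0 /basis eqxx /cofactor addn0 mulrCA mulrA; congr (_ * \det _).
apply/matrixP => i j; rewrite !mxE fl /= /bump leqNgt ltn_ord add0n.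
by rewrite (_ : _ == _ = false) //; apply/negbTE; rewrite neq_ltn ltn_ord.
Qed.

Variable E : {poly K} -> K.
Hypothesis lE : poly_linear E.

Lemma poly_linear_weight w r : poly_linear (fun P => E (w * (P * r))).
Proof. by move=> a P Q; rewrite [(_ + Q) * _]mulrDl [w * (_ + _)]mulrDr -scalerAl -scalerAr lE. Qed.

(** Christoffel's formula for an orthogonal polynomial as a quotient of Hankel determinants, cleared
    of its denominator so as to hold when that vanishes. *)
Lemma christoffel (p : nat -> {poly K}) k w (q : {poly K}) a : monic_basis p ->
  q \is monic -> size q = k.+1 -> (forall j, (j < k)%N -> E (w * (q * p j)) = 0) ->
  hankel E k (w * ('X - a%:P)) = (-1) ^+ k * q.[a] * hankel E k w.
Proof.
move=> bp mq sq oq; have := @det_root k (fun j P => E (w * (P * p j))) q a.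
rewrite -!(hankel_gram lE _ _ (@monic_basisX _) bp) => <- //.
- by congr (\det _); apply/matrixP => i j; rewrite !mxE !mulrA.
- by move=> j; exact: poly_linear_weight.
- by move=> j; exact: oq.
Qed.

Lemma monic_combination (p : nat -> {poly K}) k (a : nat -> K) : monic_basis p -> a k = 1 ->
  \sum_(j < k.+1) a j *: p j \is monic /\ size (\sum_(j < k.+1) a j *: p j) = k.+1.
Proof.
move=> bp ak; have [mk sk] := bp k; rewrite big_ord_recr /= ak scale1r addrC.
have lt : (size (\sum_(j < k) a j *: p j)%R < size (p k))%N.
  rewrite sk ltnS; apply: (leq_trans (size_sum _ _ _)); apply/bigmax_leqP => j _.
  by apply: (leq_trans (size_scale_leq _ _)); rewrite (proj2 (bp j)).
by rewrite size_polyDl // sk; split=> //; rewrite monicE lead_coefDl // -monicE.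
Qed.

Lemma hankel_shifted k w z : z != 0 ->
  hankel E k (((1 + z ^+ 2)%:P - z *: 'X) * w) = (- z) ^+ k * hankel E k (w * ('X - (z + z^-1)%:P)).
Proof.
move=> z0; rewrite -(hankelZ lE); congr (hankel _ _ _).
rewrite mulrC [in RHS]scalerAr; congr (_ * _); rewrite scalerBr !scaleNr opprK addrC -mul_polyC -[z *: (_)%:P]mul_polyC -polyCM.
by rewrite mulrDr divff // -expr2 [z ^+ 2 + 1]addrC mul_polyC.
Qed.

End Christoffel.

Section Szego.
Variables (K : numFieldType) (E : {poly K} -> K) (c : int -> K).
Hypothesis lE : poly_linear E.
Hypothesis cE : forall j, E (chebC 'X j) = 2 * c j.

Lemma cN j : c (- j) = c j. Proof. exact: moment_sym cE j. Qed.

Section Degree.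
Variables (m : nat) (p : {poly K}).
(** Coefficients of [p^* + e z p], of degree [m + 1]. For [e = 1] and [e = -1] they are symmetric
    and antisymmetric, so the polynomial folds to one in [z + 1/z], up to an elementary factor. *)
Definition reflected (e : K) i : K := (if (i <= m)%N then p`_(m - i) else 0) + e * (if i is i'.+1 then p`_i' else 0).

Lemma reflected_sym e i : e ^+ 2 = 1 -> (i <= m.+1)%N -> reflected e (m.+1 - i) = e * reflected e i.
Proof.
move=> e2; rewrite /reflected; case: i => [_|i im].
  rewrite subn0 ltnn /= mulr0 add0r addr0 subn0; ring.
rewrite subSS; have -> : (m - i <= m)%N by exact: leq_subr.
rewrite subKn // mulrDr mulrA -expr2 e2 mul1r addrC; congr (_ + _).
case: (ltnP i m) => h.
  by rewrite (_ : m - i = (m - i.+1).+1)%N //; lia.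
by rewrite (_ : m - i = 0)%N ?mulr0 //; lia.
Qed.

Hypotheses (mp : p \is monic) (sp : size p = m.+1).
Hypothesis op : forall j, (j < m)%N -> \sum_(i < m.+1) p`_i * c (i%:Z - j%:Z) = 0.

Lemma reflected_top e : reflected e m.+1 = e.
Proof. by rewrite /reflected ltnn add0r; move: mp; rewrite monicE /lead_coef sp => /eqP ->; rewrite mulr1. Qed.

(** Since [p] is orthogonal to [z^0 .. z^(m-1)], both [z p] and the reversal of [p] are orthogonal
    to [z^1 .. z^m]. *)
Lemma reflected_orthogonal e j : (0 < j <= m)%N -> \sum_(i < m.+2) reflected e i * c (i%:Z - j%:Z) = 0.
Proof.
move=> jm; under eq_bigr => i _ do rewrite /reflected mulrDl -mulrA.
rewrite big_split -mulr_sumr /= [X in X + _]big_ord_recr /= ltnn mul0r addr0.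
rewrite [X in _ * X]big_ord_recl /= mul0r add0r.
have -> : \sum_(i < m.+1) p`_i * c (i.+1%:Z - j%:Z) = 0.
  rewrite -[RHS](op (j := j.-1)); last by lia.
  by apply: eq_bigr => i _; congr (_ * c _); lia.
rewrite mulr0 addr0 -[RHS](op (j := (m - j)%N)); last by lia.
rewrite (reindex_inj rev_ord_inj) /=; apply: eq_bigr => i _.
have hi := ltn_ord i; rewrite subSS leq_subr subKn; last by lia.
by congr (_ * _); rewrite -cN; congr c; lia.
Qed.

Lemma reflected_horner e z : \sum_(i < m.+2) reflected e i * z ^+ i =
  (\poly_(i < m.+1) p`_(m - i)).[z] + e * (z * p.[z]).
Proof.
under eq_bigr => i _ do rewrite /reflected mulrDl -mulrA.
rewrite big_split -mulr_sumr /= [X in X + _]big_ord_recr /= ltnn mul0r addr0.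
rewrite [X in _ * X]big_ord_recl /= mul0r add0r horner_poly; congr (_ + _).
  by apply: eq_bigr => i _; rewrite -ltnS ltn_ord.
congr (_ * _); rewrite horner_coef sp mulr_sumr; apply: eq_bigr => i _.
by rewrite exprS; ring.
Qed.

Section Fold.
Variables (e : K) (h k : nat) (eta kap : nat -> K) (b : nat -> {poly K}) (w : {poly K}).
Hypotheses (e2 : e ^+ 2 = 1) (hk : (h + k)%N = m.+1) (h0 : (0 < h)%N) (bb : monic_basis b).
Hypothesis eta1 : eta k = 1.
Hypothesis fold : forall x : nat -> K, \sum_(i < m.+2) reflected e i * x i =
  \sum_(j < k.+1) reflected e (h + j) * (eta j * (x (h + j)%N + e * x (m.+1 - (h + j))%N)).
Hypothesis weight : forall i j, E (w * (b j * b i)) =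
  kap i * (eta j * (c (j%:Z - i%:Z) + e * c (j%:Z + i%:Z + 2 * h%:Z - m.+1%:Z))).

(** Common form of Szego's relations. Folding turns orthogonality on the circle into orthogonality
    of [q] for the weight [w] on the segment, and Christoffel's formula reads [q] at [z + z^-1]. The
    four cases differ in the family [b]; [g] clears the denominator in its values. *)
Lemma hankel_reflected z g : z != 0 ->
  (forall j, (j <= k)%N -> g * (z ^+ k * (b j).[z + z^-1]) = e * (eta j * (z ^+ (h + j) + e * z ^+ (m.+1 - (h + j))))) ->
  g * hankel E k (((1 + z ^+ 2)%:P - z *: 'X) * w) =
  ((\poly_(i < m.+1) p`_(m - i)).[z] + e * (z * p.[z])) * hankel E k w.
Proof.
move=> z0 val; pose a j := e * reflected e (h + j).
have ak : a k = 1 by rewrite /a hk reflected_top -expr2.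
have [mq sq] := monic_combination bb ak; set q := \sum_(j < _) _ in mq sq.
have oq i : (i < k)%N -> E (w * (q * b i)) = 0.
  move=> ik; rewrite (poly_linear_sum _ _ _ _ (poly_linear_weight lE w (b i))).
  have := reflected_orthogonal e (j := (h + i)%N); rewrite (fold (fun i' => c (i'%:Z - (h + i)%N%:Z))) => o'.
  have o : (0 < h + i <= m)%N by lia.
  have := congr1 ( *%R (e * kap i)) (o' o); rewrite mulr0 => {}o; apply: etrans o.
  rewrite mulr_sumr; apply: eq_bigr => j _; rewrite weight /a.
  have hj := ltn_ord j.
  have -> : (h + j)%N%:Z - (h + i)%N%:Z = j%:Z - i%:Z by lia.
  rewrite -[c ((m.+1 - (h + j))%N%:Z - _)]cN.
  by rewrite (_ : - ((m.+1 - (h + j))%N%:Z - (h + i)%N%:Z) = j%:Z + i%:Z + 2 * h%:Z - m.+1%:Z); [ring|lia].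
rewrite (hankel_shifted lE) // (christoffel lE (z + z^-1) bb mq sq oq) -reflected_horner (fold (fun i => z ^+ i)) [(- z) ^+ k]exprNn.
have sgn : (-1) ^+ k * (-1) ^+ k = 1 :> K by rewrite -expr2 -exprM mulnC exprM sqrrN expr1n expr1n.
transitivity (((-1) ^+ k * (-1) ^+ k) * (g * (z ^+ k * q.[z + z^-1]) * hankel E k w)); first by ring.
rewrite sgn mul1r; congr (_ * _); rewrite /q horner_sum !mulr_sumr; apply: eq_bigr => j _.
have hj := ltn_ord j; rewrite hornerZ [z ^+ k * _]mulrCA [g * _]mulrCA val // /a.
transitivity (e ^+ 2 * (reflected e (h + j) * (eta j * (z ^+ (h + j) + e * z ^+ (m.+1 - (h + j)))))); first by ring.
by rewrite e2 mul1r.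
Qed.

End Fold.

(** The matrix on the right pairs [(X - z^-1) * X^i], up to scaling, with the functionals that
    annihilate [p], so [det_root] applies with root [z^-1]. *)
Lemma reversed_det z :
  (\poly_(i < m.+1) p`_(m - i)).[z] * \det (\matrix_(i < m, j < m) c (i%:Z - j%:Z)) =
  \det (\matrix_(i < m, j < m) (c (i%:Z - j%:Z) - z * c (i%:Z - j%:Z + 1))).
Proof.
have lp : p`_m = 1 by move: mp; rewrite monicE /lead_coef sp => /eqP.
rewrite horner_poly; have [->|z0] := eqVneq z 0.
  rewrite big_ord_recl big1 => [|i _]; last by rewrite exprS mul0r mulr0.
  rewrite subn0 lp expr0 mulr1 addr0 mul1r; congr (\det _); apply/matrixP => i j.
  by rewrite !mxE mul0r subr0.
pose g (j : 'I_m) (P : {poly K}) := \sum_(i < m.+1) P`_i * c (i%:Z - j%:Z).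
have gX j i : (i <= m)%N -> g j 'X^i = c (i%:Z - j%:Z).
  move=> im; have im' : (i < m.+1)%N by [].
  rewrite /g (bigD1 (Ordinal im')) //= coefXn eqxx mul1r big1 ?addr0 // => i' ne.
  by rewrite coefXn (_ : _ == _ = false) ?mul0r //; apply/negbTE; rewrite -val_eqE in ne.
have lg j : poly_linear (g j).
  move=> a P Q; rewrite /g mulr_sumr -big_split /=; apply: eq_bigr => i _.
  by rewrite coefD coefZ; ring.
have gp j : g j p = 0 by exact: op.
have := det_root z^-1 lg mp sp gp.
have -> : \matrix_(i < m, j < m) g j 'X^i = \matrix_(i < m, j < m) c (i%:Z - j%:Z).
  by apply/matrixP => i j; rewrite !mxE gX // ltnW.
have -> : \matrix_(i < m, j < m) g j (('X - (z^-1)%:P) * 'X^i) =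
    (- z^-1) *: \matrix_(i < m, j < m) (c (i%:Z - j%:Z) - z * c (i%:Z - j%:Z + 1)).
  apply/matrixP => i j; rewrite !mxE mulrBl -exprS mul_polyC (poly_linearB (lg j)) (poly_linearZ (lg j)).
  rewrite !gX //; last exact: ltnW.
  rewrite (_ : i.+1%:Z - j%:Z = i%:Z - j%:Z + 1); last by lia.
  by field.
rewrite detZ => h; have sgn : (-1) ^+ m * (-1) ^+ m = 1 :> K.
  by rewrite -expr2 -exprM mulnC exprM sqrrN expr1n expr1n.
have zm : z ^+ m * z^-1 ^+ m = 1 by rewrite -exprMn divff // expr1n.
set D := \det _ in h *; set D' := \det _ in h *.
transitivity (z ^+ m * p.[z^-1] * D').
  congr (_ * _); rewrite horner_coef sp mulr_sumr (reindex_inj rev_ord_inj) /=; apply: eq_bigr => i _.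
  have hi := ltn_ord i; rewrite subSS subKn // mulrCA; congr (_ * _).
  have -> : z ^+ m = z ^+ (m - i) * z ^+ i by rewrite -exprD subnK.
  by rewrite -mulrA -exprMn divff // expr1n mulr1.
transitivity ((-1) ^+ m * z ^+ m * ((-1) ^+ m * p.[z^-1] * D')).
  by rewrite -[LHS]mul1r -{1}sgn; ring.
transitivity (((-1) ^+ m * (-1) ^+ m) * (z ^+ m * z^-1 ^+ m) * D); last by rewrite sgn zm !mul1r.
by rewrite -h [(- z^-1) ^+ m]exprNn; ring.
Qed.

End Degree.

Lemma reversed_at0 m (p : {poly K}) : p \is monic -> size p = m.+1 ->
  (\poly_(i < m.+1) p`_(m - i)).[0] = 1.
Proof. by move=> mp sp; rewrite horner_coef0 coef_poly subn0; move: mp; rewrite monicE /lead_coef sp => /eqP. Qed.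

Lemma exprn_sub (z : K) n j : z != 0 -> (j <= n)%N -> z ^+ n * z ^ (- j%:Z) = z ^+ (n - j).
Proof. by move=> z0 jn; rewrite -[z ^+ n]/(z ^ n%:Z) -expfzDr // (_ : n%:Z - j%:Z = (n - j)%N) //; lia. Qed.

Lemma phi0 : (1 + 0 ^+ 2)%:P - 0 *: 'X = 1 :> {poly K}.
Proof. by rewrite expr0n addr0 scale0r subr0. Qed.

Section Identities.
Variables (n : nat) (p : {poly K}) (z : K).
Local Notation phi := ((1 + z ^+ 2)%:P - z *: 'X).
Local Notation rev m := (\poly_(i < m.+1) p`_(m - i)).

Section Odd.
Let m := (n + n.+1)%N.
Hypotheses (mp : p \is monic) (sp : size p = m.+1).
Hypothesis op : forall j, (j < m)%N -> \sum_(i < m.+1) p`_i * c (i%:Z - j%:Z) = 0.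

(** The symmetric polynomial has a middle coefficient, counted once by the fold; this accounts for
    the half in [eta]. *)
Lemma szego_mm : hankel E n.+1 phi = ((rev m).[z] + z * p.[z]) * hankel E n.+1 1.
Proof.
have [->|z0] := eqVneq z 0; first by rewrite phi0 reversed_at0 // mul0r addr0 mul1r.
pose eta i : K := if i == 0%N then 2^-1 else 1.
have cos i : cosines K i = eta i *: chebC 'X (Posz i).
  rewrite /eta; case: i => [|i]; last by rewrite scale1r.
  have -> : chebC 'X 0%N = 2 *: (1 : {poly K}) by rewrite scaler_nat.
  by rewrite scalerA mulVf ?scale1r // pnatr_eq0.
have sym i : (i <= m.+1)%N -> reflected m p 1 (m.+1 - i) = reflected m p 1 i.
  by move=> hi; rewrite reflected_sym ?mul1r ?expr1n.
have := @hankel_reflected m p mp sp op 1 n.+1 n.+1 eta (fun i => 2 * eta i) (cosines K) 1 _ _ _ (@monic_basis_cosines K).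
move=> H; have := H _ _ _ _ _ z 1; rewrite mul1r mulr1 mul1r => {H} -> //.
- by rewrite expr1n.
- move=> x; rewrite (fold_odd (fun i => reflected m p 1 i * x i) n.+1) [RHS]big_ord_recl /=; congr (_ + _).
    rewrite /eta /= addn0 mul1r (_ : m.+1 - n.+1 = n.+1)%N; last by rewrite /m; lia.
    by field.
  apply: eq_bigr => j _; have hj := ltn_ord j; rewrite /eta /= /bump /= !mul1r add1n addnS mulrDr.
  rewrite -[reflected _ _ _ (n.+1 - j.+1)]sym; last by rewrite /m; lia.
  rewrite (_ : m.+1 - (n.+1 - j.+1) = (n.+1 + j).+1)%N; last by rewrite /m; lia.
  by rewrite (_ : m.+1 - (n.+1 + j).+1 = n.+1 - j.+1)%N //; rewrite /m; lia.
- move=> i j; rewrite !cos mul1r -scalerAl -scalerAr !(poly_linearZ lE) chebCC (poly_linearD lE) !cE mul1r.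
  rewrite (_ : j%:Z + i%:Z + 2 * n.+1%:Z - m.+1%:Z = j%:Z + i%:Z); first by ring.
  by rewrite /m; lia.
- move=> j jn; rewrite cos hornerZ horner_chebC // mul1r !mul1r mulrCA; congr (_ * _).
  rewrite mulrDr -exprD; congr (_ + _).
  rewrite (_ : m.+1 - (n.+1 + j) = n.+1 - j)%N; last by rewrite /m; lia.
  by rewrite exprn_sub.
Qed.

Lemma szego_pp : (1 - z ^+ 2) * hankel E n (phi * (4 - 'X ^+ 2)) =
  ((rev m).[z] - z * p.[z]) * hankel E n (4 - 'X ^+ 2).
Proof.
have [->|z0] := eqVneq z 0.
  by rewrite phi0 reversed_at0 // expr0n mul0r !subr0 !mul1r.
have sym i : (i <= m.+1)%N -> reflected m p (-1) (m.+1 - i) = - reflected m p (-1) i.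
  by move=> hi; rewrite reflected_sym ?mulN1r ?sqrrN ?expr1n.
(* In the antisymmetric case the middle coefficient vanishes, so the fold starts one place later, at
   [n.+2]. *)
have mid : reflected m p (-1) n.+1 = 0.
  have := sym n.+1; rewrite (_ : m.+1 - n.+1 = n.+1)%N; last by rewrite /m; lia.
  move=> h; have /eqP : reflected m p (-1) n.+1 *+ 2 = 0.
    by rewrite mulr2n {1}h ?addNr // /m; lia.
  by rewrite mulrn_eq0 => /eqP.
have H := @hankel_reflected m p mp sp op (-1) n.+2 n (fun=> 1) (fun=> 2)
  (fun n => chebU 'X n.+1) (4 - 'X ^+ 2) _ _ _ (@monic_basisU K).
have := H _ _ _ _ _ z (1 - z ^+ 2); rewrite mulN1r => {H} -> //.
- by rewrite sqrrN expr1n.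
- by rewrite /m; lia.
- move=> x; rewrite (fold_odd (fun i => reflected m p (-1) i * x i) n.+1) mid mul0r add0r.
  apply: eq_bigr => j _; have hj := ltn_ord j; rewrite mul1r mulN1r mulrBr.
  rewrite addSn addSn -[reflected _ _ _ (n.+1 - j.+1)]opprK -sym; last by rewrite /m; lia.
  rewrite (_ : m.+1 - (n.+1 - j.+1) = (n + j).+2)%N; last by rewrite /m; lia.
  by rewrite mulNr (_ : m.+1 - (n + j).+2 = n.+1 - j.+1)%N //; rewrite /m; lia.
- move=> i j; rewrite chebUU (poly_linearB lE) !cE mul1r mulN1r mulrBr.
  by congr (_ * c _ - _ * c _); rewrite /m; lia.
- move=> j jn; rewrite mul1r /chebU horner_cheb horner0.
  have -> : (1 : {poly K}).[z + z^-1] = 1 by rewrite hornerE.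
  have e : (z - z^-1) * cheb (z + z^-1) 0 1 j.+1 = z ^ j.+1%:Z - z ^ (- j.+1%:Z).
    by rewrite (cheb_powers (al := 1) (be := -1)) ?mul1r ?mulN1r ?mulr0 ?mulr1 ?subrr.
  transitivity (- (z ^+ n.+1 * ((z - z^-1) * cheb (z + z^-1) 0 1 j.+1))); first by rewrite [z ^+ n.+1]exprS; move: (cheb _ _ _ _) => X; field.
  rewrite e mulrBr !mulN1r -exprD (_ : (n.+1 + j.+1 = n.+2 + j)%N); last by lia.
  congr (- (_ - _)); rewrite (_ : m.+1 - (n.+2 + j) = n.+1 - j.+1)%N; last by rewrite /m; lia.
  by rewrite exprn_sub.
Qed.

End Odd.

Section Even.
Let m := (n + n)%N.
Hypotheses (mp : p \is monic) (sp : size p = m.+1).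
Hypothesis op : forall j, (j < m)%N -> \sum_(i < m.+1) p`_i * c (i%:Z - j%:Z) = 0.

Let reflected_fold e (x : nat -> K) : e ^+ 2 = 1 -> \sum_(i < m.+2) reflected m p e i * x i =
  \sum_(j < n.+1) reflected m p e (n.+1 + j) * (1 * (x (n.+1 + j)%N + e * x (m.+1 - (n.+1 + j))%N)).
Proof.
move=> e2; rewrite (fold_even (fun i => reflected m p e i * x i) n).
apply: eq_bigr => j _; have hj := ltn_ord j; rewrite mul1r mulrDr.
have := @reflected_sym m p e (n.+1 + j) e2.
rewrite (_ : m.+1 - (n.+1 + j) = n - j)%N; last by rewrite /m; lia.
move=> ->; first by ring.
by rewrite /m; lia.
Qed.

Lemma szego_pm : (1 - z) * hankel E n (phi * (2 - 'X)) = ((rev m).[z] - z * p.[z]) * hankel E n (2 - 'X).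
Proof.
have [->|z0] := eqVneq z 0.
  by rewrite phi0 reversed_at0 // mul0r !subr0 !mul1r.
have e2 : (-1) ^+ 2 = 1 :> K by rewrite sqrrN expr1n.
have H := @hankel_reflected m p mp sp op (-1) n.+1 n (fun=> 1) (fun=> 2)
  (fun n => chebM 'X n) (2 - 'X) e2 _ _ (@monic_basisM K).
have := H _ _ _ _ z (1 - z); rewrite mulN1r => {H} -> //.
- by move=> x; exact: reflected_fold.
- move=> i j; rewrite chebMM (poly_linearB lE) !cE mul1r mulN1r mulrBr.
  by congr (_ * c _ - _ * c _); rewrite /m; lia.
- move=> j jn; rewrite mul1r /chebM horner_cheb.
  have -> : (1 : {poly K}).[z + z^-1] = 1 by rewrite hornerE.
  have -> : ('X + 1 : {poly K}).[z + z^-1] = z + z^-1 + 1 by rewrite !hornerE.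
  have e : (z - 1) * cheb (z + z^-1) 1 (z + z^-1 + 1) j = z * z ^ j%:Z - z ^ (- j%:Z).
    by rewrite (cheb_powers (al := z) (be := -1)) ?mulN1r ?mulr1 //; field.
  transitivity (- (z ^+ n * ((z - 1) * cheb (z + z^-1) 1 (z + z^-1 + 1) j))); first by ring.
  rewrite e mulrBr !mulN1r mulrA -exprSr -exprD; congr (- (_ - _)).
  rewrite (_ : m.+1 - (n.+1 + j) = n - j)%N; last by rewrite /m; lia.
  by rewrite exprn_sub.
Qed.

Lemma szego_mp : (1 + z) * hankel E n (phi * (2 + 'X)) = ((rev m).[z] + z * p.[z]) * hankel E n (2 + 'X).
Proof.
have [->|z0] := eqVneq z 0.
  by rewrite phi0 reversed_at0 // mul0r !addr0 !mul1r.
have e2 : 1 ^+ 2 = 1 :> K by rewrite expr1n.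
have H := @hankel_reflected m p mp sp op 1 n.+1 n (fun=> 1) (fun=> 2)
  (fun n => chebP 'X n) (2 + 'X) e2 _ _ (@monic_basisP K).
have := H _ _ _ _ z (1 + z); rewrite mul1r => {H} -> //.
- by move=> x; exact: reflected_fold.
- move=> i j; rewrite chebPP (poly_linearD lE) !cE !mul1r mulrDr.
  by congr (_ * c _ + _ * c _); rewrite /m; lia.
- move=> j jn; rewrite !mul1r /chebP horner_cheb.
  have -> : (1 : {poly K}).[z + z^-1] = 1 by rewrite hornerE.
  have -> : ('X - 1 : {poly K}).[z + z^-1] = z + z^-1 - 1 by rewrite !hornerE.
  have e : (1 + z) * cheb (z + z^-1) 1 (z + z^-1 - 1) j = z * z ^ j%:Z + z ^ (- j%:Z).
    by rewrite (cheb_powers (al := z) (be := 1)) ?mul1r ?mulr1 1?addrC //; field.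
  transitivity (z ^+ n * ((1 + z) * cheb (z + z^-1) 1 (z + z^-1 - 1) j)); first by ring.
  rewrite e mulrDr mulrA -exprSr -exprD; congr (_ + _).
  rewrite (_ : m.+1 - (n.+1 + j) = n - j)%N; last by rewrite /m; lia.
  by rewrite exprn_sub.
Qed.

End Even.

End Identities.

Lemma det_reindex_nat N (f : nat -> nat) (A : nat -> nat -> K) :
  (forall i, (i < N)%N -> (f i < N)%N) -> (forall i j, (i < N)%N -> (j < N)%N -> f i = f j -> i = j) ->
  \det (\matrix_(i < N, j < N) A (f i) (f j)) = \det (\matrix_(i < N, j < N) A i j).
Proof.
move=> fN fi; pose s (i : 'I_N) := Ordinal (fN i (ltn_ord i)).
have sI : injective s by move=> i j [/fi e]; apply/val_inj/e; exact: ltn_ord.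
rewrite -[RHS](det_reindex (perm sI)); congr (\det _); apply/matrixP => i j.
by rewrite !mxE !permE.
Qed.

(** Listing each half of the indices from the centre outwards gives the blocks [A B B A], reduced by
    row and column operations to [A + B] and [A - B]. *)
Lemma toeplitz_even n : \det (\matrix_(i < n + n, j < n + n) c (i%:Z - j%:Z)) =
  \det (\matrix_(i < n, j < n) (c (i%:Z - j%:Z) + c (i%:Z + j%:Z + 1))) *
  \det (\matrix_(i < n, j < n) (c (i%:Z - j%:Z) - c (i%:Z + j%:Z + 1))).
Proof.
pose f i := (if i < n then n + i else (n + n - i).-1)%N.
have fl a : (a < n)%N -> f a = (n + a)%N by move=> h; rewrite /f h.
have fr a : (a < n)%N -> f (n + a)%N = (n - a.+1)%N by move=> h; rewrite /f ltnNge leq_addr /=; lia.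
rewrite -(@det_reindex_nat _ f (fun i j => c (i%:Z - j%:Z))); last 2 first.
- by move=> i hi; rewrite /f; case: (ltnP i n) => h; lia.
- by move=> i j hi hj; rewrite /f; case: (ltnP i n) => h; case: (ltnP j n) => h'; lia.
pose A := \matrix_(i < n, j < n) c (i%:Z - j%:Z).
pose B := \matrix_(i < n, j < n) c (i%:Z + j%:Z + 1).
have -> : \matrix_(i < n + n, j < n + n) c ((f i)%:Z - (f j)%:Z) = block_mx A B B A.
  clearbody f; apply/matrixP => i j; rewrite -[i]splitK -[j]splitK.
  case: (split i) => a; case: (split j) => b; rewrite ?block_mxEul ?block_mxEur ?block_mxEdl ?block_mxEdr !mxE /=;
    rewrite ?fr ?ltn_ord ?fl ?ltn_ord //; have := ltn_ord a; have := ltn_ord b => hb ha.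
  - by congr c; lia.
  - by congr c; lia.
  - by rewrite -[LHS]cN; congr c; lia.
  - by rewrite -[LHS]cN; congr c; lia.
have e : block_mx 1%:M 1%:M 0 1%:M *m block_mx A B B A *m block_mx 1%:M (- 1%:M) 0 1%:M =
    block_mx (A + B) 0 B (A - B).
  rewrite !mulmx_block !mul1mx !mul0mx !mulmx1 !mulmx0 !add0r !addr0 !mulmxN !mulmx1.
  by congr (block_mx _ _ _ _); rewrite ?addNr // addrC ?[B + A]addrC ?subrr.
have := congr1 determinant e; rewrite !det_mulmx !det_ublock det_lblock !det1 !mul1r mulr1 => ->.
by congr (_ * _); congr (\det _); apply/matrixP => i j; rewrite !mxE.
Qed.

(** The central index has no mirror image, hence the shift [N] between the two halves. The first row
    of the cosine matrix is doubled, hence the factor [2]. *)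
Lemma toeplitz_odd n : 2 * \det (\matrix_(i < n.+1 + n, j < n.+1 + n) c (i%:Z - j%:Z)) =
  \det (\matrix_(i < n.+1, j < n.+1) (c (i%:Z - j%:Z) + c (i%:Z + j%:Z))) *
  \det (\matrix_(i < n, j < n) (c (i%:Z - j%:Z) - c (i%:Z + j%:Z + 2))).
Proof.
pose f i := (if i < n.+1 then n + i else n + n - i)%N.
have fl a : (a < n.+1)%N -> f a = (n + a)%N by move=> h; rewrite /f h.
have fr a : (a < n)%N -> f (n.+1 + a)%N = (n - a.+1)%N by move=> h; rewrite /f ltnNge leq_addr /=; lia.
rewrite -(@det_reindex_nat _ f (fun i j => c (i%:Z - j%:Z))); last 2 first.
- by move=> i hi; rewrite /f; case: (ltnP i n.+1) => h; lia.
- by move=> i j hi hj; rewrite /f; case: (ltnP i n.+1) => h; case: (ltnP j n.+1) => h'; lia.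
pose A := \matrix_(i < n.+1, j < n.+1) c (i%:Z - j%:Z).
pose B := \matrix_(i < n.+1, j < n) c (i%:Z + j%:Z + 1).
pose C := \matrix_(i < n, j < n.+1) c (i%:Z + j%:Z + 1).
pose D := \matrix_(i < n, j < n) c (i%:Z - j%:Z).
pose N : 'M[K]_(n.+1, n) := \matrix_(i, j) (i == j.+1 :> nat)%:R.
have -> : \matrix_(i < n.+1 + n, j < n.+1 + n) c ((f i)%:Z - (f j)%:Z) = block_mx A B C D.
  clearbody f; apply/matrixP => i j; rewrite -[i]splitK -[j]splitK.
  case: (split i) => a; case: (split j) => b; rewrite ?block_mxEul ?block_mxEur ?block_mxEdl ?block_mxEdr !mxE /=;
    rewrite ?fr ?ltn_ord ?fl ?ltn_ord //; have := ltn_ord a; have := ltn_ord b => hb ha.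
  - by congr c; lia.
  - by congr c; lia.
  - by rewrite -[LHS]cN; congr c; lia.
  - by rewrite -[LHS]cN; congr c; lia.
have NM q (M : 'M[K]_(n, q)) i j : (N *m M) i j = if unlift ord0 i is Some i' then M i' j else 0.
  rewrite mxE; case: unliftP => [i' ->|->].
    rewrite (bigD1 i') //= mxE /= eqxx mul1r big1 ?addr0 // => k ki; rewrite mxE /= /bump add1n eqSS.
    by rewrite (_ : (_ == _) = false) ?mul0r //; apply/negbTE; rewrite eq_sym.
  by rewrite big1 // => k _; rewrite mxE mul0r.
have MN q (M : 'M[K]_(q, n.+1)) i j : (M *m N) i j = M i (lift ord0 j).
  rewrite mxE (bigD1 (lift ord0 j)) //= mxE /= eqxx mulr1 big1 ?addr0 // => k ki; rewrite mxE.
  by rewrite (_ : (_ == _) = false) ?mulr0 //; apply/negbTE; move: ki; rewrite -val_eqE.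
have addE a b (X Y : 'M[K]_(a, b)) i j : (X + Y) i j = X i j + Y i j by rewrite mxE.
have oppE a b (X : 'M[K]_(a, b)) i j : (- X) i j = - X i j by rewrite mxE.
have e : block_mx 1%:M N 0 1%:M *m block_mx A B C D *m block_mx 1%:M (- N) 0 1%:M =
    block_mx (A + N *m C) 0 C (D - C *m N).
  rewrite !mulmx_block !mul1mx !mul0mx !mulmx1 !mulmx0 !add0r !addr0 !mulmxN.
  congr (block_mx _ _ _ _); last by rewrite addrC.
  apply/matrixP => i j; rewrite addE oppE MN !addE !NM [RHS]mxE.
  case: unliftP => [i' ->|->]; rewrite !mxE /= /bump /= ?add1n.
    rewrite (_ : c (i'.+1%:Z - j.+1%:Z) = c (i'%:Z - j%:Z)); last by congr c; lia.
    rewrite (_ : c (i'%:Z + j.+1%:Z + 1) = c (i'.+1%:Z + j%:Z + 1)); last by congr c; lia.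
    by ring.
  rewrite !addr0 -cN (_ : - (0%N%:Z - j.+1%:Z) = 0%N%:Z + j%:Z + 1) ?addNr //; lia.
have := congr1 determinant e; rewrite !det_mulmx !det_ublock det_lblock !det1 !mul1r mulr1 => ->.
rewrite mulrA; congr (_ * _); last first.
  congr (\det _).
  apply/matrixP => i j; rewrite addE oppE MN !mxE /= /bump /= add1n.
  by congr (_ - c _); lia.
pose w (i : 'I_n.+1) : K := if i == ord0 then 2 else 1.
have -> : 2 = (\prod_i w i) * (\prod_(i < n.+1) 1).
  rewrite [X in _ * X]big1 // mulr1 (bigD1 ord0) //= big1 => [|i /negbTE i0]; rewrite /w ?i0 //.
  by rewrite eqxx mulr1.
rewrite -det_scale; congr (\det _); apply/matrixP => i j; rewrite mxE addE NM mulr1 /w [RHS]mxE.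
case: unliftP => [i' ->|->] /=; rewrite ?mxE /= /bump /= ?add1n.
  by rewrite mul1r; congr (_ + c _); lia.
by rewrite addr0 -cN (_ : - (0%N%:Z - j%:Z) = 0%N%:Z + j%:Z); [ring|lia].
Qed.

Lemma reversed_m1 m (p : {poly K}) : size p = m.+1 ->
  (\poly_(i < m.+1) p`_(m - i)).[-1] = (-1) ^+ m * p.[-1].
Proof.
move=> sp; rewrite horner_poly horner_coef sp mulr_sumr (reindex_inj rev_ord_inj) /=.
apply: eq_bigr => i _; have hi := ltn_ord i; rewrite subSS subKn // mulrCA; congr (_ * _).
by rewrite -exprD -signr_odd -[RHS]signr_odd; congr (_ ^+ nat_of_bool _); lia.
Qed.

Lemma phi_m1 : (1 + (-1) ^+ 2)%:P - (-1) *: 'X = 2 + 'X :> {poly K}.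
Proof. by rewrite sqrrN expr1n scaleN1r opprK -[1 + 1]/(2 : K) -[in RHS](rmorph_nat polyC). Qed.

(** At [z = -1] the weight factor is [2 + X], and [(2 + X) * (2 - X) = 4 - X^2] yields [pp = q * pm]
    with [q] the value of [p]; the factor [pm] is the one supplied by [toeplitz_even]. *)
Lemma signed_even n (p : {poly K}) : p \is monic -> size p = (n + n).+1 ->
  (forall j, (j < n + n)%N -> \sum_(i < (n + n).+1) p`_i * c (i%:Z - j%:Z) = 0) ->
  (\poly_(i < (n + n).+1) p`_(n + n - i)).[-1] * \det (\matrix_(i < n + n, j < n + n) c (i%:Z - j%:Z)) =
  \det (\matrix_(i < n, j < n) (c (i%:Z - j%:Z) - c (i%:Z + j%:Z + 2))) *
  \det (\matrix_(i < n, j < n) (c (i%:Z - j%:Z) + c (i%:Z + j%:Z + 1))).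
Proof.
move=> mp sp op; have := @szego_pm n p (-1) mp sp op; rewrite toeplitz_even phi_m1.
have -> : (2 + 'X) * (2 - 'X) = 4 - 'X ^+ 2 :> {poly K} by ring.
rewrite reversed_m1 // -signr_odd addnn odd_double expr0 mul1r mulN1r !opprK.
rewrite -(hankel_pp lE cE) -(hankel_pm lE cE); move: (p.[-1]) => q.
set pp := \det _; set pm := \det _; set mp' := \det _ => h.
have k0 : 2 * 2 ^+ n != 0 :> K by rewrite mulf_neq0 ?expf_neq0 ?pnatr_eq0.
have e : pp = q * pm by apply: (mulfI k0); rewrite -mulrA h; ring.
by rewrite e; ring.
Qed.

Lemma signed_odd n (p : {poly K}) : p \is monic -> size p = (n + n.+1).+1 ->
  (forall j, (j < n + n.+1)%N -> \sum_(i < (n + n.+1).+1) p`_i * c (i%:Z - j%:Z) = 0) ->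
  (\poly_(i < (n + n.+1).+1) p`_(n + n.+1 - i)).[-1] *
    \det (\matrix_(i < n + n.+1, j < n + n.+1) c (i%:Z - j%:Z)) =
  \det (\matrix_(i < n, j < n) (c (i%:Z - j%:Z) - c (i%:Z + j%:Z + 2))) *
  \det (\matrix_(i < n.+1, j < n.+1) (c (i%:Z - j%:Z) + c (i%:Z + j%:Z + 1))).
Proof.
move=> mp sp op; have := @szego_mm n p (-1) mp sp op; rewrite phi_m1.
rewrite reversed_m1 // -signr_odd addnS addnn /= odd_double expr1 mulN1r -mulN1r.
have := toeplitz_odd n; rewrite addSn addnn -(hankel_mp lE cE) => t.
have := hankel_mm lE cE (ltn0Sn n); move: (p.[-1]) t => q.
set D := \det _; set mm := \det _; set pp := \det _; set mp' := \det _.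
set H := hankel _ _ _ => t hm hp.
have two : 2 != 0 :> K by rewrite pnatr_eq0.
have k0 : 2 ^+ n.+1 != 0 :> K by rewrite expf_neq0.
have e : 2 * mp' = - q * mm.
  apply: (mulfI k0); transitivity (2 * (2 ^+ n.+1 * mp')); first by ring.
  by rewrite hp; transitivity (- q * (4 * H)); [ring|rewrite -hm; ring].
apply: (mulfI two); transitivity (- q * (2 * D)); first by ring.
by rewrite t; transitivity ((- q * mm) * pp); [ring|rewrite -e; ring].
Qed.

End Szego.

From mathcomp Require Import complex.
From mathcomp Require Import all_classical all_reals all_analysis.
Import numFieldNormedType.Exports.

(** * Taylor series of flows on partitions *)

Section Taylor.
Variable R : realType.
Local Open Scope ring_scope.
Local Open Scope classical_set_scope.
Implicit Types (f g : R -> R) (s t a b : R).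

Lemma is_derive_eq f s a b : is_derive s (1 : R) f a -> a = b -> is_derive s (1 : R) f b.
Proof. by move=> d <-. Qed.

Lemma is_derive_add f g s a b : is_derive s (1 : R) f a -> is_derive s (1 : R) g b ->
  is_derive s (1 : R) (fun x => f x + g x) (a + b).
Proof. exact: is_deriveD. Qed.

Lemma is_derive_mul f g s a b : is_derive s (1 : R) f a -> is_derive s (1 : R) g b ->
  is_derive s (1 : R) (fun x => f x * g x) (a * g s + f s * b).
Proof.
move=> df dg; apply: (is_derive_eq (is_deriveM df dg)).
by rewrite /GRing.scale /= addrC [g s * _]mulrC.
Qed.

Lemma is_derive_const (c : R) s : is_derive s (1 : R) (fun=> c) 0.
Proof. exact: is_derive_cst. Qed.

Lemma is_derive_scal f s a (c : R) : is_derive s (1 : R) f a -> is_derive s (1 : R) (fun x => c * f x) (c * a).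
Proof. by move=> df; apply: (is_derive_eq (is_derive_mul (is_derive_const c s) df)); rewrite mul0r add0r. Qed.

Lemma deriv_sum (I : eqType) (r : seq I) (P : pred I) (F : I -> R -> R) (dF : I -> R) s :
  (forall i, i \in r -> P i -> is_derive s (1 : R) (F i) (dF i)) ->
  is_derive s (1 : R) (fun x => \sum_(i <- r | P i) F i x) (\sum_(i <- r | P i) dF i).
Proof.
elim: r => [|i r IH] dF1.
  by rewrite big_nil (_ : (fun=> _) = fun=> 0); [exact: is_derive_const|apply/funext => x; rewrite big_nil].
have {}IH := IH (fun j jr => dF1 j (mem_behead (s := i :: r) jr)).
rewrite big_cons; case: ifP => Pi.
  rewrite (_ : (fun=> _) = fun x => F i x + \sum_(i <- r | P i) F i x).
    by apply: is_derive_add IH; apply: dF1; rewrite ?mem_head.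
  by apply/funext => x; rewrite big_cons Pi.
by rewrite (_ : (fun=> _) = fun x => \sum_(i <- r | P i) F i x) //; apply/funext => x; rewrite big_cons Pi.
Qed.

Lemma deriv_unique f s a b : is_derive s (1 : R) f a -> is_derive s (1 : R) f b -> a = b.
Proof. by move=> d1 d2; rewrite -(@derive_val _ _ _ _ _ _ _ d1) (@derive_val _ _ _ _ _ _ _ d2). Qed.

Lemma deriv_expR (c : R) s : is_derive s (1 : R) (fun x => expR (c * x)) (c * expR (c * s)).
Proof.
have h := is_derive_scal c (is_derive_id s (1 : R)).
by apply: (is_derive_eq (is_derive1_comp (is_derive_expR (c * s)) h)); rewrite mulr1 mulrC.
Qed.

Lemma taylor_cvg (G : nat -> R -> R) (C D t : R) : 0 <= t -> 0 <= D ->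
  (forall (n : nat) (s : R), is_derive s (1 : R) (G n) (G n.+1 s)) ->
  (forall (n : nat) (s : R), 0 <= s <= t -> `|G n s| <= C * D ^+ n) ->
  series (fun n => t ^+ n / n`!%:R * G n 0) @ \oo --> G 0%N t.
Proof.
move=> t0 D0 dG bG.
pose e k s := (t - s) ^+ k / k`!%:R.
have dpow k (s : R) : is_derive s (1 : R) (e k.+1) (- e k s).
  have k0 : k.+1%:R != 0 :> R by rewrite pnatr_eq0.
  have f0 : k`!%:R != 0 :> R by rewrite pnatr_eq0 -lt0n fact_gt0.
  have d1 : is_derive s (1 : R) (fun x => t - x) (0 - 1).
    by apply: is_deriveB.
  have d2 := @is_deriveX _ _ _ k.+1 _ _ _ d1; rewrite exprfctE in d2.
  apply: (is_derive_eq (is_derive_mul d2 (is_derive_const _ s))).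
  rewrite /GRing.scale /= /e factS natrM; move: (k.+1%:R) k0 (k`!%:R) f0 => a k0 b f0.
  by field; rewrite f0 k0.
(* The Taylor polynomial at a moving base point [s], taken at [t]. Its derivative in [s] telescopes
   to a single term, bounded by the mean value theorem between [s = 0], the partial sum, and
   [s = t], the value. *)
pose psi N (s : R) := \sum_(0 <= k < N) e k s * G k s.
have dpsi N (s : R) : is_derive s (1 : R) (psi N.+1) (e N s * G N.+1 s).
  elim: N => [|N IH].
    have -> : psi 1%N = G 0%N.
      by apply/funext => x; rewrite /psi big_nat1 /e expr0 divr1 mul1r.
    by rewrite /e expr0 divr1 mul1r; apply: dG.
  have -> : psi N.+2 = fun s => psi N.+1 s + e N.+1 s * G N.+1 s.
    by apply/funext => x; rewrite /psi big_nat_recr.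
  by apply: (is_derive_eq (is_derive_add IH (is_derive_mul (dpow N s) (dG N.+1 s)))); ring.
rewrite -cvg_shiftS.
have ee N : series (fun n => t ^+ n / n`!%:R * G n 0) N.+1 = psi N.+1 0.
  by rewrite /series /=; apply: eq_bigr => k _; rewrite /e subr0.
have psit N : psi N.+1 t = G 0%N t.
  rewrite /psi big_nat_recl //= /e subrr expr0 divr1 mul1r big1 ?addr0 // => k _.
  by rewrite expr0n /= !mul0r.
have bound N : `|psi N.+1 0 - G 0%N t| <= C * D * t * exp_coeff (t * D) N.
  have [c /andP[c0 ct]] : exists2 c, c \in `[0, t]%R & psi N.+1 t - psi N.+1 0 =
      (e N c * G N.+1 c) * (t - 0).
    apply: MVT_segment => //; apply: continuous_subspaceT => x; apply: differentiable_continuous.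
    by apply/derivable1_diffP; have [] := dpsi N x.
  rewrite psit subr0 distrC => ->; rewrite !normrM (ger0_norm t0).
  have tc : 0 <= t - c by rewrite subr_ge0.
  rewrite normrX (ger0_norm tc) normfV normr_nat /exp_coeff /= exprMn.
  have := bG N.+1 c; rewrite !bnd_simp in c0 ct; rewrite c0 ct => /(_ isT) bc.
  apply: (@le_trans _ _ (t ^+ N / N`!%:R * (C * D ^+ N.+1) * t)).
    apply: ler_wpM2r => //; apply: ler_pM => //.
      by rewrite mulr_ge0 ?exprn_ge0 ?invr_ge0.
    by apply: ler_wpM2r; rewrite ?invr_ge0 // lerXn2r ?nnegrE // lerBlDr lerDl.
  by rewrite exprS le_eqVlt; apply/orP; left; apply/eqP; ring.
have cvg0 : (fun N => C * D * t * exp_coeff (t * D) N) @ \oo --> (0 : R).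
  rewrite -(mulr0 (C * D * t)); apply: cvgMr; apply: cvg_series_cvg_0.
  exact: is_cvg_series_exp_coeff.
rewrite (_ : [sequence _]_ _ = fun N => psi N.+1 0); last by apply/funext => N; rewrite /= ee.
have lo : (fun N => - (C * D * t * exp_coeff (t * D) N)) @ \oo --> (0 : R).
  by rewrite -oppr0; apply: cvgN.
suff /subr_cvg0 : (fun N => psi N.+1 0 - G 0%N t) @ \oo --> (0 : R) by [].
apply: (squeeze_cvgr _ lo cvg0).
by apply: nearW => N; rewrite -ler_norml; exact: bound.
Qed.

(* [expands t f]: f is the sum of its Taylor series at 0 on [0, t], for the simple
   reason that its derivatives grow at most geometrically. *)
Definition expands t f : Prop := exists G : nat -> R -> R, [/\ G 0%N = f,
  forall (n : nat) (s : R), is_derive s (1 : R) (G n) (G n.+1 s) &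
  exists C D : R, [/\ 0 <= C, 0 <= D & forall (n : nat) (s : R), 0 <= s <= t -> `|G n s| <= C * D ^+ n]].

Lemma expands_cst t c : expands t (fun=> c).
Proof.
exists (fun n _ => c *+ (n == 0%N)); split=> //; first by move=> [|n] s; exact: is_derive_const.
exists `|c|, 1; split=> // n s _; rewrite expr1n mulr1; case: n => [|n] //=.
by rewrite normr0.
Qed.

Lemma expands_expR t c : expands t (fun s => expR (c * s)).
Proof.
exists (fun n s => c ^+ n * expR (c * s)); split=> //.
- by apply/funext => s; rewrite expr0 mul1r.
- by move=> n s; rewrite exprSr -mulrA; apply: is_derive_scal; exact: deriv_expR.
exists (expR (`|c| * t)), `|c|; split => [||n s /andP[s0 st]]; rewrite ?expR_ge0 //.
rewrite normrM normrX mulrC; apply: ler_wpM2r; first exact: exprn_ge0.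
rewrite ger0_norm ?expR_ge0 // ler_expR (le_trans (ler_norm _)) // normrM ler_wpM2l //.
by rewrite ger0_norm.
Qed.

Lemma expandsD t f g : expands t f -> expands t g -> expands t (fun s => f s + g s).
Proof.
move=> [F [<- dF [C [D [C0 D0 bF]]]]] [G [<- dG [C' [D' [C0' D0' bG]]]]].
exists (fun n s => F n s + G n s); split=> [//|n s|]; first exact: is_derive_add.
exists (C + C'), (D + D'); split=> [||n s st]; rewrite ?addr_ge0 //.
apply: le_trans (ler_normD _ _) _; rewrite mulrDl lerD //.
  by apply: (le_trans (bF n s st)); rewrite ler_wpM2l // lerXn2r ?nnegrE ?addr_ge0 // lerDl.
by apply: (le_trans (bG n s st)); rewrite ler_wpM2l // lerXn2r ?nnegrE ?addr_ge0 // lerDr.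
Qed.

Lemma expandsM t f g : expands t f -> expands t g -> expands t (fun s => f s * g s).
Proof.
move=> [F [<- dF [C [D [C0 D0 bF]]]]] [G [<- dG [C' [D' [C0' D0' bG]]]]].
exists (fun n s => \sum_(i < n.+1) (F (n - i)%N s * G i s) *+ 'C(n, i)); split=> [|n s|].
- by apply/funext => s; rewrite big_ord1 subn0.
- have h (i : 'I_n.+1) : i \in index_enum 'I_n.+1 -> true -> is_derive s (1 : R) (fun x => (F (n - i)%N x * G i x) *+ 'C(n, i))
      ('C(n, i)%:R * (F (n - i).+1 s * G i s + F (n - i)%N s * G i.+1 s)).
    move=> _ _; rewrite [X in is_derive _ _ X _](_ : _ =
       fun s => 'C(n, i)%:R * (F (n - i)%N s * G i s)); last by apply/funext => x; rewrite mulr_natl.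
    exact/is_derive_scal/is_derive_mul.
  apply: (is_derive_eq (deriv_sum h)).
  rewrite [RHS]big_ord_recl /= subn0 bin0.
  under [X in _ + X]eq_bigr => i _ do rewrite /bump add1n subSS binS mulrnDr.
  rewrite big_split /= addrA.
  under eq_bigr => i _ do rewrite mulrDr.
  rewrite big_split /=; congr (_ + _).
    rewrite big_ord_recl /= subn0 bin0 mul1r; congr (_ + _).
    rewrite [RHS]big_ord_recr /= bin_small // mulr0n addr0; apply: eq_bigr => i _.
    by rewrite /bump add1n mulr_natl -subSn // subSS.
  by apply: eq_bigr => i _; rewrite mulr_natl.
exists (C * C'), (D + D'); split=> [||n s st]; rewrite ?mulr_ge0 ?addr_ge0 //.
apply: le_trans (ler_norm_sum _ _ _) _; rewrite exprDn mulr_sumr; apply: ler_sum => i _.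
rewrite normrMn mulrnAr lerMn2r; apply/orP; right; rewrite normrM.
rewrite [leRHS](_ : _ = (C * D ^+ (n - i)) * (C' * D' ^+ i)); last by ring.
by apply: ler_pM; rewrite ?bF ?bG.
Qed.

Lemma expandsZ t c f : expands t f -> expands t (fun s => c * f s).
Proof. by apply: expandsM; exact: expands_cst. Qed.

Lemma expands_sum t (I : Type) (r : seq I) (F : I -> R -> R) :
  (forall i, expands t (F i)) -> expands t (fun s => \sum_(i <- r) F i s).
Proof.
move=> h; elim: r => [|i r IH].
  by rewrite (_ : (fun=> _) = fun=> 0); [exact: expands_cst|apply/funext => s; rewrite big_nil].
rewrite (_ : (fun=> _) = fun s => F i s + \sum_(i <- r) F i s); first exact: expandsD.
by apply/funext => s; rewrite big_cons.
Qed.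

End Taylor.

(** * Transfer operators and their solutions *)

Section Chamber.
Variable (R : realType) (l : nat).
Local Open Scope ring_scope.
Implicit Types (m : nat -> nat) (phi : (nat -> nat) -> R).

Definition chamber m : Prop :=
  (forall c, (m c.+1 <= m c)%N) /\ (forall c, (l <= c)%N -> m c = 0%N).

Lemma chamber_inc m c : chamber m -> (c < l)%N -> (c == 0%N) || (m c < m c.-1)%N ->
  chamber (inc c m).
Proof.
move=> [h1 h2] cl h; split=> [d|d ld]; last by rewrite /inc h2 //; have -> : (d == c) = false by lia.
rewrite /inc; have := h1 d; case: eqP => [e|]; case: eqP => e' ; try lia.
by move: h; rewrite -e /=; lia.
Qed.

Lemma chamber_dec m c : chamber m -> (m c.+1 < m c)%N -> chamber (dec c m).
Proof.
move=> [h1 h2] h; split=> [d|d ld]; last by rewrite /dec h2.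
by rewrite /dec; have := h1 d; case: eqP => [e|]; case: eqP => e'; subst; lia.
Qed.

(** The operator looks only inside the chamber and commutes with differentiation in a parameter, so
    it can act on solutions controlled there only. *)
Definition transfer (A : ((nat -> nat) -> R) -> (nat -> nat) -> R) : Prop :=
  (forall phi psi, (forall m, chamber m -> phi m = psi m) -> forall m, chamber m -> A phi m = A psi m) /\
  (forall (phi dphi : R -> (nat -> nat) -> R) s,
     (forall m, chamber m -> is_derive s (1 : R) (phi^~ m) (dphi s m)) ->
     forall m, chamber m -> is_derive s (1 : R) (fun x => A (phi x) m) (A (dphi s) m)).

Lemma transfer_up : transfer (step_up l).
Proof.
split=> [phi psi h m chm|phi dphi s h m chm].
  rewrite /step_up big_nat_cond [RHS]big_nat_cond; apply: eq_bigr => c /andP[/andP[_ cl] hc].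
  by apply: h; apply: chamber_inc.
have d c : c \in index_iota 0 l -> (c == 0%N) || (m c < m c.-1)%N ->
    is_derive s (1 : R) (fun x => phi x (inc c m)) (dphi s (inc c m)).
  by rewrite mem_index_iota => /andP[_ cl] hc; apply: h; apply: chamber_inc.
have d2 := deriv_sum d.
exact: d2.
Qed.

Lemma transfer_down : transfer (step_down l).
Proof.
split=> [phi psi h m chm|phi dphi s h m chm].
  by rewrite /step_down; apply: eq_bigr => c hc; apply: h; apply: chamber_dec.
by apply: deriv_sum => c _ hc; apply: h; apply: chamber_dec.
Qed.

Lemma transfer_updown kappa : transfer (updown l kappa).
Proof.
have [u1 u2] := transfer_up; have [d1 d2] := transfer_down.
split=> [phi psi h m chm|phi dphi s h m chm].
  by rewrite /updown (u1 _ _ h) // (d1 _ _ h) // h.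
apply: is_derive_add; last exact/is_derive_scal/h.
by apply: is_derive_add; [exact: u2|exact: d2].
Qed.

(** Applying [A] to a solution differentiates it, so the walk sums at the empty partition are the
    derivatives of [g] at time [0]. *)
Lemma walk_cvg A (g : R -> (nat -> nat) -> R) psi t : 0 <= t -> transfer A ->
  (forall m s, chamber m -> is_derive s (1 : R) (g^~ m) (A (g s) m)) ->
  (forall m, chamber m -> g 0 m = psi m) -> expands t (g^~ (fun=> 0%N)) ->
  (series (fun n => t ^+ n / n`!%:R * iter n A psi (fun=> 0%N)) @ \oo --> g t (fun=> 0%N))%classic.
Proof.
move=> t0 [Aext Ader] dg g0 [G [G0 dG [C [D [_ D0 bG]]]]].
have dA n m s : chamber m ->
    is_derive s (1 : R) (fun x => iter n A (g x) m) (iter n.+1 A (g s) m).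
  elim: n m => [|n IH] m chm; first exact: dg.
  by apply: (Ader (fun x => iter n A (g x)) (fun x => iter n.+1 A (g x))).
have Gn n : G n = fun s => iter n A (g s) (fun=> 0%N).
  elim: n => [//|n IH]; apply/funext => s.
  by have := dG n s; rewrite IH => d; apply: (deriv_unique d); apply: dA.
have Apsi n m : chamber m -> iter n A psi m = iter n A (g 0) m.
  by elim: n m => [m chm|n IH m chm]; [rewrite /= g0|apply: Aext].
have := taylor_cvg t0 D0 dG bG; rewrite G0.
rewrite (_ : (fun n => _ * G n 0) = fun n => t ^+ n / n`!%:R * iter n A psi (fun=> 0%N)) //.
by apply/funext => n; rewrite Gn Apsi.
Qed.

Lemma walk_series A (g : R -> (nat -> nat) -> R) psi t : 0 <= t -> transfer A ->
  (forall m s, chamber m -> is_derive s (1 : R) (g^~ m) (A (g s) m)) ->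
  (forall m, chamber m -> g 0 m = psi m) -> expands t (g^~ (fun=> 0%N)) ->
  limn (series (fun n => t ^+ n / n`!%:R * iter n A psi (fun=> 0%N))) = g t (fun=> 0%N).
Proof. by move=> t0 tA dg g0 eg; apply/cvg_lim => //; exact: walk_cvg. Qed.

End Chamber.

Section Leibniz.
Variables (K : comNzRingType) (T1 T2 : Type).

(** The derivation induced by the step [D]: one entry of the list moves at a time. *)
Fixpoint psum (T : Type) (D : T -> seq T) (F : seq T -> K) s : K :=
  if s is y :: s' then \sum_(z <- D y) F (z :: s') + psum D (fun u => F (y :: u)) s' else 0.

Lemma psumZ (T : Type) (D : T -> seq T) c (F : seq T -> K) s :
  psum D (fun u => c * F u) s = c * psum D F s.
Proof. by elim: s F => [|y s IH] F /=; rewrite ?mulr0 // IH mulrDr mulr_sumr. Qed.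

Lemma psumB (T : Type) (D : T -> seq T) (F G : seq T -> K) s :
  psum D (fun u => F u - G u) s = psum D F s - psum D G s.
Proof. by elim: s F G => [|y s IH] F G /=; rewrite ?subr0 // IH sumrB; ring. Qed.

Lemma dsum_leibniz (D1 : T1 -> seq T1) (D2 : T2 -> seq T2) (W W' : T1 -> T2 -> K) x F s :
  (forall y, W' x y = \sum_(z <- D1 x) W z y + \sum_(z <- D2 y) W x z) ->
  dsum W' x F s + dsum W x (psum D2 F) s =
  \sum_(z <- D1 x) dsum W z F s + psum D2 (dsum W x F) s.
Proof.
move=> hW; elim: s F => [|y s IH] F /=.
  by rewrite !addr0 big1.
rewrite sumrB psumB psumZ dsumD dsum_bigsum sumrB.
have := IH (fun u => F (y :: u)); set A := dsum W' _ _ _; set B := dsum W x _ s.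
set C := \sum_(z <- _) dsum _ _ _ _; set E := psum _ _ _ => h.
rewrite hW mulrDl !mulr_suml.
rewrite (_ : A = C + E - B); last by rewrite -h addrK.
set X := \sum_(z <- D2 y) dsum _ _ _ _; ring.
Qed.

Lemma dsum_psum (T : Type) (W : T1 -> T2 -> K) (D : T -> seq T) x (G : seq T -> seq T2 -> K) ps qs :
  dsum W x (fun u => psum D (fun v => G v u) ps) qs = psum D (fun v => dsum W x (G v) qs) ps.
Proof.
elim: ps G => [|p ps IH] G /=; first exact: dsum0.
by rewrite dsumD (dsum_bigsum W x (D p) (fun z => G (z :: ps))) IH.
Qed.

End Leibniz.

Lemma psum_map_iota (K : comNzRingType) (T : Type) (D : T -> seq T) (F : seq T -> K) h k l :
  psum D F (map h (iota k l)) =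
  \sum_(k <= c < k + l) \sum_(y <- D (h c)) F (map (fun i => if i == c then y else h i) (iota k l)).
Proof.
elim: l k F => [|l IH] k F /=; first by rewrite addn0 big_geq.
rewrite big_ltn; last by lia.
congr (_ + _).
  apply: eq_bigr => y _; rewrite eqxx; congr (F (y :: _)).
  by apply/eq_in_map => i; rewrite mem_iota => /andP[ki _]; case: eqP => // e; lia.
rewrite IH addSnnS !big_nat; apply: eq_bigr => c /andP[kc _]; apply: eq_bigr => y _.
by have -> : (k == c) = false by lia.
Qed.

Section DerivDsum.
Variable R : realType.

Lemma deriv_dsum (T1 T2 : Type) (W : R -> T1 -> T2 -> R) (W' : T1 -> T2 -> R) (F : R -> seq T2 -> R) F' s x u :
  (forall y, is_derive s (1 : R) (fun t => W t x y) (W' x y)) ->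
  (forall v, is_derive s (1 : R) (F^~ v) (F' v)) ->
  is_derive s (1 : R) (fun t => dsum (W t) x (F t) u) (dsum W' x (F s) u + dsum (W s) x F' u).
Proof.
move=> hW; elim: u F F' => [|y u IH] F F' hF /=.
  by rewrite addr0; exact: is_derive_const.
have h1 := is_derive_mul (hW y) (hF u).
have h2 := IH (fun t v => F t (y :: v)) _ (fun v => hF (y :: v)).
have -> : (fun t => W t x y * F t u - dsum (W t) x (fun v => F t (y :: v)) u) =
    (fun t => W t x y * F t u + -1 * dsum (W t) x (fun v => F t (y :: v)) u).
  by apply/funext => t; rewrite mulN1r.
by apply: (is_derive_eq (is_derive_add h1 (is_derive_scal (-1) h2))); ring.
Qed.

Lemma deriv_pfn (T : Type) (D : T -> seq T) (W : R -> T -> T -> R) s n u :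
  (forall x y, is_derive s (1 : R) (fun t => W t x y)
     (\sum_(z <- D x) W s z y + \sum_(z <- D y) W s x z)) ->
  is_derive s (1 : R) (fun t => pfn (W t) n u) (psum D (pfn (W s) n) u).
Proof.
move=> hW; elim: n u => [|n IH] [|x u] /=; try exact: is_derive_const.
  apply: (is_derive_eq (is_derive_const _ _)); rewrite big1 // add0r.
  by elim: u => //= y u IH; rewrite -IH addr0 big1.
apply: (is_derive_eq (deriv_dsum u (hW x) IH)).
exact: (@dsum_leibniz _ _ _ D D (W s) (fun x y => \sum_(z <- D x) W s z y + \sum_(z <- D y) W s x z)).
Qed.

Lemma deriv_detl (T1 T2 : Type) (D : T1 -> seq T1) (W : R -> T1 -> T2 -> R) s ps qs :
  (forall x y, is_derive s (1 : R) (fun t => W t x y) (\sum_(z <- D x) W s z y)) ->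
  is_derive s (1 : R) (fun t => detl (W t) ps qs) (psum D (fun u => detl (W s) u qs) ps).
Proof.
move=> hW; elim: ps qs => [|p ps IH] qs /=; first exact: is_derive_const.
apply: (is_derive_eq (@deriv_dsum _ _ _ (fun x y => \sum_(z <- D x) W s z y) _ _ _ _ qs (hW p) IH)).
rewrite (dsum_psum (W s) D p (fun v u => detl (W s) v u)); congr (_ + _).
have := @dsum_leibniz _ _ _ D (fun=> [::]) (W s) (fun x y => \sum_(z <- D x) W s z y) p
  (detl (W s) ps) qs.
have e F (u : seq T2) : psum (fun=> [::]) F u = 0 :> R.
  by elim: u F => //= y u IHu F; rewrite big_nil IHu addr0.
rewrite (@dsum_ext _ _ _ (W s) p (psum (fun=> [::]) (detl (W s) ps)) (fun=> 0)) => [|u]; last exact: e.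
rewrite dsum0 e !addr0 => -> // y.
by rewrite big_nil addr0.
Qed.

Lemma expands_dsum t (T1 T2 : Type) (W : R -> T1 -> T2 -> R) (F : R -> seq T2 -> R) x u :
  (forall y, expands t (fun s => W s x y)) -> (forall v, expands t (F^~ v)) ->
  expands t (fun s => dsum (W s) x (F s) u).
Proof.
move=> hW; elim: u F => [|y u IH] F hF /=; first exact: expands_cst.
have h := IH (fun t v => F t (y :: v)) (fun v => hF (y :: v)).
have -> : (fun s => W s x y * F s u - dsum (W s) x (fun v => F s (y :: v)) u) =
    (fun s => W s x y * F s u + -1 * dsum (W s) x (fun v => F s (y :: v)) u).
  by apply/funext => s; rewrite mulN1r.
by apply: expandsD; [exact: expandsM|exact: expandsZ].
Qed.

Lemma expands_pfn t (T : Type) (W : R -> T -> T -> R) n u :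
  (forall x y, expands t (fun s => W s x y)) -> expands t (fun s => pfn (W s) n u).
Proof.
move=> hW; elim: n u => [|n IH] [|x u] /=; try exact: expands_cst.
by apply: expands_dsum => // v; exact: IH.
Qed.

Lemma expands_detl t (T1 T2 : Type) (W : R -> T1 -> T2 -> R) ps qs :
  (forall x y, expands t (fun s => W s x y)) -> expands t (fun s => detl (W s) ps qs).
Proof.
move=> hW; elim: ps qs => [|p ps IH] qs /=; first exact: expands_cst.
by apply: expands_dsum => // v; exact: IH.
Qed.

End DerivDsum.

Section AlternatingWalks.
Variables (R : realType) (T : Type) (f : seq T -> R) (e : nat -> T) (pre : seq T) (b l : nat).
Hypothesis af : is_alternating f.

(* Strictly decreasing positions attached to a partition with [l] columns. *)
Definition position (m : nat -> nat) c := (m c + (l - c.+1) + b)%N.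
Definition at_positions m := f (pre ++ mkseq (fun c => e (position m c)) l).

Let moved m c k := f (pre ++ mkseq (fun i => if i == c then e k else e (position m i)) l).

Lemma alternating_mkseq h c : (c.+1 < l)%N -> h c = h c.+1 -> f (pre ++ mkseq h l) = 0.
Proof.
move=> cl hc; rewrite /mkseq (_ : l = c + (2 + (l - c.+2)))%N; last by lia.
rewrite !iotaD !map_cat catA /= add0n hc; exact: alternating_dup.
Qed.

(** A forbidden addition would bring two positions together, where an alternating function vanishes;
    so free moves already sum to the walk on partitions. *)
Lemma up_positions m : chamber l m ->
  \sum_(0 <= c < l) moved m c (position m c).+1 = step_up l at_positions m.
Proof.
move=> [m1 m2]; rewrite /step_up [RHS]big_mkcond /= !big_nat; apply: eq_bigr => c /andP[_ cl].
case: ifPn => [_|].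
  congr (f (pre ++ _)); apply: eq_mkseq => i; rewrite /position /inc.
  by case: eqP => [->|_]; congr (e _); lia.
rewrite negb_or -leqNgt => /andP[c0 mc]; apply: (@alternating_mkseq _ c.-1); first by lia.
rewrite prednK ?lt0n // eqxx; have -> : (c.-1 == c) = false by lia.
by congr (e _); rewrite /position; have := m1 c.-1; rewrite prednK ?lt0n //; lia.
Qed.

(** Only the lowest position has no neighbour below it; when the last column is empty, its step to
    [b.-1] is left over. *)
Lemma down_positions m : chamber l m ->
  \sum_(0 <= c < l) moved m c (position m c).-1 = step_down l at_positions m +
  (if (0 < l)%N && (m l.-1 == 0%N) then moved m l.-1 b.-1 else 0).
Proof.
move=> [m1 m2]; rewrite /step_down [in RHS]big_mkcond /=.
case: (posnP l) => [l0|l0]; first by rewrite l0 !big_geq // addr0.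
have ok c : (m c.+1 < m c)%N -> moved m c (position m c).-1 = at_positions (dec c m).
  move=> h; congr (f (pre ++ _)); apply: eq_mkseq => i; rewrite /position /dec.
  by case: eqP => [->|_]; congr (e _); lia.
rewrite -[l in \sum_(0 <= c < l) moved m c _](prednK l0).
rewrite -[l in X in _ = X + _](prednK l0) !big_nat_recr //= -addrA; congr (_ + _).
  rewrite !big_nat; apply: eq_bigr => c /andP[_ cl]; case: ifPn => [/ok //|].
  rewrite -leqNgt => h; apply: (@alternating_mkseq _ c); first by lia.
  have -> : (c.+1 == c) = false by lia.
  by rewrite eqxx; congr (e _); rewrite /position; have := m1 c; lia.
have e0 : m l.-1.+1 = 0%N by apply: m2; rewrite prednK.
rewrite e0; case: (posnP (m l.-1)) => [h|h].
  by rewrite add0r /position h prednK // subnn.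
by rewrite addr0 ok // e0.
Qed.

Lemma psum_up D m : (forall x, (b <= x)%N -> D (e x) = [:: e x.+1]) -> chamber l m ->
  psum D (fun u => f (pre ++ u)) (mkseq (fun c => e (position m c)) l) = step_up l at_positions m.
Proof.
move=> hD chm; rewrite psum_map_iota add0n -up_positions //.
by apply: eq_bigr => c _; rewrite hD ?leq_addl // big_seq1.
Qed.

Lemma psum_updown D m : (forall x, (b <= x)%N -> D (e x) = [:: e x.+1; e x.-1]) -> chamber l m ->
  psum D (fun u => f (pre ++ u)) (mkseq (fun c => e (position m c)) l) =
  step_up l at_positions m + step_down l at_positions m +
  (if (0 < l)%N && (m l.-1 == 0%N) then moved m l.-1 b.-1 else 0).
Proof.
move=> hD chm; rewrite psum_map_iota add0n -addrA -down_positions // -up_positions //.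
rewrite -big_split /=; apply: eq_bigr => c _.
by rewrite hD ?leq_addl // !big_cons big_nil addr0.
Qed.

(* With [b = 1] the lowest position would drop to 0, where the weight vanishes. *)
Lemma psum_killed D m : (forall x, (b <= x)%N -> D (e x) = [:: e x.+1; e x.-1]) -> chamber l m -> b = 1%N ->
  (forall u, f (u ++ [:: e 0%N]) = 0) ->
  psum D (fun u => f (pre ++ u)) (mkseq (fun c => e (position m c)) l) =
  step_up l at_positions m + step_down l at_positions m.
Proof.
move=> hD chm b1 f0; rewrite psum_updown //; case: ifP => [/andP[l0 _]|]; last by rewrite addr0.
rewrite /moved b1 -[l in mkseq _ l](prednK l0) mkseqS eqxx /= -cats1 catA f0 addr0 //.
Qed.

(* With [b = 0] a step down from position 0 stays put. *)
Lemma psum_stay D m : (forall x, (b <= x)%N -> D (e x) = [:: e x.+1; e x.-1]) -> chamber l m -> b = 0%N ->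
  psum D (fun u => f (pre ++ u)) (mkseq (fun c => e (position m c)) l) =
  step_up l at_positions m + step_down l at_positions m + stay 1 true l m * at_positions m.
Proof.
move=> hD chm b0; rewrite psum_updown // /stay mul1r /=; case: ifP => [/andP[l0 /eqP m0]|_].
  rewrite mul1r; congr (_ + f (pre ++ _)); apply: eq_mkseq => i; case: eqP => // ->.
  by rewrite /position m0 prednK // subnn b0.
by rewrite mul0r.
Qed.

End AlternatingWalks.

(** * Explicit flows from Bessel moments *)

Section MomentFlow.
Variables (R : realType) (mu : R -> nat -> R).
Hypothesis dmu : forall (s : R) i, is_derive s (1 : R) (mu^~ i) (mu s i.+1).
Hypothesis emu : forall t i, expands t (mu^~ i).
Hypothesis mu0 : forall n : nat, expect (mu 0) (chebC 'X n) = 2 * (n == 0%N)%:R.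

Lemma expect_mulX (nu : nat -> R) P : expect nu ('X * P) = expect (fun i => nu i.+1) P.
Proof.
have [->|P0] := eqVneq P 0; first by rewrite mulr0 /expect size_poly0 !big_ord0.
rewrite (@expect_wide _ nu ('X * P) (size P).+1); last by rewrite mulrC size_mulX.
rewrite big_ord_recl coefXM mul0r add0r; apply: eq_bigr => i _.
by rewrite coefXM /=.
Qed.

Lemma deriv_expect s P : is_derive s (1 : R) (fun x => expect (mu x) P) (expect (mu s) ('X * P)).
Proof. by rewrite expect_mulX; apply: deriv_sum => i _ _; exact/is_derive_scal. Qed.

Lemma expands_expect t P : expands t (fun x => expect (mu x) P).
Proof. by apply: expands_sum => i; exact/expandsZ. Qed.

Local Notation E s := (expect (mu s)).
Let lE s : poly_linear (E s). Proof. exact: poly_linear_expect. Qed.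

Lemma expect0_U n : E 0 (chebU 'X (Posz n)) = (odd n)%:R.
Proof.
suff H : E 0 (chebU 'X n) = (odd n)%:R /\ E 0 (chebU 'X n.+1) = (odd n.+1)%:R by case: H.
elim: n => [|n [h1 h2]].
  split; first exact: (poly_linear0 (lE 0)).
  have := mu0 0%N; rewrite (_ : chebC 'X 0%N = 2 *: (1 : {poly R})); last by rewrite scaler_nat.
  by rewrite (poly_linearZ (lE 0)) => /mulfI; apply; rewrite pnatr_eq0.
split=> //; rewrite (_ : chebU 'X n.+2 = chebC 'X n.+1 + chebU 'X n).
  by rewrite (poly_linearD (lE 0)) mu0 /= mulr0 add0r h1 negbK.
have := @chebU_CE _ ('X : {poly R}) n.+1.
rewrite (_ : Posz n.+1 + 1 = n.+2) 1?(_ : Posz n.+1 - 1 = n); [move=> <-; ring|lia|lia].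
Qed.

Section Orthogonal.
Variable al : R.
Local Notation phi := ((1 + al ^+ 2)%:P + al *: 'X).

(** The combination of the two exponential solutions of [g_b' = g_(b+1)] that starts at [1] for even
    [b] and at [al] for odd [b]. *)
Definition borderO (s : R) (b : nat) : R :=
  2^-1 * (1 + al) * expR s + 2^-1 * (1 - al) * expR (- s) * (-1) ^+ b.

(* Index [0] is the extra row of an odd Pfaffian, [a.+1] the position [a]. *)
Definition weightO (s : R) (i j : nat) : R :=
  match i, j with
  | 0%N, 0%N => 0
  | 0%N, b.+1 => borderO s b
  | a.+1, 0%N => - borderO s a
  | a.+1, b.+1 => 2^-1 * E s (phi * chebU 'X (a%:Z - b%:Z)) +
      4^-1 * (1 - al ^+ 2) * ((-1) ^+ b - (-1) ^+ a)
  end.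

Definition stepO (i : nat) : seq nat := if i is a.+1 then [:: a.+2] else [::].

Lemma weightO_skew s i j : weightO s i j = - weightO s j i.
Proof.
case: i j => [|i] [|j] /=; rewrite ?oppr0 ?opprK //.
rewrite -[in RHS]opprB chebUN mulrN (poly_linearN (lE s)); ring.
Qed.

Lemma deriv_borderO s b : is_derive s (1 : R) (borderO^~ b) (borderO s b.+1).
Proof.
have d1 := is_derive_scal (2^-1 * (1 + al)) (deriv_expR 1 s).
have d2 := is_derive_scal (2^-1 * (1 - al) * (-1) ^+ b) (deriv_expR (-1) s).
rewrite (_ : borderO^~ b = fun x => 2^-1 * (1 + al) * expR (1 * x) +
   2^-1 * (1 - al) * (-1) ^+ b * expR (-1 * x)).
  by apply: (is_derive_eq (is_derive_add d1 d2)); rewrite /borderO exprS !mul1r !mulN1r; ring.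
by apply/funext => x; rewrite /borderO !mul1r !mulN1r; ring.
Qed.

Lemma deriv_weightO s i j : is_derive s (1 : R) (fun x => weightO x i j)
  (\sum_(z <- stepO i) weightO s z j + \sum_(z <- stepO j) weightO s i z).
Proof.
case: i j => [|i] [|j] /=; rewrite ?big_seq1 ?big_nil ?addr0 ?add0r.
- exact: is_derive_const.
- exact: deriv_borderO.
- have -> : (fun x => - borderO x i) = (fun x => -1 * borderO x i) by apply/funext => x; rewrite mulN1r.
  by apply: (is_derive_eq (is_derive_scal (-1) (deriv_borderO s i))); rewrite mulN1r.
have d1 := is_derive_scal 2^-1 (deriv_expect s (phi * chebU 'X (i%:Z - j%:Z))).
have d2 := is_derive_add d1 (is_derive_const (4^-1 * (1 - al ^+ 2) * ((-1) ^+ j - (-1) ^+ i)) s).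
apply: (is_derive_eq d2); rewrite addr0 -/(E s) mulrCA -(@chebyshev_cheb _ ('X : {poly R})) mulrDr.
rewrite (poly_linearD (lE s)) /weightO ![(-1) ^+ _.+1]exprS.
rewrite (_ : i.+1%:Z - j%:Z = i%:Z - j%:Z + 1); last by lia.
rewrite (_ : i%:Z - j.+1%:Z = i%:Z - j%:Z - 1); last by lia.
rewrite -/(chebU _ _); ring.
Qed.

Lemma expands_borderO t b : expands t (borderO^~ b).
Proof.
rewrite (_ : borderO^~ b = fun x => 2^-1 * (1 + al) * expR (1 * x) +
   2^-1 * (1 - al) * (-1) ^+ b * expR (-1 * x)).
  by apply: expandsD; apply: expandsZ; exact: expands_expR.
by apply/funext => x; rewrite /borderO !mul1r !mulN1r; ring.
Qed.

Lemma expands_weightO t i j : expands t (fun x => weightO x i j).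
Proof.
case: i j => [|i] [|j] /=; first exact: expands_cst.
- exact: expands_borderO.
- have -> : (fun x => - borderO x i) = (fun x => -1 * borderO x i) by apply/funext => x; rewrite mulN1r.
  exact/expandsZ/expands_borderO.
by apply: expandsD; [apply: expandsZ; exact: expands_expect|exact: expands_cst].
Qed.

Definition rowO (i : nat) : R := if i is a.+1 then al ^+ (~~ odd a) else 1.
Definition colO (i : nat) : R := if i is a.+1 then al ^+ odd a else 1.

(** At time [0] the kernel is a product for decreasing positions, so [pfn_zigzag] evaluates the
    Pfaffian to [odd_weight]. The alternating term of [weightO], which the steps annihilate, is
    there to achieve this. *)
Lemma weightO_start i j : (0 < j)%N -> (i == 0%N) || (j < i)%N -> weightO 0 i j = rowO i * colO j.
Proof.
case: i j => [|a] [|b] //= _ ab.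
  rewrite /borderO oppr0 expR0 mul1r -[(-1) ^+ b]signr_odd; case: (odd b); rewrite ?expr0 ?expr1.
    by field.
  by field.
rewrite ltnS in ab; rewrite (_ : a%:Z - b%:Z = (a - b)%N); last by lia.
rewrite mulrDl (poly_linearD (lE 0)) mul_polyC -scalerAl !(poly_linearZ (lE 0)).
rewrite -(@chebyshev_cheb _ ('X : {poly R})) (poly_linearD (lE 0)) -/(chebU _ _).
rewrite (_ : Posz (a - b) + 1 = (a - b).+1) 1?(_ : Posz (a - b) - 1 = (a - b).-1); [|lia|lia].
rewrite -/(chebU _ _) !expect0_U -[(-1) ^+ b]signr_odd -[(-1) ^+ a]signr_odd /=.
have -> : odd (a - b).-1 = ~~ odd (a - b) by lia.
rewrite (oddB (ltnW ab)).
by case: (odd a); case: (odd b); rewrite /= ?expr0 ?expr1; field.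
Qed.

Lemma zigzag_mkseq (T : Type) (p q : T -> R) h n :
  zigzag p q (mkseq h n) = \prod_(0 <= c < n) (if odd c then q (h c) else p (h c)).
Proof.
elim: n p q h => [|n IH] p q h; first by rewrite big_nil.
rewrite mkseq_cons /= IH big_nat_recl //=; congr (_ * _); apply: eq_bigr => c _.
by case: (odd c).
Qed.

Lemma pairwise_mkseq (T : Type) (r : rel T) h n :
  (forall i j, (i < j < n)%N -> r (h i) (h j)) -> pairwise r (mkseq h n).
Proof.
elim: n h => [//|n IH] h hr; rewrite mkseq_cons /= IH => [|i j ij]; last by apply: hr; lia.
rewrite andbT all_map; apply/allP => i; rewrite mem_iota /= => ?; apply: hr; lia.
Qed.

Definition flowO (e : bool) k s m : R :=
  at_positions (pfn (weightO s) (k + e)) S (nseq e 0%N) 0 (2 * k + e) m.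

Lemma flowO_start (e : bool) k m : chamber (2 * k + e) m -> flowO e k 0 m = odd_weight al (2 * k + e) m.
Proof.
move=> [m1 _]; set l := (2 * k + e)%N.
have mono i j : (i <= j)%N -> (m j <= m i)%N.
  by move=> /subnK <-; elim: (j - i)%N => [//|d]; rewrite addSn; apply: leq_trans.
have st i j : (i < j < l)%N -> weightO 0 (position 0 l m i).+1 (position 0 l m j).+1 ==
    rowO (position 0 l m i).+1 * colO (position 0 l m j).+1.
  move=> ij; rewrite weightO_start // ltnS /position; apply/orP; right.
  by have := mono i j; lia.
rewrite /odd_weight /flowO /at_positions -/l.
have pw : \prod_(0 <= c < l) al ^+ odd (m c) = al ^+ (\sum_(0 <= c < l) odd (m c)).
  by rewrite expr_sum.
rewrite -pw {pw}; case: e @l st => l st /=.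
  rewrite (@pfn_zigzag _ _ _ rowO colO) /=; last 2 first.
  - by rewrite size_mkseq /l; lia.
  - rewrite pairwise_mkseq ?andbT; last exact: st.
    by rewrite all_map; apply/allP => i _ /=; rewrite -[borderO _ _]/(weightO 0 0 _.+1) weightO_start.
  rewrite mul1r zigzag_mkseq !big_nat; apply: eq_bigr => c /andP[_ cl].
  (* The alternation of [rowO] and [colO] makes up for the parity of [c] in the position. *)
  have hc : odd (position 0 l m c) = odd (m c) (+) odd c by rewrite /position /l; lia.
  by case: ifP => oc; rewrite /= hc oc ?addbT ?addbF ?negbK.
rewrite (@pfn_zigzag _ _ _ rowO colO) ?zigzag_mkseq; last 2 first.
- by rewrite size_mkseq /l; lia.
- by rewrite pairwise_mkseq //; exact: st.
rewrite !big_nat; apply: eq_bigr => c /andP[_ cl].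
have hc : odd (position 0 l m c) = ~~ (odd (m c) (+) odd c) by rewrite /position /l; lia.
by case: ifP => oc; rewrite /= hc oc ?addbT ?addbF ?negbK.
Qed.

Lemma seriesO (e : bool) k t : 0 <= t ->
  limn (series (fun n => t ^+ n / n`!%:R *
    iter n (step_up (2 * k + e)) (odd_weight al (2 * k + e)) (fun=> 0%N))) = flowO e k t (fun=> 0%N).
Proof.
move=> t0; apply: (walk_series (g := flowO e k) t0 (transfer_up _ _)).
- move=> m s chm.
  have d := deriv_pfn (k + e) (nseq e 0%N ++ mkseq (fun c => (position 0 (2 * k + e) m c).+1) (2 * k + e))
    (deriv_weightO s).
  apply: (is_derive_eq d).
  have af : is_alternating (pfn (weightO s) (k + e)) by apply: alternating_pfn; exact: weightO_skew.
  by case: e chm af d => chm af d; rewrite /= ?big_nil ?add0r;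
    rewrite -(@psum_up _ _ _ S _ 0 _ af stepO m).
- by move=> m; exact: flowO_start.
by apply: expands_pfn; exact: expands_weightO.
Qed.

Lemma seriesO_even k t : 0 <= t ->
  2 ^+ k * limn (series (fun n => t ^+ n / n`!%:R *
    iter n (step_up (2 * k)) (odd_weight al (2 * k)) (fun=> 0%N))) =
  hankel (E t) k phi + (1 - al ^+ 2) * (if k is k'.+1 then hankel (E t) k' (phi * (4 - 'X ^+ 2)) else 0).
Proof.
move=> t0; have := seriesO false k t0; rewrite addn0 => ->.
rewrite -(@pfn_even _ _ (lE t) al (weightO t) k (4^-1 * (1 - al ^+ 2))).
- rewrite /flowO /at_positions !addn0 /=; congr (_ * pfn _ _ _); apply: eq_mkseq => i.
  by rewrite /position addn0.
- by field.
- exact: weightO_skew.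
- by [].
Qed.

Lemma seriesO_odd k t : 0 <= t ->
  2 ^+ k.+1 * limn (series (fun n => t ^+ n / n`!%:R *
    iter n (step_up (2 * k + 1)) (odd_weight al (2 * k + 1)) (fun=> 0%N))) =
  (1 + al) * expR t * hankel (E t) k (phi * (2 - 'X)) +
  (1 - al) * expR (- t) * hankel (E t) k (phi * (2 + 'X)).
Proof.
move=> t0; have := seriesO true k t0; rewrite -[nat_of_bool true]/1%N => ->.
have ee : expR t * expR (- t) = 1 by rewrite -expRD subrr expR0.
have ab : 2^-1 * (1 + al) * expR t * (2^-1 * (1 - al) * expR (- t)) = 4^-1 * (1 - al ^+ 2).
  transitivity (4^-1 * (1 - al ^+ 2) * (expR t * expR (- t))); last by rewrite ee mulr1.
  by field.
have := @pfn_odd _ _ (lE t) al (weightO t) k (2^-1 * (1 + al) * expR t) (2^-1 * (1 - al) * expR (- t)).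
move=> h; rewrite exprS -mulrA.
rewrite -[flowO _ _ _ _]/(pfn (weightO t) (k + 1) (0%N :: mkseq _ _)).
have -> : mkseq (fun c => (position 0 (2 * k + 1) (fun=> 0%N) c).+1) (2 * k + 1) =
    mkseq (fun i => (2 * k + 1 - i.+1).+1) (2 * k + 1).
  by apply: eq_mkseq => i; rewrite /position addn0.
rewrite addn1 h.
- by field.
- by rewrite ab; field.
- exact: weightO_skew.
- by move=> i j; rewrite ab.
- by [].
Qed.

End Orthogonal.

End MomentFlow.

Section SkewFlow.
Variables (R : realType) (mu : R -> nat -> R).
Hypothesis dmu : forall (s : R) i, is_derive s (1 : R) (mu^~ i) (mu s i.+1).
Hypothesis emu : forall t i, expands t (mu^~ i).
Hypothesis mu0 : forall n : nat, expect (mu 0) (chebC 'X n) = 2 * (n == 0%N)%:R.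

(** The transition kernel of the free walk on the integers; for the Bessel moments it is
    [I_j(2s)]. *)
Definition fourier (s : R) (j : int) : R := 2^-1 * expect (mu s) (chebC 'X j).

Lemma fourierN s j : fourier s (- j) = fourier s j.
Proof. by rewrite /fourier chebCN. Qed.

Lemma deriv_fourier s j : is_derive s (1 : R) (fourier^~ j) (fourier s (j + 1) + fourier s (j - 1)).
Proof.
apply: (is_derive_eq (is_derive_scal 2^-1 (deriv_expect dmu s (chebC 'X j)))).
by rewrite -(@chebyshev_cheb _ ('X : {poly R})) (poly_linearD (poly_linear_expect _)) mulrDr.
Qed.

Lemma fourier0 (j : int) : fourier 0 j = (j == 0)%:R.
Proof.
suff H n : fourier 0 (Posz n) = (n == 0%N)%:R by case: j => n; rewrite ?H // NegzE fourierN H.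
by rewrite /fourier mu0 mulrA mulVf ?mul1r // pnatr_eq0.
Qed.

Lemma expands_fourier t j : expands t (fourier^~ j).
Proof. exact/expandsZ/expands_expect. Qed.

(* Reflected transition kernels: absorbing at 0, or reflecting between 0 and -1. *)
Definition reflected_kernel (e : bool) s (h j : nat) : R :=
  if e then fourier s (h%:Z - j%:Z) + fourier s (h%:Z + j%:Z + 1)
  else fourier s (h%:Z - j%:Z) - fourier s (h%:Z + j%:Z).

Definition stepS (e : bool) (h : nat) : seq nat := if e || (h != 0%N) then [:: h.+1; h.-1] else [::].

Lemma deriv_kernel e s h j :
  is_derive s (1 : R) (fun x => reflected_kernel e x h j) (\sum_(z <- stepS e h) reflected_kernel e s z j).
Proof.
have d1 := deriv_fourier s (h%:Z - j%:Z).
rewrite /reflected_kernel /stepS; case: e => /=.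
  have d2 := deriv_fourier s (h%:Z + j%:Z + 1).
  apply: (is_derive_eq (is_derive_add d1 d2)); rewrite !big_cons big_nil addr0.
  case: h {d1 d2} => [|h] /=.
    rewrite (_ : (0%N%:Z - j%:Z - 1) = - (j%:Z + 1)) 1?fourierN; last by lia.
    rewrite (_ : (0%N%:Z - j%:Z + 1) = (1%N%:Z - j%:Z)); last by lia.
    rewrite (_ : (0%N%:Z + j%:Z + 1 - 1) = j%:Z); last by lia.
    rewrite (_ : (0%N%:Z + j%:Z + 1 + 1) = (1%N%:Z + j%:Z + 1)); last by lia.
    by rewrite (_ : (0%N%:Z - j%:Z) = - j%:Z) 1?fourierN 1?(_ : (0%N%:Z + j%:Z + 1) = j%:Z + 1); [ring|lia|lia].
  rewrite (_ : (h.+1%:Z - j%:Z + 1) = (h.+2%:Z - j%:Z)); last by lia.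
  rewrite (_ : (h.+1%:Z - j%:Z - 1) = (h%:Z - j%:Z)); last by lia.
  rewrite (_ : (h.+1%:Z + j%:Z + 1 + 1) = (h.+2%:Z + j%:Z + 1)); last by lia.
  by rewrite (_ : (h.+1%:Z + j%:Z + 1 - 1) = (h%:Z + j%:Z + 1)); [ring|lia].
have d2 := deriv_fourier s (h%:Z + j%:Z).
have -> : (fun x => fourier x (h%:Z - j%:Z) - fourier x (h%:Z + j%:Z)) =
   (fun x => fourier x (h%:Z - j%:Z) + -1 * fourier x (h%:Z + j%:Z)).
  by apply/funext => x; rewrite mulN1r.
apply: (is_derive_eq (is_derive_add d1 (is_derive_scal (-1) d2))).
case: h {d1 d2} => [|h] /=; rewrite ?big_cons big_nil.
  rewrite (_ : (0%N%:Z - j%:Z - 1) = - (j%:Z + 1)) 1?fourierN; last by lia.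
  rewrite (_ : (0%N%:Z - j%:Z + 1) = - (j%:Z - 1)) 1?fourierN; last by lia.
  by rewrite add0r; ring.
rewrite (_ : (h.+1%:Z - j%:Z + 1) = (h.+2%:Z - j%:Z)); last by lia.
rewrite (_ : (h.+1%:Z - j%:Z - 1) = (h%:Z - j%:Z)); last by lia.
rewrite (_ : (h.+1%:Z + j%:Z + 1) = (h.+2%:Z + j%:Z)); last by lia.
by rewrite (_ : (h.+1%:Z + j%:Z - 1) = (h%:Z + j%:Z)); [ring|lia].
Qed.

Lemma expands_kernel t e h j : expands t (fun x => reflected_kernel e x h j).
Proof.
rewrite /reflected_kernel; case: e; first by apply: expandsD; exact: expands_fourier.
have -> : (fun x => fourier x (h%:Z - j%:Z) - fourier x (h%:Z + j%:Z)) =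
   (fun x => fourier x (h%:Z - j%:Z) + -1 * fourier x (h%:Z + j%:Z)).
  by apply/funext => x; rewrite mulN1r.
by apply: expandsD; [|apply: expandsZ]; exact: expands_fourier.
Qed.

(** Karlin-McGregor determinant for walkers between the positions of [m] and those of the empty
    partition. An absorbing wall at [0] shifts all positions by one, hence [~~ e]. *)
Definition flowS (e : bool) l s m : R :=
  at_positions (fun u => detl (reflected_kernel e s) u (mkseq (position (~~ e) l (fun=> 0%N)) l)) id [::] (~~ e) l m.

Lemma flowS_det e l s : flowS e l s (fun=> 0%N) = \det (\matrix_(i < l, j < l)
  reflected_kernel e s (i + ~~ e)%N (j + ~~ e)%N).
Proof.
rewrite /flowS /at_positions (detl_det _ 0%N 0%N (n := l)) ?size_mkseq //.
rewrite -[RHS](@det_rev _ l (fun i j => reflected_kernel e s (i + ~~ e)%N (j + ~~ e)%N)).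
congr (\det _); apply/matrixP => i j; rewrite !mxE !nth_mkseq //.
Qed.

Lemma dsum_eq0 (K : comNzRingType) (T1 : Type) (T2 : eqType) (W : T1 -> T2 -> K) x F s :
  {in s, forall y, W x y = 0} -> dsum W x F s = 0.
Proof.
move=> h; rewrite (@dsum_eq _ _ _ W (fun _ _ => 0) x F F) //.
by elim: s F {h} => [//|y s IH] F /=; rewrite IH mul0r subr0.
Qed.

(** Off the empty partition the top walker is above every target, so its row vanishes at time
    [0]. *)
Lemma flowS_start e l m : chamber l m -> flowS e l 0 m = at_origin R l m.
Proof.
move=> [m1 m2]; rewrite /at_origin; case: (posnP l) => [l0|l0].
  by rewrite /flowS /at_positions l0 /=; case: forallP => // -[] [].
have mono i : (m i <= m 0)%N by elim: i => [//|i]; apply: leq_trans.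
case: forallP => [h|].
  have m0 i : m i = 0%N.
    by case: (ltnP i l) => il; [exact/eqP/(h (Ordinal il))|exact: m2].
  have -> : m = (fun=> 0%N) by apply/funext.
  rewrite flowS_det -[RHS](@det1 _ l); congr (\det _); apply/matrixP => i j; rewrite !mxE /reflected_kernel.
  rewrite !fourier0 -val_eqE /=.
  rewrite (_ : ((i + ~~ e)%N%:Z - (j + ~~ e)%N%:Z == 0) = (i == j :> nat)); last by lia.
  rewrite (_ : ((i + ~~ e)%N%:Z + (j + ~~ e)%N%:Z + 1 == 0) = false); last by lia.
  case: e; rewrite ?addr0 // (_ : (_ == 0 :> int) = false) ?subr0 //; lia.
move=> nh; have m0 : (0 < m 0)%N.
  by rewrite lt0n; apply/negP => /eqP e0; apply: nh => c; rewrite -leqn0 -e0.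
rewrite /flowS /at_positions cat0s -(prednK l0) [X in detl _ X _]mkseq_cons.
rewrite -[LHS]/(dsum _ _ (detl _ _) _).
rewrite dsum_eq0 // => y /mem_mkseqP[i il ->].
set a := position _ _ m 0; set b := position _ _ _ i.
have n1 : a%:Z - b%:Z != 0 by rewrite /a /b /position; lia.
have n2 : a%:Z + b%:Z + 1 != 0 by lia.
have n3 : a%:Z + b%:Z != 0 by rewrite /a /b /position; lia.
move: n1 n2 n3; move: a b => a b n1 n2 n3; rewrite /reflected_kernel; case: e;
  by rewrite !fourier0 (negbTE n1) ?(negbTE n2) ?(negbTE n3) ?addr0 ?subr0.
Qed.

Lemma stepS_out e x : (~~ e <= x)%N -> stepS e x = [:: x.+1; x.-1].
Proof. by rewrite /stepS; case: e => //=; case: x. Qed.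

Lemma deriv_flowS e l m s : chamber l m -> is_derive s (1 : R) ((flowS e l)^~ m)
  (step_up l (flowS e l s) m + step_down l (flowS e l s) m + stay 1 e l m *+ e * flowS e l s m).
Proof.
move=> chm; pose cols := mkseq (position (~~ e) l (fun=> 0%N)) l.
have af : is_alternating (fun u => detl (reflected_kernel e s) u cols) by exact: alternating_detl_rows.
have d := deriv_detl (mkseq (fun c => position (~~ e) l m c) l) cols (deriv_kernel e s).
apply: (is_derive_eq d); rewrite /cols in af *.
have st x : (~~ e <= x)%N -> stepS e (id x) = [:: id x.+1; id x.-1] by exact: stepS_out.
case: e af st {d cols} => /= af st.
  by rewrite (psum_stay [::] af st chm).
rewrite mulr0n mul0r addr0; apply: (psum_killed [::] af st chm) => // u.
elim: u (mkseq _ _) => [|x u IH] v /=; last first.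
  by rewrite (@dsum_ext _ _ _ _ _ _ (fun=> 0)) ?dsum0.
apply: dsum_eq0 => y _; rewrite /reflected_kernel.
by rewrite (_ : 0%N%:Z - y%:Z = - (0%N%:Z + y%:Z)) ?fourierN ?subrr //; lia.
Qed.

(** The reflecting wall produces exactly the pause [stay] of weight [1], whence the value
    [beta = 1]. *)
Lemma seriesS_even l t : 0 <= t ->
  limn (series (fun n => t ^+ n / n`!%:R * iter n (updown l (stay 1 true l)) (at_origin R l) (fun=> 0%N))) =
  \det (\matrix_(i < l, j < l) (fourier t (i%:Z - j%:Z) + fourier t (i%:Z + j%:Z + 1))).
Proof.
move=> t0; transitivity (flowS true l t (fun=> 0%N)).
  apply: (walk_series (g := flowS true l) t0 (transfer_updown _ _)).
  - by move=> m s chm; apply: (is_derive_eq (deriv_flowS true s chm)).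
  - by move=> m; exact: flowS_start.
  - by apply: expands_detl; exact: expands_kernel.
by rewrite flowS_det; congr (\det _); apply/matrixP => i j; rewrite !mxE /reflected_kernel !addn0.
Qed.

Lemma seriesS_odd (beta : R) l t : 0 <= t ->
  limn (series (fun n => t ^+ n / n`!%:R * iter n (updown l (stay beta false l)) (at_origin R l) (fun=> 0%N))) =
  expR (beta * t) * \det (\matrix_(i < l, j < l) (fourier t (i%:Z - j%:Z) - fourier t (i%:Z + j%:Z + 2))).
Proof.
move=> t0; pose g s m := expR (beta * s) * flowS false l s m.
transitivity (g t (fun=> 0%N)).
  apply: (walk_series (g := g) t0 (transfer_updown _ _)).
  - move=> m s chm; apply: (is_derive_eq (is_derive_mul (deriv_expR beta s) (deriv_flowS false s chm))).
    rewrite /updown /step_up /step_down !mulrDr !mulr_sumr /stay /= mulr1 mulr0n mul0r mulr0 addr0.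
    by rewrite addrC mulr1 /g mulrA.
  - by move=> m chm; rewrite /g mulr0 expR0 mul1r; exact: flowS_start.
  - by apply: expandsM; [exact: expands_expR|apply: expands_detl; exact: expands_kernel].
rewrite /g flowS_det; congr (_ * \det _); apply/matrixP => i j; rewrite !mxE /reflected_kernel.
by congr (fourier _ _ - fourier _ _); lia.
Qed.

End SkewFlow.

Lemma pfn_isolated (K : comNzRingType) (T : Type) (W : T -> T -> K) z n u : (forall x, W x z = 0) ->
  pfn W n (u ++ [:: z]) = 0.
Proof.
move=> Wz; rewrite cats1; elim: n u => [|n IH] [|x u] //=.
by rewrite -[pfn _ _ _]/(dsum W x (pfn W n) (rcons u z)) dsum_rcons Wz mul0r mulr0 addr0 (@dsum_ext _ _ _ _ _ _ (fun=> 0)) ?dsum0.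
Qed.

Section SignedFlow.
Variables (R : realType) (mu : R -> nat -> R).
Hypothesis dmu : forall (s : R) i, is_derive s (1 : R) (mu^~ i) (mu s i.+1).
Hypothesis emu : forall t i, expands t (mu^~ i).
Hypothesis mu0 : forall n : nat, expect (mu 0) (chebC 'X n) = 2 * (n == 0%N)%:R.
Variable al : R.

Local Notation E s := (expect (mu s)).
Local Notation chrg s := (charge_form (E s) al).
Local Notation th s := (theta (E s) al).
Let lE s : poly_linear (E s). Proof. exact: poly_linear_expect. Qed.

Lemma deriv_charge s k P : is_derive s (1 : R) (fun x => chrg x k P) (chrg s k ('X * P)).
Proof.
have d := is_derive_scal 2^-1 (deriv_expect dmu s (P * (chebC 'X k + al *: chebC 'X (k + 1)))).
by apply: (is_derive_eq d); rewrite /charge_form mulrA.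
Qed.

Lemma expands_charge t k P : expands t (fun x => chrg x k P).
Proof. exact/expandsZ/expands_expect. Qed.

Lemma thetaE s i j : th s i j = 2 * chrg s 0 'X^i * chrg s 0 'X^j +
  (-1 * (chrg s 1 'X^i * chrg s (-1) 'X^j) + -1 * (chrg s (-1) 'X^i * chrg s 1 'X^j)).
Proof. by rewrite /theta; ring. Qed.

Lemma deriv_theta s i j : is_derive s (1 : R) (fun x => th x i j) (th s i.+1 j + th s i j.+1).
Proof.
have d k m := deriv_charge s k 'X^m.
have -> : (fun x => th x i j) = fun x => 2 * (chrg x 0 'X^i * chrg x 0 'X^j) +
  (-1 * (chrg x 1 'X^i * chrg x (-1) 'X^j) + -1 * (chrg x (-1) 'X^i * chrg x 1 'X^j)).
  by apply/funext => x; rewrite thetaE mulrA.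
have h k k' := is_derive_mul (d k i) (d k' j).
apply: (is_derive_eq (is_derive_add (is_derive_scal 2 (h 0 0)) (is_derive_add (is_derive_scal (-1) (h 1 (-1))) (is_derive_scal (-1) (h (-1) 1))))).
by rewrite /theta -!exprS; ring.
Qed.

Lemma expands_theta t i j : expands t (fun x => th x i j).
Proof.
have -> : (fun x => th x i j) = fun x => 2 * (chrg x 0 'X^i * chrg x 0 'X^j) +
  (-1 * (chrg x 1 'X^i * chrg x (-1) 'X^j) + -1 * (chrg x (-1) 'X^i * chrg x 1 'X^j)).
  by apply/funext => x; rewrite thetaE mulrA.
by apply: expandsD; [|apply: expandsD]; apply: expandsZ; apply: expandsM; exact: expands_charge.
Qed.

Local Notation om s := (undisplace (th s)).

Lemma undisplace_form s i j : om s i j = 2^-1 * (antidiagonal (th s) i j + -1 * antidiagonal (th s) j i).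
Proof. by rewrite mulN1r. Qed.

(** [theta] evolves by shifting either index. Both candidates for the derivative are antisymmetric
    with the same displacement, so [undisplace_uniq] identifies them. *)
Lemma deriv_undisplace s i j : is_derive s (1 : R) (fun x => om x i j) (om s i.+1 j + om s i j.+1).
Proof.
pose th' i j := th s i.+1 j + th s i j.+1.
have da k m : is_derive s (1 : R) (fun x => antidiagonal (th x) k m) (antidiagonal th' k m).
  by apply: deriv_sum => n _ _; exact: deriv_theta.
have -> : (fun x => om x i j) = fun x => 2^-1 * (antidiagonal (th x) i j + -1 * antidiagonal (th x) j i).
  by apply/funext => x; exact: undisplace_form.
apply: (is_derive_eq (is_derive_scal 2^-1 (is_derive_add (da i j) (is_derive_scal (-1) (da j i))))).
have sym := thetaC (E s) al.
rewrite mulN1r -[LHS]/(undisplace th' i j); apply/esym.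
apply: (@undisplace_uniq _ th' _ (fun i j => om s i.+1 j + om s i j.+1) (i + j)) => //.
- by move=> a b; rewrite /th' addrC ![th s a _]sym ![th s a.+1 _]sym.
- by move=> a b; rewrite (undisplaceN _ a.+1) (undisplaceN _ a); ring.
move=> a b _; have h1 := undisplaceE sym a.+1 b; have h2 := undisplaceE sym a b.+1.
by rewrite /th' -h1 -h2; ring.
Qed.

Lemma expands_undisplace t i j : expands t (fun x => om x i j).
Proof.
have -> : (fun x => om x i j) = fun x => 2^-1 * (antidiagonal (th x) i j + -1 * antidiagonal (th x) j i).
  by apply/funext => x; exact: undisplace_form.
have h k m : expands t (fun x => antidiagonal (th x) k m).
  by apply: expands_sum => n; exact: expands_theta.
by apply/expandsZ/expandsD => //; exact/expandsZ.
Qed.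

Lemma deriv_pairing s P Q :
  is_derive s (1 : R) (fun x => bil (om x) P Q) (bil (om s) ('X * P) Q + bil (om s) P ('X * Q)).
Proof.
have -> : bil (om s) ('X * P) Q + bil (om s) P ('X * Q) =
    \sum_(i < size P) P`_i * (\sum_(j < size Q) Q`_j * (om s i.+1 j + om s i j.+1)).
  rewrite /bil expect_mulX /expect -big_split /=; apply: eq_bigr => i _.
  rewrite -mulrDr; congr (_ * _); rewrite -[\sum_(_ < size ('X * Q)) _]/(expect (om s i) ('X * Q)) expect_mulX.
  by rewrite -big_split /=; apply: eq_bigr => j _; rewrite mulrDr.
apply: deriv_sum => i _ _; apply: is_derive_scal; apply: deriv_sum => j _ _; apply: is_derive_scal.
exact: deriv_undisplace.
Qed.

Lemma expands_pairing t P Q : expands t (fun x => bil (om x) P Q).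
Proof.
apply: expands_sum => i; apply: expandsZ; apply: expands_sum => j; apply: expandsZ.
exact: expands_undisplace.
Qed.

(** Index [1] is the position [0], where [chebU] vanishes and the walk is absorbed; index [0], the
    extra row, does not move. *)
Definition stepU (i : nat) : seq nat := if i is a.+2 then [:: a.+3; a.+1] else [::].

Let U n := chebU 'X (Posz n) : {poly R}.

Lemma chebU_step n : U n.+2 + U n = 'X * U n.+1.
Proof. by rewrite /U /chebU -(@chebyshev_cheb _ ('X : {poly R})); congr (cheb _ _ _ _ + cheb _ _ _ _); lia. Qed.

Lemma weightU1 s i : weightU (E s) al i 1 = 0.
Proof.
have z : chebU 'X 0%N = 0 :> {poly R} by [].
case: i => [|i] /=; first by rewrite z /charge_form mul0r (poly_linear0 (lE s)) mulr0.
by rewrite z; exact: (poly_linear0 (bil_linr _ _)).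
Qed.

(** Differentiation multiplies an argument by ['X], which acts on [chebU] as the step to both
    neighbours. *)
Lemma deriv_weightU s i j : is_derive s (1 : R) (fun x => weightU (E x) al i j)
  (\sum_(z <- stepU i) weightU (E s) al z j + \sum_(z <- stepU j) weightU (E s) al i z).
Proof.
have lc k := @poly_linear_charge _ (E s) al (lE s) k.
wlog ij : i j / (i <= j)%N.
  move=> H; case: (leqP i j) => [|ji]; first exact: H.
  have -> : (fun x => weightU (E x) al i j) = fun x => -1 * weightU (E x) al j i.
    by apply/funext => x; rewrite weightUN mulN1r.
  apply: (is_derive_eq (is_derive_scal (-1) (H j i (ltnW ji)))).
  rewrite mulN1r opprD addrC -!sumrN; congr (_ + _); apply: eq_bigr => z _; rewrite -weightUN //.
case: j ij => [|[|b]] ij.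
- by case: i ij => // _; rewrite !big_nil addr0; exact: is_derive_const.
- have -> : (fun x => weightU (E x) al i 1) = fun=> 0 by apply/funext => x; exact: weightU1.
  by apply: (is_derive_eq (is_derive_const 0 s)); case: i ij => [|[]] // _; rewrite !big_nil addr0.
case: i ij => [|[|a]] _.
- apply: (is_derive_eq (deriv_charge s 0 (U b.+1))).
  rewrite -chebU_step (poly_linearD (lc 0)) /stepU big_nil add0r !big_cons big_nil addr0.
  by rewrite /weightU.
- have -> : (fun x => weightU (E x) al 1 b.+2) = fun=> 0.
    by apply/funext => x; rewrite weightUN weightU1 oppr0.
  apply: (is_derive_eq (is_derive_const 0 s)); rewrite /stepU big_nil !big_cons big_nil add0r addr0.
  by rewrite !(weightUN _ _ 1) !weightU1 oppr0 addr0.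
apply: (is_derive_eq (deriv_pairing s (U a.+1) (U b.+1))).
by rewrite -!chebU_step bilDl bilDr /stepU !big_cons !big_nil !addr0.
Qed.

Lemma expands_weightU t i j : expands t (fun x => weightU (E x) al i j).
Proof.
case: i j => [|i] [|j]; rewrite /weightU; first exact: expands_cst.
- exact: expands_charge.
- have -> : (fun x => - chrg x 0 (chebU 'X i)) = (fun x => -1 * chrg x 0 (chebU 'X i)).
    by apply/funext => x; rewrite mulN1r.
  exact/expandsZ/expands_charge.
exact: expands_pairing.
Qed.

Definition rowU (i : nat) : R := if i is a.+1 then al ^+ odd a else 1.
Definition colU (i : nat) : R := if i is a.+1 then al ^+ (~~ odd a) else 1.

Let u (n : int) : R := E 0 (chebU 'X n).

Lemma charge0E k n : chrg 0 k (chebU 'X n) =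
  2^-1 * (u (n + k) + u (n - k) + al * (u (n + (k + 1)) + u (n - (k + 1)))).
Proof.
rewrite /charge_form mulrDr -scalerAr ![chebU _ _ * _]mulrC !chebCU.
by rewrite (poly_linearD (lE 0)) (poly_linearZ (lE 0)) !(poly_linearD (lE 0)).
Qed.

Lemma uE (n : nat) : u n = (odd n)%:R. Proof. exact: expect0_U. Qed.

Lemma charges0 a : [/\ chrg 0 0 (U a.+1) = if odd a then al else 1,
  chrg 0 1 (U a.+1) = if odd a then 1 else if a == 0%N then 0 else al &
  chrg 0 (-1) (U a.+1) = if odd a then 1 else al].
Proof.
rewrite /U !charge0E.
have -> : a.+1%:Z + 0 = a.+1 by lia.
have -> : a.+1%:Z + (0 + 1) = a.+2 by lia.
have -> : a.+1%:Z - (0 + 1) = a by lia.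
have -> : a.+1%:Z + (1 + 1) = a.+3 by lia.
have -> : a.+1%:Z - (1 + 1) = a%:Z - 1 by lia.
have -> : u (a%:Z - 1) = if a == 0%N then -1 else (odd a.-1)%:R.
  case: a => [|a]; first by rewrite sub0r /u chebUN (poly_linearN (lE 0)) -[E 0 _]/(u 1%N) uE.
  by rewrite (_ : a.+1%:Z - 1 = a) ?uE //; lia.
rewrite !uE /=; have := odd_double_half a; case: (odd a) => /= h; case: eqP => ha; try lia.
- rewrite (_ : odd a.-1 = false) /=; first by split; field.
  by lia.
- by split; field.
rewrite (_ : odd a.-1 = true) /=; first by split; field.
by lia.
Qed.

(** The product that [pfn_zigzag] calls for, made antisymmetric; [pairing0] shows that the flow
    starts from it. *)
Definition target (a b : nat) : R := if (a == 0%N) || (b == 0%N) then 0 else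
  if (b < a)%N then al ^+ odd a * al ^+ (~~ odd b)
  else if (a < b)%N then - (al ^+ odd b * al ^+ (~~ odd a)) else 0.

Lemma targetN a b : target a b = - target b a.
Proof. by rewrite /target orbC; case: ifP => _; case: (ltngtP a b) => _; rewrite ?oppr0 ?opprK. Qed.

Lemma target_displacement a b :
  target a.+2 b.+1 + target a b.+1 - target a.+1 b.+2 - target a.+1 b = bil (th 0) (U a.+1) (U b.+1).
Proof.
have -> : bil (th 0) (U a.+1) (U b.+1) = 2 * chrg 0 0 (U a.+1) * chrg 0 0 (U b.+1) -
    chrg 0 1 (U a.+1) * chrg 0 (-1) (U b.+1) - chrg 0 (-1) (U a.+1) * chrg 0 1 (U b.+1).
  have lc k := @poly_linear_charge _ (E 0) al (lE 0) k.
  rewrite /bil /expect !(poly_linear_coef (lc _) (leqnn _)) -!mulrA !mulr_suml mulr_sumr.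
  rewrite -!sumrB; apply: eq_bigr => i _; rewrite mulrA !mulr_sumr -!sumrB.
  by apply: eq_bigr => j _; rewrite -/(expect (mu 0)) /theta; ring.
wlog ba : a b / (b <= a)%N.
  move=> H; case: (leqP b a) => [|/ltnW/H e]; first exact: H.
  rewrite targetN (targetN a) (targetN a.+1 b.+2) (targetN a.+1 b).
  transitivity (target b.+2 a.+1 + target b a.+1 - target b.+1 a.+2 - target b.+1 a); first by ring.
  by rewrite e; ring.
have [-> -> ->] := charges0 a; have [-> -> ->] := charges0 b.
rewrite /target /= !orbF.
have [d da] : exists d, a = (b + d)%N by exists (a - b)%N; lia.
have oa : odd a = odd b (+) odd d by rewrite da oddD.
have -> : (b.+1 < a.+2)%N by lia.
have -> : (a.+1 < b.+2)%N = (d == 0%N) by lia.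
have -> : (b < a.+1)%N by lia.
have -> : (b.+2 < a.+1)%N = (1 < d)%N by lia.
have -> : (b.+1 < a)%N = (1 < d)%N by lia.
have -> : (a < b.+1)%N = (d == 0%N) by lia.
have -> : (a == 0%N) = (b == 0%N) && (d == 0%N) by lia.
have b0 : odd b -> (b == 0%N) = false by case: (b).
rewrite oa /=; case: d {da oa} => [|[|d]]; rewrite /=; move: b0; case: (odd b) => [->//|_];
  try case: (odd d); try case: (b == 0%N); rewrite /= ?expr0 ?expr1; ring.
Qed.

(** Both tables are antisymmetric, vanish at index [0] and satisfy the same recursion. Once the
    smaller sums [x + y] are settled, their difference is constant along [x + y = n] off the border,
    and antisymmetry makes it vanish. *)
Lemma pairing0 a b : bil (om 0) (U a) (U b) = target a b.
Proof.
have sk := skew_bil (undisplaceN (th 0)).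
pose d a b := bil (om 0) (U a) (U b) - target a b.
have dN x y : d x y = - d y x by rewrite /d targetN (proj1 sk); ring.
have d0 x : d x 0%N = 0.
  by rewrite /d /target orbT (poly_linear0 (bil_linr _ _)) subrr.
have disp P Q : bil (om 0) ('X * P) Q - bil (om 0) P ('X * Q) = bil (th 0) P Q.
  rewrite /bil expect_mulX /expect -sumrB; apply: eq_bigr => i _.
  rewrite -mulrBr; congr (_ * _); rewrite -[\sum_(_ < size ('X * Q)) _]/(expect (om 0 i) ('X * Q)) expect_mulX.
  rewrite -sumrB; apply: eq_bigr => j _; rewrite -mulrBr; congr (_ * _).
  exact: (undisplaceE (thetaC (E 0) al)).
have dS x y : d x.+2 y.+1 + d x y.+1 = d x.+1 y.+2 + d x.+1 y.
  have := disp (U x.+1) (U y.+1); rewrite -!chebU_step bilDl bilDr => h.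
  have := target_displacement x y; rewrite -h /d; move: (bil _ _ _) (bil _ _ _) (bil _ _ _) (bil _ _ _).
  by move=> *; lra.
suff H n x y :  (x + y <= n)%N -> d x y = 0 by apply/eqP; rewrite -subr_eq0 -/(d a b) (H _ _ _ (leqnn _)).
clearbody d; elim: n x y => [|n IH] x y xy.
  by have -> : y = 0%N by lia.
case: (ltnP (x + y) n.+1) => [|xyn]; first exact: IH.
have shift k m : (k + m).+2 = n.+1 -> d k.+1 m.+1 = d 1%N (k + m).+1.
  elim: k m => [//|k IHk] m km; rewrite addSnnS -IHk; last by lia.
  by have := dS k m; rewrite [d k m.+1]IH ?[d k.+1 m]IH ?addr0 //; lia.
case: x y xy xyn => [|x] [|y] xy xyn; rewrite ?d0 //; first by rewrite dN d0 oppr0.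
have e1 := shift x y; have e2 := shift y x.
have := dN x.+1 y.+1; rewrite e1 1?e2 1?addnC; try lia.
by rewrite [(y + x)%N]addnC; lra.
Qed.

Lemma weightU_start i j : (1 < j)%N -> (i == 0%N) || (j < i)%N -> weightU (E 0) al i j = rowU i * colU j.
Proof.
case: i j => [|a] [|[|b]] //= _ ab.
  by have [-> _ _] := charges0 b; rewrite mul1r negbK; case: (odd b).
rewrite -[LHS]/(bil (om 0) (U a) (U b.+1)) pairing0 /target /=.
by rewrite ltnS in ab; rewrite ab; case: (a) ab.
Qed.

Definition flowU (e : bool) n l s m : R :=
  at_positions (pfn (weightU (E s) al) n) S (nseq e 0%N) 1 l m.

Lemma flowU_start (e : bool) n l m : (e + l)%N = n.*2 -> chamber l m -> flowU e n l 0 m = odd_weight al l m.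
Proof.
move=> el [m1 _].
have mono i j : (i <= j)%N -> (m j <= m i)%N.
  by move=> /subnK <-; elim: (j - i)%N => [//|d]; rewrite addSn; apply: leq_trans.
have st i j : (i < j < l)%N -> weightU (E 0) al (position 1 l m i).+1 (position 1 l m j).+1 ==
    rowU (position 1 l m i).+1 * colU (position 1 l m j).+1.
  move=> ij; rewrite weightU_start // ?ltnS /position; first by lia.
  by apply/orP; right; have := mono i j; lia.
rewrite /odd_weight /flowU /at_positions.
have pw : \prod_(0 <= c < l) al ^+ odd (m c) = al ^+ (\sum_(0 <= c < l) odd (m c)).
  by rewrite expr_sum.
rewrite -pw {pw} (@pfn_zigzag _ _ _ rowU colU); last 2 first.
- by rewrite size_cat size_nseq size_mkseq.
- case: (e) => /=; rewrite pairwise_mkseq ?andbT; try exact: st; last by [].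
  rewrite all_map; apply/allP => i _ /=; rewrite -[charge_form _ _ _ _]/(weightU (E 0) al 0 _.+1) weightU_start //.
  by rewrite /position; lia.
case: e el => el /=; rewrite ?mul1r zigzag_mkseq !big_nat; apply: eq_bigr => c /andP[_ cl].
  have hc : odd (position 1 l m c) = ~~ (odd (m c) (+) odd c) by rewrite /position; lia.
  by case: ifP => oc; rewrite /= hc oc ?addbT ?addbF ?negbK.
have hc : odd (position 1 l m c) = odd (m c) (+) odd c by rewrite /position; lia.
by case: ifP => oc; rewrite /= hc oc ?addbT ?addbF ?negbK.
Qed.

Lemma deriv_flowU (e : bool) n l m s : chamber l m -> is_derive s (1 : R) ((flowU e n l)^~ m)
  (step_up l (flowU e n l s) m + step_down l (flowU e n l s) m).
Proof.
move=> chm.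
have d := deriv_pfn n (nseq e 0%N ++ mkseq (fun c => (position 1 l m c).+1) l) (deriv_weightU s).
apply: (is_derive_eq d).
have af : is_alternating (pfn (weightU (E s) al) n) by apply: alternating_pfn; exact: weightUN.
have k0 v : pfn (weightU (E s) al) n (v ++ [:: 1%N]) = 0 by apply: pfn_isolated; exact: weightU1.
have st x : (1 <= x)%N -> stepU x.+1 = [:: x.+2; x.-1.+1] by case: x.
by case: e {d}; rewrite /= ?big_nil ?add0r; rewrite -(@psum_killed _ _ _ S _ 1 _ af stepU m).
Qed.

(** The convergence is recorded along with the limit, because [toeplitz_ge1] compares the limit with
    the partial sums. *)
Lemma seriesU_cvg (e : bool) n l (b : R) t : 0 <= t -> (e + l)%N = n.*2 ->
  (series (fun n => t ^+ n / n`!%:R * iter n (updown l (stay b false l)) (odd_weight al l) (fun=> 0%N)) @ \oo -->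
  expR (b * t) * \det (\matrix_(i < l, j < l)
    (fourier mu t (i%:Z - j%:Z) + al * fourier mu t (i%:Z - j%:Z + 1))))%classic.
Proof.
move=> t0 el; pose g s m := expR (b * s) * flowU e n l s m.
suff -> : expR (b * t) * \det (\matrix_(i < l, j < l)
    (fourier mu t (i%:Z - j%:Z) + al * fourier mu t (i%:Z - j%:Z + 1))) = g t (fun=> 0%N).
  apply: (walk_cvg (g := g) t0 (transfer_updown _ _)).
  - move=> m s chm; apply: (is_derive_eq (is_derive_mul (deriv_expR b s) (deriv_flowU e n s chm))).
    rewrite /updown /step_up /step_down !mulrDr !mulr_sumr /stay /= mulr1.
    by rewrite addrC /g mulrA.
  - by move=> m chm; rewrite /g mulr0 expR0 mul1r; exact: flowU_start.
  - by apply: expandsM; [exact: expands_expR|apply: expands_pfn; exact: expands_weightU].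
rewrite /g -(@pfn_weightU _ (E t) al (lE t) _ _ e n l) //.
  rewrite /flowU /at_positions; congr (_ * pfn _ _ (_ ++ _)); apply: eq_mkseq => i.
  by rewrite /position add0n addn1.
by move=> j; rewrite /fourier mulrA mulfV ?mul1r // pnatr_eq0.
Qed.

Lemma seriesU l (b : R) t : 0 <= t ->
  limn (series (fun n => t ^+ n / n`!%:R * iter n (updown l (stay b false l)) (odd_weight al l) (fun=> 0%N))) =
  expR (b * t) * \det (\matrix_(i < l, j < l)
    (fourier mu t (i%:Z - j%:Z) + al * fourier mu t (i%:Z - j%:Z + 1))).
Proof.
move=> t0; apply/cvg_lim => //; apply: (@seriesU_cvg (odd l) (uphalf l)) => //.
by rewrite -{2}[l]odd_double_half uphalf_half doubleD addnA addnn.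
Qed.

End SignedFlow.

(* The determinant is a power series with nonnegative coefficients and constant term 1. *)
Lemma toeplitz_ge1 (R : realType) (mu : R -> nat -> R) :
  (forall (s : R) i, is_derive s (1 : R) (mu^~ i) (mu s i.+1)) -> (forall t i, expands t (mu^~ i)) ->
  (forall n : nat, expect (mu 0) (chebC 'X n) = 2 * (n == 0%N)%:R) ->
  forall l t, 0 <= t -> 1 <= \det (\matrix_(i < l, j < l) fourier mu t (i%:Z - j%:Z)).
Proof.
move=> dmu emu mu0 l t t0.
have el : (odd l + l = (uphalf l).*2)%N by rewrite -{2}[l]odd_double_half uphalf_half doubleD addnA addnn.
have := seriesU_cvg dmu emu mu0 (al := 0) (b := 0) t0 el; rewrite mul0r expR0 mul1r.
have -> : \matrix_(i < l, j < l) (fourier mu t (i%:Z - j%:Z) + 0 * fourier mu t (i%:Z - j%:Z + 1)) =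
    \matrix_(i < l, j < l) fourier mu t (i%:Z - j%:Z).
  by apply/matrixP => i j; rewrite !mxE mul0r addr0.
move=> cv; have pos n m : 0 <= iter n (updown l (stay (0 : R) false l)) (odd_weight 0 l) m.
  elim: n m => [|n IH] m; first exact: exprn_ge0.
  rewrite iterS; move: (iter n _ _) IH => psi IH; rewrite /updown /stay mul0r mul0r addr0.
  by apply: addr_ge0; apply: sumr_ge0 => c _; exact: IH.
rewrite -(cvg_lim (@Rhausdorff R) cv); apply: limr_ge; first by apply/cvg_ex; exists (\det (\matrix_(i < l, j < l) fourier mu t (i%:Z - j%:Z))).
near=> n; have n0 : (0 < n)%N by near: n; exact: nbhs_infty_gt.
rewrite /series /= -(prednK n0) big_nat_recl //= expr0 divr1 mul1r.
have -> : odd_weight 0 l (fun=> 0%N) = 1 :> R.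
  by rewrite /odd_weight big1 ?expr0.
rewrite lerDl; apply: sumr_ge0 => k _; apply: mulr_ge0; last exact: (pos k.+1).
by rewrite divr_ge0 // exprn_ge0.
Unshelve. all: by end_near.
Qed.

Local Open Scope classical_set_scope.

(** * Bessel moments *)

Section CircleMean.
Variable R : realType.
Implicit Types (f g v : R -> R).

Local Notation D := (`[0, 2 * pi]%classic : set R).

Definition arc_mean f : R := (2 * pi)^-1 * \int[@lebesgue_measure R]_(x in D) f x.

Let pi2 : 0 < 2 * pi :> R. Proof. by rewrite mulr_gt0 // pi_gt0. Qed.

Lemma continuous_mul f g : continuous f -> continuous g -> continuous (fun x => f x * g x).
Proof. by move=> cf cg x; exact: cvgM (cf x) (cg x). Qed.

Lemma continuous_add f g : continuous f -> continuous g -> continuous (fun x => f x + g x).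
Proof. by move=> cf cg x; exact: cvgD (cf x) (cg x). Qed.

Lemma continuous_cst (c : R) : continuous ((fun=> c) : R -> R).
Proof. exact: cst_continuous. Qed.

Lemma continuous_scale a f : continuous f -> continuous (fun x => a * f x).
Proof. by move=> cf; apply: continuous_mul => //; exact: continuous_cst. Qed.

Lemma continuous_exp f n : continuous f -> continuous (fun x => f x ^+ n).
Proof.
move=> cf; elim: n => [|n IH].
  by rewrite (_ : (fun x => _) = fun=> 1); [exact: continuous_cst|apply/funext => x; rewrite expr0].
rewrite (_ : (fun x => _) = fun x => f x * f x ^+ n); first exact: continuous_mul.
by apply/funext => x; rewrite exprS.
Qed.

Lemma arc_integrable f : continuous f -> lebesgue_measure.-integrable D (EFin \o f).
Proof.
move=> cf; apply: continuous_compact_integrable; first exact: segment_compact.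
exact: continuous_subspaceT.
Qed.

Lemma arc_lin a f g : continuous f -> continuous g -> arc_mean (fun x => a * f x + g x) = a * arc_mean f + arc_mean g.
Proof.
move=> cf cg; rewrite /arc_mean RintegralD ?RintegralZl //; try exact: arc_integrable; first by ring.
by apply: (arc_integrable (f := fun x => a * f x)); exact: continuous_scale.
Qed.

Lemma arc_cst c : arc_mean (fun=> c) = c.
Proof.
rewrite /arc_mean Rintegral_cst //= lebesgue_measure_itv /= lte_fin pi2 /= subr0 mulrCA mulVf ?mulr1 //.
exact: lt0r_neq0.
Qed.

Lemma arc_bound f C : continuous f -> (forall x, `|f x| <= C) -> `|arc_mean f| <= C.
Proof.
move=> cf hf; rewrite -[leRHS]arc_cst /arc_mean normrM ger0_norm; last by rewrite invr_ge0 ltW.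
apply: ler_wpM2l; first by rewrite invr_ge0 ltW.
apply: (le_trans (le_normr_Rintegral _ (arc_integrable cf))) => //.
apply: le_Rintegral => //; first exact: (integrable_norm (arc_integrable cf)).
by apply: arc_integrable; exact: continuous_cst.
Qed.

Lemma arcZ a f : continuous f -> arc_mean (fun x => a * f x) = a * arc_mean f.
Proof.
move=> cf; have := arc_lin a cf (@continuous_cst 0); rewrite arc_cst addr0 => <-.
by congr arc_mean; apply/funext => x; rewrite addr0.
Qed.

Lemma arc_derivative F f : continuous f -> (forall x, is_derive x (1 : R) F (f x)) ->
  F (2 * pi) = F 0 -> arc_mean f = 0.
Proof.
move=> cf dF F0.
have cF : continuous F.
  by move=> x; apply: differentiable_continuous; apply/derivable1_diffP; have [] := dF x.
rewrite /arc_mean /Rintegral (@continuous_FTC2 _ f F) //.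
- by rewrite F0 subee //= mulr0.
- exact: continuous_subspaceT.
- split; first by move=> x _; have [] := dF x.
    by apply: cvg_at_right_filter; exact: cF.
  by apply: cvg_at_left_filter; exact: cF.
- by move=> x _; rewrite derive1E; have := dF x => d; rewrite derive_val.
Qed.

End CircleMean.

Section Moments.
Variables (R : realType) (v : R -> R).
Hypotheses (cv : continuous v) (bv : forall x, `|v x| <= 1).

(** The factor [v] is [1] for the real part of the Bessel integral and [sin] for its imaginary
    part. *)
Definition moment (s : R) (i : nat) : R := arc_mean (fun x => v x * (2 * cos x) ^+ i * expR (2 * s * cos x)).

Let wave (s : R) i := fun x : R => v x * (2 * cos x) ^+ i * expR (2 * s * cos x).

Let cont_wave s i : continuous (wave s i).
Proof.
apply: continuous_mul.
  apply: continuous_mul => //; apply: continuous_exp; apply: continuous_scale; exact: continuous_cos.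
move=> x; apply: (@continuous_comp _ _ _ (fun x : R => 2 * s * cos x) expR); last exact: continuous_expR.
by apply: continuous_scale; exact: continuous_cos.
Qed.

Let bound_wave s i M : `|s| <= M -> forall x, `|wave s i x| <= 2 ^+ i * expR (2 * M).
Proof.
move=> sM x; rewrite !normrM normrX normrM (ger0_norm (expR_ge0 _)).
have c1 : `|cos x| <= 1 by rewrite ler_norml cos_geN1 cos_le1.
apply: ler_pM; rewrite ?mulr_ge0 ?exprn_ge0 ?expR_ge0 //.
  rewrite -[leRHS]mul1r; apply: ler_pM => //; rewrite ?exprn_ge0 //.
  by apply: lerXn2r; rewrite ?nnegrE // ger0_norm // -[leRHS]mulr1 ler_wpM2l.
rewrite ler_expR; apply: (le_trans (ler_norm _)); rewrite !normrM ger0_norm // -mulrA ler_wpM2l //.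
by rewrite -[leRHS]mulr1; apply: ler_pM.
Qed.

Lemma bound_moment s i M : `|s| <= M -> `|moment s i| <= 2 ^+ i * expR (2 * M).
Proof. by move=> sM; apply: arc_bound; [exact: cont_wave|exact: bound_wave]. Qed.

Let deriv_wave i x s : is_derive s (1 : R) (fun s => wave s i x) (wave s i.+1 x).
Proof.
have d := is_derive_scal (v x * (2 * cos x) ^+ i) (deriv_expR (2 * cos x) s).
rewrite (_ : (fun s => wave s i x) = fun s => v x * (2 * cos x) ^+ i * expR (2 * cos x * s)).
  by apply: (is_derive_eq d); rewrite /wave [in RHS]exprSr !mulrA; congr (_ * expR _); ring.
by apply/funext => y; rewrite /wave; congr (_ * expR _); ring.
Qed.

(** Differentiation under the integral sign, dominated by a constant on the interval of radius [1]
    around [s]. *)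
Lemma deriv_moment s i : is_derive s (1 : R) (moment^~ i) (moment s i.+1).
Proof.
pose f s x := wave s i x.
have Ia : `]s - 1, s + 1[%classic s by rewrite /= in_itv /= ltrBlDr ltrDl ltr01.
have intf x : `]s - 1, s + 1[%classic x -> (@lebesgue_measure R).-integrable `[0, 2 * pi] (EFin \o f x).
  by move=> _; apply: arc_integrable; exact: cont_wave.
have der x y : `]s - 1, s + 1[%classic x -> `[0, 2 * pi]%classic y -> derivable (f^~ y) x 1.
  by move=> _ _; have [] := deriv_wave i y x.
pose B := 2 ^+ i.+1 * expR (2 * (`|s| + 1)).
have B0 (y : R) : 0 <= B by rewrite mulr_ge0 ?exprn_ge0 ?expR_ge0.
have iB : (@lebesgue_measure R).-integrable `[0, 2 * pi] (EFin \o (fun=> B)).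
  by apply: arc_integrable; exact: cst_continuous.
have p1 x y : partial1of2 f x y = wave x i.+1 y.
  by rewrite partial1of2E; have d := deriv_wave i y x; rewrite derive_val.
have ub x y : `]s - 1, s + 1[%classic x -> `[0, 2 * pi]%classic y -> `|partial1of2 f x y| <= B.
  rewrite /= in_itv /= => /andP[x1 x2] _; rewrite p1; apply: bound_wave.
  rewrite -[x](subrK s) addrC; apply: (le_trans (ler_normD _ _)).
  by rewrite lerD2l ler_distl !ltW.
have mD : measurable (`[0, 2 * pi] : set R) by [].
have dd := @derivable_under_integral R _ _ lebesgue_measure f _ mD s (s - 1) (s + 1) Ia intf der _ B0 iB ub.
have e := @differentiation_under_integral R _ _ lebesgue_measure f _ mD s (s - 1) (s + 1) Ia intf der _ B0 iB ub.
apply: (is_derive_scal (2 * pi)^-1); split; first exact: dd.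
rewrite -derive1E e; congr (fine _); apply: eq_integral => x _; congr EFin; exact: p1.
Qed.

Lemma expands_moment t i : expands t (moment^~ i).
Proof.
exists (fun n s => moment s (i + n)); split; first by rewrite addn0.
  by move=> n s; rewrite addnS; exact: deriv_moment.
exists (2 ^+ i * expR (2 * t)), 2; split; rewrite ?mulr_ge0 ?exprn_ge0 ?expR_ge0 //.
move=> n s /andP[s0 st]; rewrite mulrAC -exprD; apply: bound_moment.
by rewrite ger0_norm.
Qed.

Lemma expect_moment s P :
  expect (moment s) P = arc_mean (fun x => v x * P.[2 * cos x] * expR (2 * s * cos x)).
Proof.
rewrite /expect.
have -> : (fun x => v x * P.[2 * cos x] * expR (2 * s * cos x)) =
    fun x => \sum_(i < size P) P`_i * wave s i x.
  by apply/funext => x; rewrite horner_coef mulr_sumr mulr_suml; apply: eq_bigr => i _; rewrite /wave; ring.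
elim: (size P) => [|n IH].
  rewrite big_ord0 (_ : (fun=> _) = fun=> 0) ?arc_cst //.
  by apply/funext => x; rewrite big_ord0.
rewrite big_ord_recr /= IH addrC -(arc_lin _ (@cont_wave s n)); last first.
  elim: n {IH} => [|n IH].
    rewrite (_ : (fun=> _) = fun=> 0); first exact: continuous_cst.
    by apply/funext => y; rewrite big_ord0.
  rewrite (_ : (fun y => _) = fun y => \sum_(i < n) P`_i * wave s i y + P`_n * wave s n y); last first.
    by apply/funext => y; rewrite big_ord_recr.
  by apply: continuous_add => //; apply: continuous_scale; exact: cont_wave.
by congr arc_mean; apply/funext => x; rewrite big_ord_recr addrC.
Qed.

End Moments.

Section Bessel.
Variable R : realType.

Lemma horner_chebC_cos (x : R) (n : int) : (chebC 'X n).[2 * cos x] = 2 * cos (n%:~R * x).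
Proof.
rewrite /chebC horner_cheb hornerX -[in (2 : {poly R})](rmorph_nat polyC) hornerC.
move: n; apply: (chebyshev_ext (X := 2 * cos x)).
- exact: chebyshev_cheb.
- move=> n; rewrite intrD intrB !mulrDl mulNr !mul1r cosD cosB; ring.
- by rewrite cheb0 mul0r cos0 mulr1.
- by rewrite cheb1 mul1r.
Qed.

Lemma horner_chebU_sin (x : R) (n : int) : sin x * (chebU 'X n).[2 * cos x] = sin (n%:~R * x).
Proof.
rewrite /chebU horner_cheb horner0 hornerC.
move: n; apply: (chebyshev_ext (X := 2 * cos x)).
- by apply: chebyshevMl; exact: chebyshev_cheb.
- move=> n; rewrite intrD intrB !mulrDl mulNr !mul1r sinD sinB; ring.
- by rewrite cheb0 mulr0 mul0r sin0.
- by rewrite cheb1 mulr1 mul1r.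
Qed.

Definition mu : R -> nat -> R := @moment R (fun=> 1).

Let c1 : continuous ((fun=> 1) : R -> R). Proof. exact: continuous_cst. Qed.
Let b1 (x : R) : `|1 : R| <= 1. Proof. by rewrite normr1. Qed.

Lemma deriv_mu (s : R) i : is_derive s (1 : R) (mu^~ i) (mu s i.+1).
Proof. exact: deriv_moment c1 b1 s i. Qed.

Lemma expands_mu t i : expands t (mu^~ i).
Proof. exact: expands_moment c1 b1 t i. Qed.

Lemma sin_2pi n : sin (n%:R * (2 * pi)) = 0 :> R.
Proof.
have := periodicn (@sinD2pi R) n 0; rewrite add0r sin0 => <-; congr sin.
by rewrite -[RHS]mulr_natl -[pi *+ 2]mulr_natl.
Qed.

Lemma mu_start (n : nat) : expect (mu 0) (chebC 'X n) = 2 * (n == 0%N)%:R.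
Proof.
rewrite expect_moment //.
have -> : (fun x : R => 1 * (chebC 'X n).[2 * cos x] * expR (2 * 0 * cos x)) = fun x => 2 * cos (n%:R * x).
  by apply/funext => x; rewrite horner_chebC_cos mulr0 mul0r expR0 mulr1 mul1r.
case: n => [|n].
  rewrite (_ : (fun=> _) = fun=> 2) ?arc_cst ?mulr1 //.
  by apply/funext => x; rewrite mul0r cos0 mulr1.
rewrite mulr0; apply: (@arc_derivative _ (fun x => 2 / n.+1%:R * sin (n.+1%:R * x))).
- apply: continuous_scale => x.
  apply: (@continuous_comp _ _ _ (fun x : R => n.+1%:R * x) cos); last exact: continuous_cos.
  exact: mulrl_continuous.
- move=> x; have d := is_derive_scal n.+1%:R (is_derive_id x (1 : R)).
  apply: (is_derive_eq (is_derive_scal (2 / n.+1%:R) (is_derive1_comp (is_derive_sin (n.+1%:R * x)) d))).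
  have n0 : n.+1%:R != 0 :> R by rewrite pnatr_eq0.
  by rewrite mulr1; move: (n.+1%:R) n0 => N n0; field.
- by rewrite sin_2pi mulr0 mulr0 sin0 mulr0.
Qed.

Let cs : continuous (@sin R). Proof. exact: continuous_sin. Qed.
Let bs (x : R) : `|sin x| <= 1. Proof. by rewrite ler_norml sin_geN1 sin_le1. Qed.

(** At time [0] the integrand is the derivative of a multiple of a power of [2 * cos x], so every
    moment vanishes; the derivatives in [s] are again such moments, and the Taylor series is [0]. *)
Lemma moment_sin t i : 0 <= t -> @moment R (@sin R) t i = 0.
Proof.
move=> t0.
have z n : @moment R (@sin R) 0 n = 0.
  rewrite /moment (_ : (fun x => _) = fun x : R => sin x * (2 * cos x) ^+ n); last first.
    by apply/funext => x; rewrite mulr0 mul0r expR0 mulr1.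
  apply: (@arc_derivative _ (fun x => - (2 * n.+1%:R)^-1 * (2 * cos x) ^+ n.+1)).
  - by apply: continuous_mul => //; apply: continuous_exp; apply: continuous_scale; exact: continuous_cos.
  - move=> x; have d := @is_deriveX _ _ _ n.+1 _ _ _ (is_derive_scal 2 (is_derive_cos x)).
    rewrite exprfctE in d; apply: (is_derive_eq (is_derive_scal _ d)).
    have n0 : n.+1%:R != 0 :> R by rewrite pnatr_eq0.
    rewrite /GRing.scale /=; move: ((2 * cos x) ^+ n) (n.+1%:R) n0 => y N n0.
    by field.
  - by rewrite (mulr_natl pi 2) cos2pi cos0.
have [G [G0 dG [C [E [C0 E0 bG]]]]] := expands_moment cs bs t i.
have Gn n : G n = @moment R (@sin R)^~ (i + n)%N.
  elim: n => [|n IH]; first by rewrite addn0.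
  apply/funext => s; have := dG n s; rewrite IH => d; rewrite addnS.
  by apply: (deriv_unique d); exact: deriv_moment.
have := taylor_cvg t0 E0 dG bG; rewrite G0 => /cvg_lim <- //.
rewrite (_ : series _ = fun=> 0) ?lim_cst //.
by apply/funext => n; rewrite /series /= big1 // => k _; rewrite Gn z mulr0.
Qed.

Lemma circle_meanE (f : R -> R[i]) :
  circle_mean f = (arc_mean (fun x => complex.Re (f x)) +i* arc_mean (fun x => complex.Im (f x)))%C.
Proof. by rewrite /circle_mean /arc_mean; apply/eqP; rewrite eq_complex /= !mul0r subr0 addr0 !eqxx. Qed.

(** The sine of a multiple angle is [sin] times a [chebU], so the imaginary part is a combination of
    the moments in [moment_sin]. *)
Lemma besselE (j : int) t : 0 <= t -> besselI j (2 * t) = (fourier mu t j)%:C%C.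
Proof.
move=> t0; rewrite /besselI circle_meanE; congr (_ +i* _)%C.
  rewrite /fourier expect_moment //.
  rewrite -arcZ; last first.
    rewrite (_ : (fun x => _) = fun x => expR (2 * t * cos x) * (2 * cos (j%:~R * x))); last first.
      by apply/funext => x; rewrite horner_chebC_cos mul1r mulrC.
    apply: continuous_mul.
      move=> x; apply: (@continuous_comp _ _ _ (fun x : R => 2 * t * cos x) expR); last exact: continuous_expR.
      by apply: continuous_scale; exact: continuous_cos.
    apply: continuous_scale => x.
    by apply: (@continuous_comp _ _ _ (fun x : R => j%:~R * x) cos); [exact: mulrl_continuous|exact: continuous_cos].
  by congr arc_mean; apply/funext => x; rewrite horner_chebC_cos /=; field.
transitivity (expect (@moment R (@sin R) t) (chebU 'X j)).
  rewrite (expect_moment cs).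
  by congr arc_mean; apply/funext => x; rewrite horner_chebU_sin /=; ring.
by rewrite /expect big1 // => i _; rewrite moment_sin // mulr0.
Qed.

End Bessel.

Local Close Scope classical_set_scope.

(** * From the counts to the walk series *)

Section Counting.
Variables (K : comNzRingType) (T : finType).

Lemma sum_pow_card (P : pred T) (u : T -> nat) (a : K) N : (forall s, P s -> (u s < N)%N) ->
  \sum_(0 <= m < N) a ^+ m * #|[set s | P s && (u s == m)]|%:R = \sum_(s | P s) a ^+ u s.
Proof.
move=> uN; rewrite big_mkord (partition_big (fun s => inord (u s) : 'I_N.-1.+1) predT) //=.
have N0 : (exists s, P s) -> (0 < N)%N by case=> s /uN; exact: leq_trans.
case: N uN N0 => [|N] uN N0.
  rewrite big_ord0 big1 // => i _; rewrite big1 // => s /andP[Ps _].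
  by have := N0 (ex_intro _ s Ps).
apply: eq_bigr => m _; rewrite (eq_bigl (mem [set s | P s && (u s == m)])); last first.
  move=> s; rewrite !inE; case Ps: (P s) => //=; apply/eqP/eqP => [<-|e].
    by rewrite inordK // uN.
  by apply/val_inj; rewrite /= inordK ?e.
rewrite (eq_bigr (fun=> a ^+ m)); first by rewrite sumr_const mulr_natr.
by move=> s; rewrite !inE => /andP[_ /eqP ->].
Qed.

Lemma sum_pow_card2 (P : pred T) (u v : T -> nat) (a b : K) N :
  (forall s, P s -> (u s < N)%N) -> (forall s, P s -> (v s < N)%N) ->
  \sum_(0 <= m < N) \sum_(0 <= k < N) a ^+ m * b ^+ k * #|[set s | [&& P s, u s == m & v s == k]]|%:R =
  \sum_(s | P s) a ^+ u s * b ^+ v s.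
Proof.
move=> uN vN; rewrite big_mkord.
transitivity (\sum_(m < N) a ^+ m * \sum_(s | P s && (u s == m)) b ^+ v s).
  apply: eq_bigr => m _; rewrite -(@sum_pow_card _ v b N) => [|s /andP[/vN //]].
  rewrite mulr_sumr; apply: eq_bigr => k _; rewrite mulrA; congr (_ * _%:R).
  by apply: eq_card => s; rewrite !inE andbA.
transitivity (\sum_(m < N) \sum_(s | P s && (u s == m)) a ^+ u s * b ^+ v s).
  by apply: eq_bigr => m _; rewrite mulr_sumr; apply: eq_bigr => s /andP[_ /eqP ->].
rewrite (exchange_big_dep P) /=; last by move=> m s _ /andP[].
apply: eq_bigr => s Ps; rewrite (big_pred1 (Ordinal (uN s Ps))) // => m.
by rewrite /= Ps -val_eqE /= eq_sym.
Qed.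

End Counting.

Section Series.
Variable R : realType.

Lemma PO_series l (t a : R) : PO l t a = expR (- (a * t) - t ^+ 2 / 2) *
  limn (series (fun n => t ^+ n / n`!%:R * iter n (step_up l) (odd_weight a l) (fun=> 0%N))).
Proof.
rewrite /PO; congr (_ * _); apply: (congr1 (fun u : nat -> R => limn (series u))); apply/funext => n; congr (_ * _).
rewrite -sum_involutions -(@sum_pow_card _ _ _ (fun s => #|fixed_points s|) a n.+1).
  apply: eq_bigr => m _; congr (_ * _%:R); apply: eq_card => s; rewrite !inE.
  by rewrite [_ && no_increasing_gt _ _]andbC [in LHS]andbCA [in LHS]andbC; case: (_ == m); rewrite ?andbF ?andbT // andbC.
by move=> s _; rewrite ltnS -[leqRHS]card_ord max_card.
Qed.

Lemma PS_series (e : bool) l (t b : R) : PS (2 * l + ~~ e) t b = expR (- (b * t) - t ^+ 2 / 2) *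
  limn (series (fun n => t ^+ n / n`!%:R * iter n (updown l (stay b e l)) (at_origin R l) (fun=> 0%N))).
Proof.
rewrite /PS; congr (_ * _); apply: (congr1 (fun u : nat -> R => limn (series u))); apply/funext => n; congr (_ * _).
rewrite -sum_skew_involutions -(@sum_pow_card _ _ _ (fun s => #|negated_points s|) b n.+1).
  apply: eq_bigr => m _; congr (_ * _%:R); apply: eq_card => s; rewrite !inE.
  by rewrite -!andbA [_ && no_increasing_gt _ _]andbC.
by move=> s _; rewrite ltnS -[leqRHS]card_ord max_card.
Qed.

Lemma Pu_series l (t a b : R) : Pu (2 * l + 1) t a b = expR (- (a * t) - b * t - t ^+ 2) *
  limn (series (fun n => t ^+ n / n`!%:R * iter n (updown l (stay b false l)) (odd_weight a l) (fun=> 0%N))).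
Proof.
rewrite /Pu; congr (_ * _); apply: (congr1 (fun u : nat -> R => limn (series u))); apply/funext => n; congr (_ * _).
have half (A : {set 'I_(2 * n)}) : (#|A| %/ 2 < n.+1)%N.
  by rewrite ltnS -[leqRHS](mulKn n (isT : 0 < 2)%N) leq_div2r // -[leqRHS]card_ord max_card.
rewrite -sum_signed_involutions -(@sum_pow_card2 _ _ _ (fun s => #|fixed_points s| %/ 2)%N
  (fun s => #|negated_points s| %/ 2)%N a b n.+1) //.
apply: eq_bigr => mp _; apply: eq_bigr => mm _; congr (_ * _%:R); apply: eq_card => s; rewrite !inE.
apply/idP/idP => [/and5P[h1 h2 /eqP h3 /eqP h4 h5]|/and3P[/andP[h1 h5] /eqP h3 /eqP h4]].
  by rewrite /signed_perm h1 h2 h5 h3 h4 !mulKn ?eqxx.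
move: (signed_fixed h1) (signed_negated h1) h3 h4 => -> ->; rewrite !mulKn // => -> ->.
by move: h1; rewrite /signed_perm h5 !eqxx => /andP[-> ->].
Qed.

End Series.

Local Open Scope complex_scope.

(** * Orthogonal polynomials from Toeplitz determinants *)

Section Orthogonality.
Variables (K : fieldType) (c : int -> K).
Hypothesis cN : forall j, c (- j) = c j.

Definition toeplitz_form (p q : {poly K}) : K :=
  \sum_(i < size p) \sum_(j < size q) p`_i * q`_j * c (i%:Z - j%:Z).

Lemma toeplitz_formC p q : toeplitz_form p q = toeplitz_form q p.
Proof.
rewrite /toeplitz_form exchange_big; apply: eq_bigr => j _; apply: eq_bigr => i _.
by rewrite -cN opprB; ring.
Qed.

(** The lower coefficients solve a linear system whose matrix is the Toeplitz matrix. *)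
Lemma toeplitz_orthogonal m : \det (\matrix_(i < m, j < m) c (i%:Z - j%:Z)) != 0 ->
  exists p : {poly K}, [/\ p \is monic, size p = m.+1 &
    forall j, (j < m)%N -> \sum_(i < m.+1) p`_i * c (i%:Z - j%:Z) = 0].
Proof.
set T := \matrix_(i, j) _ => d0; have Tu : T \in unitmx by rewrite unitmxE unitfE.
pose x := - (\row_(j < m) c (m%:Z - j%:Z)) *m invmx T.
pose p : {poly K} := \poly_(i < m.+1) (if insub i is Some i' then x ord0 i' else 1).
have pm : p`_m = 1 by rewrite coef_poly ltnSn insubF // ltnn.
have pi (i : 'I_m) : p`_i = x ord0 i by rewrite coef_poly ltnS ltnW // valK.
have sp : size p = m.+1 by rewrite size_poly_eq // insubF ?ltnn // oner_eq0.
exists p; split=> [|//|j jm]; first by rewrite monicE /lead_coef sp /= pm.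
rewrite big_ord_recr /= pm mul1r.
have /matrixP/(_ ord0 (Ordinal jm)) : x *m T = - (\row_(j < m) c (m%:Z - j%:Z)) by rewrite mulmxKV.
rewrite !mxE /= => /eqP; rewrite -addr_eq0 => /eqP e; rewrite -[RHS]e; congr (_ + _).
by apply: eq_bigr => i _; rewrite pi !mxE.
Qed.

Lemma toeplitz_form_low (p q : {poly K}) m : size p = m.+1 -> (size q <= m)%N ->
  (forall j, (j < m)%N -> \sum_(i < m.+1) p`_i * c (i%:Z - j%:Z) = 0) -> toeplitz_form p q = 0.
Proof.
move=> sp sq op; rewrite /toeplitz_form sp exchange_big big1 // => j _.
transitivity (q`_j * \sum_(i < m.+1) p`_i * c (i%:Z - j%:Z)).
  by rewrite mulr_sumr; apply: eq_bigr => i _; ring.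
by rewrite op ?mulr0 // (leq_trans (ltn_ord j)).
Qed.

(* Expanding a monomial of lower degree in the orthogonal family. *)
Lemma toeplitz_form_orthogonal (p : nat -> {poly K}) m : (forall l, p l \is monic /\ size (p l) = l.+1) ->
  (forall l k, l <> k -> toeplitz_form (p l) (p k) = 0) ->
  forall j, (j < m)%N -> \sum_(i < m.+1) (p m)`_i * c (i%:Z - j%:Z) = 0.
Proof.
move=> mp op j; have [_ sm] := mp m.
elim/ltn_ind: j => j IH jm; have [mj sj] := mp j.
have := op m j; rewrite /toeplitz_form sm exchange_big sj big_ord_recr /= => e.
have {}e := e _; rewrite big1 ?add0r in e; last first.
  move=> k _; transitivity ((p j)`_k * \sum_(i < m.+1) (p m)`_i * c (i%:Z - k%:Z)).
    by rewrite mulr_sumr; apply: eq_bigr => i _; ring.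
  by rewrite IH ?mulr0 // (ltn_trans _ jm).
have lj : (p j)`_j = 1 by move: mj; rewrite monicE /lead_coef sj => /eqP.
apply: etrans (e _); last by lia.
by apply: eq_bigr => i _; rewrite lj mulr1.
Qed.

End Orthogonality.

Section Circle.
Variable R : realType.

Definition ccontinuous (f : R -> R[i]) :=
  continuous (fun x => complex.Re (f x)) /\ continuous (fun x => complex.Im (f x)).

Lemma ccontinuous_lin (a : R[i]) f g : ccontinuous f -> ccontinuous g ->
  ccontinuous (fun x => a * f x + g x).
Proof.
move=> [f1 f2] [g1 g2]; case: a => a b; split.
  rewrite (_ : (fun x => _) = fun x => (a * complex.Re (f x) + (- b) * complex.Im (f x)) + complex.Re (g x)).
    by apply: continuous_add => //; apply: continuous_add; exact: continuous_scale.
  by apply/funext => x; case: (f x) => u v; case: (g x) => u' v' /=; ring.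
rewrite (_ : (fun x => _) = fun x => (a * complex.Im (f x) + b * complex.Re (f x)) + complex.Im (g x)).
  by apply: continuous_add => //; apply: continuous_add; exact: continuous_scale.
by apply/funext => x; case: (f x) => u v; case: (g x) => u' v' /=; ring.
Qed.

Lemma circle_mean_lin (a : R[i]) f g : ccontinuous f -> ccontinuous g ->
  circle_mean (fun x => a * f x + g x) = a * circle_mean f + circle_mean g.
Proof.
move=> [f1 f2] [g1 g2]; case: a => a b; rewrite !circle_meanE.
have -> : (fun x => complex.Re ((a +i* b) * f x + g x)) =
    fun x => a * complex.Re (f x) + ((- b) * complex.Im (f x) + complex.Re (g x)).
  by apply/funext => x; case: (f x) => u v; case: (g x) => u' v' /=; ring.
have -> : (fun x => complex.Im ((a +i* b) * f x + g x)) =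
    fun x => a * complex.Im (f x) + (b * complex.Re (f x) + complex.Im (g x)).
  by apply/funext => x; case: (f x) => u v; case: (g x) => u' v' /=; ring.
rewrite !arc_lin //; try by apply: continuous_add => //; exact: continuous_scale.
by apply/eqP; rewrite eq_complex /=; apply/andP; split; apply/eqP; ring.
Qed.

Lemma circle_mean_sum (I : Type) (r : seq I) (a : I -> R[i]) (f : I -> R -> R[i]) :
  (forall i, ccontinuous (f i)) ->
  circle_mean (fun x => \sum_(i <- r) a i * f i x) = \sum_(i <- r) a i * circle_mean (f i).
Proof.
move=> cf; have z : ccontinuous (fun=> 0) by split; exact: continuous_cst.
have cs s : ccontinuous (fun x => \sum_(i <- s) a i * f i x).
  elim: s => [|i s IH].
    by rewrite (_ : (fun x => _) = fun=> 0) //; apply/funext => x; rewrite big_nil.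
  rewrite (_ : (fun x => _) = fun x => a i * f i x + \sum_(j <- s) a j * f j x).
    exact: ccontinuous_lin.
  by apply/funext => x; rewrite big_cons.
elim: r => [|i r IH].
  rewrite big_nil (_ : (fun x => _) = fun=> 0); last by apply/funext => x; rewrite big_nil.
  by rewrite circle_meanE /= !arc_cst.
rewrite big_cons -IH -circle_mean_lin //; congr circle_mean.
by apply/funext => x; rewrite big_cons.
Qed.

Lemma expiD (a b : R) : expi (a + b) = expi a * expi b.
Proof. by rewrite /expi sinD cosD; apply/eqP; rewrite eq_complex /=; apply/andP; split; apply/eqP; ring. Qed.

Lemma expi0 : expi (0 : R) = 1.
Proof. by rewrite /expi sin0 cos0. Qed.

Lemma expiX (a : R) n : expi a ^+ n = expi (n%:R * a).
Proof.
elim: n => [|n IH]; first by rewrite mul0r expi0.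
by rewrite exprS IH -expiD -natr1 mulrDl mul1r addrC.
Qed.

Lemma circle_innerE t (p q : {poly R[i]}) :
  circle_inner t p q = toeplitz_form (fun j => besselI j (2 * t)) p q.
Proof.
rewrite /circle_inner /toeplitz_form pair_big /= -circle_mean_sum.
  congr circle_mean; apply/funext => x; rewrite !horner_coef big_distrlr /= pair_big /= mulr_suml.
  apply: eq_bigr => -[i j] _ /=; rewrite !expiX intrB mulrBl expiD mulrN.
  by rewrite -[(expR _)%:C * _]mulrC; ring.
move=> [i j]; split => /=.
  rewrite (_ : (fun x => _) = fun x => expR (2 * t * cos x) * cos ((i%:Z - j%:Z)%:~R * x)); last first.
    by apply/funext => x; rewrite mul0r subr0.
  apply: continuous_mul; last first.
    move=> x; apply: (@continuous_comp _ _ _ (fun x : R => (i%:Z - j%:Z)%:~R * x) cos); [exact: mulrl_continuous|exact: continuous_cos].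
  move=> x; apply: (@continuous_comp _ _ _ (fun x : R => 2 * t * cos x) expR); last exact: continuous_expR.
  by apply: continuous_scale; exact: continuous_cos.
rewrite (_ : (fun x => _) = fun x => expR (2 * t * cos x) * sin ((i%:Z - j%:Z)%:~R * x)); last first.
  by apply/funext => x; rewrite mul0r addr0.
apply: continuous_mul; last first.
  move=> x; apply: (@continuous_comp _ _ _ (fun x : R => (i%:Z - j%:Z)%:~R * x) sin); [exact: mulrl_continuous|exact: continuous_sin].
move=> x; apply: (@continuous_comp _ _ _ (fun x : R => 2 * t * cos x) expR); last exact: continuous_expR.
by apply: continuous_scale; exact: continuous_cos.
Qed.

Variable t : R.
Hypothesis t0 : 0 <= t.
Local Notation c := (fun j : int => (fourier (@mu R) t j)%:C).

Lemma circle_inner_fourier p q : circle_inner t p q = toeplitz_form c p q.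
Proof.
rewrite circle_innerE; apply: eq_bigr => i _; apply: eq_bigr => j _.
by rewrite besselE.
Qed.

Lemma toeplitz_neq0 m : \det (\matrix_(i < m, j < m) c (i%:Z - j%:Z)) != 0.
Proof.
have -> : \matrix_(i < m, j < m) c (i%:Z - j%:Z) =
    map_mx (real_complex R) (\matrix_(i < m, j < m) fourier (@mu R) t (i%:Z - j%:Z)).
  by apply/matrixP => i j; rewrite !mxE.
rewrite det_map_mx fmorph_eq0; apply: lt0r_neq0; apply: lt_le_trans ltr01 _.
exact: (toeplitz_ge1 (@deriv_mu R) (@expands_mu R) (@mu_start R)).
Qed.

(** The determinants do not vanish, so an orthogonal family exists and [xget] returns one;
    orthogonality within the family becomes orthogonality to lower powers. *)
Lemma opuc_orthogonal m : [/\ opuc m t \is monic, size (opuc m t) = m.+1 &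
  forall j, (j < m)%N -> \sum_(i < m.+1) (opuc m t)`_i * c (i%:Z - j%:Z) = 0].
Proof.
have cN j : c (- j) = c j by rewrite /= fourierN.
have ex n := cid (toeplitz_orthogonal (toeplitz_neq0 n)).
have mo : monic_orthogonal t (fun n => projT1 (ex n)).
  split=> [l|l k lk]; first by have [] := projT2 (ex l).
  rewrite circle_inner_fourier.
  have [_ sl ol] := projT2 (ex l); have [_ sk ok] := projT2 (ex k).
  case: (ltnP k l) => h; first by apply: (toeplitz_form_low sl) => //; rewrite sk.
  rewrite toeplitz_formC //; apply: (toeplitz_form_low sk) => //; rewrite sl ltn_neqAle h andbT.
  exact/eqP.
have [h1 h2] := @xgetPex _ (fun=> 0) [set p | monic_orthogonal t p]%classic (ex_intro _ _ mo).
have [mm sm] := h1 m; split=> // j jm.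
apply: (@toeplitz_form_orthogonal _ (fun j => (fourier (@mu R) t j)%:C) (fun l => opuc l t) m h1) => // l k lk.
by rewrite -circle_inner_fourier; exact: h2.
Qed.

End Circle.

(** * The formulas *)

Section Complexification.
Variables (R : realType) (nu : nat -> R).

(** The series are real while [opuc] has complex coefficients; this functional carries the real
    Hankel determinants to where Szego's relations are applied. *)
Definition cexpect : {poly R[i]} -> R[i] := expect (fun i => (nu i)%:C).

Lemma cexpect_map (P : {poly R}) : cexpect (map_poly (real_complex R) P) = (expect nu P)%:C.
Proof.
rewrite /cexpect (@expect_wide _ _ _ (size P)) ?size_poly // /expect rmorph_sum.
by apply: eq_bigr => i _; rewrite coef_map rmorphM.
Qed.

Lemma rmorph_cheb (A B : comNzRingType) (f : {rmorphism A -> B}) X a b n :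
  f (cheb X a b n) = cheb (f X) (f a) (f b) n.
Proof.
have h k : forall a b, f (chebn X a b k) = chebn (f X) (f a) (f b) k.
  by elim: k => [//|k IH] a' b' /=; rewrite IH rmorphB rmorphM.
by case: n => n; rewrite /cheb h // rmorphB rmorphM.
Qed.

Lemma cexpect_chebC j : cexpect (chebC 'X j) = (expect nu (chebC 'X j))%:C.
Proof.
rewrite -cexpect_map /chebC (rmorph_cheb (map_poly (real_complex R))) /= map_polyX.
by rewrite (rmorph_nat (map_poly (real_complex R))).
Qed.

Lemma hankel_map n (w : {poly R}) : hankel cexpect n (map_poly (real_complex R) w) = (hankel (expect nu) n w)%:C.
Proof.
rewrite /hankel -(det_map_mx (real_complex R)); congr (\det _); apply/matrixP => i j.
by rewrite !mxE -[RHS]/((expect nu (w * 'X^(i + j)))%:C) -cexpect_map rmorphM /= map_polyXn.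
Qed.

End Complexification.

Section Assembly.
Variables (R : realType) (t : R).
Hypothesis t0 : 0 <= t.
Local Notation mu := (@mu R).
Local Notation c := (fun j : int => (fourier mu t j)%:C).
Local Notation E := (cexpect (mu t)).
Local Notation real := (real_complex R).

Let lE : poly_linear E. Proof. exact: poly_linear_expect. Qed.

Let cE j : E (chebC 'X j) = 2 * c j.
Proof.
by rewrite cexpect_chebC /fourier rmorphM fmorphV rmorph_nat mulrA mulfV ?mul1r // pnatr_eq0.
Qed.

Lemma Dl_fourier l : Dl l t = \det (\matrix_(i < l, j < l) c (i%:Z - j%:Z)).
Proof. by congr (\det _); apply/matrixP => i j; rewrite !mxE besselE. Qed.

Lemma Dpp_fourier l : Dpp l t = \det (\matrix_(i < l, j < l) (c (i%:Z - j%:Z) - c (i%:Z + j%:Z + 2))).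
Proof. by congr (\det _); apply/matrixP => i j; rewrite !mxE !besselE. Qed.

Lemma Dpm_fourier l : Dpm l t = \det (\matrix_(i < l, j < l) (c (i%:Z - j%:Z) - c (i%:Z + j%:Z + 1))).
Proof. by congr (\det _); apply/matrixP => i j; rewrite !mxE !besselE. Qed.

Lemma Dmp_fourier l : Dmp l t = \det (\matrix_(i < l, j < l) (c (i%:Z - j%:Z) + c (i%:Z + j%:Z + 1))).
Proof. by congr (\det _); apply/matrixP => i j; rewrite !mxE !besselE. Qed.

Lemma Dmm_fourier l : Dmm l.+1 t =
  2^-1 * \det (\matrix_(i < l.+1, j < l.+1) (c (i%:Z - j%:Z) + c (i%:Z + j%:Z))).
Proof. by rewrite /Dmm /=; congr (_ * \det _); apply/matrixP => i j; rewrite !mxE !besselE. Qed.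

Let two : 2 != 0 :> R[i]. Proof. by rewrite pnatr_eq0. Qed.

Let scaled (a b : R) (x y : R[i]) : b%:C = x * y -> (a * b)%:C = x * a%:C * y.
Proof. by move=> e; rewrite rmorphM /= e mulrCA mulrA. Qed.

Section Orthogonal.
Variable al : R.
Local Notation z := (- al%:C).

Lemma phi_map : map_poly real ((1 + al ^+ 2)%:P + al *: 'X) = (1 + z ^+ 2)%:P - z *: 'X.
Proof.
rewrite rmorphD /= map_polyC /= map_polyZ map_polyX scaleNr opprK sqrrN.
by rewrite rmorphD rmorphXn rmorph1.
Qed.

Lemma four_map : map_poly real (4 - 'X ^+ 2) = 4 - 'X ^+ 2.
Proof. by rewrite rmorphB rmorphXn /= map_polyX (rmorph_nat (map_poly real)). Qed.

Lemma two_mapB : map_poly real (2 - 'X) = 2 - 'X.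
Proof. by rewrite rmorphB /= map_polyX (rmorph_nat (map_poly real)). Qed.

Lemma two_mapD : map_poly real (2 + 'X) = 2 + 'X.
Proof. by rewrite rmorphD /= map_polyX (rmorph_nat (map_poly real)). Qed.

Lemma phi_mapM w : map_poly real (((1 + al ^+ 2)%:P + al *: 'X) * w) =
  ((1 + z ^+ 2)%:P - z *: 'X) * map_poly real w.
Proof. by rewrite rmorphM /= phi_map. Qed.

(** Both Hankel determinants of the series contain the factor [1 + al^2 + al X] in their weight;
    [szego_mm] and [szego_pp] at [z = - al] trade it for values of [opuc]. *)
Lemma PO_even n : (PO (2 * n.+1) t al)%:C = 2^-1 * (expR (- (al * t) - t ^+ 2 / 2))%:C *
  (((opuc_star (2 * n.+1 - 1) t).[z] - al%:C * (opuc (2 * n.+1 - 1) t).[z]) * Dmm n.+1 t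
   + ((opuc_star (2 * n.+1 - 1) t).[z] + al%:C * (opuc (2 * n.+1 - 1) t).[z]) * Dpp n t).
Proof.
have -> : (2 * n.+1 - 1 = n + n.+1)%N by lia.
have [mp sp op] := opuc_orthogonal t0 (n + n.+1).
rewrite PO_series; apply: scaled.
have := congr1 real (seriesO_even (@deriv_mu R) (@expands_mu R) (@mu_start R) al n.+1 t0).
set L := limn _; rewrite rmorphM rmorphXn rmorph_nat => h.
have k0 : 2 ^+ n.+1 != 0 :> R[i] by rewrite expf_neq0.
apply: (mulfI k0); rewrite [LHS]h rmorphD rmorphM /= -!hankel_map phi_mapM four_map phi_map.
rewrite rmorphB rmorph1 rmorphXn /=.
have e1 := szego_mm lE cE z mp sp op; have e2 := szego_pp lE cE z mp sp op.
rewrite -(sqrrN al%:C) e1 e2 -(hankel_pp lE cE) -Dpp_fourier.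
have := hankel_mm lE cE (ltn0Sn n); rewrite Dmm_fourier /opuc_star /reversed_poly.
set H := hankel _ _ _; set D := \det _; move: (_.[z]) (_.[z]) (Dpp n t) => S P D' hm.
have -> : H = 4^-1 * (2 ^+ n.+1 * D) by rewrite hm mulrA mulVf ?mul1r // pnatr_eq0.
by rewrite exprS; field.
Qed.

(** The coefficients [1 + al] and [1 - al] of the series are the very factors that accompany the
    Hankel determinants in [szego_pm] and [szego_mp]. *)
Lemma PO_odd n : (PO (2 * n + 1) t al)%:C = 2^-1 * (expR (- (al * t) - t ^+ 2 / 2))%:C *
  (((opuc_star (2 * n) t).[z] + al%:C * (opuc (2 * n) t).[z]) * (expR t)%:C * Dpm n t
   + ((opuc_star (2 * n) t).[z] - al%:C * (opuc (2 * n) t).[z]) * (expR (- t))%:C * Dmp n t).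
Proof.
rewrite [in opuc_star _ _]mul2n [in opuc _ _]mul2n -addnn.
have [mp sp op] := opuc_orthogonal t0 (n + n).
rewrite PO_series; apply: scaled.
have := congr1 real (seriesO_odd (@deriv_mu R) (@expands_mu R) (@mu_start R) al n t0).
set L := limn _; rewrite rmorphM rmorphXn rmorph_nat => h.
have k0 : 2 ^+ n.+1 != 0 :> R[i] by rewrite expf_neq0.
apply: (mulfI k0); rewrite [LHS]h rmorphD !rmorphM /= -!hankel_map !phi_mapM two_mapB two_mapD.
rewrite rmorphB rmorphD rmorph1 /=.
have e1 := szego_pm lE cE z mp sp op; have e2 := szego_mp lE cE z mp sp op.
rewrite opprK in e1.
rewrite [X in X + _ = _]mulrAC e1 [X in _ + X = _]mulrAC e2.
rewrite -(hankel_pm lE cE) -(hankel_mp lE cE) -Dpm_fourier -Dmp_fourier /opuc_star /reversed_poly.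
move: (_.[z]) (_.[z]) (Dpm n t) (Dmp n t) => S P D D'.
by rewrite exprS; field.
Qed.

Lemma Pu_odd l (b : R) : (Pu (2 * l + 1) t al b)%:C =
  (expR (- (al * t) - t ^+ 2))%:C * (opuc_star l t).[z] * Dl l t.
Proof.
have [mp sp op] := opuc_orthogonal t0 l.
rewrite Pu_series (seriesU (@deriv_mu R) (@expands_mu R) (@mu_start R)) // mulrA -expRD rmorphM.
rewrite -mulrA; congr (_%:C * _); first by congr expR; ring.
have r := @reversed_det _ c l (opuc l t) mp sp op z.
rewrite Dl_fourier /opuc_star /reversed_poly; apply: (etrans _ (esym r)).
rewrite -(det_map_mx real).
congr (\det _); apply/matrixP => i j; rewrite !mxE mulNr opprK.
exact: etrans (rmorphD real _ _) (congr1 _ (rmorphM real _ _)).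
Qed.

End Orthogonal.

(** At [1] the second Hankel term drops out and the weight [1 + al^2 + al X] is [2 + X], that of
    [hankel_mp]. *)
Lemma PO_even1 l : PO (2 * l) t 1 = expR (- t - t ^+ 2 / 2) *
  \det (\matrix_(i < l, j < l) (fourier mu t (i%:Z - j%:Z) + fourier mu t (i%:Z + j%:Z + 1))).
Proof.
rewrite PO_series mul1r; congr (_ * _).
have k0 : 2 ^+ l != 0 :> R by rewrite expf_neq0 // pnatr_eq0.
apply: (mulfI k0); rewrite (seriesO_even (@deriv_mu R) (@expands_mu R) (@mu_start R) 1 l t0).
rewrite (@hankel_mp _ (expect (mu t))).
- by rewrite expr1n subrr mul0r addr0 scale1r -[1 + 1]/(2 : R) -[in RHS](rmorph_nat polyC).
- exact: poly_linear_expect.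
- by move=> j; rewrite /fourier mulrA mulfV ?mul1r // pnatr_eq0.
Qed.

Lemma PS_even1 l : PS (2 * l) t 1 = expR (- t - t ^+ 2 / 2) *
  \det (\matrix_(i < l, j < l) (fourier mu t (i%:Z - j%:Z) + fourier mu t (i%:Z + j%:Z + 1))).
Proof.
have := PS_series true l t 1; rewrite addn0 mul1r => ->.
by rewrite (seriesS_even (@deriv_mu R) (@expands_mu R) (@mu_start R)).
Qed.

(** Only the term with [2 - X] survives; times [2 + X] it is the weight of [hankel_pp]. *)
Lemma PO_odd1 l : PO (2 * l + 1) t 1 = expR (- (t ^+ 2 / 2)) *
  \det (\matrix_(i < l, j < l) (fourier mu t (i%:Z - j%:Z) - fourier mu t (i%:Z + j%:Z + 2))).
Proof.
rewrite PO_series mul1r.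
have -> : expR (- (t ^+ 2 / 2)) = expR (- t - t ^+ 2 / 2) * expR t by rewrite -expRD; congr expR; ring.
rewrite -mulrA; congr (_ * _).
have k0 : 2 ^+ l.+1 != 0 :> R by rewrite expf_neq0 // pnatr_eq0.
apply: (mulfI k0); rewrite (seriesO_odd (@deriv_mu R) (@expands_mu R) (@mu_start R) 1 l t0).
rewrite subrr !mul0r addr0 [2 ^+ l.+1]exprS.
have e : ((1 + 1 ^+ 2)%:P + 1 *: 'X) * (2 - 'X) = 4 - 'X ^+ 2 :> {poly R}.
  rewrite expr1n scale1r -[1 + 1]/(2 : R) -[in LHS](rmorph_nat polyC); ring.
rewrite e -(@hankel_pp _ (expect (mu t)) _ (fourier mu t)); first by ring.
- exact: poly_linear_expect.
- by move=> j; rewrite /fourier mulrA mulfV ?mul1r // pnatr_eq0.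
Qed.

Lemma PS_odd l (b : R) : PS (2 * l + 1) t b = expR (- (t ^+ 2 / 2)) *
  \det (\matrix_(i < l, j < l) (fourier mu t (i%:Z - j%:Z) - fourier mu t (i%:Z + j%:Z + 2))).
Proof.
have := PS_series false l t b => ->.
rewrite (seriesS_odd (@deriv_mu R) (@expands_mu R) (@mu_start R)) // mulrA -expRD; congr (expR _ * _).
by ring.
Qed.

Lemma Dmp_real l : Dmp l t = (\det (\matrix_(i < l, j < l)
  (fourier mu t (i%:Z - j%:Z) + fourier mu t (i%:Z + j%:Z + 1))))%:C.
Proof.
rewrite Dmp_fourier -(det_map_mx real); congr (\det _); apply/matrixP => i j.
by rewrite !mxE rmorphD.
Qed.

Lemma Dpp_real l : Dpp l t = (\det (\matrix_(i < l, j < l)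
  (fourier mu t (i%:Z - j%:Z) - fourier mu t (i%:Z + j%:Z + 2))))%:C.
Proof.
rewrite Dpp_fourier -(det_map_mx real); congr (\det _); apply/matrixP => i j.
by rewrite !mxE rmorphB.
Qed.

Lemma Pu_1 n (b : R) : (Pu (4 * n + 1) t 1 b)%:C = (expR (- t - t ^+ 2))%:C * Dpp n t * Dmp n t.
Proof.
have [mp sp op] := opuc_orthogonal t0 (n + n).
rewrite (_ : (4 * n + 1 = 2 * (n + n) + 1)%N); last by lia.
rewrite Pu_odd mul1r -!mulrA; congr (_ * _); rewrite Dl_fourier Dpp_fourier Dmp_fourier.
exact: (signed_even lE cE mp sp op).
Qed.

Lemma Pu_3 n (b : R) : (Pu (4 * n + 3) t 1 b)%:C = (expR (- t - t ^+ 2))%:C * Dpp n t * Dmp n.+1 t.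
Proof.
have [mp sp op] := opuc_orthogonal t0 (n + n.+1).
rewrite (_ : (4 * n + 3 = 2 * (n + n.+1) + 1)%N); last by lia.
rewrite Pu_odd mul1r -!mulrA; congr (_ * _); rewrite Dl_fourier Dpp_fourier Dmp_fourier.
exact: (signed_odd lE cE mp sp op).
Qed.

End Assembly.

Theorem corollary4p3 (R : realType) (alpha beta t : R) :
  0 <= alpha -> 0 <= beta -> 0 <= t ->
  (forall l : nat, (1 <= l)%N ->
    (PO (2 * l) t alpha)%:C =
      2^-1 * (expR (- (alpha * t) - t ^+ 2 / 2))%:C *
      (((opuc_star (2 * l - 1) t).[- alpha%:C]
          - alpha%:C * (opuc (2 * l - 1) t).[- alpha%:C]) * Dmm l t
       + ((opuc_star (2 * l - 1) t).[- alpha%:C]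
          + alpha%:C * (opuc (2 * l - 1) t).[- alpha%:C]) * Dpp (l - 1) t))
  /\ (forall l : nat,
    (PO (2 * l + 1) t alpha)%:C =
      2^-1 * (expR (- (alpha * t) - t ^+ 2 / 2))%:C *
      (((opuc_star (2 * l) t).[- alpha%:C]
          + alpha%:C * (opuc (2 * l) t).[- alpha%:C]) * (expR t)%:C * Dpm l t
       + ((opuc_star (2 * l) t).[- alpha%:C]
          - alpha%:C * (opuc (2 * l) t).[- alpha%:C])
         * (expR (- t))%:C * Dmp l t))
  /\ (forall l : nat,
    PO (2 * l) t 1 = PS (2 * l) t 1 /\
    (PS (2 * l) t 1)%:C = (expR (- t - t ^+ 2 / 2))%:C * Dmp l t)
  /\ (forall l : nat,
    PO (2 * l + 1) t 1 = PS (2 * l + 1) t 1 /\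
    (PS (2 * l + 1) t 1)%:C = (expR (- (t ^+ 2 / 2)))%:C * Dpp l t)
  /\ (forall l : nat,
    (PS (2 * l + 1) t beta)%:C = (expR (- (t ^+ 2 / 2)))%:C * Dpp l t)
  /\ (forall l : nat,
    (Pu (2 * l + 1) t alpha beta)%:C =
      (expR (- (alpha * t) - t ^+ 2))%:C
      * (opuc_star l t).[- alpha%:C] * Dl l t)
  /\ (forall l : nat,
    (Pu (4 * l + 1) t 1 beta)%:C =
      (expR (- t - t ^+ 2))%:C * Dpp l t * Dmp l t)
  /\ (forall l : nat,
    (Pu (4 * l + 3) t 1 beta)%:C =
      (expR (- t - t ^+ 2))%:C * Dpp l t * Dmp (l + 1) t).
Proof.
move=> _ _ t0; split; [|split; [|split; [|split; [|split; [|split; [|split]]]]]].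
- case=> // l _; rewrite [(l.+1 - 1)%N]subn1 /=; exact: PO_even.
- by move=> l; exact: PO_odd.
- by move=> l; rewrite PO_even1 // PS_even1 // Dmp_real // rmorphM.
- by move=> l; rewrite PO_odd1 // PS_odd // Dpp_real // rmorphM.
- by move=> l; rewrite PS_odd // Dpp_real // rmorphM.
- by move=> l; exact: Pu_odd.
- by move=> l; exact: Pu_1.
- by move=> l; rewrite addn1; exact: Pu_3.
Qed.
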